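(* There exists $c_* \in (0,1)$ such that, for any $c \in \mathbb{R}^2$ with $|c| < c_*$, there exist $(U_c, N_c, V_c) \in H^1(\mathbb{R}^2,\mathbb{C}) \times L^2(\mathbb{R}^2,\mathbb{R}) \times L^2(\mathbb{R}^2,\mathbb{R}^2)$ such that, for any $\omega > 0$, the functions $(u,n,v)$ of $(t,x) \in \mathbb{R}\times\mathbb{R}^2$ defined by $$u(t,x) = \sqrt{\omega}\, U_c\big(\sqrt{\omega}(x-ct)\big)\, e^{i\left(\frac{c\cdot x}{2} - \frac{|c|^2 t}{4} + \omega t\right)}, \quad n(t,x) = \omega N_c\big(\sqrt{\omega}(x-ct)\big), \quad v(t,x) = \omega V_c\big(\sqrt{\omega}(x-ct)\big)$$ are solutions to the two-dimensional Zakharov system $$\partial_t u = i\Delta u - i n u, \qquad \partial_t n = -\nabla\cdot v, \qquad \partial_t v = -\nabla n - \nabla(|u|^2).$$ The functions $U_c$, $N_c$ and $V_c$ belong to $H^s$ for any $s \geqslant 0$, and satisfy $$\|U_c - Q\|_{H^2} \lesssim |c|^2, \qquad \|N_c + Q^2\|_{H^2} \lesssim |c|^2, \qquad \|V_c\|_{H^2\times H^2} \lesssim |c|.$$ Moreover, for any $m \in \mathbb{N}^2$ and any $y \in \mathbb{R}^2$ with $|y| \geqslant 1$, $$|\partial^m U_c(y)| \lesssim_m e^{-\frac12 |y|}, \qquad |\partial^m N_c(y)| \lesssim_m e^{-|y|} + \frac{|c|^2}{|y|^{|m|+2}}, \qquad |\partial^m V_c(y)| \lesssim_m \frac{|c|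}{|y|^{|m|+2}}.$$
   Context: $Q$ denotes the unique positive radial solution in $H^1(\mathbb{R}^2)$ of $\Delta Q = Q - Q^3$ (the cubic NLS ground state in dimension two). For $m = (m_1,m_2) \in \mathbb{N}^2$ (with $0\in\mathbb{N}$), $\partial^m = \partial_{y_1}^{m_1}\partial_{y_2}^{m_2}$ and $|m| = m_1+m_2$. The notation $A \lesssim B$ means that there is a constant $C>0$, independent of all parameters and functions (in particular of $c$ and $y$), such that $A \leqslant C B$; $A \lesssim_m B$ means that the constant may depend on $m$ (and on nothing else). *)

(* Defs.v *)
From HB Require Import structures.
From mathcomp Require Import all_boot all_order all_algebra.
From mathcomp Require Import complex.
From mathcomp Require Import all_classical all_reals all_analysis.

Set Implicit Arguments.
Unset Strict Implicit.
Unset Printing Implicit Defensive.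

Import Order.TTheory GRing.Theory Num.Theory numFieldNormedType.Exports.

Local Open Scope classical_set_scope.
Local Open Scope complex_scope.
Local Open Scope ring_scope.

(* The library norm on [R * R] is the sup norm (it only fixes the topology);
   every length in the statement is the Euclidean one. *)
Definition dot2 (R : realType) (x y : R * R) : R := x.1 * y.1 + x.2 * y.2.

Definition enorm2 (R : realType) (x : R * R) : R := Num.sqrt (dot2 x x).

Definition cis (R : realType) (theta : R) : R[i] := cos theta +i* sin theta.

Definition leb2 (R : realType) :
    {measure set (measurableTypeR R * measurableTypeR R) -> \bar R} :=
  ((@lebesgue_measure R) \x (@lebesgue_measure R))%E.

Definition dir1 (R : realType) : R * R := (1, 0).
Definition dir2 (R : realType) : R * R := (0, 1).

Definition pd1 (R : realType) (f : R * R -> R) : R * R -> R :=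
  fun x => 'D_(dir1 R) f x.
Definition pd2 (R : realType) (f : R * R -> R) : R * R -> R :=
  fun x => 'D_(dir2 R) f x.

Definition pdm (R : realType) (m : nat * nat) (f : R * R -> R) : R * R -> R :=
  iter m.1 (@pd1 R) (iter m.2 (@pd2 R) f).

Definition mlen (m : nat * nat) : nat := (m.1 + m.2)%N.

(* ['D_v f x] is a total operator, so differentiability is required separately.
   Differentiability of the lower-order [pdm m f] makes mixed partials commute;
   hence the single order of differentiation used in [pdm] covers them all. *)
Definition classC (R : realType) (k : nat) (f : R * R -> R) : Prop :=
  (forall m x, (mlen m < k)%N -> differentiable (pdm m f) x) /\
  (forall m, (mlen m <= k)%N -> continuous (pdm m f)).

Definition smooth (R : realType) (f : R * R -> R) : Prop :=
  forall k, classC k f.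

Definition laplacian (R : realType) (f : R * R -> R) : R * R -> R :=
  fun x => pdm (2%N, 0%N) f x + pdm (0%N, 2%N) f x.

(* Complex-valued functions are differentiated and integrated through their
   real and imaginary parts. *)
Definition reF (R : realType) (T : Type) (f : T -> R[i]) : T -> R :=
  fun x => complex.Re (f x).
Definition imF (R : realType) (T : Type) (f : T -> R[i]) : T -> R :=
  fun x => complex.Im (f x).

Definition classC_c (R : realType) (k : nat) (f : R * R -> R[i]) : Prop :=
  classC k (reF f) /\ classC k (imF f).

Definition smooth_c (R : realType) (f : R * R -> R[i]) : Prop :=
  forall k, classC_c k f.

Definition pdm_c (R : realType) (m : nat * nat) (f : R * R -> R[i])
    : R * R -> R[i] :=
  fun x => pdm m (reF f) x +i* pdm m (imF f) x.

Definition laplacian_c (R : realType) (f : R * R -> R[i]) : R * R -> R[i] :=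
  fun x => laplacian (reF f) x +i* laplacian (imF f) x.

Definition fst_of (R : realType) (f : R * R -> R * R) : R * R -> R :=
  fun x => (f x).1.
Definition snd_of (R : realType) (f : R * R -> R * R) : R * R -> R :=
  fun x => (f x).2.

Definition pdm_v (R : realType) (m : nat * nat) (f : R * R -> R * R)
    : R * R -> R * R :=
  fun x => (pdm m (fst_of f) x, pdm m (snd_of f) x).

Definition toC (R : realType) (f : R * R -> R) : R * R -> R[i] :=
  fun x => (f x)%:C.

Definition measurable_c (R : realType) (f : R * R -> R[i]) : Prop :=
  measurable_fun [set: measurableTypeR R * measurableTypeR R] (reF f) /\
  measurable_fun [set: measurableTypeR R * measurableTypeR R] (imF f).

Definition in_L2 (R : realType) (f : R * R -> R[i]) : Prop :=
  measurable_c f /\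
  (\int[leb2 R]_x ((Normc.normc (f x)) ^+ 2)%:E < +oo)%E.

Definition trunc_fourier (R : realType) (f : R * R -> R[i]) (r : R)
    : R * R -> R[i] :=
  fun xi =>
    let h := fun x : R * R => cis (- dot2 x xi) * f x in
    Rintegral (leb2 R) [set x | enorm2 x <= r] (reF h) +i*
    Rintegral (leb2 R) [set x | enorm2 x <= r] (imF h).

(* Plancherel's definition of the Fourier transform on L^2, as the limit in
   the mean of the truncated integrals; [g] is determined by [f] up to a null
   set. Unnormalised convention: kernel exp (- i x . xi). *)
Definition is_fourier (R : realType) (f g : R * R -> R[i]) : Prop :=
  [/\ in_L2 f, measurable_c g &
   (fun r : R =>
      (\int[leb2 R]_xi
         ((Normc.normc (g xi - trunc_fourier f r xi)) ^+ 2)%:E)%E)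
     @ +oo --> 0%E].

(* The squared H^s norm (2 pi)^-2 \int (1 + |xi|^2)^s |f^(xi)|^2 d xi.
   The set below is a singleton when [f] is in L^2 and empty otherwise, in
   which case the infimum is +oo. *)
Definition sobolev_sq (R : realType) (s : R) (f : R * R -> R[i]) : \bar R :=
  ereal_inf
    [set (((2 * pi) ^- 2)%:E *
          \int[leb2 R]_xi
            (powR (1 + dot2 xi xi) s * (Normc.normc (g xi)) ^+ 2)%:E)%E
    | g in is_fourier f].

Definition in_Hs (R : realType) (s : R) (f : R * R -> R[i]) : Prop :=
  (sobolev_sq s f < +oo)%E.

Definition sobolev_norm (R : realType) (s : R) (f : R * R -> R[i]) : \bar R :=
  poweR (sobolev_sq s f) (2^-1).

Definition sobolev_norm_v (R : realType) (s : R) (f : R * R -> R * R)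
    : \bar R :=
  poweR (sobolev_sq s (toC (fst_of f)) + sobolev_sq s (toC (snd_of f)))%E
    (2^-1).

(* Classical C^2 solutions: H^1 distributional solutions of this equation are
   smooth by elliptic regularity. *)
Definition positive_radial_solution (R : realType) (Q : R * R -> R) : Prop :=
  [/\ (forall x, 0 < Q x),
      (forall x y, enorm2 x = enorm2 y -> Q x = Q y),
      in_Hs 1 (toC Q),
      classC 2 Q &
      (forall x, laplacian Q x = Q x - Q x ^+ 3)].

Definition is_ground_state (R : realType) (Q : R * R -> R) : Prop :=
  unique (@positive_radial_solution R) Q.

(* Classical solutions: the derivatives in the system exist pointwise. *)
Record zakharov_solution (R : realType) (u : R -> R * R -> R[i])
    (n : R -> R * R -> R) (v : R -> R * R -> R * R) : Prop := {
  zak_u_C2 : forall t, classC_c 2 (u t);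
  zak_n_C1 : forall t, classC 1 (n t);
  zak_v_C1 : forall t, classC 1 (fst_of (v t)) /\ classC 1 (snd_of (v t));
  zak_u_dt : forall t x,
    derivable (fun t' => complex.Re (u t' x)) t 1 /\
    derivable (fun t' => complex.Im (u t' x)) t 1;
  zak_n_dt : forall t x, derivable (fun t' => n t' x) t 1;
  zak_v_dt : forall t x,
    derivable (fun t' => (v t' x).1) t 1 /\
    derivable (fun t' => (v t' x).2) t 1;
  zak_u_eq : forall t x,
    derive1 (fun t' => complex.Re (u t' x)) t +i*
    derive1 (fun t' => complex.Im (u t' x)) t =
    'i%C * laplacian_c (u t) x - 'i%C * (n t x)%:C * u t x;
  zak_n_eq : forall t x,
    derive1 (fun t' => n t' x) t =
    - (pd1 (fst_of (v t)) x + pd2 (snd_of (v t)) x);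
  zak_v_eq1 : forall t x,
    derive1 (fun t' => (v t' x).1) t =
    - pd1 (n t) x - pd1 (fun z => Normc.normc (u t z) ^+ 2) x;
  zak_v_eq2 : forall t x,
    derive1 (fun t' => (v t' x).2) t =
    - pd2 (n t) x - pd2 (fun z => Normc.normc (u t z) ^+ 2) x }.

Definition moving_frame (R : realType) (omega : R) (c : R * R) (t : R)
    (x : R * R) : R * R :=
  Num.sqrt omega *: (x - t *: c).

Definition wave_u (R : realType) (U : R * R -> R[i]) (omega : R) (c : R * R)
    (t : R) (x : R * R) : R[i] :=
  (Num.sqrt omega)%:C * U (moving_frame omega c t x) *
  cis (dot2 c x / 2 - enorm2 c ^+ 2 * t / 4 + omega * t).

Definition wave_n (R : realType) (N : R * R -> R) (omega : R) (c : R * R)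
    (t : R) (x : R * R) : R :=
  omega * N (moving_frame omega c t x).

Definition wave_v (R : realType) (V : R * R -> R * R) (omega : R) (c : R * R)
    (t : R) (x : R * R) : R * R :=
  omega *: V (moving_frame omega c t x).

(* Main.v *)
Require Import Defs.
From HB Require Import structures.
From mathcomp Require Import all_boot all_order all_algebra.
From mathcomp Require Import complex.
From mathcomp Require Import all_classical all_reals all_analysis.
From mathcomp Require Import measurable_realfun ring lra.

(** In the moving frame the system reduces to [N = - U^2 + c . V] together with a scalar elliptic equation for the
    real even profile [U]; on the Fourier side, with [J = 1 + |xi|^2], it reads [J g = ((1 + mu) (g * g)) * g], where
    [mu = (c . xi)^2 / (|xi|^2 - (c . xi)^2)] is bounded by a multiple of [|c|^2].  Linearising at the transform of
    [Q], the operator is a compact perturbation of the identity.  It is injective on even functions: off the origin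
    of the closed quarter plane a supersolution kills the part odd in one variable, so the kernel is radial, and a
    Wronskian argument excludes radial elements.  Approximation by finite rank operators makes it invertible, and a
    contraction yields [g], at distance [O(|c|^2)] from the transform of [Q].  [U] decays by comparison with
    [exp (- sqrt (1 + |x|^2) / 2)].  [V] and [N + U^2] are second derivatives of the solution of
    [(- Laplacian + (c . grad)^2) psi = U^2]: regularising the symbol by [e^2], the radial and rotational derivatives
    of [psi] are bounded uniformly in [e], interior estimates propagate the algebraic decay to all derivatives, and
    [e] tends to zero. *)

Set Implicit Arguments.
Unset Strict Implicit.
Unset Printing Implicit Defensive.

Import Order.TTheory GRing.Theory Num.Theory numFieldNormedType.Exports.

Local Open Scope classical_set_scope.
Local Open Scope ring_scope.

(* [lra] reifies every hypothesis, including the propositions it cannot use. *)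
Ltac lran := repeat match goal with
 | H : ?P |- _ => lazymatch type of P with Prop => lazymatch P with
   | is_true (_ <= _) => fail | is_true (_ < _) => fail | _ = _ => fail
   | _ => clear H end end
 end; lra.

(** All profiles are real and even, so the Fourier transform is a cosine transform and complex
    numbers return only with the phase of u; evenness also removes the translation modes d1 Q and d2
    Q from the kernel of the linearised operator. The unknown g is measured in the sup norm weighted
    by [(1 + |xi|^2)^2]: the inverse weight is integrable in the plane, the space is an algebra for
    convolution, and the norm dominates that of H^2, so the bound on the fixed point is at once the
    Sobolev bound. The obstacle is that [mu] is homogeneous of degree 0 and jumps at the origin. In
    the equation for g it is only a bounded multiplier followed by a convolution, so g stays
    continuous and rapidly decreasing; but N and V inherit the jump, which limits them to algebraic
    decay. Their rate cannot be read off a discontinuous symbol, whence the detour through psi,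
    whose regularised symbol is smooth. Every bound must be uniform in c: it is proved for the whole
    class [sol] of solutions, with constants fixed before c. *)

Section Calculus.
Variable R : realType.
Implicit Types (f g : R * R -> R) (x v : R * R).

Lemma scaleRE (a b : R) : a *: (b : R^o) = a * b. Proof. by []. Qed.
Lemma p1D x v : (x + v).1 = x.1 + v.1. Proof. by []. Qed.
Lemma p2D x v : (x + v).2 = x.2 + v.2. Proof. by []. Qed.
Lemma p1N x : (- x).1 = - x.1. Proof. by []. Qed.
Lemma p2N x : (- x).2 = - x.2. Proof. by []. Qed.
Lemma p1Z (k : R) x : (k *: x).1 = k * x.1. Proof. by []. Qed.
Lemma p2Z (k : R) x : (k *: x).2 = k * x.2. Proof. by []. Qed.
Definition pE := (p1D, p2D, p1N, p2N, p1Z, p2Z).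
Lemma normD_le (a b c : R) : `|a| + `|b| <= c -> `|a + b| <= c.
Proof. exact: le_trans (ler_normD _ _). Qed.
Lemma normB_le (a b c : R) : `|a| + `|b| <= c -> `|a - b| <= c.
Proof. exact: le_trans (ler_normB _ _). Qed.
Lemma eqW (a b : R) : a = b -> a <= b. Proof. by move=> ->. Qed.

Lemma choice2 (P : nat -> nat -> R -> Prop) : (forall a b, exists2 C, 0 <= C & P a b C) ->
 exists2 C, forall a b, 0 <= C a b & forall a b, P a b (C a b).
Proof.
move=> h; have ex (p : nat * nat) : exists C, 0 <= C /\ P p.1 p.2 C by have [C C0 hC] := h p.1 p.2; exists C.
by have [C hC] := choice ex; exists (fun a b => C (a, b)) => a b; have [] := hC (a, b).
Qed.

Lemma pt_eq x v : x.1 = v.1 -> x.2 = v.2 -> x = v.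
Proof. by case: x v => a b [c d] /= -> ->. Qed.

(** * Differential calculus in the plane *)

Definition hg f x (a b : R) : Prop := is_diff x f (fun v : R * R => a * v.1 + b * v.2).
Lemma hg_diff f x a b : hg f x a b -> differentiable f x.
Proof. by move=> [? _]. Qed.
Lemma hg_dE f x a b : hg f x a b -> forall v, 'd f x v = a * v.1 + b * v.2.
Proof. by move=> [? e] v; rewrite e. Qed.
Lemma hg_pd1 f x a b : hg f x a b -> pd1 f x = a.
Proof. move=> h; rewrite /pd1 deriveE ?(hg_dE h) /dir1/=; [ring|exact: hg_diff h]. Qed.
Lemma hg_pd2 f x a b : hg f x a b -> pd2 f x = b.
Proof. move=> h; rewrite /pd2 deriveE ?(hg_dE h) /dir2/=; [ring|exact: hg_diff h]. Qed.

Lemma diff_hg f x : differentiable f x -> hg f x (pd1 f x) (pd2 f x).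
Proof.
move=> df; split=> //; apply/funext => v.
have -> : v = v.1 *: dir1 R + v.2 *: dir2 R.
 by case: v => a b; rewrite /dir1 /dir2; congr pair => /=; rewrite /GRing.scale/=; ring.
rewrite linearD !linearZ /= /pd1 /pd2 !deriveE// /GRing.scale /=; ring.
Qed.

Lemma hg_cont f x a b : hg f x a b -> {for x, continuous f}.
Proof. by move=> /hg_diff h; apply: differentiable_continuous. Qed.
Lemma hg_eq f x a b a' b' : hg f x a b -> a = a' -> b = b' -> hg f x a' b'.
Proof. by move=> h <- <-. Qed.
Lemma hg_ext f g x a b : (forall z, f z = g z) -> hg f x a b -> hg g x a b.
Proof. by move=> /funext ->. Qed.

Lemma hg_cst (k : R) x : hg (fun=> k) x 0 0.
Proof.
apply: (is_diff_eq (is_diff_cst k x)); apply/funext => v /=; by rewrite !mul0r addr0.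
Qed.

Lemma hgD f g x a b a' b' : hg f x a b -> hg g x a' b' ->
 hg (fun z => f z + g z) x (a + a') (b + b').
Proof.
move=> h h'; apply: (is_diff_eq (is_diffD h h')); apply/funext => v.
rewrite fctE; ring.
Qed.

Lemma hgN f x a b : hg f x a b -> hg (fun z => - f z) x (- a) (- b).
Proof.
move=> h; apply: (is_diff_eq (is_diffN h)); apply/funext => v.
rewrite fctE; ring.
Qed.

Lemma hgB f g x a b a' b' : hg f x a b -> hg g x a' b' ->
 hg (fun z => f z - g z) x (a - a') (b - b').
Proof. by move=> h h'; apply: hgD h (hgN h'). Qed.

Lemma hgM f g x a b a' b' : hg f x a b -> hg g x a' b' ->
 hg (fun z => f z * g z) x (a * g x + f x * a') (b * g x + f x * b').
Proof.
move=> h h'; apply: (is_diff_eq (is_diffM h h')); apply/funext => v.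
rewrite !fctE /GRing.scale /=; ring.
Qed.

Lemma hgZ (k : R) f x a b : hg f x a b -> hg (fun z => k * f z) x (k * a) (k * b).
Proof. by move=> h; apply: (hg_eq (hgM (hg_cst k x) h)); ring. Qed.
Definition lin2 (k l : R) (z : R * R) : R := k * z.1 + l * z.2.
Lemma lin2_linear (k l : R) : linear (lin2 k l).
Proof. move=> a x y; rewrite /lin2 /= /GRing.scale /=; ring. Qed.

HB.instance Definition _ (k l : R) :=
 GRing.isLinear.Build R (R * R)%type R *:%R (lin2 k l) (lin2_linear k l).

Lemma lin2_continuous (k l : R) : continuous (lin2 k l).
Proof.
move=> x; apply: cvgD; (apply: cvgMl_tmp).
 exact: cvg_fst.
exact: cvg_snd.
Qed.

Lemma hg_lin (k l : R) x : hg (fun z => k * z.1 + l * z.2) x k l.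
Proof.
have c := @lin2_continuous k l.
split; first exact: (@linear_differentiable R (R * R)%type R (lin2 k l) x c).
exact: (@diff_lin R (R * R)%type R (lin2 k l) x c).
Qed.

Lemma hg_fst x : hg (fun z => z.1) x 1 0.
Proof. by apply: hg_ext (hg_lin 1 0 x) => z; ring. Qed.
Lemma hg_snd x : hg (fun z => z.2) x 0 1.
Proof. by apply: hg_ext (hg_lin 0 1 x) => z; ring. Qed.

Lemma is_derive_diff (p : R -> R) (t d : R) : is_derive t (1 : R) p d ->
 is_diff t p (fun s => s * d).
Proof.
move=> [dp e]; split; first exact/derivable1_diffP.
by apply/funext => s; rewrite deriv1E// derive1E e.
Qed.

Lemma hg_comp (p : R -> R) f x a b d : is_derive (f x) 1 p d -> hg f x a b ->
 hg (fun z => p (f z)) x (d * a) (d * b).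
Proof.
move=> /is_derive_diff h h'.
apply: (is_diff_eq (is_diff_comp h' h)); apply/funext => v /=; ring.
Qed.

Lemma is_diff_line x v (t : R) : is_diff t (fun s : R => x + s *: v) (fun s => s *: v).
Proof.
apply: (is_diff_eq (is_diffD (is_diff_cst x t) (is_diff_scalel t v))).
by apply/funext => s; rewrite fctE /= add0r.
Qed.

Section Derive1.
Variables (p q : R -> R) (t a b : R).
Hypotheses (hp : is_derive t (1 : R) p a) (hq : is_derive t (1 : R) q b).

Lemma drvD : is_derive t (1 : R) (fun s => p s + q s) (a + b).
Proof. exact: is_deriveD. Qed.
Lemma drvN : is_derive t (1 : R) (fun s => - p s) (- a).
Proof. exact: is_deriveN. Qed.
Lemma drvB : is_derive t (1 : R) (fun s => p s - q s) (a - b).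
Proof. exact: is_deriveB. Qed.
Lemma drvM : is_derive t (1 : R) (fun s => p s * q s) (a * q t + p t * b).
Proof. by apply: (is_derive_eq (is_deriveM hp hq)); rewrite !scaleRE; ring. Qed.
Lemma drvZ (k : R) : is_derive t (1 : R) (fun s => k * p s) (k * a).
Proof. by apply: (is_derive_eq (is_deriveZ k hp)); rewrite !scaleRE; ring. Qed.

Lemma drvV : p t != 0 -> is_derive t (1 : R) (fun s => (p s)^-1) (- a / p t ^+ 2).
Proof.
move=> p0; apply: (is_derive_eq (is_deriveV p0 hp)); rewrite scaleRE.
by rewrite mulrC !mulrN mulNr.
Qed.

Lemma drv_eq a' : a = a' -> is_derive t (1 : R) p a'.
Proof. by move=> <-. Qed.
Lemma drv_cont : {for t, continuous p}.
Proof. by apply: differentiable_continuous; apply/derivable1_diffP; case: hp. Qed.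

End Derive1.

Lemma drv_id (t : R) : is_derive t (1 : R) (fun s => s) 1.
Proof. exact: is_derive_id. Qed.
Lemma drv_cst (k t : R) : is_derive t (1 : R) (fun=> k) 0.
Proof. exact: is_derive_cst. Qed.

Lemma drv_comp (p q : R -> R) (t a b : R) : is_derive (q t) (1 : R) p a ->
 is_derive t (1 : R) q b -> is_derive t (1 : R) (fun s => p (q s)) (a * b).
Proof. by move=> h h'; exact: is_derive1_comp. Qed.

Lemma drv_lin (k t : R) : is_derive t (1 : R) (fun s => k * s) k.
Proof. by apply: (drv_eq (drvZ (drv_id t) k)); rewrite mulr1. Qed.

Lemma hg_line f x v a b (t : R) : hg f (x + t *: v) a b ->
 is_derive t (1 : R) (fun s : R => f (x + s *: v)) (a * v.1 + b * v.2).
Proof.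
move=> h.
have [d e] := is_diff_comp (is_diff_line x v t) h.
apply: DeriveDef; first exact/derivable1_diffP.
by rewrite deriveE// e /= /GRing.scale /=; ring.
Qed.

Lemma is_diff_proj1 (z u : R * R) : is_diff z (fun z : R * R => z.1 *: u) (fun z => z.1 *: u).
Proof.
have := is_diff_comp (hg_fst z) (is_diff_scalel z.1 u).
by move/is_diff_eq; apply; apply/funext => s /=; congr (_ *: _); ring.
Qed.

Lemma is_diff_proj2 (z u : R * R) : is_diff z (fun z : R * R => z.2 *: u) (fun z => z.2 *: u).
Proof.
have := is_diff_comp (hg_snd z) (is_diff_scalel z.2 u).
by move/is_diff_eq; apply; apply/funext => s /=; congr (_ *: _); ring.
Qed.

Lemma hg_aff f (p u v : R * R) z a b : hg f (p + z.1 *: u + z.2 *: v) a b ->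
 hg (fun z : R * R => f (p + z.1 *: u + z.2 *: v)) z (a * u.1 + b * u.2) (a * v.1 + b * v.2).
Proof.
move=> h.
have h1 := is_diffD (is_diffD (is_diff_cst p z) (is_diff_proj1 z u)) (is_diff_proj2 z v).
apply: (is_diff_eq (is_diff_comp h1 h)); apply/funext => w /=.
rewrite !scaleRE; ring.
Qed.

Lemma hg_shift f p k z a b : hg f (k *: (z - p)) a b ->
 hg (fun z => f (k *: (z - p))) z (k * a) (k * b).
Proof.
have e w : k *: (w - p) = - (k *: p) + w.1 *: (k, 0) + w.2 *: (0, k).
 by apply: pt_eq; rewrite !pE /=; ring.
rewrite e => /hg_aff h; apply: (hg_ext (f := fun z => _)) (hg_eq h _ _) => [w||]; rewrite /= ?e//; ring.
Qed.

(** C^k with the derivatives as existential witnesses: closure under sums, products and cosines is a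
    plain induction on k, and [classC] is recovered at the end by [Dk_classC]. *)
Fixpoint Dk (k : nat) f : Prop :=
 match k with
 | 0 => continuous f
 | k'.+1 => exists f1 f2, [/\ forall x, hg f x (f1 x) (f2 x), Dk k' f1 & Dk k' f2]
 end.

Lemma Dk_cont k f : Dk k f -> continuous f.
Proof. by case: k => [//|k] [f1 [f2 [h _ _]]] x; exact: (hg_cont (h x)). Qed.

Lemma DkW k f : Dk k.+1 f -> Dk k f.
Proof.
elim: k f => [|k IH] f [f1 [f2 [h d1 d2]]]; first by move=> x; exact: (hg_cont (h x)).
by exists f1, f2; split => //; apply: IH.
Qed.

Lemma Dk_le k l f : (k <= l)%N -> Dk l f -> Dk k f.
Proof.
move=> kl; rewrite -(subnK kl); elim: (l - k)%N => [//|n IH]; rewrite addSn => /DkW; exact: IH.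
Qed.

Lemma Dk_ext k f g : (forall z, f z = g z) -> Dk k f -> Dk k g.
Proof. by move=> /funext ->. Qed.

Lemma Dk_cst k (c : R) : Dk k (fun=> c).
Proof.
elim: k c => [|k IH] c /=; first exact: cst_continuous.
by exists (fun=> 0), (fun=> 0); split => // x; apply: hg_cst.
Qed.

Lemma DkD k f g : Dk k f -> Dk k g -> Dk k (fun z => f z + g z).
Proof.
elim: k f g => [|k IH] f g /=; first by move=> cf cg x; apply: cvgD; [exact: cf|exact: cg].
move=> [f1 [f2 [h d1 d2]]] [g1 [g2 [h' d1' d2']]].
exists (fun z => f1 z + g1 z), (fun z => f2 z + g2 z); split; try exact: IH.
by move=> x; apply: hgD.
Qed.

Lemma DkM k f g : Dk k f -> Dk k g -> Dk k (fun z => f z * g z).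
Proof.
elim: k f g => [|k IH] f g; first by move=> cf cg x; apply: cvgM; [exact: cf|exact: cg].
move=> Df Dg; have Df' := DkW Df; have Dg' := DkW Dg.
move: Df Dg => [f1 [f2 [h d1 d2]]] [g1 [g2 [h' d1' d2']]].
exists (fun z => f1 z * g z + f z * g1 z), (fun z => f2 z * g z + f z * g2 z); split.
- by move=> x; apply: hgM.
- by apply: DkD; apply: IH.
- by apply: DkD; apply: IH.
Qed.

Lemma DkZ k (c : R) f : Dk k f -> Dk k (fun z => c * f z).
Proof. by apply: DkM; apply: Dk_cst. Qed.
Lemma DkN k f : Dk k f -> Dk k (fun z => - f z).
Proof. by move=> /(DkZ (-1)); apply: Dk_ext => z; ring. Qed.
Lemma DkB k f g : Dk k f -> Dk k g -> Dk k (fun z => f z - g z).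
Proof. by move=> h h'; apply: DkD h (DkN h'). Qed.

Lemma Dk_lin k (a b c : R) : Dk k (fun z => a * z.1 + b * z.2 + c).
Proof.
case: k => [|k].
 move=> x; apply: cvgD; last exact: cvg_cst.
 exact: (lin2_continuous (k := a) (l := b)).
exists (fun=> a), (fun=> b); split; try exact: Dk_cst.
by move=> x; apply: (hg_eq (hgD (hg_lin a b x) (hg_cst c x))); ring.
Qed.

Lemma Dk_fst k : Dk k (fun z => z.1).
Proof. by apply: Dk_ext (Dk_lin k 1 0 0) => z; ring. Qed.
Lemma Dk_snd k : Dk k (fun z => z.2).
Proof. by apply: Dk_ext (Dk_lin k 0 1 0) => z; ring. Qed.

Lemma Dk_cos k f : Dk k f -> forall t : R, Dk k (fun z => cos (f z + t)).
Proof.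
elim: k f => [|k IH] f.
 move=> cf t x.
 apply: (@continuous_comp _ _ _ (fun z => f z + t) cos).
  by apply: cvgD; [exact: cf|exact: cvg_cst].
 exact: continuous_cos.
move=> D t; have D' := DkW D; move: D => [f1 [f2 [h d1 d2]]].
have e z : - sin (f z + t) = cos (f z + (t + pi / 2)) by rewrite addrA cosDpihalf.
exists (fun z => cos (f z + (t + pi / 2)) * f1 z), (fun z => cos (f z + (t + pi / 2)) * f2 z); split.
- move=> x; have h0 := hgD (h x) (hg_cst t x).
 by apply: (hg_eq (hg_comp (is_derive_cos _) h0)); rewrite addr0 -e.
- by apply: DkM => //; apply: IH.
- by apply: DkM => //; apply: IH.
Qed.

Lemma Dk_pd1 k f : Dk k.+1 f -> Dk k (pd1 f).
Proof.
move=> [f1 [f2 [h d1 d2]]]; apply: Dk_ext d1 => z; by rewrite (hg_pd1 (h z)).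
Qed.

Lemma Dk_pd2 k f : Dk k.+1 f -> Dk k (pd2 f).
Proof.
move=> [f1 [f2 [h d1 d2]]]; apply: Dk_ext d2 => z; by rewrite (hg_pd2 (h z)).
Qed.

Lemma Dk_hg k f x : Dk k.+1 f -> hg f x (pd1 f x) (pd2 f x).
Proof. by move=> [f1 [f2 [h _ _]]]; apply: diff_hg; exact: hg_diff (h x). Qed.

Lemma Dk_pdm k m f : Dk (mlen m + k) f -> Dk k (pdm m f).
Proof.
case: m => m1 m2; rewrite /pdm /mlen /=.
elim: m1 k => [|m1 IH] k; last by rewrite !addSn -addnS => /IH; exact: Dk_pd1.
rewrite add0n; elim: m2 k => [//|m2 IH2] k; rewrite addSn -addnS => /IH2; exact: Dk_pd2.
Qed.

Lemma Dk_classC k f : Dk k f -> classC k f.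
Proof.
move=> D; split=> [m x mk|m mk].
 apply: hg_diff; apply: (@Dk_hg 0); apply: Dk_pdm; apply: Dk_le D; by rewrite addn1.
by apply: (@Dk_cont 0); apply: Dk_pdm; apply: Dk_le D; rewrite addn0.
Qed.

Lemma Dk_smooth f : (forall k, Dk k f) -> smooth f.
Proof. by move=> h k; apply: Dk_classC. Qed.

(** A positive [d] would make [g1] positive on an interval ]0, t0], and the mean value theorem would
    give g t0 > g 0. *)
Lemma max_d2 (g g1 : R -> R) (d : R) :
 (\forall t \near (0 : R), is_derive t (1 : R) g (g1 t)) ->
 is_derive (0 : R) (1 : R) g1 d ->
 (\forall t \near (0 : R), g t <= g 0) -> g1 0 = 0 /\ d <= 0.
Proof.
move=> /nbhs_ballP[e1 /= e10 h1] hd /nbhs_ballP[e2 /= e20 h2].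
pose e := Num.min e1 e2.
have e0 : 0 < e by rewrite lt_min e10.
have h1' t : `|t| < e -> is_derive t (1 : R) g (g1 t).
 move=> te; apply: h1; rewrite /ball /= sub0r normrN.
 by apply: lt_le_trans te _; rewrite ge_min lexx.
have h2' t : `|t| < e -> g t <= g 0.
 move=> te; apply: h2; rewrite /ball /= sub0r normrN.
 by apply: lt_le_trans te _; rewrite ge_min lexx orbT.
have g10 : g1 0 = 0.
 have : is_derive (0:R) (1:R) g 0.
  apply: (@derive1_at_max _ g (- e / 2) (e / 2)); rewrite ?in_itv /=; try lra.
   move=> t; rewrite in_itv /= => /andP[t1 t2].
   by have [] := h1' t _; first by rewrite ltr_norml; apply/andP; split; lra.
  by move=> t; rewrite in_itv /= => /andP[t1 t2]; apply: h2'; rewrite ltr_norml; apply/andP; split; lra.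
 case=> _ E; have [|_ E'] := h1' 0; first by rewrite normr0.
 by rewrite -E'.
split=> //; rewrite leNgt; apply/negP => d0.
have [dg1 e1E] := hd.
have : (fun h => h^-1 *: ((g1 \o shift 0) (h *: (1:R)) - g1 0)) @ 0^' --> d.
 by rewrite -e1E; exact: dg1.
move=> /cvgrPdist_lt /(_ d d0) /nbhs_ballP[e3 /= e30 h3].
pose t0 := Num.min e e3 / 2.
have m0 : 0 < Num.min e e3 by rewrite lt_min e0.
have m1 : Num.min e e3 <= e by rewrite ge_min lexx.
have m2 : Num.min e e3 <= e3 by rewrite ge_min lexx orbT.
have pos t : 0 < t <= t0 -> 0 < g1 t.
 move=> /andP[t1 t2]; rewrite /t0 in t2.
 have := h3 t; rewrite /ball /= sub0r normrN.
 have -> : `|t| < e3 by rewrite gtr0_norm//; lra.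
 move=> /(_ isT); rewrite gt_eqF// => /(_ isT).
 rewrite g10 subr0 scaleRE scaleRE mulr1 addr0 => h4.
 have : 0 < t^-1 * g1 t by move: h4; rewrite ltr_norml => /andP[_]; lra.
 by rewrite pmulr_rgt0// invr_gt0.
have t00 : 0 < t0 by rewrite /t0; lra.
have : g 0 < g t0.
 have [c] : exists2 c, c \in `]0, t0[ & g t0 - g 0 = g1 c * (t0 - 0).
  apply: MVT => //.
   move=> t; rewrite in_itv /= => /andP[t1 t2]; apply: h1'.
   by rewrite gtr0_norm//; rewrite /t0 in t2; lra.
  apply: derivable_within_continuous => t; rewrite in_itv /= => /andP[t1 t2].
  by have [] := h1' t _; first by rewrite ger0_norm//; rewrite /t0 in t2; lra.
 rewrite in_itv /= => /andP[c1 c2] E.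
 have : 0 < g1 c * (t0 - 0) by apply: mulr_gt0; [apply: pos; rewrite c1 ltW|rewrite subr0].
 lran.
apply/negP; rewrite -leNgt; apply: h2'; rewrite gtr0_norm// /t0; lra.
Qed.

Lemma near_line x v (P : R * R -> Prop) : (\forall z \near x, P z) ->
 \forall t \near (0 : R), P (x + t *: v).
Proof.
move=> h; have [d _] := is_diff_line x v 0.
have c : (x + t *: v) @[t --> (0 : R)] --> x.
 by have := differentiable_continuous d; rewrite /prop_for /continuous_at /= scale0r addr0.
exact: c h.
Qed.

Lemma max2 f f1 f2 x a11 a12 a21 a22 :
 (\forall z \near x, hg f z (f1 z) (f2 z)) ->
 hg f1 x a11 a12 -> hg f2 x a21 a22 -> (\forall z \near x, f z <= f x) ->
 [/\ f1 x = 0, f2 x = 0, a11 <= 0 & a22 <= 0].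
Proof.
move=> h h1 h2 m.
have L (w : R * R) (p : R * R -> R) b1 b2 : hg p x b1 b2 -> is_derive (0 : R) (1 : R)
  (fun t : R => p (x + t *: w)) (b1 * w.1 + b2 * w.2).
 by move=> hp; apply: hg_line; rewrite scale0r addr0.
have [p1 p2] : f1 x = 0 /\ a11 <= 0.
 have -> : f1 x = f1 (x + 0 *: (1, 0)) by rewrite scale0r addr0.
 apply: (@max_d2 (fun t : R => f (x + t *: (1, 0))) (fun t : R => f1 (x + t *: (1, 0)))).
 - near=> t.
  have : hg f (x + t *: (1, 0)) (f1 (x + t *: (1, 0))) (f2 (x + t *: (1, 0))).
   by near: t; exact: (near_line (1, 0) h).
  by move=> /hg_line /=; rewrite mulr1 mulr0 addr0.
 - by have := L (1, 0) _ _ _ h1; rewrite /= mulr1 mulr0 addr0.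
 - by rewrite scale0r addr0; exact: (near_line (1, 0) m).
have [p3 p4] : f2 x = 0 /\ a22 <= 0.
 have -> : f2 x = f2 (x + 0 *: (0, 1)) by rewrite scale0r addr0.
 apply: (@max_d2 (fun t : R => f (x + t *: (0, 1))) (fun t : R => f2 (x + t *: (0, 1)))).
 - near=> t.
  have : hg f (x + t *: (0, 1)) (f1 (x + t *: (0, 1))) (f2 (x + t *: (0, 1))).
   by near: t; exact: (near_line (0, 1) h).
  by move=> /hg_line /=; rewrite mulr1 mulr0 add0r.
 - by have := L (0, 1) _ _ _ h2; rewrite /= mulr1 mulr0 add0r.
 - by rewrite scale0r addr0; exact: (near_line (0, 1) m).
by split.
Unshelve. all: by end_near. Qed.

End Calculus.

(** * Measure and integration on the plane *)

Section Plane.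
Variable R : realType.
Implicit Types (f g : R * R -> R).
Local Notation mu := (@lebesgue_measure R).
Local Notation T2 := (measurableTypeR R * measurableTypeR R)%type.
Local Notation mu2 := (leb2 R).

(** The sigma-algebra is the product one, so an open set is written as a countable union of squares
    with rational centres and radii 1 / (n + 1). *)
Lemma open_meas2 (A : set (R * R)) : open A -> measurable (A : set T2).
Proof.
move=> oA.
pose B (p q : rat) (n : nat) : set T2 :=
 ball (ratr p : R) n.+1%:R^-1 `*` ball (ratr q : R) n.+1%:R^-1.
have -> : (A : set T2) = \bigcup_p \bigcup_q \bigcup_n (if `[< B p q n `<=` A >] then B p q n else set0).
 apply/seteqP; split => [x Ax|x [p _ [q _ [n _]]]]; last by case: asboolP => // h; exact: h.
 have /nbhs_ballP[e /= e0 he] : nbhs (x : R * R) A by exact: open_nbhs_nbhs.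
 have [n _ hn] : \forall n \near \oo, n.+1%:R^-1 < e / 2.
  by apply: near_infty_natSinv_lt (PosNum (_ : 0 < e / 2)); lra.
 have {}hn := hn n (leqnn n).
 set d : R := n.+1%:R^-1 in hn.
 have d0 : 0 < d by rewrite invr_gt0.
 have [p hp] : exists p : rat, ratr p \in `]x.1 - d, x.1 + d[ by apply: rat_in_itvoo; lra.
 have [q hq] : exists q : rat, ratr q \in `]x.2 - d, x.2 + d[ by apply: rat_in_itvoo; lra.
 exists p => //; exists q => //; exists n => //.
 rewrite !in_itv /= in hp hq; case/andP: hp => hp1 hp2; case/andP: hq => hq1 hq2.
 case: asboolP; last first.
  case=> y [/= y1 y2]; apply: he; rewrite /ball /= /ball /=; move: y1 y2; rewrite -/d /ball /=.
  rewrite !ltr_norml => /andP[y1 y1'] /andP[y2 y2'].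
  by split; rewrite /ball /= ltr_norml; apply/andP; split; lra.
 by move=> _; split; rewrite /ball /= -/d ltr_norml; apply/andP; split; lra.
apply: bigcupT_measurable_rat => p; apply: bigcupT_measurable_rat => q.
apply: bigcupT_measurable => n; case: asboolP => // _.
by apply: measurableX; apply: open_measurable; exact: ball_open.
Qed.

Definition meas (f : R * R -> R) : Prop := measurable_fun (setT : set T2) (f : T2 -> R).

Lemma open_meas (D : set (R * R)) (f : R * R -> R) : open D ->
 (forall x, D x -> {for x, continuous f}) -> measurable_fun (D : set T2) (f : T2 -> R).
Proof.
move=> oD cf; apply: (measurability _ (RGenOpens.measurableE R)).
move=> _ [_ [a [b ->] <-]]; apply: open_meas2.
rewrite openE => x [Dx /= fx].
have h1 : nbhs x D by exact: open_nbhs_nbhs.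
have h2 : nbhs x (f @^-1` `]a, b[).
 by apply: cf => //; apply: open_nbhs_nbhs; split => //; exact: interval_open.
exact: filterI.
Qed.

Lemma measC (f : R * R -> R) : continuous f -> meas f.
Proof. by move=> cf; apply: open_meas => // *; [exact: openT|exact: cf]. Qed.

Lemma meas_set1 (x : R * R) : measurable ([set x] : set T2).
Proof.
have -> : [set x] = ([set x.1] `*` [set x.2] : set T2).
 by apply/seteqP; split => [y ->//|[a b] [/= -> ->]]; case: x.
by apply: measurableX.
Qed.

(** Serves symbols such as [mu c], which jump at the origin: one point is measurable, and f is
    continuous on its open complement. *)
Lemma punctured_meas (f : R * R -> R) (x0 : R * R) :
 (forall x, x != x0 -> {for x, continuous f}) -> meas f.
Proof.
move=> cf; rewrite /meas.
have -> : (setT : set T2) = [set x0] `|` ~` [set x0] by rewrite setUv.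
apply/measurable_funU; first exact: meas_set1.
- apply: measurableC; exact: meas_set1.
- split.
 + move=> _ Y mY.
  have [h|h] := pselect (Y (f x0)).
   rewrite (_ : _ `&` _ = [set x0]); first exact: meas_set1.
   by apply/seteqP; split => [y []//|y ->].
  rewrite (_ : _ `&` _ = set0)//.
  by apply/seteqP; split => [y [->]//|y].
 + apply: open_meas; last by move=> x /= /eqP; exact: cf.
  rewrite openC; apply: accessible_closed_set1; apply: hausdorff_accessible.
  exact: norm_hausdorff.
Qed.

Lemma measD f g : meas f -> meas g -> meas (fun x => f x + g x).
Proof. by move=> h h'; apply: measurable_funD. Qed.
Lemma measB f g : meas f -> meas g -> meas (fun x => f x - g x).
Proof. by move=> h h'; apply: measurable_funB. Qed.
Lemma measM f g : meas f -> meas g -> meas (fun x => f x * g x).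
Proof. by move=> h h'; apply: measurable_funM. Qed.
Lemma meas_cst c : meas (fun=> c).
Proof. by apply: measurable_cst. Qed.
Lemma measX f k : meas f -> meas (fun x => f x ^+ k).
Proof. exact: measurable_funX. Qed.
Lemma meas_abs f : meas f -> meas (fun x => `|f x|).
Proof. by move=> h; apply: measurableT_comp. Qed.
Definition Int (f : R * R -> R) : Prop := mu2.-integrable setT (EFin \o f).
Definition II (f : R * R -> R) : R := Rintegral mu2 setT f.
Lemma Int_meas f : Int f -> meas f.
Proof. by move=> /integrableP[/measurable_EFinP]. Qed.

Lemma Int_le f g : meas f -> (forall x, `|f x| <= g x) -> Int g -> Int f.
Proof.
move=> mf fg; apply: le_integrable => //; first exact/measurable_EFinP.
move=> x _ /=; rewrite lee_fin; apply: le_trans (fg x) _; exact: ler_norm.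
Qed.

Lemma Int_ext f g : (forall x, f x = g x) -> Int f -> Int g.
Proof. by move=> /funext ->. Qed.
Lemma II_ext f g : (forall x, f x = g x) -> II f = II g.
Proof. by move=> /funext ->. Qed.
Lemma IntD f g : Int f -> Int g -> Int (fun x => f x + g x).
Proof. by move=> h h'; exact: (integrableD _ h h'). Qed.
Lemma IntZ k f : Int f -> Int (fun x => k * f x).
Proof. by move=> h; exact: (integrableZl _ k h). Qed.
Lemma IntN f : Int f -> Int (fun x => - f x).
Proof. by move=> /(IntZ (-1)); apply: Int_ext => x; rewrite mulN1r. Qed.
Lemma IntB f g : Int f -> Int g -> Int (fun x => f x - g x).
Proof. by move=> h h'; exact: IntD h (IntN h'). Qed.

Lemma Int_abs f : Int f -> Int (fun x => `|f x|).
Proof.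
move=> h; apply: (Int_le (g := fun x => `|f x|)) => [|x|].
- by apply: meas_abs; exact: Int_meas.
- by rewrite normr_id.
- have := integrable_abse h; by apply: eq_integrable.
Qed.

Lemma Int0 : Int (fun=> 0).
Proof. exact: integrable0. Qed.
Lemma IID f g : Int f -> Int g -> II (fun x => f x + g x) = II f + II g.
Proof. by move=> h h'; exact: RintegralD. Qed.
Lemma IIZ k f : Int f -> II (fun x => k * f x) = k * II f.
Proof. by move=> h; exact: RintegralZl. Qed.
Lemma IIN f : Int f -> II (fun x => - f x) = - II f.
Proof. by move=> h; rewrite -mulN1r -IIZ//; apply: II_ext => x; rewrite mulN1r. Qed.
Lemma IIB f g : Int f -> Int g -> II (fun x => f x - g x) = II f - II g.
Proof. by move=> h h'; exact: RintegralB. Qed.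
Lemma II0 : II (fun=> 0) = 0.
Proof. by rewrite -[RHS](mul0r (II (fun=> 0))) -(IIZ _ Int0); apply: II_ext => x; rewrite mul0r. Qed.
Lemma II_le f g : Int f -> Int g -> (forall x, f x <= g x) -> II f <= II g.
Proof. by move=> h h' fg; exact: le_Rintegral. Qed.
Lemma II_ge0 f : (forall x, 0 <= f x) -> 0 <= II f.
Proof. by move=> h; exact: Rintegral_ge0. Qed.
Lemma II_abs f : Int f -> `|II f| <= II (fun x => `|f x|).
Proof. by move=> h; exact: le_normr_Rintegral. Qed.

Lemma II_absle f g : meas f -> Int g -> (forall x, `|f x| <= g x) -> `|II f| <= II g.
Proof.
move=> mf ig fg; have h := Int_le mf fg ig.
by apply: le_trans (II_abs h) _; apply: II_le => //; exact: Int_abs.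
Qed.

Lemma IIE f : Int f -> (\int[mu2]_x (f x)%:E)%E = (II f)%:E.
Proof. by move=> h; rewrite fineK//; exact: integrable_fin_num. Qed.

Lemma Int_lty f : meas f -> (forall x, 0 <= f x) ->
 (\int[mu2]_x (f x)%:E < +oo)%E -> Int f.
Proof.
move=> mf f0 h; apply/integrableP; split; first exact/measurable_EFinP.
by under eq_integral do rewrite /= ger0_norm//.
Qed.

Lemma leb1_aff (s a : R) : (s = 1) \/ (s = -1) ->
 forall A : set (measurableTypeR R), measurable A ->
 mu A = mu ((fun x => s * x + a) @^-1` A).
Proof.
move=> hs A mA.
have mphi : measurable_fun (setT : set (measurableTypeR R))
  ((fun x => s * x + a) : measurableTypeR R -> measurableTypeR R).
 apply: continuous_measurable_fun => x; apply: cvgD; last exact: cvg_cst.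
 by apply: cvgMl_tmp; exact: cvg_id.
apply: (@lebesgue_measure_unique R (measure_function_pushforward__canonical__measure_function_Measure mu mphi)) => // _ [[u v] _ <-] /=.
rewrite /pushforward.
case: hs => ->.
- rewrite (_ : _ @^-1` _ = [set` `]u - a, v - a]]); last first.
  apply/seteqP; split => x; rewrite /= !in_itv /= => /andP[h1 h2]; apply/andP; split; lra.
 rewrite !lebesgue_measure_itv /= !lte_fin ltrD2r; case: ifP => // _.
 rewrite -!EFinB; congr _%:E; lra.
- rewrite (_ : _ @^-1` _ = [set` `[a - v, a - u[]); last first.
  apply/seteqP; split => x; rewrite /= !in_itv /= => /andP[h1 h2]; apply/andP; split; lra.
 rewrite !lebesgue_measure_itv /= !lte_fin ltrD2l ltrN2; case: ifP => // _.
 rewrite -!EFinB; congr _%:E; lra.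
Qed.

Definition aff (s : R) (a x : R * R) : R * R := (s * x.1 + a.1, s * x.2 + a.2).

Lemma meas_aff (s : R) a : measurable_fun (setT : set T2) (aff s a : T2 -> T2).
Proof.
have h (k : R) : measurable_fun (setT : set (measurableTypeR R))
  ((fun x => s * x + k) : measurableTypeR R -> measurableTypeR R).
 apply: continuous_measurable_fun => x; apply: cvgD; last exact: cvg_cst.
 by apply: cvgMl_tmp; exact: cvg_id.
apply: measurable_fun_pair.
 exact: (measurableT_comp (h a.1) measurable_fst).
exact: (measurableT_comp (h a.2) measurable_snd).
Qed.

Lemma leb2E (A B : set (measurableTypeR R)) : measurable A -> measurable B ->
 mu2 (A `*` B) = (mu A * mu B)%E.
Proof. exact: product_measure1E. Qed.

Lemma leb2_aff (s : R) a : (s = 1) \/ (s = -1) ->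
 forall A : set T2, measurable A -> mu2 A = mu2 (aff s a @^-1` A).
Proof.
move=> hs A mA; have mphi := meas_aff s a.
apply: (@product_measure_unique _ _ _ _ _ mu mu (measure_function_pushforward__canonical__measure_function_Measure mu2 mphi)) => // B C mB mC.
rewrite /= /pushforward.
have -> : aff s a @^-1` (B `*` C) =
  ((fun x => s * x + a.1) @^-1` B) `*` ((fun x => s * x + a.2) @^-1` C).
 by apply/seteqP; split => x.
have hm (k : R) E : measurable (E : set (measurableTypeR R)) ->
  measurable (((fun x => s * x + k) @^-1` E) : set (measurableTypeR R)).
 move=> mE; rewrite -[X in measurable X]setTI.
 have : measurable_fun (setT : set (measurableTypeR R))
   ((fun x => s * x + k) : measurableTypeR R -> measurableTypeR R).
  apply: continuous_measurable_fun => x; apply: cvgD; last exact: cvg_cst.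
  by apply: cvgMl_tmp; exact: cvg_id.
 exact.
by rewrite leb2E ?(leb1_aff a.1 hs mB) ?(leb1_aff a.2 hs mC)//; exact: hm.
Qed.

Definition push2 (s : R) a : {measure set T2 -> \bar R} :=
 measure_function_pushforward__canonical__measure_function_Measure mu2 (meas_aff s a).

Lemma ge0_int_aff (s : R) a (f : T2 -> \bar R) : (s = 1) \/ (s = -1) ->
 measurable_fun setT f -> (forall x, 0 <= f x)%E ->
 (\int[mu2]_x f (aff s a x) = \int[mu2]_x f x)%E.
Proof.
move=> hs mf f0.
have h : forall A : set T2, measurable A -> A `<=` setT -> mu2 A = push2 s a A.
 by move=> A mA _; exact: leb2_aff.
have E1 := @eq_measure_integral _ T2 R setT (push2 s a) mu2 f h.
have E2 := @ge0_integral_pushforward _ _ T2 T2 R _ (meas_aff s a) mu2 setT f measurableT mf (fun x _ => f0 x).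
rewrite preimage_setT in E2.
by rewrite E1; symmetry; exact: E2.
Qed.

Lemma int_aff (s : R) a (f : T2 -> \bar R) : (s = 1) \/ (s = -1) ->
 measurable_fun setT f -> mu2.-integrable setT (f \o aff s a) ->
 (\int[mu2]_x f (aff s a x) = \int[mu2]_x f x)%E.
Proof.
move=> hs mf f0.
have h : forall A : set T2, measurable A -> A `<=` setT -> mu2 A = push2 s a A.
 by move=> A mA _; exact: leb2_aff.
have E1 := @eq_measure_integral _ T2 R setT (push2 s a) mu2 f h.
have f0' : mu2.-integrable (aff s a @^-1` setT) (f \o aff s a) by rewrite preimage_setT.
have E2 := @integral_pushforward _ _ T2 T2 R _ (meas_aff s a) mu2 setT f mf f0' measurableT.
rewrite preimage_setT in E2.
by rewrite E1; symmetry; exact: E2.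
Qed.

Lemma meas_comp_aff f (s : R) a : meas f -> meas (fun x => f (aff s a x)).
Proof. move=> mf; exact: (measurableT_comp mf (meas_aff s a)). Qed.

Lemma Int_aff f (s : R) a : (s = 1) \/ (s = -1) -> Int f -> Int (fun x => f (aff s a x)).
Proof.
move=> hs /integrableP[mf h]; apply/integrableP; split.
 apply/measurable_EFinP; apply: meas_comp_aff; exact/measurable_EFinP.
have mf' : measurable_fun setT (fun x : T2 => `|(f x)%:E|)%E by exact: measurableT_comp.
by have -> := ge0_int_aff a hs mf' (fun x => abse_ge0 _).
Qed.

Lemma II_aff f (s : R) a : (s = 1) \/ (s = -1) -> Int f -> II (fun x => f (aff s a x)) = II f.
Proof.
move=> hs h; rewrite /II /Rintegral; congr fine.
apply: (int_aff (f := EFin \o f)) => //; first by case/integrableP: h.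
exact: (Int_aff a hs h).
Qed.

Lemma aff_opp x : aff (-1) 0 x = - x.
Proof. by apply: pt_eq; rewrite /aff ?pE /=; ring. Qed.
Lemma aff_add a x : aff 1 a x = x + a.
Proof. by apply: pt_eq; rewrite /aff ?pE /=; ring. Qed.
Lemma aff_sub a x : aff (-1) a x = a - x.
Proof. by apply: pt_eq; rewrite /aff ?pE /=; ring. Qed.
Lemma II_opp f : Int f -> II (fun x => f (- x)) = II f.
Proof. by move=> /(II_aff 0 (or_intror erefl)) <-; apply: II_ext => x; rewrite aff_opp. Qed.
Lemma Int_add a f : Int f -> Int (fun x => f (x + a)).
Proof. by move=> /(Int_aff a (or_introl erefl)); apply: Int_ext => x; rewrite aff_add. Qed.
Lemma II_add a f : Int f -> II (fun x => f (x + a)) = II f.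
Proof. by move=> /(II_aff a (or_introl erefl)) <-; apply: II_ext => x; rewrite aff_add. Qed.
Lemma Int_sub a f : Int f -> Int (fun x => f (a - x)).
Proof. by move=> /(Int_aff a (or_intror erefl)); apply: Int_ext => x; rewrite aff_sub. Qed.
Lemma II_sub a f : Int f -> II (fun x => f (a - x)) = II f.
Proof. by move=> /(II_aff a (or_intror erefl)) <-; apply: II_ext => x; rewrite aff_sub. Qed.

Lemma leb2_sigma_finite : sigma_finite (setT : set T2) mu2.
Proof.
exists (fun n => [set` `[- n%:R, n%:R]] `*` [set` `[- n%:R, n%:R]]).
 apply/esym/seteqP; split => // x _.
 pose n := (Num.truncn (`|x.1| + `|x.2|)).+1.
 have h : `|x.1| + `|x.2| < n%:R by apply: truncnS_gt.
 have [h1 h2] : `|x.1| <= n%:R /\ `|x.2| <= n%:R.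
  by have := normr_ge0 x.1; have := normr_ge0 x.2; split; lra.
 by exists n => //; split; rewrite /= in_itv /= -ler_norml.
move=> n; split; first by apply: measurableX; exact: measurable_itv.
rewrite leb2E; [|exact: measurable_itv..].
by rewrite lebesgue_measure_itv /=; case: ifP => _; rewrite -?EFinB -?EFinM ?ltry// mule0.
Qed.

Definition leb2s : {sigma_finite_measure set T2 -> \bar R} :=
 HB.pack (Measure.sort (leb2 R)) (Measure_isSigmaFinite.Build _ _ _ (leb2 R) leb2_sigma_finite).

(** Fubini for a kernel on two planes. The integrable majorant [a] of the absolute slices provides
    the Tonelli bound. *)
Lemma Fub (F : R * R -> R * R -> R) (a : R * R -> R) :
 measurable_fun (setT : set (T2 * T2)%type) (fun z : T2 * T2 => F z.1 z.2) ->
 (forall x, Int (F x)) -> (forall y, Int (fun x => F x y)) ->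
 Int a -> (forall x, II (fun y => `|F x y|) <= a x) ->
 [/\ Int (fun x => II (F x)), Int (fun y => II (fun x => F x y)) &
   II (fun x => II (F x)) = II (fun y => II (fun x => F x y))].
Proof.
move=> mF h1 h2 ia hle.
pose m2 := leb2s.
have mF' : measurable_fun setT (fun z : T2 * T2 => (F z.1 z.2)%:E) by exact/measurable_EFinP.
have hI : (m2 \x m2)%E.-integrable setT (fun z : T2 * T2 => (F z.1 z.2)%:E).
 apply/(integrable12ltyP m2 m2 mF').
 rewrite (_ : (fun x => _) = (fun x => (II (fun y => `|F x y|))%:E)); last first.
  by apply/funext => x /=; rewrite -IIE//; exact: Int_abs.
 apply: (@le_lt_trans _ _ (\int[m2]_x (a x)%:E)%E).
  apply: ge0_le_integral => //.
  - by move=> x _; rewrite lee_fin; exact: II_ge0.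
  - have mabs : measurable_fun setT (fun z : T2 * T2 => `|(F z.1 z.2)%:E|%E).
    by apply: measurableT_comp => //.
   have := @measurable_fun_fubini_tonelli_F _ _ T2 T2 R m2 _ mabs (fun x => abse_ge0 _).
   move=> H; apply: eq_measurable_fun H => x _ /=.
   by rewrite -IIE//; exact: Int_abs.
  - by apply/measurable_EFinP; exact: Int_meas.
  - by move=> x _; rewrite lee_fin.
 have -> : (\int[m2]_x (a x)%:E)%E = (II a)%:E by rewrite -IIE.
 exact: ltry.
have e1 : (fun x => II (F x)) =1 fine \o (fun x => \int[m2]_y (F x y)%:E)%E by [].
have E1 : EFin \o (fun x => II (F x)) = fubini_F m2 (fun z : T2 * T2 => (F z.1 z.2)%:E).
 by apply/funext => x; rewrite /fubini_F /= -IIE.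
have E2 : EFin \o (fun y => II (fun x => F x y)) = fubini_G m2 (fun z : T2 * T2 => (F z.1 z.2)%:E).
 by apply/funext => x; rewrite /fubini_G /= -IIE.
split.
- by rewrite /Int E1; have := integrable_fubini_F hI.
- rewrite /Int E2; apply/integrableP; split; first by have := measurable_fubini_G hI.
 have mabs : measurable_fun setT (fun z : T2 * T2 => `|(F z.1 z.2)%:E|%E).
  by apply: measurableT_comp => //.
 apply: le_lt_trans ((integrable21ltyP m2 m2 mF').1 hI).
 apply: ge0_le_integral => //.
 + by apply: measurableT_comp => //; have := measurable_fubini_G hI.
 + exact: (@measurable_fun_fubini_tonelli_G _ _ T2 T2 R m2 _ mabs (fun x => abse_ge0 _)).
 + move=> y _; rewrite /fubini_G; apply: le_abse_integral => //.
  by case/integrableP: (h2 y).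
- rewrite /II /Rintegral; congr fine.
 have := integral12_prod_meas1 hI; have := integral21_prod_meas1 hI.
 by rewrite -E1 -E2 => -> ->.
Qed.

End Plane.

(** * Dominated convergence for real-valued integrals *)

Section DCT.
Context (R : realType) (d : measure_display) (T : measurableType d) (m : {measure set T -> \bar R}).

Lemma Rdct (f_ : nat -> T -> R) (f g : T -> R) :
 (forall n, measurable_fun setT (f_ n)) -> measurable_fun setT f ->
 m.-integrable setT (EFin \o g) ->
 (forall x, f_ n x @[n --> \oo] --> f x) -> (forall n x, `|f_ n x| <= g x) ->
 Rintegral m setT (f_ n) @[n --> \oo] --> Rintegral m setT f.
Proof.
move=> mf_ mf ig cf bf.
have [|||||h1 _ h] := @dominated_convergence _ _ R m setT measurableT
 (fun n x => (f_ n x)%:E) (EFin \o f) (EFin \o g).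
- by move=> n; apply/measurable_EFinP.
- exact/measurable_EFinP.
- by apply: aeW => x _ /=; apply: cvg_EFin; [exact: nearW|exact: cf].
- exact: ig.
- by apply: aeW => x n _ /=; rewrite lee_fin.
apply: fine_cvg; rewrite fineK; last exact: integrable_fin_num.
exact: h.
Qed.
End DCT.

(** * One-dimensional integrals: the Cauchy and exponential kernels *)

Section Line.
Variable R : realType.
Local Notation mu := (@lebesgue_measure R).
Local Notation T2 := (measurableTypeR R * measurableTypeR R)%type.
Implicit Types (p q F G : R -> R).

Definition Int1 p : Prop := mu.-integrable setT (EFin \o p).
Definition I1 p : R := Rintegral mu setT p.

Lemma Int1_le p q : continuous p -> (forall x, `|p x| <= q x) -> Int1 q -> Int1 p.
Proof.
move=> cp pq; apply: le_integrable => //.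
 by apply/measurable_EFinP; exact: continuous_measurable_fun.
move=> x _ /=; rewrite lee_fin; apply: le_trans (pq x) _; exact: ler_norm.
Qed.

Lemma Int1_ext p q : (forall x, p x = q x) -> Int1 p -> Int1 q.
Proof. by move=> /funext ->. Qed.
Lemma Int1Z k p : Int1 p -> Int1 (fun x => k * p x).
Proof. by move=> h; exact: (integrableZl _ k h). Qed.
Lemma I1_ext p q : (forall x, p x = q x) -> I1 p = I1 q.
Proof. by move=> /funext ->. Qed.
Lemma I1E p : Int1 p -> (\int[mu]_x (p x)%:E)%E = (I1 p)%:E.
Proof. by move=> h; rewrite fineK//; exact: integrable_fin_num. Qed.
Lemma I1Z k p : Int1 p -> I1 (fun x => k * p x) = k * I1 p.
Proof. by move=> h; exact: RintegralZl. Qed.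

Lemma FTC_itv p F (a b : R) : a < b -> continuous p ->
 (forall x, a <= x <= b -> is_derive x (1 : R) F (p x)) ->
 Rintegral mu [set` `[a, b]] p = F b - F a.
Proof.
move=> ab cp hF; rewrite /Rintegral (@continuous_FTC2 _ p F)//.
- by apply: continuous_subspaceT.
- split.
 + by move=> x; rewrite in_itv /= => /andP[h1 h2]; have [|] := hF x; rewrite ?(ltW h1) ?(ltW h2).
 + apply: cvg_at_right_filter; apply: differentiable_continuous; apply/derivable1_diffP.
  by have [|] := hF a; rewrite ?lexx ?ltW.
 + apply: cvg_at_left_filter; apply: differentiable_continuous; apply/derivable1_diffP.
  by have [|] := hF b; rewrite ?lexx ?ltW.
- move=> x; rewrite in_itv /= => /andP[h1 h2].
 by rewrite derive1E; have [|_ ->] := hF x; rewrite ?(ltW h1) ?(ltW h2).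
Qed.

(** Two antiderivatives, one per half line, because [expR (- (e * |x|))] has different ones on the
    two sides. The truncations to [-n - 1, n + 1] converge by dominated convergence. *)
Lemma FTC_split p F G (l l' : R) : continuous p -> Int1 p ->
 (forall x : R, 0 <= x -> is_derive x (1 : R) F (p x)) ->
 (forall x : R, x <= 0 -> is_derive x (1 : R) G (p x)) ->
 F n%:R @[n --> \oo] --> l -> G (- n%:R) @[n --> \oo] --> l' ->
 I1 p = (l - F 0) + (G 0 - l').
Proof.
move=> cp ip hF hG Fl Gl.
pose D (n : nat) := [set` `[- n.+1%:R, n.+1%:R] : interval R].
have mD n : measurable (D n : set (measurableTypeR R)) by exact: measurable_itv.
have E (n : nat) : Rintegral mu (D n) p = (F n.+1%:R - F 0) + (G 0 - G (- n.+1%:R)).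
 have n0 : 0 < n.+1%:R :> R by rewrite ltr0n.
 have i : mu.-integrable (D n) (EFin \o p) by exact: integrableS ip.
 have := @Rintegral_itvB R p (BLeft (- n.+1%:R)) (BRight n.+1%:R) 0 i.
 rewrite !bnd_simp => /(_ _ _).
 rewrite oppr_le0 ltW// => /(_ isT isT).
 have -> : Rintegral mu [set` `[- n.+1%:R, 0]] p = G 0 - G (- n.+1%:R).
  by apply: FTC_itv => // x /andP[_ x0]; exact: hG.
 rewrite Rintegral_itv_obnd_cbnd; last first.
  by apply: integrableS ip => //; exact: measurable_itv.
 have -> : Rintegral mu [set` `[0, n.+1%:R]] p = F n.+1%:R - F 0.
  by apply: FTC_itv => // x /andP[x0 _]; exact: hF.
 by move=> e; rewrite /D; lra.
have : (fun n : nat => (Rintegral mu (D n) p)) @ \oo --> I1 p.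
 under eq_fun do rewrite Rintegral_mkcond.
 apply: (@Rdct _ _ _ mu (fun n => p \_ (D n)) p (fun x => `|p x|)).
 - move=> n; apply/(measurable_restrictT p (mD n)).
  by apply: measurable_funTS; exact: continuous_measurable_fun.
 - exact: continuous_measurable_fun.
 - exact: (integrable_abse ip).
 - move=> x; apply: cvg_near_cst.
  exists (Num.truncn `|x|) => // n /= hn.
  rewrite patchE mem_set// /D /= in_itv /= -ler_norml.
  have : `|x| < (Num.truncn `|x|).+1%:R by apply: truncnS_gt.
  move=> /ltW /le_trans; apply; rewrite ler_nat; exact: leq_ltn_trans hn _.
 - by move=> n x; rewrite patchE; case: ifP => // _; rewrite normr0.
under eq_fun do rewrite E.
have : (fun n : nat => (F n.+1%:R - F 0) + (G 0 - G (- n.+1%:R))) @ \oo --> (l - F 0) + (G 0 - l').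
 apply: cvgD; [apply: cvgB; last exact: cvg_cst|apply: cvgB; first exact: cvg_cst].
  by rewrite -(cvg_shiftS (fun n => F n%:R)) in Fl.
 by rewrite -(cvg_shiftS (fun n => G (- n%:R))) in Gl.
move=> h1 h2; exact: (cvg_unique _ h2 h1).
Qed.

Lemma natr_pinfty : (fun n : nat => n%:R : R) @ \oo --> +oo.
Proof. exact: cvgr_idn. Qed.
Lemma mulr_pinfty (e : R) : 0 < e -> e * x @[x --> +oo] --> +oo.
Proof. by move=> e0; apply: (gt0_cvgMry (f := fun x => x)) => //; exact: cvg_id. Qed.

Lemma cauchy_kernel (e : R) : 0 < e ->
 Int1 (fun x => e / (e ^+ 2 + x ^+ 2)) /\ I1 (fun x => e / (e ^+ 2 + x ^+ 2)) = pi.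
Proof.
move=> e0; pose p x := e / (e ^+ 2 + x ^+ 2).
have d0 x : 0 < e ^+ 2 + x ^+ 2 by have := sqr_ge0 x; have := exprn_gt0 2 e0; lra.
have cp : continuous p.
 move=> x; apply: cvgMl_tmp.
 apply: cvgV; first by rewrite gt_eqF.
 by apply: cvgD; [exact: cvg_cst|exact: (@exprn_continuous R 2 x)].
pose F x := atan (e^-1 * x).
have dF x : is_derive x (1 : R) F (p x).
 apply: (drv_eq (drv_comp (is_derive1_atan _) (drv_lin e^-1 x))); rewrite /p; field.
 by rewrite !gt_eqF//; have := d0 x.
have Fy : F x @[x --> +oo] --> pi / 2.
 have ei : 0 < e^-1 by rewrite invr_gt0.
 exact: (cvg_comp _ _ (mulr_pinfty ei) (@cvgy_atan R)).
have FN : F (- n%:R) @[n --> \oo] --> - (pi / 2 : R).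
 rewrite [X in X @ _ --> _](_ : _ = (fun n : nat => - F n%:R)); last first.
  by apply/funext => n; rewrite /F mulrN atanN.
 by apply: cvgN; apply: (cvg_comp _ F natr_pinfty Fy).
have F0 : F 0 = 0 by rewrite /F mulr0 atan0.
have ip : Int1 p.
 apply/integrableP; split.
  by apply/measurable_EFinP; exact: continuous_measurable_fun.
 under eq_integral do rewrite /= ger0_norm ?divr_ge0 ?ltW//.
 rewrite ge0_symfun_integralT//.
 - rewrite -set_itvcy (ge0_continuous_FTC2y (F := F) (l := pi / 2))//.
  + by rewrite -EFinB -EFinM ltry.
  + by move=> x _; rewrite divr_ge0 ?ltW.
  + exact: continuous_subspaceT.
  + apply: cvg_at_right_filter; apply: differentiable_continuous; apply/derivable1_diffP.
   by case: (dF 0).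
  + by move=> x _; rewrite derive1E; case: (dF x).
 - by move=> x; rewrite divr_ge0 ?ltW.
 - by move=> x; rewrite /p /= sqrrN.
split => //.
have := FTC_split cp ip (fun x _ => dF x) (fun x _ => dF x)
 (cvg_comp _ F natr_pinfty Fy) FN.
rewrite F0 => ->; lra.
Qed.

Lemma expR_lim (e : R) : 0 < e -> expR (- (e * x)) @[x --> +oo] --> 0.
Proof. by move=> e0; exact: (cvg_comp _ _ (mulr_pinfty e0) (@cvgr_expR R)). Qed.
Lemma expRN_cvg (e : R) : 0 < e -> expR (- (e * n%:R)) @[n --> \oo] --> 0.
Proof. by move=> e0; exact: (cvg_comp _ _ natr_pinfty (expR_lim e0)). Qed.

Lemma exp_kernel (e : R) : 0 < e -> Int1 (fun x => expR (- (e * `|x|))).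
Proof.
move=> e0; set p := (fun x => _).
have cp : continuous p.
 move=> x; apply: (@continuous_comp _ _ _ (fun x => - (e * `|x|)) expR); last exact: continuous_expR.
 by apply: cvgN; apply: cvgMl_tmp; exact: norm_continuous.
apply/integrableP; split.
 by apply/measurable_EFinP; exact: continuous_measurable_fun.
under eq_integral do rewrite /= ger0_norm ?expR_ge0//.
rewrite ge0_symfun_integralT//; last 2 first.
- by move=> x; exact: expR_ge0.
- by move=> x; rewrite /p /= normrN.
pose F x := - (e^-1 * expR (- (e * x))).
have dF (x : R) : is_derive x (1 : R) F (expR (- (e * x))).
 apply: (drv_eq (drvN (drvZ (drv_comp (is_derive_expR _) (drvN (drv_lin e x))) e^-1))).
 by rewrite mulrN mulrN opprK mulrCA mulVf ?gt_eqF// mulr1.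
rewrite -set_itvcy (ge0_continuous_FTC2y (F := F) (l := 0))//.
- by rewrite -EFinB -EFinM ltry.
- by move=> x _; exact: expR_ge0.
- exact: continuous_subspaceT.
- rewrite -oppr0; apply: cvgN; rewrite -[X in _ --> X](mulr0 e^-1); apply: cvgMl_tmp.
 exact: expR_lim.
- apply: cvg_at_right_filter; apply: differentiable_continuous; apply/derivable1_diffP.
 by case: (dF 0).
- move=> x; rewrite in_itv /= andbT => x0; rewrite derive1E /p gtr0_norm//; by case: (dF x).
Qed.

Lemma exp_cos_kernel (e t : R) : 0 < e ->
 [/\ Int1 (fun x => expR (- (e * `|x|)) * cos (t * x)),
   I1 (fun x => expR (- (e * `|x|)) * cos (t * x)) = 2 * (e / (e ^+ 2 + t ^+ 2)),
   Int1 (fun x => expR (- (e * `|x|)) * sin (t * x)) &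
   I1 (fun x => expR (- (e * `|x|)) * sin (t * x)) = 0].
Proof.
move=> e0.
have cE : continuous (fun x : R => expR (- (e * `|x|))).
 move=> x; apply: (@continuous_comp _ _ _ (fun x => - (e * `|x|)) expR); last exact: continuous_expR.
 by apply: cvgN; apply: cvgMl_tmp; exact: norm_continuous.
have ct : continuous (fun x : R => t * x).
 by move=> x; apply: cvgMl_tmp; exact: cvg_id.
have osc (h : R -> R) : continuous h -> (forall u, `|h u| <= 1) ->
  continuous (fun x => expR (- (e * `|x|)) * h (t * x)) /\ Int1 (fun x => expR (- (e * `|x|)) * h (t * x)).
 move=> ch h1; have c : continuous (fun x => expR (- (e * `|x|)) * h (t * x)).
  by move=> x; apply: cvgM; [exact: cE|apply: continuous_comp; [exact: ct|exact: ch]].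
 split => //; apply: Int1_le (exp_kernel e0) => // x.
 by rewrite normrM (ger0_norm (expR_ge0 _)) ler_piMr ?expR_ge0.
have cos1 u : `|cos u| <= (1 : R) by rewrite ler_norml cos_geN1 cos_le1.
have sin1 u : `|sin u| <= (1 : R) by rewrite ler_norml sin_geN1 sin_le1.
have [cc ic] := osc _ (@continuous_cos R) cos1.
have [cs is'] := osc _ (@continuous_sin R) sin1.
have d0 : 0 < e ^+ 2 + t ^+ 2 by have := sqr_ge0 t; have := exprn_gt0 2 e0; lra.
pose D := (e ^+ 2 + t ^+ 2)^-1.
have De : D * (e ^+ 2 + t ^+ 2) = 1 by rewrite mulVf ?gt_eqF.
have dexp (a x : R) : is_derive x (1 : R) (fun x => expR (a * x)) (a * expR (a * x)).
 by apply: (drv_eq (drv_comp (is_derive_expR _) (drv_lin a x))); rewrite mulrC.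
have hcos (x : R) : is_derive x (1 : R) (fun x => cos (t * x)) (- t * sin (t * x)).
 by apply: (drv_eq (drv_comp (is_derive_cos _) (drv_lin t x))); ring.
have hsin (x : R) : is_derive x (1 : R) (fun x => sin (t * x)) (t * cos (t * x)).
 by apply: (drv_eq (drv_comp (is_derive_sin _) (drv_lin t x))); ring.
(* Antiderivatives of [expR (a x) cos (t x)] and [expR (a x) sin (t x)] when a^2 = e^2; they are
   used with a = - e on the right half line and a = e on the left. *)
pose Fc (a x : R) := D * (expR (a * x) * (t * sin (t * x) + a * cos (t * x))).
pose Fs (a x : R) := D * (expR (a * x) * (a * sin (t * x) - t * cos (t * x))).
have dFc (a x : R) : a ^+ 2 = e ^+ 2 -> is_derive x (1 : R) (Fc a) (expR (a * x) * cos (t * x)).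
 move=> ae.
 apply: (drv_eq (drvZ (drvM (dexp a x) (drvD (drvZ (hsin x) t) (drvZ (hcos x) a))) D)).
 rewrite -[RHS]mul1r -De -ae; ring.
have dFs (a x : R) : a ^+ 2 = e ^+ 2 -> is_derive x (1 : R) (Fs a) (expR (a * x) * sin (t * x)).
 move=> ae.
 apply: (drv_eq (drvZ (drvM (dexp a x) (drvB (drvZ (hsin x) a) (drvZ (hcos x) t))) D)).
 rewrite -[RHS]mul1r -De -ae; ring.
have lim0 (g : nat -> R) M : (forall n, `|g n| <= M) -> D * (expR (- e * n%:R) * g n) @[n --> \oo] --> 0.
 move=> gM; rewrite -[X in _ --> X](mulr0 D); apply: cvgMl_tmp.
 apply/norm_cvg0P.
 apply: (@squeeze_cvgr _ _ _ _ (fun=> 0) (fun n : nat => expR (- (e * n%:R)) * M)); last 2 first.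
 - exact: cvg_cst.
 - by rewrite -[X in _ --> X](mul0r M); apply: cvgM; [exact: expRN_cvg|exact: cvg_cst].
 apply: nearW => n; rewrite normr_ge0 /= normrM (ger0_norm (expR_ge0 _)) mulNr.
 by rewrite ler_wpM2l ?expR_ge0.
have bd (a b u : R) : `|a * sin u + b * cos u| <= `|a| + `|b|.
 by apply: normD_le; rewrite !normrM; apply: lerD; rewrite ler_piMr.
split => //.
- apply: (etrans (FTC_split (F := Fc (- e)) (G := Fc e) (l := 0) (l' := 0) cc ic _ _ _ _)).
 + move=> x x0; have := dFc (- e) x; rewrite sqrrN => /(_ erefl) /is_derive_eq; apply.
  by rewrite ger0_norm// mulNr.
 + move=> x x0; have := dFc e x erefl => /is_derive_eq; apply.
  by rewrite ler0_norm// mulrN opprK.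
 + by apply: (lim0 _ (`|t| + `|- e|)) => n.
 + rewrite /Fc; under eq_fun do rewrite mulrN -mulNr.
  apply: (lim0 _ (`|t| + `|e|)) => n; exact: bd.
 + rewrite /Fc !mulr0 expR0 sin0 cos0 /D; ring.
- apply: (etrans (FTC_split (F := Fs (- e)) (G := Fs e) (l := 0) (l' := 0) cs is' _ _ _ _)).
 + move=> x x0; have := dFs (- e) x; rewrite sqrrN => /(_ erefl) /is_derive_eq; apply.
  by rewrite ger0_norm// mulNr.
 + move=> x x0; have := dFs e x erefl => /is_derive_eq; apply.
  by rewrite ler0_norm// mulrN opprK.
 + by apply: (lim0 _ (`|- e| + `|- t|)) => n; rewrite -mulNr.
 + rewrite /Fs; under eq_fun do rewrite mulrN -mulNr.
  by apply: (lim0 _ (`|e| + `|- t|)) => n; rewrite -mulNr.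
 + rewrite /Fs !mulr0 expR0 sin0 cos0 /D; ring.
Qed.

Lemma Int_prod p q : Int1 p -> Int1 q ->
 Int (fun x => p x.1 * q x.2) /\ II (fun x => p x.1 * q x.2) = I1 p * I1 q.
Proof.
move=> ip iq.
have ipa : mu.-integrable setT (fun y => `|p y|%:E) := integrable_abse ip.
have iqa : mu.-integrable setT (fun y => `|q y|%:E) := integrable_abse iq.
have mp : measurable_fun setT (fun x : T2 => p x.1).
 by apply: (measurableT_comp (f := p)) => //; apply/measurable_EFinP; case/integrableP: ip.
have mq : measurable_fun setT (fun x : T2 => q x.2).
 by apply: (measurableT_comp (f := q)) => //; apply/measurable_EFinP; case/integrableP: iq.
have mF : measurable_fun setT (fun x : T2 => (p x.1 * q x.2)%:E).
 by apply/measurable_EFinP; exact: measurable_funM.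
have hI : (mu \x mu)%E.-integrable setT (fun x : T2 => (p x.1 * q x.2)%:E).
 apply/(integrable12ltyP mu mu mF).
 under eq_integral => x _.
  under eq_integral => y _ do rewrite /= normrM EFinM.
  rewrite integralZl//.
  over.
 rewrite (_ : (\int[mu]_x `|(EFin \o q) x|)%E = (I1 (fun x => `|q x|))%:E); last first.
  by rewrite -I1E.
 rewrite (_ : (fun x : R => _) = (fun x => (I1 (fun x => `|q x|) * `|p x|)%:E)); last first.
  by apply/funext => x; rewrite -EFinM mulrC.
 rewrite I1E ?ltry//; exact: Int1Z.
split => //.
rewrite /II /Rintegral /leb2.
have := integral12_prod_meas1 hI => <-.
rewrite /fubini_F.
under eq_integral => x _.
 under eq_integral => y _ do rewrite /= EFinM.
 rewrite integralZl// I1E// -EFinM mulrC.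
 over.
by rewrite -[fine _]/(I1 (fun x => I1 q * p x)) I1Z// mulrC.
Qed.

End Line.

(** * Weights and cosine transforms with a phase *)

Section Trig.
Variable R : realType.
Implicit Types (f g h : R * R -> R) (x y : R * R).

(** A quadratic remainder is what Taylor's formula under an integral sign delivers, and it implies
    the little-o of the Frechet derivative. *)
Lemma hg_of_quad f x (a b C : R) :
 (forall v, `|f (x + v) - f x - (a * v.1 + b * v.2)| <= C * (v.1 ^+ 2 + v.2 ^+ 2)) ->
 hg f x a b.
Proof.
move=> H.
have C0 : 0 <= C.
 have := H (1, 0); rewrite /= => h; have := normr_ge0 (f (x + (1, 0)) - f x - (a * 1 + b * 0)); lra.
have cl := @lin2_continuous R a b.
have lit : f \o shift x = cst (f x) + lin2 a b +o_ (0 : R * R) id.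
 apply/eqaddoP => e e0.
 have := nbhsx_ballx (0 : R * R) (e / (2 * C + 1)) _.
 rewrite divr_gt0//; last lra.
 move=> /(_ isT); apply: filterS => v hv.
 have {}hv : `|v| < e / (2 * C + 1).
  by case: hv; rewrite -!ball_normE /ball_ /= !sub0r !normrN => h1 h2; rewrite gt_max h1 h2.
 have hv1 : `|v.1| <= `|v| by rewrite num_le_max lexx.
 have hv2 : `|v.2| <= `|v| by rewrite num_le_max lexx orbT.
 have -> : (f \o shift x - (cst (f x) + lin2 a b)) v = f (x + v) - f x - (a * v.1 + b * v.2).
  by rewrite -[LHS]/(f (v + x) - (f x + (a * v.1 + b * v.2))) [v + x]addrC; ring.
 apply: le_trans (H v) _.
 have n0 : 0 <= `|v| := normr_ge0 v.
 have s1 : v.1 ^+ 2 <= `|v| ^+ 2 by rewrite -(real_normK (num_real v.1)) lerXn2r// nnegrE.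
 have s2 : v.2 ^+ 2 <= `|v| ^+ 2 by rewrite -(real_normK (num_real v.2)) lerXn2r// nnegrE.
 apply: (@le_trans _ _ (C * (2 * `|v| ^+ 2))).
  by apply: ler_wpM2l => //; lra.
 have -> : C * (2 * `|v| ^+ 2) = (2 * C * `|v|) * `|v| by ring.
 apply: ler_wpM2r => //.
 apply: (@le_trans _ _ ((2 * C + 1) * `|v|)); last first.
  by rewrite mulrC -ler_pdivlMr ?ltW//; lra.
 by apply: ler_wpM2r => //; lra.
split.
 apply/diff_locallyP; rewrite (diff_unique cl lit); split => //.
exact: (diff_unique cl lit).
Qed.

Lemma sin_lip (a b : R) : `|sin a - sin b| <= `|a - b|.
Proof.
wlog ab : a b / a < b.
 move=> H; have [h|h|->] := ltgtP a b; first exact: H.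
  by rewrite distrC (distrC a); exact: H.
 by rewrite !subrr.
have [c _ E] : exists2 c, c \in `]a, b[ & sin b - sin a = cos c * (b - a).
 apply: MVT => //.
 apply: continuous_subspaceT; exact: continuous_sin.
rewrite distrC E normrM distrC ler_piMl// ler_norml cos_geN1 cos_le1//.
Qed.

Lemma cos_lip (a b : R) : `|cos a - cos b| <= `|a - b|.
Proof.
rewrite -!sinDpihalf; apply: le_trans (sin_lip _ _) _.
by rewrite opprD addrACA subrr addr0.
Qed.

(** The derivative of the cosine is written as a cosine advanced by pi / 2, so differentiation never
    leaves the family [Tr]. *)
Lemma cos_taylor (a d : R) : `|cos (a + d) - cos a - d * cos (a + pi / 2)| <= d ^+ 2.
Proof.
rewrite cosDpihalf.
have [->|d0] := eqVneq d 0; first by rewrite addr0 subrr mul0r subr0 normr0 expr0n.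
have [c cE Ed] : exists2 c, `|sin a - sin c| <= `|d| & cos (a + d) - cos a = - sin c * d.
 have cc u v : {within `[u, v], continuous (@cos R)}.
  by apply: continuous_subspaceT; exact: continuous_cos.
 case: (ltgtP d 0) => h; last by rewrite h eqxx in d0.
  have [c /itvP cE E] : exists2 c, c \in `](a + d), a[ & cos a - cos (a + d) = - sin c * (a - (a + d)).
   by apply: MVT => //; lra.
  exists c; last lra.
  apply: le_trans (sin_lip _ _) _; rewrite (ltr0_norm h) ler_norml.
  have h1 : a + d < c by rewrite cE.
  have h2 : c < a by rewrite cE.
  by apply/andP; split; lra.
 have [c /itvP cE E] : exists2 c, c \in `]a, (a + d)[ & cos (a + d) - cos a = - sin c * (a + d - a).
  by apply: MVT => //; lra.
 exists c; last lra.
 apply: le_trans (sin_lip _ _) _; rewrite (gtr0_norm h) ler_norml.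
 have h1 : a < c by rewrite cE.
 have h2 : c < a + d by rewrite cE.
 by apply/andP; split; lra.
rewrite Ed.
have -> : - sin c * d - d * - sin a = d * (sin a - sin c) by ring.
by rewrite normrM -(real_normK (num_real d)) expr2; apply: ler_wpM2l.
Qed.

(** The square of the Japanese bracket, hence a polynomial, and the symbol of 1 - Laplacian. Its
    inverse square [japw] is integrable in the plane, its inverse is not. *)
Definition jap x : R := 1 + dot2 x x.
Lemma J_ge1 x : 1 <= jap x.
Proof. by rewrite /jap /dot2 lerDl -!expr2 addr_ge0 ?sqr_ge0. Qed.
Lemma J_gt0 x : 0 < jap x.
Proof. exact: lt_le_trans ltr01 (J_ge1 x). Qed.
Lemma J_ge0 x : 0 <= jap x.
Proof. exact: ltW (J_gt0 x). Qed.
Lemma J_neq0 x : jap x != 0.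
Proof. by rewrite gt_eqF ?J_gt0. Qed.
Lemma J_opp x : jap (- x) = jap x.
Proof. rewrite /jap /dot2 !pE; ring. Qed.

Lemma J_sum x y : jap (x + y) <= 2 * (jap x + jap y).
Proof.
rewrite /jap /dot2 !pE.
have := sqr_ge0 (x.1 - y.1); have := sqr_ge0 (x.2 - y.2); nra.
Qed.

Lemma sq1_le_J x : x.1 ^+ 2 <= jap x.
Proof. rewrite /jap /dot2; have := sqr_ge0 x.2; nra. Qed.
Lemma sq2_le_J x : x.2 ^+ 2 <= jap x.
Proof. rewrite /jap /dot2; have := sqr_ge0 x.1; nra. Qed.
Lemma abs1_le_J x : `|x.1| <= jap x.
Proof.
have := sqr_ge0 (`|x.1| - 1); have := real_normK (num_real x.1).
rewrite /jap /dot2; have := sqr_ge0 x.2; nra.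
Qed.
Lemma abs2_le_J x : `|x.2| <= jap x.
Proof.
have := sqr_ge0 (`|x.2| - 1); have := real_normK (num_real x.2).
rewrite /jap /dot2; have := sqr_ge0 x.1; nra.
Qed.

Lemma dot2_sq x y : dot2 x y ^+ 2 <= dot2 x x * dot2 y y.
Proof. rewrite /dot2; have := sqr_ge0 (x.1 * y.2 - x.2 * y.1); nra. Qed.

Lemma abs_dot2_le x y : `|dot2 x y| <= (`|x.1| + `|x.2|) * jap y.
Proof.
rewrite /dot2; apply: normD_le; rewrite !normrM mulrDl.
by apply: lerD; apply: ler_wpM2l => //; [exact: abs1_le_J|exact: abs2_le_J].
Qed.

Lemma J_cont : continuous jap.
Proof.
apply: (@Dk_cont R 0); apply: DkD; first exact: Dk_cst.
by apply: DkD; apply: DkM; (exact: Dk_fst || exact: Dk_snd).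
Qed.

Lemma J_meas : meas jap. Proof. exact: measC J_cont. Qed.
Definition japw x : R := (jap x) ^- 2.

Lemma Jinv_cont k : continuous (fun x => (jap x) ^- k).
Proof.
move=> x; apply: cvgV; first by rewrite expf_neq0 ?J_neq0.
by apply: (@continuous_comp _ _ _ jap (fun t => t ^+ k)); [exact: J_cont|exact: exprn_continuous].
Qed.

Lemma w2_ge0 x : 0 <= japw x. Proof. by rewrite invr_ge0 exprn_ge0 ?J_ge0. Qed.

Lemma Int_w2 : Int japw.
Proof.
have [h _] := cauchy_kernel (@ltr01 R); have [h1 _] := Int_prod h h.
apply: Int_le h1; first by apply: measC; exact: Jinv_cont.
move=> x; rewrite ger0_norm ?w2_ge0// /japw !div1r -invfM lef_pV2 ?posrE; last 2 first.
- by rewrite exprn_gt0 ?J_gt0.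
- by rewrite expr1n mulr_gt0// ltr_pwDl ?sqr_ge0.
rewrite /jap /dot2 expr1n; have := sqr_ge0 x.1; have := sqr_ge0 x.2; nra.
Qed.

(** The weighted sup bound used throughout on the frequency side; k = 2 is the first integer power
    that gives integrability. *)
Definition bd (k : nat) (M : R) g := forall x, `|g x| <= M * (jap x) ^- k.
Lemma Jk_ge0 k x : 0 <= (jap x) ^- k.
Proof. by rewrite invr_ge0 exprn_ge0 ?J_ge0. Qed.
Lemma Jk_gt0 k x : 0 < (jap x) ^- k.
Proof. by rewrite invr_gt0 exprn_gt0 ?J_gt0. Qed.

Lemma Jk_le (k l : nat) x : (k <= l)%N -> (jap x) ^- l <= (jap x) ^- k.
Proof.
by move=> kl; rewrite lef_pV2 ?posrE ?exprn_gt0 ?J_gt0//; rewrite ler_weXn2l// J_ge1.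
Qed.

Lemma bd_ge0 k M g : bd k M g -> 0 <= M.
Proof.
move=> /(_ 0) h; have := le_trans (normr_ge0 _) h; by rewrite pmulr_lge0 ?Jk_gt0.
Qed.

Lemma bd_le k l M M' g : (k <= l)%N -> M <= M' -> bd l M g -> bd k M' g.
Proof.
move=> kl MM h x; have M0 := bd_ge0 h.
apply: le_trans (h x) _; apply: (@le_trans _ _ (M * (jap x) ^- k)).
 by apply: ler_wpM2l => //; exact: Jk_le.
by apply: ler_wpM2r => //; exact: Jk_ge0.
Qed.

Lemma bd_abs k M g x : bd k M g -> `|g x| <= M.
Proof.
by move=> /(bd_le (leq0n k) (lexx M)) /(_ x); rewrite expr0 invr1 mulr1.
Qed.

Lemma bd_Int M g : meas g -> bd 2 M g -> Int g.
Proof. by move=> mg h; apply: Int_le (IntZ M Int_w2). Qed.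
(** On even functions phase 0 is the Fourier transform and phase pi / 2 vanishes. Each derivative
    multiplies by a coordinate and adds pi / 2 to the phase. *)
Definition Tr (th : R) g x : R := II (fun xi => g xi * cos (dot2 x xi + th)).

Lemma cont_cosdot th x : continuous (fun xi => cos (dot2 x xi + th)).
Proof.
apply: (@Dk_cont R 0); apply: Dk_cos.
by apply: Dk_ext (Dk_lin 0 x.1 x.2 0) => z; rewrite addr0.
Qed.

Lemma abscos (a : R) : `|cos a| <= 1.
Proof. by rewrite ler_norml cos_geN1 cos_le1. Qed.

Lemma Int_Tr th g x : Int g -> Int (fun xi => g xi * cos (dot2 x xi + th)).
Proof.
move=> h; apply: Int_le (Int_abs h).
 apply: measM; first exact: Int_meas.
 by apply: measC; exact: cont_cosdot.
by move=> xi; rewrite normrM ler_piMr ?abscos.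
Qed.

Lemma Tr_bd th g x : Int g -> `|Tr th g x| <= II (fun xi => `|g xi|).
Proof.
move=> h; apply: II_absle; first exact: Int_meas (Int_Tr th x h).
 exact: Int_abs.
by move=> xi; rewrite normrM ler_piMr ?abscos.
Qed.

Lemma Tr_ext th g h x : (forall xi, g xi = h xi) -> Tr th g x = Tr th h x.
Proof. by move=> /funext ->. Qed.

Lemma TrD th g h x : Int g -> Int h -> Tr th (fun xi => g xi + h xi) x = Tr th g x + Tr th h x.
Proof.
move=> ig ih; rewrite /Tr -IID; try exact: Int_Tr.
by apply: II_ext => xi; rewrite mulrDl.
Qed.

Lemma TrZ th (k : R) g x : Int g -> Tr th (fun xi => k * g xi) x = k * Tr th g x.
Proof.
move=> ig; rewrite /Tr -IIZ; last exact: Int_Tr.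
by apply: II_ext => xi; rewrite mulrA.
Qed.

Lemma TrB th g h x : Int g -> Int h -> Tr th (fun xi => g xi - h xi) x = Tr th g x - Tr th h x.
Proof.
move=> ig ih; rewrite /Tr -IIB; try exact: Int_Tr.
by apply: II_ext => xi; rewrite mulrBl.
Qed.

Lemma meas_fst : meas (fun x : R * R => x.1).
Proof. by apply: measC; exact: (@Dk_cont R 0 _ (@Dk_fst R 0)). Qed.
Lemma meas_snd : meas (fun x : R * R => x.2).
Proof. by apply: measC; exact: (@Dk_cont R 0 _ (@Dk_snd R 0)). Qed.

Lemma Int_mulJ g p : meas g -> meas p -> (forall x, `|p x| <= jap x) ->
 Int (fun x => `|g x| * jap x) -> Int (fun x => p x * g x).
Proof.
move=> mg mp pJ h; apply: Int_le h; first exact: measM.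
by move=> x; rewrite normrM mulrC; apply: ler_wpM2l.
Qed.

Lemma Int_J g : meas g -> Int (fun x => `|g x| * jap x) -> Int g.
Proof.
move=> mg h; apply: Int_le h => // x; rewrite ler_peMr//; exact: J_ge1.
Qed.

(** Differentiation under the integral sign: the Taylor error of the cosine is at most
    [|g| J |v|^2], so one power of J suffices for a derivative. *)
Lemma Tr_hg th g x : meas g -> Int (fun xi => `|g xi| * jap xi) ->
 hg (Tr th g) x (Tr (th + pi / 2) (fun xi => xi.1 * g xi) x)
  (Tr (th + pi / 2) (fun xi => xi.2 * g xi) x).
Proof.
move=> mg ig.
have i0 := Int_J mg ig.
have i1 := Int_mulJ mg meas_fst abs1_le_J ig.
have i2 := Int_mulJ mg meas_snd abs2_le_J ig.
apply: (hg_of_quad (C := II (fun xi => `|g xi| * jap xi))) => v.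
rewrite /Tr mulrC -IIZ; last exact: Int_Tr.
rewrite [_ * v.2]mulrC -IIZ; last exact: Int_Tr.
have k1 := IntZ v.1 (Int_Tr (th + pi / 2) x i1).
have k2 := IntZ v.2 (Int_Tr (th + pi / 2) x i2).
rewrite -IID// -!IIB//; try exact: Int_Tr; last 2 first.
- by apply: IntB; exact: Int_Tr.
- exact: IntD.
rewrite [leRHS]mulrC -IIZ//.
apply: II_absle; last 1 first.
- move=> xi.
 set c := cos (dot2 x xi + th); set s := cos (dot2 x xi + (th + pi / 2)).
 have e1 : dot2 (x + v) xi + th = (dot2 x xi + th) + dot2 v xi.
  by rewrite /dot2 !pE; ring.
 have -> : g xi * cos (dot2 (x + v) xi + th) - g xi * c -
   (v.1 * (xi.1 * g xi * s) + v.2 * (xi.2 * g xi * s)) =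
   g xi * (cos (dot2 (x + v) xi + th) - c - dot2 v xi * s) by rewrite /dot2; ring.
 have e2 : s = cos (dot2 x xi + th + pi / 2) by rewrite /s addrA.
 rewrite normrM e1 e2.
 apply: (@le_trans _ _ (`|g xi| * (dot2 v xi ^+ 2))).
  by apply: ler_wpM2l => //; exact: cos_taylor.
 rewrite [leRHS]mulrCA; apply: ler_wpM2l => //.
 apply: le_trans (dot2_sq _ _) _.
 rewrite /dot2 /jap /dot2; have := sqr_ge0 v.1; have := sqr_ge0 v.2; nra.
- apply: measB; first by apply: measB; apply: (Int_meas (Int_Tr _ _ i0)).
 by apply: Int_meas; exact: IntD.
- exact: IntZ.
Qed.

Lemma Tr_lip th g x y : meas g -> Int (fun xi => `|g xi| * jap xi) ->
 `|Tr th g x - Tr th g y| <= II (fun xi => `|g xi| * jap xi) * (`|x.1 - y.1| + `|x.2 - y.2|).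
Proof.
move=> mg ig; have i0 := Int_J mg ig.
rewrite /Tr -IIB; try exact: Int_Tr.
rewrite mulrC -IIZ//; apply: II_absle; last 1 first.
- move=> xi; rewrite -mulrBr normrM mulrCA; apply: ler_wpM2l => //.
 apply: le_trans (cos_lip _ _) _.
 have -> : dot2 x xi + th - (dot2 y xi + th) = dot2 (x - y) xi by rewrite /dot2 !pE; ring.
 by apply: le_trans (abs_dot2_le _ _) _; rewrite !pE.
- by apply: measB; apply: (Int_meas (Int_Tr _ _ i0)).
- exact: IntZ.
Qed.

(** The moments consumed by repeated application of [Tr_hg]: transforms of such functions are
    smooth. *)
Definition rap g := meas g /\ forall k : nat, Int (fun xi => `|g xi| * jap xi ^+ k).
Lemma rap_meas g : rap g -> meas g. Proof. by case. Qed.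
Lemma rap_J g : rap g -> Int (fun xi => `|g xi| * jap xi).
Proof. by case=> _ /(_ 1%N); apply: Int_ext => x; rewrite expr1. Qed.
Lemma rap_Int g : rap g -> Int g.
Proof. by move=> r; exact: (Int_J (rap_meas r) (rap_J r)). Qed.

Lemma rap_mul (p g : R * R -> R) (C : R) (n : nat) : meas p -> (forall x, `|p x| <= C * jap x ^+ n) -> rap g ->
 rap (fun x => p x * g x).
Proof.
move=> mp pJ [mg ig]; split=> [|k]; first exact: measM.
apply: Int_le (IntZ C (ig (n + k)%N)).
 apply: measM; first by apply: meas_abs; exact: measM.
 by apply: measC => x; apply: (@continuous_comp _ _ _ jap (fun t => t ^+ k)); [exact: J_cont|exact: exprn_continuous].
move=> x; rewrite normrM normr_id normrM exprD (ger0_norm (exprn_ge0 _ (J_ge0 _))).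
have := ler_wpM2r (mulr_ge0 (normr_ge0 (g x)) (exprn_ge0 k (J_ge0 x))) (pJ x); nra.
Qed.

Lemma rap1 g : rap g -> rap (fun x => x.1 * g x).
Proof. by apply: (@rap_mul _ _ 1 1); [exact: meas_fst|move=> x; rewrite mul1r expr1; exact: abs1_le_J]. Qed.
Lemma rap2 g : rap g -> rap (fun x => x.2 * g x).
Proof. by apply: (@rap_mul _ _ 1 1); [exact: meas_snd|move=> x; rewrite mul1r expr1; exact: abs2_le_J]. Qed.
Definition mono (m : nat * nat) x : R := x.1 ^+ m.1 * x.2 ^+ m.2.

Lemma rap_mono m g : rap g -> rap (fun x => mono m x * g x).
Proof.
case: m => m1 m2 rg; rewrite /mono /=.
elim: m1 => [|m1 IH].
 elim: m2 => [|m2 IH].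
  by rewrite (_ : (fun x : R * R => _) = g)//; apply/funext => x; rewrite !expr0 !mul1r.
 have := rap2 IH; congr rap; apply/funext => x; rewrite exprS; ring.
have := rap1 IH; congr rap; apply/funext => x; rewrite exprS; ring.
Qed.

End Trig.

(** * Convolution and the multiplication formulas *)

Section Conv.
Variable R : realType.
Local Notation T2 := (measurableTypeR R * measurableTypeR R)%type.
Local Notation J := (@jap R).
Local Notation w2 := (@japw R).
Implicit Types (f g h a b : R * R -> R) (x y xi : R * R).

Definition kap : R := ((2 * pi) ^+ 2)^-1.
Lemma kap_gt0 : 0 < kap.
Proof. by rewrite invr_gt0 exprn_gt0// mulr_gt0// pi_gt0. Qed.
Lemma kap_ge0 : 0 <= kap. Proof. exact: ltW kap_gt0. Qed.
Lemma kap_neq0 : kap != 0. Proof. by rewrite gt_eqF ?kap_gt0. Qed.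
Definition evn g : Prop := forall x, g (- x) = g x.

Definition uc g : Prop := forall e : R, 0 < e -> exists2 d : R, 0 < d &
 forall x y, `|x.1 - y.1| < d -> `|x.2 - y.2| < d -> `|g x - g y| <= e.

Lemma uc_cont g : uc g -> continuous g.
Proof.
move=> ug x; apply/cvgrPdist_le => e e0; have [d d0 H] := ug e e0.
have := nbhsx_ballx x d d0; apply: filterS => y [/= h1 h2].
by apply: H; [move: h1|move: h2]; rewrite -ball_normE.
Qed.

Lemma uc_meas g : uc g -> meas g.
Proof. by move=> ug; apply: measC; exact: uc_cont. Qed.

Lemma uc_lip g (L : R) : (forall x y, `|g x - g y| <= L * (`|x.1 - y.1| + `|x.2 - y.2|)) -> uc g.
Proof.
move=> H e e0.
have L0 : 0 <= L.
 have := H (1, 0) 0; rewrite /= subr0 normr1 subrr normr0 addr0 mulr1; exact: le_trans.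
exists (e / (2 * L + 1)); first by rewrite divr_gt0//; lra.
move=> x y h1 h2; apply: le_trans (H x y) _.
apply: (@le_trans _ _ ((2 * L + 1) * (e / (2 * L + 1)))); last first.
 by rewrite mulrCA divff ?mulr1// gt_eqF//; lra.
have d0 : 0 < e / (2 * L + 1) by rewrite divr_gt0//; lra.
set d := e / (2 * L + 1) in h1 h2 d0 *; nra.
Qed.

Lemma ucD f g : uc f -> uc g -> uc (fun x => f x + g x).
Proof.
move=> uf ug e e0; have e2 : 0 < e / 2 by lra.
have [d d0 H] := uf _ e2; have [d' d0' H'] := ug _ e2.
exists (Num.min d d'); first by rewrite lt_min d0.
move=> x y; rewrite !lt_min => /andP[h1 h1'] /andP[h2 h2'].
have -> : f x + g x - (f y + g y) = (f x - f y) + (g x - g y) by ring.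
apply: normD_le.
have := H x y h1 h2; have := H' x y h1' h2'; lra.
Qed.

Lemma ucZ f k : uc f -> uc (fun x => k * f x).
Proof.
move=> uf e e0; have k1 : 0 < `|k| + 1 by have := normr_ge0 k; lra.
have [d d0 H] := uf _ (divr_gt0 e0 k1).
exists d => // x y h1 h2; rewrite -mulrBr normrM.
apply: le_trans (_ : (`|k| + 1) * (e / (`|k| + 1)) <= e); last first.
 by rewrite mulrCA divff ?mulr1// gt_eqF.
apply: ler_pM => //; first by lra.
exact: H.
Qed.

Lemma ucM f g (F G : R) : (forall x, `|f x| <= F) -> (forall x, `|g x| <= G) -> uc f -> uc g ->
 uc (fun x => f x * g x).
Proof.
move=> bf bg uf ug e e0.
have F0 : 0 <= F := le_trans (normr_ge0 _) (bf 0).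
have G0 : 0 <= G := le_trans (normr_ge0 _) (bg 0).
have e2 : 0 < e / (F + G + 1) by rewrite divr_gt0//; lra.
have [d d0 H] := uf _ e2; have [d' d0' H'] := ug _ e2.
exists (Num.min d d'); first by rewrite lt_min d0.
move=> x y; rewrite !lt_min => /andP[h1 h1'] /andP[h2 h2'].
have -> : f x * g x - f y * g y = (f x - f y) * g x + f y * (g x - g y) by ring.
apply: normD_le; rewrite !normrM.
have E : e / (F + G + 1) * (F + G + 1) = e by rewrite divfK// gt_eqF//; lra.
have A := ler_pM (normr_ge0 _) (normr_ge0 _) (H x y h1 h2) (bg x).
have B := ler_pM (normr_ge0 _) (normr_ge0 _) (bf y) (H' x y h1' h2').
set q := e / (F + G + 1) in E A B e2 *.
rewrite -[leRHS]E; nra.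
Qed.

Lemma uc_lim (g : R * R -> R) : (forall e : R, 0 < e -> exists2 f, uc f & forall x, `|g x - f x| <= e) -> uc g.
Proof.
move=> H e e0; have e3 : 0 < e / 3 by lra.
have [f uf hf] := H _ e3; have [d d0 hd] := uf _ e3.
exists d => // x y h1 h2.
have -> : g x - g y = (g x - f x) + (f x - f y) - (g y - f y) by ring.
apply: normB_le; have := ler_normD (g x - f x) (f x - f y).
have := hf x; have := hf y; have := hd x y h1 h2; lra.
Qed.

Lemma measurable_sub2 : measurable_fun setT (fun z : T2 * T2 => ((z.1 : R * R) - z.2 : T2)).
Proof.
have m1 : measurable_fun setT (fun z : T2 * T2 => z.1) by exact: measurable_fst.
have m2 : measurable_fun setT (fun z : T2 * T2 => z.2) by exact: measurable_snd.
apply: measurable_fun_pair => /=.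
 apply: measurable_funB; first exact: (measurableT_comp measurable_fst m1).
 exact: (measurableT_comp measurable_fst m2).
apply: measurable_funB; first exact: (measurableT_comp measurable_snd m1).
exact: (measurableT_comp measurable_snd m2).
Qed.

Definition meas2 (F : R * R -> R * R -> R) : Prop :=
 measurable_fun setT (fun z : T2 * T2 => F z.1 z.2).

Lemma meas2_sub b : meas b -> meas2 (fun x y => b (x - y)).
Proof. by move=> mb; exact: (measurableT_comp mb measurable_sub2). Qed.
Lemma meas2_1 b : meas b -> meas2 (fun x y => b x).
Proof. by move=> mb; exact: (measurableT_comp mb measurable_fst). Qed.
Lemma meas2_2 b : meas b -> meas2 (fun x y => b y).
Proof. by move=> mb; exact: (measurableT_comp mb measurable_snd). Qed.
Lemma meas2M F G : meas2 F -> meas2 G -> meas2 (fun x y => F x y * G x y).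
Proof. by move=> h h'; exact: measurable_funM. Qed.
Lemma meas2_cosdot : meas2 (fun x y => cos (dot2 x y)).
Proof.
apply: (@measurableT_comp _ _ _ _ _ _ (@cos R)).
 by apply: continuous_measurable_fun; exact: continuous_cos.
have m1 : measurable_fun setT (fun z : T2 * T2 => z.1) by exact: measurable_fst.
have m2 : measurable_fun setT (fun z : T2 * T2 => z.2) by exact: measurable_snd.
apply: measurable_funD; apply: measurable_funM.
- exact: (measurableT_comp measurable_fst m1).
- exact: (measurableT_comp measurable_fst m2).
- exact: (measurableT_comp measurable_snd m1).
- exact: (measurableT_comp measurable_snd m2).
Qed.

(** Normalised so that the inverse transform of [cnv a b] is the product of the inverse transforms,
    without constants. *)
Definition cnv a b xi : R := kap * II (fun eta => a eta * b (xi - eta)).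

Lemma meas_sub b xi : meas b -> meas (fun eta => b (xi - eta)).
Proof.
move=> mb; have := meas_comp_aff (-1) xi mb.
by rewrite (_ : (fun x => b (aff (-1) xi x)) = (fun eta => b (xi - eta)))//; apply/funext => eta; rewrite aff_sub.
Qed.

Lemma conv_Int a b (B : R) xi : Int a -> meas b -> (forall x, `|b x| <= B) ->
 Int (fun eta => a eta * b (xi - eta)).
Proof.
move=> ia mb bB; apply: Int_le (IntZ B (Int_abs ia)).
 by apply: measM; [exact: Int_meas|exact: meas_sub].
by move=> x; rewrite normrM mulrC; apply: ler_wpM2r.
Qed.

Lemma conv_uc a b (B : R) : Int a -> (forall x, `|b x| <= B) -> uc b -> uc (cnv a b).
Proof.
move=> ia bB ub e e0.
pose A := kap * II (fun x => `|a x|) + 1.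
have A0 : 0 < A by rewrite ltr_wpDl// mulr_ge0 ?kap_ge0// II_ge0.
have [d d0 H] := ub (e / A) (divr_gt0 e0 A0).
exists d => // x y h1 h2.
have mb := uc_meas ub.
rewrite -mulrBr -IIB; try exact: conv_Int ia mb bB.
rewrite normrM (ger0_norm kap_ge0).
apply: (@le_trans _ _ (kap * (e / A * II (fun x => `|a x|)))).
 apply: ler_wpM2l; first exact: kap_ge0.
 rewrite -IIZ; last exact: Int_abs.
 apply: II_absle.
 - by apply: measB; apply: Int_meas; exact: conv_Int ia mb bB.
 - by apply: IntZ; exact: Int_abs.
 - move=> z; rewrite -mulrBr normrM mulrC; apply: ler_wpM2r => //.
  apply: H.
   by rewrite (_ : (x - z).1 - (y - z).1 = x.1 - y.1)// !pE; ring.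
  by rewrite (_ : (x - z).2 - (y - z).2 = x.2 - y.2)// !pE; ring.
have An : A != 0 by rewrite gt_eqF.
rewrite mulrCA -[leRHS](divfK An).
apply: ler_wpM2l; first by rewrite divr_ge0 ?ltW.
by rewrite /A lerDl.
Qed.

Lemma conv_even a b : evn a -> evn b -> Int a -> meas b -> (exists B, forall x, `|b x| <= B) -> evn (cnv a b).
Proof.
move=> ea eb ia mb [B bB] x; rewrite /cnv; congr (_ * _).
rewrite -(II_opp (conv_Int (- x) ia mb bB)); apply: II_ext => z.
by rewrite ea -[in RHS]eb; congr (_ * b _); rewrite opprB opprK addrC.
Qed.

Lemma conv_comm a b (A B : R) : Int a -> Int b -> (forall x, `|a x| <= A) -> (forall x, `|b x| <= B) ->
 forall x, cnv a b x = cnv b a x.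
Proof.
move=> ia ib bA bB x; rewrite /cnv; congr (_ * _).
rewrite -(II_sub x (conv_Int x ia (Int_meas ib) bB)); apply: II_ext => z.
by rewrite mulrC; congr (b _ * _); rewrite opprB addrC subrK.
Qed.

Lemma J_half x y : (J (x + y) <= 4 * J x) || (J (x + y) <= 4 * J y).
Proof.
have h := J_sum x y; case: (leP (J x) (J y)) => h'; apply/orP; [right|left]; lra.
Qed.

Definition Ck (k : nat) : R := kap * (4 ^+ k * 2 * II w2).
Lemma Ck_ge0 k : 0 <= Ck k.
Proof. by rewrite !mulr_ge0 ?kap_ge0 ?exprn_ge0 ?II_ge0//; move=> x; exact: w2_ge0. Qed.

(** By [J_half] one of the two arguments is comparable to x and supplies 4^k J(x)^-k; the other
    factor is at most [w2], since k >= 2, and is integrated. The two cases account for the 2 in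
    [Ck]. *)
Lemma conv_bd k A B a b : (2 <= k)%N -> meas a -> meas b -> bd k A a -> bd k B b ->
 bd k (Ck k * A * B) (cnv a b).
Proof.
move=> k2 ma mb hA hB x.
have A0 := bd_ge0 hA; have B0 := bd_ge0 hB.
have P : 0 <= A * B * (4 ^+ k * (J x) ^- k).
 by rewrite !mulr_ge0 ?exprn_ge0 ?Jk_ge0.
have iw := Int_w2 R; have iw' := Int_sub x iw.
rewrite /cnv normrM (ger0_norm kap_ge0).
have -> : Ck k * A * B * (J x) ^- k = kap * (A * B * (4 ^+ k * (J x) ^- k) * (II w2 + II w2)).
 by rewrite /Ck; ring.
apply: ler_wpM2l; first exact: kap_ge0.
rewrite -[X in _ * (_ + X)](II_sub x iw) -IID// -IIZ; last exact: IntD.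
apply: II_absle.
- by apply: measM => //; exact: meas_sub.
- by apply: IntZ; exact: IntD.
move=> y; rewrite normrM.
have hAB := ler_pM (normr_ge0 _) (normr_ge0 _) (hA y) (hB (x - y)).
apply: le_trans hAB _.
have -> : A * (J y) ^- k * (B * (J (x - y)) ^- k) = A * B * ((J y) ^- k * (J (x - y)) ^- k) by ring.
rewrite -(mulrA (A * B)); apply: ler_wpM2l; first exact: mulr_ge0.
have key u v : J (u + v) <= 4 * J u -> (J u) ^- k * (J v) ^- k <= 4 ^+ k * (J (u + v)) ^- k * w2 v.
 move=> huv; apply: ler_pM; try exact: Jk_ge0.
  rewrite -[X in X * _]invrK -invfM lef_pV2 ?posrE; last 2 first.
  + by rewrite exprn_gt0 ?J_gt0.
  + by rewrite mulr_gt0 ?invr_gt0 ?exprn_gt0 ?J_gt0.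
  by rewrite mulrC ler_pdivrMr ?exprn_gt0// -exprMn mulrC lerXn2r// ?nnegrE ?J_ge0// mulr_ge0// J_ge0.
 exact: Jk_le.
have e : x = y + (x - y) by rewrite addrC subrK.
have pos u v : 0 <= 4 ^+ k * (J u) ^- k * w2 v by rewrite !mulr_ge0 ?exprn_ge0 ?Jk_ge0.
case/orP: (J_half y (x - y)) => hh.
 have := key _ _ hh; rewrite -e; have := pos x y; lra.
rewrite addrC in hh.
have := key _ _ hh; rewrite [_ + y]addrC -e; have := pos x (x - y); lra.
Qed.

Lemma II_sin0 b x : Int b -> evn b -> Tr (pi / 2) b x = 0.
Proof.
move=> ib eb; have i := Int_Tr (pi / 2) x ib.
have := II_opp i.
have -> : II (fun xi => b (- xi) * cos (dot2 x (- xi) + pi / 2)) = - Tr (pi / 2) b x.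
 rewrite /Tr -IIN//; apply: II_ext => xi; rewrite eb -mulrN; congr (_ * _).
 by rewrite !cosDpihalf (_ : dot2 x (- xi) = - dot2 x xi) ?sinN//; rewrite /dot2 !pE; ring.
rewrite -/(Tr _ _ _); lra.
Qed.

(** After translation the cosine of a sum has a sine part, whose integral against the even function
    b is zero. *)
Lemma Tr_shift b x eta : Int b -> evn b ->
 Int (fun xi => b (xi - eta) * cos (dot2 x xi)) /\
 II (fun xi => b (xi - eta) * cos (dot2 x xi)) = cos (dot2 x eta) * Tr 0 b x.
Proof.
move=> ib eb.
have i1 := Int_Tr (dot2 x eta) x ib.
have E xi : b (xi - eta) * cos (dot2 x xi) =
  (fun z => b z * cos (dot2 x z + dot2 x eta)) (xi + - eta).
 by congr (_ * cos _); rewrite /dot2 !pE; ring.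
split; first by apply: Int_ext (Int_add (- eta) i1) => xi; rewrite E.
rewrite (II_ext E) (II_add _ i1).
rewrite (@II_ext _ _ (fun z => cos (dot2 x eta) * (b z * cos (dot2 x z + 0)) +
  sin (dot2 x eta) * (b z * cos (dot2 x z + pi / 2)))); last first.
 by move=> z; rewrite addr0 cosDpihalf cosD; ring.
have j1 := Int_Tr 0 x ib; have j2 := Int_Tr (pi / 2) x ib.
rewrite (IID (IntZ _ j1) (IntZ _ j2)) !IIZ//.
by rewrite -![II _]/(Tr _ _ _) (II_sin0 x ib eb) mulr0 addr0.
Qed.

Lemma conv_Tr A B a b x : meas a -> meas b -> evn b -> bd 2 A a -> bd 2 B b ->
 Tr 0 (cnv a b) x = kap * (Tr 0 a x * Tr 0 b x).
Proof.
move=> ma mb eb hA hB.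
have ia := bd_Int ma hA; have ib := bd_Int mb hB.
have bB := fun x => bd_abs x hB.
pose F xi eta := a eta * b (xi - eta) * cos (dot2 x xi).
have hc : Int (fun xi : R * R => (Ck 2 * A * B / kap) * w2 xi) by apply: IntZ; exact: Int_w2.
have i1 xi : Int (F xi).
 apply: Int_le (Int_abs (conv_Int xi ia mb bB)).
  apply: measM; last exact: meas_cst.
  by apply: measM => //; exact: meas_sub.
 by move=> eta; rewrite /F normrM ler_piMr ?abscos.
have i2 eta : Int (fun xi => F xi eta).
 by apply: Int_ext (IntZ (a eta) (Tr_shift x eta ib eb).1) => xi; rewrite /F mulrA.
have [||||| h1 h2 h3] := @Fub _ F (fun xi => (Ck 2 * A * B / kap) * w2 xi).
- rewrite -/(meas2 _); apply: meas2M.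
  by apply: meas2M; [exact: meas2_2|exact: meas2_sub].
 by apply: (meas2_1 (b := fun xi => cos (dot2 x xi))); apply: measC => z;
  have := @cont_cosdot R 0 x z; under eq_fun do rewrite addr0.
- exact: i1.
- exact: i2.
- exact: hc.
- move=> xi.
 have ma' : meas (fun z => `|a z|) by exact: meas_abs.
 have mb' : meas (fun z => `|b z|) by exact: meas_abs.
 have hA' : bd 2 A (fun z => `|a z|) by move=> z; rewrite normr_id.
 have hB' : bd 2 B (fun z => `|b z|) by move=> z; rewrite normr_id.
 have := conv_bd (leqnn 2) ma' mb' hA' hB' xi.
 rewrite /cnv normrM (ger0_norm kap_ge0) mulrC -ler_pdivlMr ?kap_gt0// => h.
 apply: le_trans (_ : II (fun eta => `|a eta| * `|b (xi - eta)|) <= _).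
  apply: II_le; first exact: Int_abs.
   by apply: (conv_Int (B := B) _ (Int_abs ia) mb') => z; rewrite normr_id.
  by move=> eta; rewrite /F !normrM ler_piMr ?abscos ?mulr_ge0.
 apply: le_trans (ler_norm _) _; apply: le_trans h _.
 by rewrite [leRHS]mulrAC.
rewrite /Tr /cnv.
transitivity (kap * II (fun xi => II (F xi))).
 rewrite -IIZ//; apply: II_ext => xi; rewrite -mulrA; congr (_ * _).
 rewrite mulrC -IIZ ?addr0; last exact: conv_Int ia mb bB.
 by apply: II_ext => z; rewrite mulrC.
congr (_ * _); rewrite h3 mulrC -IIZ; last exact: Int_Tr.
apply: II_ext => eta.
rewrite (@II_ext _ _ (fun xi => a eta * (b (xi - eta) * cos (dot2 x xi)))); last first.
 by move=> xi; rewrite /F mulrA.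
rewrite IIZ; last exact: (Tr_shift x eta ib eb).1.
rewrite (Tr_shift x eta ib eb).2 /Tr addr0; ring.
Qed.

Lemma meas_cosdot x : meas (fun y => cos (dot2 x y)).
Proof.
by apply: measC => z; have := @cont_cosdot R 0 x z; under eq_fun do rewrite addr0.
Qed.

Lemma dot2C x y : dot2 x y = dot2 y x.
Proof. rewrite /dot2; ring. Qed.

(** The multiplication formula: both sides are the double integral of p(x) h(y) cos (x . y),
    dominated by |p| times the L^1 norm of h. *)
Lemma Parseval p h : Int p -> Int h ->
 [/\ Int (fun x => p x * Tr 0 h x), Int (fun x => Tr 0 p x * h x) &
   II (fun x => p x * Tr 0 h x) = II (fun x => Tr 0 p x * h x)].
Proof.
move=> ip ih; have mp := Int_meas ip; have mh := Int_meas ih.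
pose F x y := p x * (h y * cos (dot2 x y)).
have E1 x : II (F x) = p x * Tr 0 h x.
 rewrite /Tr -IIZ; last exact: Int_Tr.
 by apply: II_ext => y; rewrite addr0.
have E2 y : II (fun x => F x y) = Tr 0 p y * h y.
 rewrite mulrC /Tr -IIZ; last exact: Int_Tr.
 by apply: II_ext => x; rewrite addr0 /F (dot2C y); ring.
have [||||| h1 h2 h3] := @Fub _ F (fun x => II (fun z => `|h z|) * `|p x|).
- rewrite -/(meas2 _); apply: meas2M; first exact: meas2_1.
 by apply: meas2M; [exact: meas2_2|exact: meas2_cosdot].
- move=> x; apply: IntZ; have := Int_Tr 0 x ih.
 by apply: Int_ext => y; rewrite addr0.
- move=> y; have := IntZ (h y) (Int_Tr 0 y ip).
 by apply: Int_ext => x; rewrite addr0 /F (dot2C y); ring.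
- by apply: IntZ; exact: Int_abs.
- move=> x; rewrite mulrC -IIZ; last exact: Int_abs.
 apply: II_le.
 + apply: Int_abs; apply: IntZ; have := Int_Tr 0 x ih.
  by apply: Int_ext => y; rewrite addr0.
 + by apply: IntZ; exact: Int_abs.
 + by move=> z; rewrite /F !normrM; apply: ler_wpM2l => //; rewrite ler_piMr ?abscos.
split; [exact: Int_ext h1|exact: Int_ext h2|].
by rewrite -(II_ext E1) h3 (II_ext E2).
Qed.

(** The transform exchanges products and convolutions in this direction as well; with p the Abel
    weight [Ee] it identifies Abel summation with a smoothing. *)
Lemma conv_FT p h (H : R) xi : Int p -> Int h -> evn h -> (forall x, `|h x| <= H) ->
 cnv (Tr 0 p) h xi = Tr 0 (fun x => p x * (kap * Tr 0 h x)) xi.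
Proof.
move=> ip ih eh hH.
have mp := Int_meas ip; have mh := Int_meas ih.
have H0 : 0 <= H := le_trans (normr_ge0 _) (hH 0).
pose F x eta := p x * (h (xi - eta) * cos (dot2 x eta)).
have ih' := Int_sub xi ih.
have i0 x : Int (fun eta => h (xi - eta) * cos (dot2 x eta)).
 apply: Int_le (Int_abs ih'); first by apply: measM; [exact: meas_sub|exact: meas_cosdot].
 by move=> eta; rewrite normrM ler_piMr ?abscos.
have sub_cos x : II (fun eta => h (xi - eta) * cos (dot2 x eta)) = cos (dot2 x xi) * Tr 0 h x.
 have [j1 j2] := Tr_shift x xi ih eh.
 rewrite -j2; apply: II_ext => eta; congr (_ * _).
 by rewrite -eh opprB.
have i1 x : Int (F x) by exact: IntZ.
have i2 eta : Int (fun x => F x eta).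
 apply: Int_le (IntZ H (Int_abs ip)).
  apply: measM => //; apply: measM; first exact: meas_cst.
  have := meas_cosdot eta; congr meas; apply/funext => z; congr cos; rewrite /dot2; ring.
 move=> x; rewrite normrM mulrC; apply: ler_wpM2r => //.
 by rewrite normrM; apply: le_trans (hH (xi - eta)); rewrite ler_piMr ?abscos.
have [||||| h1 h2 h3] := @Fub _ F (fun x => II (fun z => `|h z|) * `|p x|).
- rewrite -/(meas2 _); apply: meas2M; first exact: meas2_1.
 apply: meas2M; last exact: meas2_cosdot.
 apply: (meas2_2 (b := fun eta => h (xi - eta))); exact: meas_sub.
- exact: i1.
- exact: i2.
- by apply: IntZ; exact: Int_abs.
- move=> x; rewrite -(II_sub xi (Int_abs ih)) mulrC -IIZ; last exact: Int_abs.
 apply: II_le; [exact: Int_abs|by apply: IntZ; exact: Int_abs|].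
 by move=> z; rewrite /F !normrM; apply: ler_wpM2l => //; rewrite ler_piMr ?abscos.
rewrite /cnv [RHS](_ : _ = kap * II (fun x => II (F x))); last first.
 rewrite -IIZ// -[LHS]/(II (fun x => p x * (kap * Tr 0 h x) * cos (dot2 xi x + 0))).
 apply: II_ext => x; rewrite IIZ// sub_cos addr0 (dot2C x); ring.
congr (_ * _); rewrite h3; apply: II_ext => eta.
rewrite /Tr mulrC -IIZ; last exact: Int_Tr.
by apply: II_ext => x; rewrite addr0 (dot2C eta) /F; ring.
Qed.

End Conv.

(** * Fourier inversion, Plancherel identity and Sobolev norms *)

Section Planch.
Variable R : realType.
Local Notation mu2 := (leb2 R).
Local Notation T2 := (measurableTypeR R * measurableTypeR R)%type.
Local Notation J := (@jap R).
Local Notation w2 := (@japw R).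
Local Notation kap := (@kap R).
Implicit Types (f g h a b : R * R -> R) (x y xi : R * R) (e : R).

Definition pk e (t : R) : R := e / (e ^+ 2 + t ^+ 2).
(** A product of two one-dimensional Poisson kernels, of mass one. Up to [kap^-1] it is the
    transform of [Ee], so damping a transform by [Ee] amounts to convolution with an approximate
    identity. *)
Definition PK e x : R := pi ^- 2 * (pk e x.1 * pk e x.2).
Definition Ee e x : R := expR (- (e * `|x.1|)) * expR (- (e * `|x.2|)).
Lemma pk_ge0 e t : 0 < e -> 0 <= pk e t.
Proof. by move=> /ltW e0; rewrite divr_ge0// addr_ge0 ?sqr_ge0. Qed.
Lemma PK_ge0 e x : 0 < e -> 0 <= PK e x.
Proof. by move=> e0; apply: mulr_ge0; [rewrite invr_ge0 exprn_ge0// pi_ge0|apply: mulr_ge0; exact: pk_ge0]. Qed.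

Lemma PK_Int e : 0 < e -> Int (PK e) /\ II (PK e) = 1.
Proof.
move=> e0; have [i1 i2] := cauchy_kernel e0; have [j1 j2] := Int_prod i1 i1.
split; first exact: (IntZ _ j1).
rewrite /PK (IIZ _ j1) j2 i2 -expr2 mulVf// expf_neq0// gt_eqF// pi_gt0//.
Qed.

Lemma Ee_ge0 e x : 0 <= Ee e x.
Proof. by rewrite mulr_ge0 ?expR_ge0. Qed.

Lemma Ee_le1 e x : 0 <= e -> Ee e x <= 1.
Proof.
by move=> e0; rewrite mulr_ile1 ?expR_ge0// -expR0 ler_expR oppr_le0 mulr_ge0.
Qed.

Lemma Ee_Int e : 0 < e -> Int (Ee e).
Proof. by move=> e0; have i := exp_kernel e0; case: (Int_prod i i). Qed.

Lemma Ee_Tr e x : 0 < e -> Tr 0 (Ee e) x = kap^-1 * PK e x.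
Proof.
move=> e0.
have [a1 a2 a3 a4] := exp_cos_kernel x.1 e0.
have [b1 b2 b3 b4] := exp_cos_kernel x.2 e0.
have [c1 c2] := Int_prod a1 b1; have [d1 d2] := Int_prod a3 b3.
rewrite /Tr; transitivity (II (fun xi => (expR (- (e * `|xi.1|)) * cos (x.1 * xi.1)) * (expR (- (e * `|xi.2|)) * cos (x.2 * xi.2))
 - (expR (- (e * `|xi.1|)) * sin (x.1 * xi.1)) * (expR (- (e * `|xi.2|)) * sin (x.2 * xi.2)))).
 by apply: II_ext => xi; rewrite addr0 /dot2 cosD /Ee; ring.
rewrite IIB// c2 d2 a2 b2 a4 b4 mul0r subr0 /PK /pk /kap invrK exprMn.
have p0 : pi != 0 :> R by rewrite gt_eqF ?pi_gt0.
move: p0; generalize (pi : R) => p p0.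
have n1 : e ^+ 2 + x.1 ^+ 2 != 0 by rewrite gt_eqF// ltr_wpDr ?sqr_ge0 ?exprn_gt0.
have n2 : e ^+ 2 + x.2 ^+ 2 != 0 by rewrite gt_eqF// ltr_wpDr ?sqr_ge0 ?exprn_gt0.
by field; rewrite n1 n2 p0.
Qed.

Definition sm e g x : R := II (fun y => PK e y * g (x - y)).

Lemma sm_Int e g (B : R) x : 0 < e -> meas g -> (forall x, `|g x| <= B) ->
 Int (fun y => PK e y * g (x - y)).
Proof. move=> e0 mg gB; exact: conv_Int (PK_Int e0).1 mg gB. Qed.

Lemma sm_bd e g (B : R) x : 0 < e -> meas g -> (forall x, `|g x| <= B) -> `|sm e g x| <= B.
Proof.
move=> e0 mg gB; have [i1 i2] := PK_Int e0.
rewrite -[leRHS]mulr1 -i2 -IIZ//; apply: II_absle.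
- exact: Int_meas (sm_Int x e0 mg gB).
- exact: IntZ.
- by move=> y; rewrite normrM (ger0_norm (PK_ge0 _ e0)) mulrC ler_wpM2r ?PK_ge0.
Qed.

(** Near 0 the continuity of g costs eps / 2. Elsewhere one coordinate is at least d, its Poisson
    kernel is at most e times an integrable function, and the contribution is O(e). *)
Lemma sm_cvg g (B : R) x (en : nat -> R) : meas g -> (forall x, `|g x| <= B) ->
 {for x, continuous g} -> (forall n, 0 < en n) -> en n @[n --> \oo] --> 0 ->
 sm (en n) g x @[n --> \oo] --> g x.
Proof.
move=> mg gB cg en0 enl.
have B0 : 0 <= B := le_trans (normr_ge0 _) (gB 0).
apply/cvgrPdist_le => eps eps0.
have eps2 : 0 < eps / 2 by lra.
move/cvgrPdist_le: cg => /(_ _ eps2) /nbhs_ballP [d /= d0 hd].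
(* The constant for which 1 / t^2 <= D / (1 + t^2) as soon as |t| >= d. *)
pose D := (1 + d ^+ 2) / d ^+ 2.
have D0 : 0 <= D by rewrite divr_ge0 ?addr_ge0 ?sqr_ge0.
have D1 (t : R) : d <= `|t| -> (t ^+ 2)^-1 <= D * (1 + t ^+ 2)^-1.
 move=> dt; have d2 : 0 < d ^+ 2 by exact: exprn_gt0.
 have t2 : d ^+ 2 <= t ^+ 2 by rewrite -(real_normK (num_real t)) lerXn2r// nnegrE ltW.
 have t20 : 0 < t ^+ 2 := lt_le_trans d2 t2.
 have h : (t ^+ 2)^-1 <= (d ^+ 2)^-1 by rewrite lef_pV2 ?posrE.
 have dn : d != 0 by rewrite gt_eqF.
 have tn : t ^+ 2 != 0 by rewrite gt_eqF.
 have sn : 1 + t ^+ 2 != 0 by rewrite gt_eqF//; lra.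
 have -> : D = (d ^+ 2)^-1 + 1 by rewrite /D mulrDl div1r divff ?expf_neq0.
 have -> : (t ^+ 2)^-1 = ((t ^+ 2)^-1 + 1) * (1 + t ^+ 2)^-1.
  by apply: (mulIf sn); rewrite mulfVK// mulrDr mulr1 mulVf// addrC.
 by apply: ler_wpM2r; [rewrite invr_ge0; lra|lran].
have [k1 k2] := cauchy_kernel (@ltr01 R).
pose c1 (t : R) : R := (1 + t ^+ 2)^-1.
have ic1 : Int1 c1 by apply: Int1_ext k1 => t; rewrite /c1 expr1n div1r.
have Ic1 : I1 c1 = pi by rewrite -k2; apply: I1_ext => t; rewrite /c1 expr1n div1r.
pose K := 4 * B * D / pi * pi.
have hn : forall n, `|g x - sm (en n) g x| <= eps / 2 + 4 * B * D * en n.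
 move=> n; set e := en n; have e0 : 0 < e := en0 n.
 have [i1 i2] := PK_Int e0.
 have [q1 q2] := cauchy_kernel e0.
 have [r1 r2] := Int_prod ic1 q1; have [s1 s2] := Int_prod q1 ic1.
 have isg := sm_Int x e0 mg gB.
 have -> : g x - sm e g x = II (fun y => PK e y * (g x - g (x - y))).
  rewrite -[X in X - _]mulr1 -i2 -IIZ// -IIB//; last exact: IntZ.
  by apply: II_ext => y; ring.
 have iM : Int (fun y => eps / 2 * PK e y + 2 * B * D * pi ^- 2 * e * (c1 y.1 * pk e y.2 + pk e y.1 * c1 y.2)).
  by apply: IntD; apply: IntZ => //; exact: IntD.
 apply: (@le_trans _ _ (II (fun y => eps / 2 * PK e y + 2 * B * D * pi ^- 2 * e * (c1 y.1 * pk e y.2 + pk e y.1 * c1 y.2)))); last first.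
  rewrite IID; [|exact: IntZ|by apply: IntZ; exact: IntD].
  rewrite (IIZ _ i1) (IIZ _ (IntD r1 s1)) (IID r1 s1) r2 s2 i2 mulr1 Ic1 q2 lerD2l.
  have p0 : pi != 0 :> R by rewrite gt_eqF ?pi_gt0.
  have al (p a b c : R) : p != 0 -> 2 * a * b * p ^- 2 * c * (p * p + p * p) = 4 * a * b * c.
   by move=> pn; field.
  by rewrite al.
 apply: II_absle => //.
  apply: Int_meas; apply: Int_ext (IntB (IntZ (g x) i1) isg) => y; ring.
 move=> y; rewrite normrM (ger0_norm (PK_ge0 _ e0)).
 have P0 := PK_ge0 y e0.
 have T1 : 0 <= 2 * B * D * pi ^- 2 * e * (c1 y.1 * pk e y.2 + pk e y.1 * c1 y.2).
  have c0 t : 0 <= c1 t by rewrite invr_ge0 addr_ge0 ?sqr_ge0.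
  have ip : 0 <= pi ^- 2 :> R by rewrite invr_ge0 exprn_ge0 ?pi_ge0.
  apply: mulr_ge0; last by apply: addr_ge0; apply: mulr_ge0 => //; exact: pk_ge0.
  by apply: mulr_ge0; [apply: mulr_ge0 => //; do 2 apply: mulr_ge0 => //|exact: ltW].
 have g2 : `|g x - g (x - y)| <= 2 * B.
  by apply: normB_le; have := gB x; have := gB (x - y); lra.
 have ip0 : 0 <= pi ^- 2 :> R by rewrite invr_ge0 exprn_ge0 ?pi_ge0.
 have cpos t s : 0 <= c1 t * pk e s by rewrite mulr_ge0 ?pk_ge0 ?invr_ge0 ?addr_ge0 ?sqr_ge0.
 have far (t s : R) : d <= `|t| -> PK e y = (pk e t * pk e s) * pi ^- 2 ->
   PK e y * `|g x - g (x - y)| <= 2 * B * D * pi ^- 2 * e * (c1 t * pk e s + pk e t * c1 s).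
  move=> dt hPK; apply: (@le_trans _ _ (PK e y * (2 * B))); first exact: ler_wpM2l.
  rewrite hPK (_ : _ * (2 * B) = (2 * B * pi ^- 2) * (pk e t * pk e s)); last by ring.
  have -> : 2 * B * D * pi ^- 2 * e * (c1 t * pk e s + pk e t * c1 s) =
   (2 * B * pi ^- 2) * (D * e * (c1 t * pk e s) + D * e * (c1 s * pk e t)) by ring.
  apply: ler_wpM2l; first by rewrite !mulr_ge0.
  rewrite -[leLHS]addr0; apply: lerD; last by do 2 (apply: mulr_ge0 => //); exact: ltW.
  rewrite [leRHS]mulrA; apply: ler_wpM2r; first exact: pk_ge0.
  rewrite /pk mulrC -[leRHS]mulrA (mulrC e) mulrA; apply: ler_wpM2r; first exact: ltW.
  apply: le_trans (D1 t dt); rewrite lef_pV2 ?posrE; last 2 first.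
  - by rewrite ltr_wpDr ?sqr_ge0 ?exprn_gt0.
  - by rewrite -(real_normK (num_real t)) exprn_gt0//; lra.
  by rewrite lerDr ?sqr_ge0.
 have U1 : 0 <= eps / 2 * PK e y by apply: mulr_ge0 => //; exact: ltW.
 case: (leP d `|y.1|) => hy1.
  by rewrite -[leLHS]add0r; apply: lerD => //; apply: far => //; rewrite /PK; ring.
 case: (leP d `|y.2|) => hy2.
  rewrite -[leLHS]add0r; apply: lerD => //; have := far _ y.1 hy2.
  by rewrite [pk e y.2 * c1 _]mulrC [c1 y.2 * _]mulrC [_ * c1 y.2 + _]addrC; apply; rewrite /PK; ring.
 rewrite -[leLHS]addr0; apply: lerD => //; rewrite mulrC; apply: ler_wpM2r => //.
 apply: hd; split; rewrite -ball_normE /ball_ /=.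
  by rewrite (_ : x.1 - _ = y.1)//=; ring.
 by rewrite (_ : x.2 - _ = y.2)//=; ring.
have hl : (4 * B * D * en n) @[n --> \oo] --> 0.
 by rewrite -[X in _ --> X](mulr0 (4 * B * D)); apply: cvgM => //; exact: cvg_cst.
move/cvgrPdist_le : hl => /(_ _ eps2); apply: filterS => n; rewrite sub0r normrN => h.
apply: le_trans (hn n) _; have := ler_norm (4 * B * D * en n); lra.
Qed.

(** [conv_FT] with the Abel weight: smoothing f is the same as inverting its damped transform. Both
    the inversion formula and the quadratic identities rest on it. *)
Lemma sm_Tr e f (B : R) x : 0 < e -> Int f -> evn f -> (forall x, `|f x| <= B) ->
 sm e f x = kap * Tr 0 (fun xi => Ee e xi * Tr 0 f xi) x.
Proof.
move=> e0 iF ef fB.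
have := conv_FT x (Ee_Int e0) iF ef fB.
rewrite /cnv (@II_ext _ _ (fun eta => kap^-1 * (PK e eta * f (x - eta)))); last first.
 by move=> y; rewrite (Ee_Tr y e0) -mulrA.
rewrite IIZ ?mulVKf ?kap_neq0//; last exact: sm_Int e0 (Int_meas iF) fB.
rewrite -/(sm e f x) => ->; have [i1 _ _] := Parseval (Ee_Int e0) iF.
by rewrite -TrZ//; apply: Tr_ext => xi; ring.
Qed.

Lemma seq_e : (forall n : nat, 0 < n.+1%:R^-1 :> R) /\ (n.+1%:R^-1 : R) @[n --> \oo] --> 0.
Proof. by split=> [n|]; [rewrite invr_gt0|exact: cvg_harmonic]. Qed.

Lemma Ee_cvg x : Ee n.+1%:R^-1 x @[n --> \oo] --> (1 : R).
Proof.
have h (t : R) : expR (- (n.+1%:R^-1 * t)) @[n --> \oo] --> (1 : R).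
 have h1 : - (n.+1%:R^-1 * t) @[n --> \oo] --> (0 : R).
  rewrite -[X in _ --> X]oppr0 -[X in _ --> - X](mul0r t).
  by apply: cvgN; apply: cvgM; [exact: (proj2 seq_e)|exact: cvg_cst].
 rewrite -[X in _ --> X](@expR0 R).
 by apply: (cvg_comp _ _ h1); exact: continuous_expR.
by rewrite -[X in _ --> X]mulr1; apply: cvgM; exact: h.
Qed.

Lemma inversion f (B : R) x : Int f -> evn f -> (forall x, `|f x| <= B) ->
 {for x, continuous f} -> Int (Tr 0 f) -> f x = kap * Tr 0 (Tr 0 f) x.
Proof.
move=> iF ef fB cf iT.
have [e0 el] := seq_e.
have h1 := sm_cvg (Int_meas iF) fB cf e0 el.
have h2 : sm n.+1%:R^-1 f x @[n --> \oo] --> kap * Tr 0 (Tr 0 f) x.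
 under eq_fun do rewrite (sm_Tr x (e0 _) iF ef fB).
 apply: cvgMl_tmp.
 apply: (@Rdct _ _ _ mu2 (fun n xi => Ee n.+1%:R^-1 xi * Tr 0 f xi * cos (dot2 x xi + 0)) _ (fun xi => `|Tr 0 f xi|)).
 - move=> n; have [i1 _ _] := Parseval (Ee_Int (e0 n)) iF.
  exact: Int_meas (Int_Tr 0 x i1).
 - exact: Int_meas (Int_Tr 0 x iT).
 - exact: Int_abs.
 - move=> xi; have -> : Tr 0 f xi * cos (dot2 x xi + 0) = 1 * Tr 0 f xi * cos (dot2 x xi + 0) by rewrite mul1r.
  by apply: cvgM; [apply: cvgM; [exact: Ee_cvg|exact: cvg_cst]|exact: cvg_cst].
 - move=> n xi; rewrite normrM [X in X * _]normrM (ger0_norm (Ee_ge0 _ _)).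
  rewrite -[leRHS]mulr1; apply: ler_pM => //; last exact: abscos.
   by rewrite mulr_ge0 ?Ee_ge0.
  by rewrite ler_piMl// Ee_le1// ltW.
exact: (cvg_unique _ h1 h2).
Qed.

Lemma Ee_meas e : meas (Ee e).
Proof.
apply: measC => x.
have h (t : R) : {for t, continuous (fun t : R => expR (- (e * `|t|)))}.
 apply: (@continuous_comp _ _ _ (fun t => - (e * `|t|)) expR); last exact: continuous_expR.
 by apply: cvgN; apply: cvgMl_tmp; exact: norm_continuous.
apply: cvgM.
 by apply: (@continuous_comp _ _ _ fst (fun t : R => expR (- (e * `|t|)))); [exact: (@Dk_cont R 0 _ (@Dk_fst R 0))|exact: h].
by apply: (@continuous_comp _ _ _ snd (fun t : R => expR (- (e * `|t|)))); [exact: (@Dk_cont R 0 _ (@Dk_snd R 0))|exact: h].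
Qed.

(* The regularised quadratic form behind both the Bessel inequality and the Plancherel identity. *)
Lemma quad_sm e h (B : R) : 0 < e -> Int h -> evn h -> (forall x, `|h x| <= B) -> meas (Tr 0 h) ->
 [/\ Int (fun x => Ee e x * Tr 0 h x ^+ 2), Int (fun x => h x * sm e h x) &
  II (fun x => Ee e x * Tr 0 h x ^+ 2) = kap^-1 * II (fun x => h x * sm e h x)].
Proof.
move=> e0 ih eh hB mT.
have [i1 _ _] := Parseval (Ee_Int e0) ih.
have [j1 j2 j3] := Parseval ih i1.
have E x : h x * sm e h x = kap * (h x * Tr 0 (fun xi => Ee e xi * Tr 0 h xi) x).
 by rewrite (sm_Tr x e0 ih eh hB); ring.
have E2 x : Tr 0 h x * (Ee e x * Tr 0 h x) = Ee e x * Tr 0 h x ^+ 2 by ring.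
split.
- exact: Int_ext j2.
- by apply: Int_ext (IntZ kap j1) => x; rewrite E.
- by rewrite (II_ext E) IIZ// mulKf ?kap_neq0// j3 (II_ext E2).
Qed.

Lemma sm_II e g (B : R) : 0 < e -> Int g -> (forall x, `|g x| <= B) ->
 Int (sm e g) /\ II (sm e g) = II g.
Proof.
move=> e0 ig gB; have [i1 i2] := PK_Int e0; have mg := Int_meas ig.
pose F y x := PK e y * g (x - y).
have ia y : Int (fun x => g (x - y)) by exact: Int_add.
have [||||| h1 h2 h3] := @Fub _ F (fun y => II (fun z => `|g z|) * PK e y).
- rewrite -/(meas2 _); apply: meas2M; first by apply: meas2_1; exact: Int_meas.
 have : measurable_fun setT (fun z : T2 * T2 => g (z.2 - z.1)).
  exact: (measurableT_comp (meas2_sub mg) (measurable_fun_pair measurable_snd measurable_fst)).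
 exact.
- by move=> y; exact: IntZ.
- by move=> x; exact: sm_Int e0 mg gB.
- exact: IntZ.
- move=> y; rewrite mulrC -(II_add (- y) (Int_abs ig)) -IIZ; last exact: Int_add (Int_abs ig).
 apply: II_le; first by apply: Int_abs; exact: IntZ.
  by apply: IntZ; exact: Int_add (Int_abs ig).
 by move=> x; rewrite /F normrM (ger0_norm (PK_ge0 _ e0)).
split; first exact: h2.
rewrite -[LHS]/(II (fun x => II (fun y => F y x))) -h3.
transitivity (II (fun y => II g * PK e y)).
 by apply: II_ext => y; rewrite (IIZ _ (ia y)) (II_add _ ig) mulrC.
by rewrite (IIZ _ i1) i2 mulr1.
Qed.

Lemma Int_sq h (B : R) : Int h -> (forall x, `|h x| <= B) -> Int (fun x => h x ^+ 2).
Proof.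
move=> ih hB; apply: Int_le (IntZ B (Int_abs ih)).
 by apply: measM; exact: Int_meas.
by move=> x; rewrite normrX expr2; apply: ler_wpM2r.
Qed.

Lemma Int_liminf (f_ : nat -> R * R -> R) f (M : R) : meas f -> (forall n, Int (f_ n)) ->
 (forall n x, 0 <= f_ n x) -> (forall x, f_ n x @[n --> \oo] --> f x) ->
 (forall n, II (f_ n) <= M) -> Int f /\ II f <= M.
Proof.
move=> mf if_ f0 cf fM.
have f0' x : 0 <= f x.
 rewrite -(cvg_lim (@Rhausdorff R) (cf x)).
 by apply: limr_ge; [exact: cvgP (cf x)|exact: nearW].
have key : (\int[mu2]_x (f x)%:E <= M%:E)%E.
 have mf_ n : measurable_fun setT (fun x : T2 => (f_ n x)%:E) by apply/measurable_EFinP; exact: Int_meas.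
 have H := @fatou _ T2 R mu2 setT measurableT (fun n x => (f_ n x)%:E) mf_
  (fun n x _ => (f0 n x : (0 <= (f_ n x)%:E)%E)).
 have e x : limn_einf (fun n => (f_ n x)%:E) = (f x)%:E.
  have c : (f_ n x)%:E @[n --> \oo] --> (f x)%:E by apply: cvg_EFin; [exact: nearW|exact: cf].
  by have [-> _] := cvg_limn_einf_sup c.
 have -> : (\int[mu2]_x (f x)%:E = \int[mu2]_x limn_einf (fun n => (f_ n x)%:E))%E.
  by apply: eq_integral => x _; rewrite e.
 apply: le_trans H _.
 rewrite limn_einf_lim; apply: lime_le; first exact: is_cvg_einfs.
 apply: nearW => n; apply: (@le_trans _ _ (\int[mu2]_x (f_ n x)%:E)%E).
  by apply: ereal_inf_lbound; exists n => /=.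
 by rewrite IIE// lee_fin.
have iF : Int f.
 by apply: Int_lty => //; apply: le_lt_trans key _; exact: ltry.
by split => //; rewrite -lee_fin -IIE.
Qed.

(** In the identity [quad_sm] the product h (x) h (x - y) is at most the mean of the squares, and
    smoothing preserves the integral; Fatou's lemma removes the damping. Continuity of h does not
    enter, so truncated functions are covered. *)
Lemma Bessel h (B : R) : Int h -> evn h -> (forall x, `|h x| <= B) -> meas (Tr 0 h) ->
 Int (fun x => Tr 0 h x ^+ 2) /\ II (fun x => Tr 0 h x ^+ 2) <= kap^-1 * II (fun x => h x ^+ 2).
Proof.
move=> ih eh hB mT.
have [e0 el] := seq_e.
have ih2 := Int_sq ih hB.
have bound n : II (fun x => Ee n.+1%:R^-1 x * Tr 0 h x ^+ 2) <= kap^-1 * II (fun x => h x ^+ 2).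
 have [a1 a2 ->] := quad_sm (e0 n) ih eh hB mT.
 apply: ler_wpM2l; first by rewrite invr_ge0 kap_ge0.
 have h2B x : `|h x ^+ 2| <= B ^+ 2 by rewrite normrX lerXn2r// ?nnegrE ?(le_trans (normr_ge0 _) (hB 0)).
 have [b1 b2] := sm_II (e0 n) ih2 h2B.
 apply: (@le_trans _ _ (II (fun x => 2^-1 * (h x ^+ 2 + sm n.+1%:R^-1 (fun x => h x ^+ 2) x)))).
  apply: II_le => //; first by apply: IntZ; exact: IntD.
  move=> x.
  have [p1 p2] := PK_Int (e0 n).
  have s1 := sm_Int x (e0 n) (Int_meas ih) hB.
  have s2 := sm_Int x (e0 n) (Int_meas ih2) h2B.
  have -> : h x * sm n.+1%:R^-1 h x = II (fun y => h x * (PK n.+1%:R^-1 y * h (x - y))) by rewrite (IIZ _ s1).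
  have -> : 2^-1 * (h x ^+ 2 + sm n.+1%:R^-1 (fun x => h x ^+ 2) x) =
    II (fun y => 2^-1 * (h x ^+ 2 * PK n.+1%:R^-1 y + PK n.+1%:R^-1 y * h (x - y) ^+ 2)).
   by rewrite (IIZ _ (IntD (IntZ _ p1) s2)) (IID (IntZ _ p1) s2) (IIZ _ p1) p2 mulr1.
  apply: II_le; [exact: IntZ|by apply: IntZ; apply: IntD => //; exact: IntZ|].
  move=> y; have := PK_ge0 y (e0 n); have := sqr_ge0 (h x - h (x - y)); nra.
 rewrite (IIZ _ (IntD ih2 b1)) (IID ih2 b1) b2; lra.
apply: (Int_liminf (f_ := fun n x => Ee n.+1%:R^-1 x * Tr 0 h x ^+ 2)) => //.
- by apply: measM.
- by move=> n; have [] := quad_sm (e0 n) ih eh hB mT.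
- by move=> n x; rewrite mulr_ge0 ?Ee_ge0 ?sqr_ge0.
- move=> x; rewrite -[X in _ --> X]mul1r.
 by apply: cvgM; [exact: Ee_cvg|exact: cvg_cst].
Qed.

Lemma leb2_pt x : mu2 [set x] = 0%E.
Proof.
have -> : [set x] = [set x.1] `*` [set x.2].
 by apply/seteqP; split=> z /=; [move=> ->|case=> h1 h2; exact: pt_eq].
by rewrite leb2E ?lebesgue_measure_set1 ?mul0e//; exact: measurable_set1.
Qed.

Lemma II_off0 f g : meas f -> Int g -> (forall x, x != 0 -> f x = g x) -> Int f /\ II f = II g.
Proof.
move=> mf ig fg.
have ae : ae_eq mu2 (setT : set T2) (EFin \o f) (EFin \o g).
 exists [set 0]; split; [exact: meas_set1|exact: leb2_pt|].
 move=> x /=; apply: contra_notP => /eqP x0 _; by rewrite /= fg.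
split.
 apply/integrableP; split; first exact/measurable_EFinP.
 have /integrableP[m1] := ig; congr (_ < _)%E; apply: ae_eq_integral => //.
 - exact: measurableT_comp m1.
 - by apply: measurableT_comp => //; exact/measurable_EFinP.
 exists [set 0]; split; [exact: meas_set1|exact: leb2_pt|].
 move=> x /=; apply: contra_notP => /eqP x0 _; by rewrite /= fg.
congr fine; apply: ae_eq_integral => //; apply/measurable_EFinP => //.
exact: Int_meas.
Qed.

(** [Bessel] supplies the integrable majorant, so that both sides of [quad_sm] pass to the limit by
    dominated convergence. *)
Lemma Plancherel h (B : R) : Int h -> evn h -> (forall x, `|h x| <= B) -> meas (Tr 0 h) ->
 (forall x, x != 0 -> {for x, continuous h}) ->
 II (fun x => Tr 0 h x ^+ 2) = kap^-1 * II (fun x => h x ^+ 2).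
Proof.
move=> ih eh hB mT ch.
have [e0 el] := seq_e.
have [iT _] := Bessel ih eh hB mT.
have mh := Int_meas ih.
(* Multiplying by the indicator of the complement of the origin hides the point where h may be
   discontinuous, without changing any integral. *)
pose c x : R := (x != 0)%:R.
have mc : meas c.
 apply: (@punctured_meas _ _ 0) => x x0; apply: (near_cst_continuous (1 : R)).
 apply: filterS (_ : \forall y \near x, y != 0).
  by move=> y y0; rewrite /c y0.
 apply: open_nbhs_nbhs; split; last exact: x0.
 rewrite (_ : (fun y : R * R => is_true (y != 0)) = ~` [set (0 : R * R)]).
  rewrite openC; apply: accessible_closed_set1; apply: hausdorff_accessible; exact: norm_hausdorff.
 by apply/seteqP; split=> y /=; [move=> /eqP|move=> y0; apply/eqP].
have cn x : x != 0 -> c x = 1 by rewrite /c => ->.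
have h1 : II (fun x => Ee n.+1%:R^-1 x * Tr 0 h x ^+ 2) @[n --> \oo] --> II (fun x => Tr 0 h x ^+ 2).
 apply: (@Rdct _ _ _ mu2 _ _ (fun x => Tr 0 h x ^+ 2)) => //.
 - by move=> n; apply: measM; [exact: Ee_meas|exact: Int_meas].
 - exact: Int_meas iT.
 - move=> x; rewrite -[X in _ --> X]mul1r.
  by apply: cvgM; [exact: Ee_cvg|exact: cvg_cst].
 - move=> n x; rewrite normrM (ger0_norm (Ee_ge0 _ _)) (ger0_norm (sqr_ge0 _)).
  by rewrite ler_piMl ?sqr_ge0// Ee_le1// ltW.
have h2 : II (fun x => c x * (h x * sm n.+1%:R^-1 h x)) @[n --> \oo] --> II (fun x => c x * (h x * h x)).
 have q n := quad_sm (e0 n) ih eh hB mT.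
 apply: (@Rdct _ _ _ mu2 _ _ (fun x => B * `|h x|)) => //.
 - by move=> n; apply: measM => //; have [_ i _] := q n; exact: Int_meas.
 - by apply: measM => //; exact: measM.
 - exact: IntZ (Int_abs ih).
 - move=> x; have [->|x0] := eqVneq x 0.
   rewrite /c eqxx mul0r; under eq_fun do rewrite mul0r; exact: cvg_cst.
  apply: cvgMl_tmp.
  by apply: cvgMl_tmp; exact: sm_cvg (ch x x0) e0 el.
 - move=> n x; rewrite normrM [X in _ * X]normrM.
  apply: (@le_trans _ _ (1 * (`|h x| * `|sm n.+1%:R^-1 h x|))).
   by apply: ler_wpM2r; [exact: mulr_ge0|rewrite /c; case: (x != 0); rewrite ?normr1 ?normr0].
  by rewrite mul1r mulrC; apply: ler_wpM2r => //; exact: sm_bd (e0 n) mh hB.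
have E n : II (fun x => Ee n.+1%:R^-1 x * Tr 0 h x ^+ 2) = kap^-1 * II (fun x => c x * (h x * sm n.+1%:R^-1 h x)).
 have [_ i ->] := quad_sm (e0 n) ih eh hB mT; congr (_ * _).
 apply/esym; apply: (II_off0 _ i _).2; first by apply: measM => //; exact: Int_meas i.
 by move=> x x0; rewrite cn// mul1r.
have E2 : II (fun x => h x ^+ 2) = II (fun x => c x * (h x * h x)).
 apply/esym; apply: (II_off0 _ (Int_sq ih hB) _).2; first by apply: measM => //; exact: measM.
 by move=> x x0; rewrite cn// mul1r -expr2.
have h3 : II (fun x => Ee n.+1%:R^-1 x * Tr 0 h x ^+ 2) @[n --> \oo] --> kap^-1 * II (fun x => h x ^+ 2).
 by rewrite E2; under eq_fun do rewrite E; apply: cvgM => //; exact: cvg_cst.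
exact: (cvg_unique _ h1 h3).
Qed.

(* Fourier transforms arising below may be discontinuous at the origin, because of the symbol of the wave equation. *)
Definition spec g : Prop :=
 [/\ rap g, evn g, exists B : R, forall x, `|g x| <= B & forall x, x != 0 -> {for x, continuous g}].

Definition FI g x : R := kap * Tr 0 g x.
Definition chi (r : R) x : R := ((enorm2 x <= r)%R : nat)%:R.

Lemma enorm2_cont : continuous (@enorm2 R).
Proof.
move=> x; apply: (@continuous_comp _ _ _ (fun x => dot2 x x) Num.sqrt); last exact: sqrt_continuous.
have := @J_cont R x => h.
have : {for x, continuous (fun y => J y - 1)} by apply: cvgB; [exact: h|exact: cvg_cst].
by rewrite (_ : (fun y => J y - 1) = (fun y => dot2 y y))//; apply/funext => y; rewrite /jap addrC addKr.
Qed.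

Lemma chi_meas r : meas (chi r).
Proof.
have m : measurable ([set x | enorm2 x <= r] : set T2).
 have -> : [set x : R * R | enorm2 x <= r] = ~` [set x | r < enorm2 x].
  by apply/seteqP; split=> x /=; [move=> h; apply/negP; rewrite -leNgt|move/negP; rewrite -leNgt].
 apply: measurableC; apply: open_meas2.
 by apply: (open_comp (D := [set y : R | r < y])) => [x _|]; [exact: enorm2_cont|exact: open_gt].
have mi : meas (\1_[set x : R * R | enorm2 x <= r]) := measurable_indic m.
have <- // : \1_[set x : R * R | enorm2 x <= r] = chi r.
apply/funext => x; rewrite indicE /chi; congr (_ %:R); congr nat_of_bool.
by apply/idP/idP => [/set_mem|h]; [|apply/mem_set].
Qed.

Lemma chi01 r x : 0 <= chi r x <= 1.
Proof. by rewrite /chi; case: (enorm2 x <= r); rewrite ?lexx ?ler01. Qed.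

Lemma chi_bd r f (B : R) : meas f -> (forall x, `|f x| <= B) -> rap (fun x => f x * chi r x).
Proof.
move=> mf fB; have B0 : 0 <= B := le_trans (normr_ge0 _) (fB 0).
split; first by apply: measM => //; exact: chi_meas.
move=> k; apply: (@Int_le _ _ (fun x => B * (1 + r ^+ 2) ^+ (k + 2) * w2 x)); last exact: IntZ (@Int_w2 R).
 apply: measM; first by apply: meas_abs; apply: measM => //; exact: chi_meas.
 exact: measX _ (@J_meas R).
move=> x; rewrite normrM normr_id (ger0_norm (exprn_ge0 _ (J_ge0 _))) normrM.
have [h01 _] := andP (chi01 r x).
rewrite (ger0_norm h01) -!mulrA; apply: ler_pM => //; first by rewrite mulr_ge0// exprn_ge0// J_ge0.
rewrite /chi; case: (leP (enorm2 x) r) => h; last first.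
 by rewrite mul0r mulr_ge0 ?exprn_ge0 ?w2_ge0 ?addr_ge0 ?sqr_ge0.
rewrite mul1r ler_pdivlMr ?exprn_gt0 ?J_gt0// -exprD lerXn2r ?nnegrE ?J_ge0 ?addr_ge0 ?sqr_ge0//.
rewrite /jap lerD2l.
have d0 : 0 <= dot2 x x by rewrite addr_ge0// -expr2 sqr_ge0.
by rewrite -[leLHS](sqr_sqrtr d0) lerXn2r ?nnegrE ?sqrtr_ge0// (le_trans _ h)// sqrtr_ge0.
Qed.

Lemma normc_toC (a : R) : Normc.normc (a%:C)%C = `|a|.
Proof. by rewrite /= expr0n addr0 sqrtr_sqr. Qed.
Lemma enorm2N x : enorm2 (- x) = enorm2 x.
Proof. by rewrite /enorm2 /dot2 !pE !mulrNN. Qed.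

Lemma trunc_fourierE f (r : R) xi (B : R) : meas f -> evn f -> (forall x, `|f x| <= B) ->
 trunc_fourier (toC f) r xi = ((Tr 0 (fun x => f x * chi r x) xi)%:C)%C.
Proof.
move=> mf ef fB; have rp := chi_bd r mf fB.
have ec : evn (fun x => f x * chi r x) by move=> x; rewrite ef /chi enorm2N.
have key (F : R * R -> R) : Rintegral mu2 [set x | enorm2 x <= r] F = II (fun x => F x * chi r x).
 rewrite /II /Rintegral integral_mkcond; congr fine; apply: eq_integral => x _.
 rewrite /patch /chi; case: ifPn => [/set_mem /= ->|]; first by rewrite mulr1.
 by move=> /negP h; case: (boolP (enorm2 x <= r)) => [h'|_]; [case: h; apply/mem_set|rewrite mulr0].
rewrite /trunc_fourier; congr (_ +i* _)%C; rewrite key.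
 apply: II_ext => x; rewrite /reF /toC /= addr0 dot2C cosN mulr0 subr0; ring.
rewrite -[RHS](II_sin0 xi (rap_Int rp) ec) /Tr.
transitivity (II (fun x => - (f x * chi r x * cos (dot2 xi x + pi / 2) * (-1)))).
 apply: II_ext => x; rewrite /imF /toC /= mulr0 add0r dot2C sinN cosDpihalf; ring.
by apply: II_ext => x; ring.
Qed.

Lemma Tr_meas g th : meas g -> Int (fun xi => `|g xi| * J xi) -> meas (Tr th g).
Proof. by move=> mg ig; apply: uc_meas; apply: uc_lip => x y; exact: Tr_lip. Qed.

Lemma II_chi f : Int f -> II (fun x => f x * (1 - chi n%:R x)) @[n --> \oo] --> (0 : R).
Proof.
move=> iF; have mf := Int_meas iF; have <- : II (fun=> 0 : R) = 0 by exact: II0.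
apply: (@Rdct _ _ _ mu2 _ _ (fun x => `|f x|)).
- by move=> n; apply: measM => //; apply: measB; [exact: meas_cst|exact: chi_meas].
- exact: meas_cst.
- exact: Int_abs.
- move=> x; apply: cvg_near_cst.
 near=> n; rewrite /chi (_ : _ <= _) ?subrr ?mulr0//.
 near: n; exact: nbhs_infty_ger.
- move=> n x; rewrite normrM ler_piMr//; have := chi01 n%:R x => /andP[h1 h2].
 by rewrite ger0_norm; lra.
Unshelve. all: by end_near. Qed.

Lemma FI_Bessel g : spec g -> Int (fun x => FI g x ^+ 2) /\ II (fun x => FI g x ^+ 2) = kap * II (fun x => g x ^+ 2).
Proof.
move=> [rg eg [B gB] cg].
have mT := Tr_meas 0 (rap_meas rg) (rap_J rg).
have [i1 _] := Bessel (rap_Int rg) eg gB mT.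
have e1 := Plancherel (rap_Int rg) eg gB mT cg.
have E x : FI g x ^+ 2 = kap ^+ 2 * Tr 0 g x ^+ 2 by rewrite exprMn.
split; first by apply: Int_ext (IntZ (kap ^+ 2) i1) => x; rewrite E.
by rewrite (II_ext E) IIZ// e1 expr2 -mulrA mulVKf// kap_neq0.
Qed.

Lemma measurable_toC f : meas f -> measurable_c (toC f).
Proof. by move=> mf; split; [exact: mf|exact: meas_cst]. Qed.
Lemma FI_meas g : rap g -> meas (FI g).
Proof. by move=> rg; apply: measM; [exact: meas_cst|exact: Tr_meas (rap_meas rg) (rap_J rg)]. Qed.

Lemma toC_L2 f : meas f -> Int (fun x => f x ^+ 2) -> in_L2 (toC f).
Proof.
move=> mf i; split; first exact: measurable_toC.
have -> : (\int[mu2]_x (Normc.normc (toC f x) ^+ 2)%:E = \int[mu2]_x (f x ^+ 2)%:E)%E.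
 by apply: eq_integral => x _; rewrite /toC normc_toC real_normK ?num_real.
by rewrite IIE// ltry.
Qed.

(** Let G be the truncated transform of f = [FI g]. Expanding the square of g - G, the cross term is
    computed by [Parseval], g is handled by the Plancherel identity and G by [Bessel]; what remains
    is a multiple of the L^2 tail of f outside the ball. *)
Lemma spec_fourier g : spec g -> is_fourier (toC (FI g)) (toC g).
Proof.
move=> sg; have [i2 e2] := FI_Bessel sg; have [rg eg [B gB] cg] := sg.
have mF := FI_meas rg; have iG := rap_Int rg.
pose f := FI g.
have fB x : `|f x| <= kap * II (fun xi => `|g xi|).
 by rewrite normrM (ger0_norm (kap_ge0 R)); apply: ler_wpM2l; [exact: kap_ge0|exact: Tr_bd].
have ef : evn f.
 move=> x; rewrite /f /FI; congr (_ * _); rewrite -[RHS](II_opp (Int_Tr 0 x iG)).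
 by apply: II_ext => xi; rewrite eg /dot2 !pE !mulNr !mulrN.
split; [exact: toC_L2|exact: measurable_toC (rap_meas rg)|].
pose P r : R := II (fun xi => (g xi - Tr 0 (fun x => f x * chi r x) xi) ^+ 2).
have ig2 := Int_sq iG gB.
have main r : Int (fun xi => (g xi - Tr 0 (fun x => f x * chi r x) xi) ^+ 2) /\
  0 <= P r <= kap^-1 * II (fun x => f x ^+ 2 * (1 - chi r x)).
 have rp := chi_bd r mF fB.
 have fcB x : `|f x * chi r x| <= kap * II (fun xi => `|g xi|).
  by apply: le_trans (fB x); rewrite normrM ler_piMr//; have /andP[h1 h2] := chi01 r x; rewrite ger0_norm.
 have ec : evn (fun x => f x * chi r x) by move=> x; rewrite ef /chi enorm2N.
 have mT := Tr_meas 0 (rap_meas rp) (rap_J rp).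
 have [b1 b2] := Bessel (rap_Int rp) ec fcB mT.
 have [c1 c2 c3] := Parseval (rap_Int rp) iG.
 set G := Tr 0 (fun x => f x * chi r x) in mT b1 b2 c1 c2 c3 *.
 have ex x : (g x - G x) ^+ 2 = g x ^+ 2 - 2 * (G x * g x) + G x ^+ 2 by ring.
 have i1 : Int (fun x => g x ^+ 2 - 2 * (G x * g x)) by apply: IntB => //; exact: IntZ.
 have iD : Int (fun x => g x ^+ 2 - 2 * (G x * g x) + G x ^+ 2) by exact: IntD.
 split; first exact: Int_ext (fun x => esym (ex x)) iD.
 rewrite II_ge0/=; last by move=> x; exact: sqr_ge0.
 rewrite /P (II_ext ex) (IID i1 b1) (IIB ig2 (IntZ 2 c2)) (IIZ 2 c2) -c3.
 have chi2 x : chi r x * chi r x = chi r x by rewrite /chi; case: (enorm2 x <= r); rewrite ?mulr1 ?mulr0.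
 have ifc : Int (fun x => f x ^+ 2 * chi r x).
  by apply: Int_ext (Int_sq (rap_Int rp) fcB) => x; rewrite exprMn expr2 [chi _ _ ^+ 2]expr2 chi2.
 have -> : II (fun x => f x * chi r x * Tr 0 g x) = kap^-1 * II (fun x => f x ^+ 2 * chi r x).
  rewrite -IIZ//; apply: II_ext => x.
  have -> : Tr 0 g x = kap^-1 * f x by rewrite /f /FI mulKf ?kap_neq0.
  ring.
 have -> : II (fun x => f x ^+ 2 * (1 - chi r x)) = II (fun x => f x ^+ 2) - II (fun x => f x ^+ 2 * chi r x).
  by rewrite -IIB//; apply: II_ext => x; ring.
 have -> : II (fun x => f x ^+ 2) = kap * II (fun x => g x ^+ 2) := e2.
 rewrite mulrBr mulKf ?kap_neq0//.
 have : II (fun x => (f x * chi r x) ^+ 2) = II (fun x => f x ^+ 2 * chi r x).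
  by apply: II_ext => x; rewrite exprMn [chi _ _ ^+ 2]expr2 chi2.
 move=> E; rewrite E in b2; move: b2; set p := II _; set q := II _; set r1 := kap^-1 * _; move=> b2; lra.
have -> : (fun r : R => (\int[mu2]_xi ((Normc.normc (toC g xi - trunc_fourier (toC f) r xi)) ^+ 2)%:E)%E) = (fun r => (P r)%:E).
 apply/funext => r; rewrite -(IIE (main r).1); apply: eq_integral => xi _.
 by rewrite (trunc_fourierE r xi mF ef fB) /toC -raddfB normc_toC real_normK ?num_real.
apply: cvg_EFin; first exact: nearW.
apply/cvgrPdist_le => eps eps0.
(* The tail is small along integer radii; since it decreases with the radius, the bound extends to
   real r. *)
have /cvgrPdist_le /(_ (kap * eps)) : II (fun x => f x ^+ 2 * (1 - chi n%:R x)) @[n --> \oo] --> (0 : R) by exact: II_chi.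
rewrite mulr_gt0 ?kap_gt0// => /(_ isT) [N _ hN].
near=> r.
have [ir /andP[p0 p1]] := main r.
rewrite sub0r normrN ger0_norm//; apply: le_trans p1 _.
rewrite mulrC ler_pdivrMr ?kap_gt0// mulrC.
apply: le_trans (le_trans (ler_norm _) _); last first.
 by have := hN N (leqnn N); rewrite sub0r normrN; exact.
have iq q : Int (fun x => f x ^+ 2 * (1 - chi q x)).
 apply: Int_le i2; first by apply: measM; [exact: measM|apply: measB; [exact: meas_cst|exact: chi_meas]].
 move=> x; rewrite normrM (ger0_norm (sqr_ge0 _)) ler_piMr ?sqr_ge0//.
 by have /andP[h1 h2] := chi01 q x; rewrite ger0_norm; lra.
apply: II_le.
- exact: iq.
- exact: iq.
- move=> x; apply: ler_wpM2l; first exact: sqr_ge0.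
 rewrite lerD2l lerN2 /chi; case: (leP (enorm2 x) N%:R) => h; last by rewrite ler0n.
 by rewrite (_ : enorm2 x <= r)//; apply: le_trans h _; near: r; exact: nbhs_pinfty_ge.
Unshelve. all: by end_near. Qed.

Lemma spec_sobolev g (s : R) : spec g -> Int (fun x => powR (J x) s * g x ^+ 2) ->
 (sobolev_sq s (toC (FI g)) <= (kap * II (fun x => powR (J x) s * g x ^+ 2))%:E)%E.
Proof.
move=> sg i; apply: ereal_inf_lbound; exists (toC g); first exact: spec_fourier.
rewrite EFinM -(IIE i); congr (_ * _)%E; apply: eq_integral => x _.
by rewrite /toC normc_toC real_normK ?num_real.
Qed.

Lemma powJ_meas (s : R) : meas (fun x => powR (J x) s).
Proof.
apply: measC => x; have e y : powR (J y) s = expR (s * ln (J y)) by rewrite /powR gt_eqF ?J_gt0.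
rewrite (_ : (fun y => _) = (fun y => expR (s * ln (J y)))); last exact/funext.
apply: (@continuous_comp _ _ _ (fun y => s * ln (J y)) expR); last exact: continuous_expR.
apply: cvgMl_tmp.
by apply: (@continuous_comp _ _ _ J (@ln R)); [exact: J_cont|apply: continuous_ln; exact: J_gt0].
Qed.

Lemma spec_Hs g (s : R) : spec g -> in_Hs s (toC (FI g)).
Proof.
move=> sg; have [rg eg [B gB] cg] := sg.
have B0 : 0 <= B := le_trans (normr_ge0 _) (gB 0).
apply: le_lt_trans (spec_sobolev sg _) (ltry _).
have [n hn] : exists n : nat, s <= n%:R by exists (Num.bound `|s|); apply: le_trans (ler_norm _) (ltW (archi_boundP (normr_ge0 s))).
apply: Int_le (IntZ B (rg.2 n)).
 apply: (@measM _ (fun x => powR (J x) s) (fun x => g x ^+ 2)); first exact: powJ_meas.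
 by apply: measM; exact: rap_meas.
move=> x; rewrite normrM (ger0_norm (powR_ge0 _ _)) normrX expr2 mulrC.
rewrite -!mulrA; apply: ler_pM => //; first by rewrite mulr_ge0 ?powR_ge0.
by apply: ler_wpM2l => //; rewrite -powR_mulrn ?J_ge0//; apply: ler_powR => //; exact: J_ge1.
Qed.

Definition hK : R := kap * II w2.
Lemma hK_ge0 : 0 <= hK.
Proof. by apply: mulr_ge0; [exact: kap_ge0|apply: II_ge0; exact: w2_ge0]. Qed.

(** The weight of H^2 times the square of the bound M J^-2 is exactly M^2 [w2]: weighted sup bounds
    are Sobolev bounds. *)
Lemma spec_sq2 g (M : R) : spec g -> bd 2 M g -> (sobolev_sq 2 (toC (FI g)) <= (M ^+ 2 * hK)%:E)%E.
Proof.
move=> sg gM; have M0 := bd_ge0 gM.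
have mg : meas g by case: sg => /rap_meas.
have b x : `|powR (J x) 2 * g x ^+ 2| <= M ^+ 2 * w2 x.
 rewrite normrM (ger0_norm (powR_ge0 _ _)) normrX (powR_mulrn 2 (J_ge0 x)).
 apply: (@le_trans _ _ (J x ^+ 2 * (M * J x ^- 2) ^+ 2)).
  apply: ler_wpM2l; first by rewrite exprn_ge0 ?J_ge0.
  by rewrite lerXn2r ?nnegrE// ?gM// mulr_ge0// Jk_ge0.
 rewrite exprMn [leLHS]mulrCA; apply: ler_wpM2l; first exact: sqr_ge0.
 by rewrite [(_ ^- 2) ^+ 2]expr2 mulVKf// expf_neq0 ?J_neq0.
have i : Int (fun x => powR (J x) 2 * g x ^+ 2).
 apply: Int_le b (IntZ _ (@Int_w2 R)).
 apply: (@measM _ (fun x => powR (J x) 2) (fun x => g x ^+ 2)); first exact: powJ_meas.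
 by apply: measM.
apply: le_trans (spec_sobolev sg i) _; rewrite lee_fin /hK mulrCA; apply: ler_wpM2l; first exact: kap_ge0.
rewrite -(IIZ _ (@Int_w2 R)); apply: II_le => //; first exact: IntZ (@Int_w2 R).
by move=> x; apply: le_trans (b x); exact: ler_norm.
Qed.

Lemma sobolev_sq_ge0 (s : R) (f : R * R -> R[i]%C) : (0 <= sobolev_sq s f)%E.
Proof.
apply: le_ereal_inf_tmp => _ [g _ <-]; apply: mule_ge0; first by rewrite lee_fin kap_ge0.
by apply: integral_ge0 => x _; rewrite lee_fin mulr_ge0 ?powR_ge0 ?sqr_ge0.
Qed.

Lemma poweR_sqrt_le (z : \bar R) (M : R) : (0 <= z)%E -> (z <= M%:E)%E -> (poweR z (2^-1) <= (Num.sqrt M)%:E)%E.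
Proof.
case: z => [z| |] // z0 zM; rewrite !lee_fin in z0 zM.
rewrite poweR_EFin lee_fin powR12_sqrt//; exact: ler_wsqrtr.
Qed.

End Planch.

(** * Second derivatives, maximum principles and barriers *)

Section MaxP.
Variable R : realType.
Local Notation J := (@jap R).
Implicit Types (f g h w : R * R -> R) (x y z : R * R) (d e : R).

(* [b1], [b2] are the first and [a11], [a22] the pure second derivatives of [f] at [x]. *)
Definition h2 f x (b1 b2 a11 a22 : R) : Prop := exists f1 f2 a12 a21,
 [/\ \forall z \near x, hg f z (f1 z) (f2 z), f1 x = b1 /\ f2 x = b2,
   hg f1 x a11 a12 & hg f2 x a21 a22].

Lemma near2W (P : R * R -> Prop) x : (forall z, P z) -> \forall z \near x, P z.
Proof. by move=> h; apply: filterS (filterT : nbhs x setT) => z _. Qed.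
Lemma near1W (P : R -> Prop) (t : R) : (forall s : R, P s) -> \forall z \near t, P z.
Proof. by move=> h; apply: filterS (filterT : nbhs t setT) => z _. Qed.

Lemma pair_cont f g x : {for x, continuous f} -> {for x, continuous g} ->
 {for x, continuous (fun z => (f z, g z) : R * R)}.
Proof. move=> cf cg; exact: (cvg_pair cf cg). Qed.

Lemma fst_cont : continuous (fun z : R * R => z.1).
Proof. exact: (@Dk_cont R 0 _ (@Dk_fst R 0)). Qed.
Lemma snd_cont : continuous (fun z : R * R => z.2).
Proof. exact: (@Dk_cont R 0 _ (@Dk_snd R 0)). Qed.
Lemma h2_hg f x b1 b2 a11 a22 : h2 f x b1 b2 a11 a22 -> hg f x b1 b2.
Proof. by move=> [f1 [f2 [_ [_ [/nbhs_singleton h [<- <-] _ _]]]]]. Qed.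

Lemma h2_eq f x b1 b2 a11 a22 b1' b2' a11' a22' : h2 f x b1 b2 a11 a22 ->
 b1 = b1' -> b2 = b2' -> a11 = a11' -> a22 = a22' -> h2 f x b1' b2' a11' a22'.
Proof. by move=> h <- <- <- <-. Qed.

Lemma h2_ext f g x b1 b2 a11 a22 : (forall z, f z = g z) -> h2 f x b1 b2 a11 a22 -> h2 g x b1 b2 a11 a22.
Proof. by move=> /funext ->. Qed.

Lemma h2D f g x b1 b2 a11 a22 c1 c2 d11 d22 : h2 f x b1 b2 a11 a22 -> h2 g x c1 c2 d11 d22 ->
 h2 (fun z => f z + g z) x (b1 + c1) (b2 + c2) (a11 + d11) (a22 + d22).
Proof.
move=> [f1 [f2 [a12 [a21 [nf [ef1 ef2] hf1 hf2]]]]] [g1 [g2 [e12 [e21 [ng [eg1 eg2] hg1 hg2]]]]].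
exists (fun z => f1 z + g1 z), (fun z => f2 z + g2 z), (a12 + e12), (a21 + e21); split.
- by apply: filterS2 nf ng => z; exact: hgD.
- by rewrite ef1 ef2 eg1 eg2.
- exact: hgD.
- exact: hgD.
Qed.

Lemma h2Z (k : R) f x b1 b2 a11 a22 : h2 f x b1 b2 a11 a22 ->
 h2 (fun z => k * f z) x (k * b1) (k * b2) (k * a11) (k * a22).
Proof.
move=> [f1 [f2 [a12 [a21 [nf [ef1 ef2] hf1 hf2]]]]].
exists (fun z => k * f1 z), (fun z => k * f2 z), (k * a12), (k * a21); split.
- by apply: filterS nf => z; exact: hgZ.
- by rewrite ef1 ef2.
- exact: hgZ.
- exact: hgZ.
Qed.

Lemma h2B f g x b1 b2 a11 a22 c1 c2 d11 d22 : h2 f x b1 b2 a11 a22 -> h2 g x c1 c2 d11 d22 ->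
 h2 (fun z => f z - g z) x (b1 - c1) (b2 - c2) (a11 - d11) (a22 - d22).
Proof.
move=> hf hg'; have := h2D hf (h2Z (-1) hg'); rewrite !mulN1r.
by apply: h2_ext => z; rewrite mulN1r.
Qed.

Lemma h2M f g x b1 b2 a11 a22 c1 c2 d11 d22 : h2 f x b1 b2 a11 a22 -> h2 g x c1 c2 d11 d22 ->
 h2 (fun z => f z * g z) x (b1 * g x + f x * c1) (b2 * g x + f x * c2)
  (a11 * g x + 2 * (b1 * c1) + f x * d11) (a22 * g x + 2 * (b2 * c2) + f x * d22).
Proof.
move=> hf hg'; have Hf := h2_hg hf; have Hg := h2_hg hg'.
move: hf hg' => [f1 [f2 [a12 [a21 [nf [ef1 ef2] hf1 hf2]]]]] [g1 [g2 [e12 [e21 [ng [eg1 eg2] hg1 hg2]]]]].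
exists (fun z => f1 z * g z + f z * g1 z), (fun z => f2 z * g z + f z * g2 z),
 (a12 * g x + f1 x * c2 + (b2 * g1 x + f x * e12)), (a21 * g x + f2 x * c1 + (b1 * g2 x + f x * e21)); split.
- by apply: filterS2 nf ng => z; exact: hgM.
- by rewrite ef1 ef2 eg1 eg2.
- by apply: hg_eq (hgD (hgM hf1 Hg) (hgM Hf hg1)) _ _ => //; rewrite ef1 eg1; ring.
- by apply: hg_eq (hgD (hgM hf2 Hg) (hgM Hf hg2)) _ _ => //; rewrite ef2 eg2; ring.
Qed.

Lemma h2_comp (p p1 : R -> R) (e : R) f x b1 b2 a11 a22 :
 (\forall t \near f x, is_derive t (1 : R) p (p1 t)) -> is_derive (f x) (1 : R) p1 e ->
 h2 f x b1 b2 a11 a22 ->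
 h2 (fun z => p (f z)) x (p1 (f x) * b1) (p1 (f x) * b2)
  (e * b1 ^+ 2 + p1 (f x) * a11) (e * b2 ^+ 2 + p1 (f x) * a22).
Proof.
move=> np dp hf; have Hf := h2_hg hf; have cf := hg_cont Hf.
move: hf => [f1 [f2 [a12 [a21 [nf [ef1 ef2] hf1 hf2]]]]].
have H1 := hg_comp dp Hf.
exists (fun z => p1 (f z) * f1 z), (fun z => p1 (f z) * f2 z),
 (e * b2 * f1 x + p1 (f x) * a12), (e * b1 * f2 x + p1 (f x) * a21); split.
- have np' : \forall z \near x, is_derive (f z) (1 : R) p (p1 (f z)) by exact: cf np.
 by apply: filterS2 nf np' => z h h'; exact: hg_comp h' h.
- by rewrite ef1 ef2.
- by apply: hg_eq (hgM H1 hf1) _ _ => //; rewrite ef1; ring.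
- by apply: hg_eq (hgM H1 hf2) _ _ => //; rewrite ef2; ring.
Qed.

Lemma h2_cst (k : R) x : h2 (fun=> k) x 0 0 0 0.
Proof.
exists (fun=> 0), (fun=> 0), 0, 0; split => //; try exact: hg_cst.
by apply: near2W => z; exact: hg_cst.
Qed.

Lemma h2_lin (k l : R) x : h2 (fun z => k * z.1 + l * z.2) x k l 0 0.
Proof.
exists (fun=> k), (fun=> l), 0, 0; split => //; try exact: hg_cst.
by apply: near2W => z; exact: hg_lin.
Qed.

Lemma h2_fst x : h2 (fun z => z.1) x 1 0 0 0.
Proof. by apply: h2_ext (h2_lin 1 0 x) => z; rewrite mul1r mul0r addr0. Qed.
Lemma h2_snd x : h2 (fun z => z.2) x 0 1 0 0.
Proof. by apply: h2_ext (h2_lin 0 1 x) => z; rewrite mul1r mul0r add0r. Qed.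

Lemma h2_max f x b1 b2 a11 a22 : h2 f x b1 b2 a11 a22 -> (\forall z \near x, f z <= f x) ->
 [/\ b1 = 0, b2 = 0, a11 <= 0 & a22 <= 0].
Proof.
move=> [f1 [f2 [a12 [a21 [nf [<- <-] hf1 hf2]]]]] m; exact: max2 nf hf1 hf2 m.
Qed.

Lemma h2_lap f x b1 b2 a11 a22 : h2 f x b1 b2 a11 a22 ->
 pdm (2%N, 0%N) f x = a11 /\ pdm (0%N, 2%N) f x = a22.
Proof.
move=> [f1 [f2 [a12 [a21 [nf [_ _] hf1 hf2]]]]]; split.
- have n1 : \forall z \near x, f1 z = pd1 f z by apply: filterS nf => z /hg_pd1.
 rewrite -(hg_pd1 hf1) /pdm /= /pd1; apply: near_eq_derive.
 by apply: filterS n1 => z ->.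
- have n1 : \forall z \near x, f2 z = pd2 f z by apply: filterS nf => z /hg_pd2.
 rewrite -(hg_pd2 hf2) /pdm /= /pd2; apply: near_eq_derive.
 by apply: filterS n1 => z ->.
Qed.

Lemma h2_refl f x b1 b2 a11 a22 : h2 f (x.1, - x.2) b1 b2 a11 a22 ->
 h2 (fun z => f (z.1, - z.2)) x b1 (- b2) a11 a22.
Proof.
have E z : (z.1, - z.2) = 0 + z.1 *: (1, 0) + z.2 *: (0, - 1) :> R * R.
 by apply: pt_eq => /=; rewrite !scaleRE; ring.
have H p z c1 c2 : hg p (z.1, - z.2) c1 c2 -> hg (fun z => p (z.1, - z.2)) z c1 (- c2).
 rewrite (E z) => /hg_aff /hg_eq h; apply: (hg_ext (f := fun z => p (0 + z.1 *: (1, 0) + z.2 *: (0, - 1)))).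
  by move=> t; rewrite (E t).
 by apply: h => /=; ring.
move=> [f1 [f2 [a12 [a21 [nf [<- <-] hf1 hf2]]]]].
exists (fun z => f1 (z.1, - z.2)), (fun z => - f2 (z.1, - z.2)), (- a12), (- a21); split => //.
- have c : {for x, continuous (fun z : R * R => (z.1, - z.2) : R * R)}.
  by apply: pair_cont; [exact: fst_cont|apply: cvgN; exact: snd_cont].
 by have : \forall z \near x, hg f (z.1, - z.2) (f1 (z.1, - z.2)) (f2 (z.1, - z.2)) := c _ nf; apply: filterS => z; exact: H.
- exact: H.
- by apply: hg_eq (hgN (H _ _ _ _ hf2)) _ _ => //; rewrite opprK.
Qed.

Lemma box_max f (a1 b1 a2 b2 : R) : a1 <= b1 -> a2 <= b2 ->
 (forall x, a1 <= x.1 <= b1 -> a2 <= x.2 <= b2 -> {for x, continuous f}) ->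
 exists x, [/\ a1 <= x.1 <= b1, a2 <= x.2 <= b2 &
  forall y, a1 <= y.1 <= b1 -> a2 <= y.2 <= b2 -> f y <= f x].
Proof.
move=> h1 h2' cf.
pose K : set (R * R) := [set` `[a1, b1]] `*` [set` `[a2, b2]].
have cK : compact K by apply: compact_setX; exact: segment_compact.
have inK y : K y <-> (a1 <= y.1 <= b1) /\ (a2 <= y.2 <= b2) by rewrite /K /= !in_itv.
have K0 : K !=set0 by exists (a1, a2); apply/inK; rewrite /= !lexx h1 h2'.
have [|x /set_mem /inK [x1 x2] mx] := @compact_EVT_max _ R f K K0 cK.
 by apply: continuous_in_subspaceT => y /set_mem /inK [y1 y2]; exact: cf.
by exists x; split => // y y1 y2; apply: mx; apply/mem_set/inK.
Qed.

(** A positive maximum over the box would be a maximum over the whole plane, because f <= 0 outside;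
    there the Laplacian is nonpositive, against the hypothesis. *)
Lemma comparison f (B : R) : continuous f -> (forall x, (B < `|x.1|) || (B < `|x.2|) -> f x <= 0) ->
 (forall x, 0 < f x -> exists b1 b2 a11 a22, h2 f x b1 b2 a11 a22 /\ 0 < a11 + a22) ->
 forall x, f x <= 0.
Proof.
move=> cf fB fL y0; rewrite leNgt; apply/negP => fy0.
have B0 : 0 <= B.
 by rewrite leNgt; apply/negP => B0; have := fB y0; rewrite (lt_le_trans B0 (normr_ge0 _)) => /(_ isT); lra.
have BB : - B <= B by lra.
have [|x [x1 x2 mx]] := @box_max f (- B) B (- B) B BB BB; first by move=> x _ _; exact: cf.
have mx' y : f y <= Num.max (f x) 0.
 rewrite le_max; case: (leP `|y.1| B) => hy1; last by rewrite fB ?hy1 ?orbT.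
 case: (leP `|y.2| B) => hy2; last by rewrite fB ?hy2 ?orbT.
 by rewrite mx// -ler_norml.
have fx0 : 0 < f x by have := lt_le_trans fy0 (mx' y0); rewrite lt_max ltxx orbF.
have [b1 [b2 [a11 [a22 [hh s]]]]] := fL x fx0.
have [|_ _ l1 l2] := h2_max hh; last by lra.
by apply: near2W => z; apply: le_trans (mx' z) _; rewrite max_l// ltW.
Qed.

Lemma h2_J x : h2 J x (2 * x.1) (2 * x.2) 2 2.
Proof.
have h := h2D (h2_cst 1 x) (h2D (h2M (h2_fst x) (h2_fst x)) (h2M (h2_snd x) (h2_snd x))).
by apply: (h2_eq h) => /=; ring.
Qed.

(** Exponential decay of rate 1/2 in [sqrt (1 + |x|^2)], which is smooth at the origin. Its
    Laplacian is at most a quarter of itself, below the level 1/2 of the potentials at infinity. *)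
Definition barrier x : R := expR (- (Num.sqrt (J x) / 2)).
Lemma phi_gt0 x : 0 < barrier x. Proof. exact: expR_gt0. Qed.

Lemma h2_phi x : exists b1 b2 a11 a22, h2 barrier x b1 b2 a11 a22 /\ a11 + a22 <= barrier x / 4.
Proof.
pose p (t : R) : R := expR (- (Num.sqrt t / 2)).
pose p1 (t : R) : R := - (p t * (4 * Num.sqrt t)^-1).
have dp (t : R) : 0 < t -> is_derive t (1 : R) p (p1 t).
 move=> t0; have s0 : Num.sqrt t != 0 by rewrite gt_eqF ?sqrtr_gt0.
 have h1 := is_derive1_sqrt t0.
 have h2' := drvN (drvZ h1 2^-1).
 have h3 := @drv_comp R expR (fun s => - (2^-1 * Num.sqrt s)) t _ _ (is_derive_expR _) h2'.
 have -> : p = (fun s => expR (- (2^-1 * Num.sqrt s))) by apply/funext => s; rewrite /p mulrC.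
 apply: (drv_eq h3); rewrite /p1 /p mulrC; set q := expR _; rewrite mulNr (mulrC _ q) mulrC.
 rewrite (_ : expR _ = q); last by rewrite /q mulrC.
 by field.
have Jx : 0 < J x := J_gt0 x.
have s0 : 0 < Num.sqrt (J x) by rewrite sqrtr_gt0.
have sn : Num.sqrt (J x) != 0 by rewrite gt_eqF.
have dp1 : is_derive (J x) (1 : R) p1 (p (J x) * (16^-1 * (Num.sqrt (J x)) ^- 2 + 8^-1 * (Num.sqrt (J x)) ^- 3)).
 have h1 := drvZ (is_derive1_sqrt Jx) 4.
 have n4 : 4 * Num.sqrt (J x) != 0 by rewrite mulf_neq0// pnatr_eq0.
 have h := drvN (drvM (dp _ Jx) (drvV h1 n4)).
 by apply: (drv_eq h); rewrite /p1; field.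
have hh := h2_comp (p := p) (p1 := p1) _ dp1 (h2_J x).
do 4 eexists; split; first apply: hh.
 have n0 : \forall t \near J x, 0 < t by apply: open_nbhs_nbhs; split; [exact: open_gt|exact: Jx].
 by apply: filterS n0 => t; exact: dp.
have E : Num.sqrt (J x) ^+ 2 = 1 + x.1 ^+ 2 + x.2 ^+ 2 by rewrite sqr_sqrtr ?J_ge0// /jap /dot2; ring.
rewrite /p1 -[p (J x)]/(barrier x); have := phi_gt0 x; set q := barrier x; set s := Num.sqrt _ in s0 sn E *.
move=> q0.
rewrite -subr_ge0; have -> : q / 4 - (q * (16^-1 * s ^- 2 + 8^-1 * s ^- 3) * (2 * x.1) ^+ 2 + - (q / (4 * s)) * 2 +
  (q * (16^-1 * s ^- 2 + 8^-1 * s ^- 3) * (2 * x.2) ^+ 2 + - (q / (4 * s)) * 2)) =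
  q / 4 - (q * (16^-1 * s ^- 2 + 8^-1 * s ^- 3) * 4 * (x.1 ^+ 2 + x.2 ^+ 2)  - (q / s)) by field.
have -> : x.1 ^+ 2 + x.2 ^+ 2 = s ^+ 2 - 1 by rewrite E; ring.
have -> : q / 4 - (q * (16^-1 * s ^- 2 + 8^-1 * s ^- 3) * 4 * (s ^+ 2 - 1)  - (q / s)) =
 q * (s ^- 2 / 4 + s^-1 / 2 + s ^- 3 / 2) by field.
have i0 : 0 <= s^-1 by rewrite invr_ge0 ltW.
by apply: mulr_ge0; [exact: ltW|rewrite -!exprVn !addr_ge0// divr_ge0// exprn_ge0].
Qed.

(** Twice the sum of the hyperbolic cosines of x.1 / 4 and x.2 / 4. It grows at infinity and its
    Laplacian is only kos / 16, so a small multiple of it forces maxima to be attained without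
    spoiling a strict inequality. *)
Definition kos x : R := expR (x.1 / 4) + expR (- (x.1 / 4)) + (expR (x.2 / 4) + expR (- (x.2 / 4))).
Lemma kos_gt0 x : 0 < kos x.
Proof. by rewrite !addr_gt0 ?expR_gt0. Qed.

Lemma kos_ge x : 1 + `|x.1| / 4 <= kos x /\ 1 + `|x.2| / 4 <= kos x.
Proof.
have h (t : R) : 1 + `|t| / 4 <= expR (t / 4) + expR (- (t / 4)).
 have := expR_ge1Dx (t / 4); have := expR_ge1Dx (- (t / 4)).
 have := expR_ge0 (t / 4); have := expR_ge0 (- (t / 4)).
 by case: (leP 0 t) => t0; [rewrite ger0_norm|rewrite ltr0_norm]; lra.
have := h x.1; have := h x.2; rewrite /kos.
by have := normr_ge0 x.1; have := normr_ge0 x.2; split; lra.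
Qed.

Lemma h2_exp_lin (k l : R) x : h2 (fun z => expR (k * z.1 + l * z.2)) x (expR (k * x.1 + l * x.2) * k) (expR (k * x.1 + l * x.2) * l)
  (expR (k * x.1 + l * x.2) * k ^+ 2) (expR (k * x.1 + l * x.2) * l ^+ 2).
Proof.
have := h2_comp (p := expR) (p1 := expR) _ (is_derive_expR (k * x.1 + l * x.2)) (h2_lin k l x).
rewrite !mulr0 !addr0; apply; apply: near1W => t; exact: is_derive_expR.
Qed.

Lemma h2_kos x : exists b1 b2 a11 a22, h2 kos x b1 b2 a11 a22 /\ a11 + a22 = kos x / 16.
Proof.
have h := h2D (h2D (h2_exp_lin 4^-1 0 x) (h2_exp_lin (- 4^-1) 0 x)) (h2D (h2_exp_lin 0 4^-1 x) (h2_exp_lin 0 (- 4^-1) x)).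
have E z : (expR (4^-1 * z.1 + 0 * z.2) + expR (- 4^-1 * z.1 + 0 * z.2)) +
 (expR (0 * z.1 + 4^-1 * z.2) + expR (0 * z.1 + - 4^-1 * z.2)) = kos z.
 by rewrite /kos !mul0r !addr0 !add0r !mulNr !(mulrC 4^-1).
do 4 eexists; split; first exact: (h2_ext E h).
by rewrite -E; field.
Qed.

Lemma phi_cont : continuous barrier.
Proof. by move=> x; have [b1 [b2 [a11 [a22 [/h2_hg /hg_cont]]]]] := h2_phi x. Qed.
Lemma kos_cont : continuous kos.
Proof. by move=> x; have [b1 [b2 [a11 [a22 [/h2_hg /hg_cont]]]]] := h2_kos x. Qed.

(** w is compared with C barrier + eps kos, and eps tends to 0. Between the levels 1/2 and 1/4 there
    is room for C / 4, which absorbs the source once C >= 4 F; the other summand of C makes C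
    barrier at least W on the ball of radius rho, where no equation is assumed. *)
Lemma decay_le w (W F rho : R) : 0 <= rho -> 0 <= F -> continuous w -> (forall x, `|w x| <= W) ->
 (forall x, rho < enorm2 x -> 0 < w x -> exists b1 b2 a11 a22, h2 w x b1 b2 a11 a22 /\
   w x / 2 - F * barrier x <= a11 + a22) ->
 forall x, w x <= (4 * F + W / expR (- (Num.sqrt (1 + rho ^+ 2) / 2))) * barrier x.
Proof.
move=> rho0 F0 cw wW wL; set p0 := expR _; set C := 4 * F + _.
have W0 : 0 <= W := le_trans (normr_ge0 _) (wW 0).
have p00 : 0 < p0 by exact: expR_gt0.
have C0 : 0 <= C by apply: addr_ge0; [exact: mulr_ge0|apply: divr_ge0 => //; exact: ltW].
have key eps : 0 < eps -> forall x, w x - (C * barrier x + eps * kos x) <= 0.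
 move=> eps0; apply: (@comparison _ (4 * W / eps)).
 - move=> x; apply: cvgB; first exact: cw.
  by apply: cvgD; apply: cvgM; [exact: cvg_cst|exact: phi_cont|exact: cvg_cst|exact: kos_cont].
 - move=> x h; have [k1 k2] := kos_ge x.
  have hk : W <= eps * kos x.
   move: h; rewrite !ltr_pdivrMr// => /orP[] h.
    by apply: (@le_trans _ _ (eps * (1 + `|x.1| / 4))); [lran|rewrite ler_pM2l].
   by apply: (@le_trans _ _ (eps * (1 + `|x.2| / 4))); [lran|rewrite ler_pM2l].
  have := wW x; have := ler_norm (w x); have := mulr_ge0 C0 (ltW (phi_gt0 x)); lra.
 - move=> x h.
  have [q0 k0] : 0 < barrier x /\ 0 < kos x by split; [exact: phi_gt0|exact: kos_gt0].
  have Cq := mulr_ge0 C0 (ltW q0); have ek : 0 < eps * kos x by exact: mulr_gt0.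
  have rx : rho < enorm2 x.
   rewrite ltNge; apply/negP => hx.
   have : p0 <= barrier x.
    rewrite ler_expR lerN2 ler_pM2r ?invr_gt0// ler_wsqrtr// /jap lerD2l.
    have d0 : 0 <= dot2 x x by rewrite addr_ge0// -expr2 sqr_ge0.
    by rewrite -[leLHS](sqr_sqrtr d0) lerXn2r ?nnegrE ?sqrtr_ge0.
   move=> hp; have : W <= C * barrier x.
    apply: (@le_trans _ _ (W / p0 * barrier x)).
     by rewrite -mulrA ler_peMr// mulrC ler_pdivlMr// mul1r.
    by apply: ler_wpM2r; [exact: ltW|rewrite /C lerDr mulr_ge0].
   have := wW x; have := ler_norm (w x); lra.
  have w0 : 0 < w x by lra.
  have [b1 [b2 [a11 [a22 [ha hl]]]]] := wL x rx w0.
  have [c1 [c2 [d11 [d22 [hc hd]]]]] := h2_phi x.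
  have [e1 [e2 [g11 [g22 [he hk]]]]] := h2_kos x.
  do 4 eexists; split; first exact: h2B ha (h2D (h2Z C hc) (h2Z eps he)).
  have : C * (d11 + d22) <= C * (barrier x / 4) by exact: ler_wpM2l.
  have -> : C * (barrier x / 4) = C * barrier x / 4 by ring.
  have : eps * (g11 + g22) = eps * kos x / 16 by rewrite hk; ring.
  have : 4 * F * barrier x <= C * barrier x by apply: ler_wpM2r; [exact: ltW|rewrite lerDl divr_ge0// ltW].
  rewrite -mulrA.
  by lra.
move=> x; rewrite -subr_le0; apply/ler_addgt0Pr => eps eps0; rewrite add0r.
have e1 : 0 < eps / kos x by rewrite divr_gt0 ?kos_gt0.
by have := key _ e1 x; rewrite divfK ?gt_eqF ?kos_gt0//; lra.
Qed.

Lemma drv_right (p : R -> R) (a d : R) : 0 < d -> is_derive (0 : R) (1 : R) p a -> p 0 = 0 ->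
 (forall t, 0 < t < d -> p t <= 0) -> a <= 0.
Proof.
move=> d0 [dp <-] p0 pn; rewrite leNgt; apply/negP => a0.
have c : h^-1 *: (p (h *: (1 : R) + 0) - p 0) @[h --> (0 : R)^'] --> 'D_1 p 0.
 rewrite /derive; apply: cvg_trans dp.
 by apply: near_eq_cvg; near=> h => /=; rewrite addrC.
have : \forall h \near (0 : R)^', 0 < h^-1 *: (p (h *: (1 : R) + 0) - p 0) by exact: cvgr_gt c _ a0.
move=> /nbhs_ballP [r /= r0 hr].
pose t : R := Num.min r d / 2.
have t0 : 0 < t by rewrite divr_gt0// lt_min r0.
have tr : t < r /\ t < d.
 have : Num.min r d <= r /\ Num.min r d <= d by rewrite !ge_min !lexx orbT.
 by move=> [h1 h2']; rewrite /t; split; lra.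
have := hr t; rewrite -ball_normE /ball_ /= sub0r normrN gtr0_norm// => /(_ tr.1); rewrite gt_eqF// => /(_ isT).
rewrite p0 subr0 addr0 (_ : t%:A = t); last by rewrite /GRing.scale /= mulr1.
rewrite scaleRE pmulr_rgt0 ?invr_gt0//.
by have := pn t; rewrite t0 tr.2 => /(_ isT); lra.
Unshelve. all: by end_near. Qed.

(** * Interior gradient estimate by odd reflection *)

Section Grad.
Variables (u : R * R -> R) (a1 a2 e M N d : R).
Hypotheses (d0 : 0 < d) (a1b : 2^-1 <= a1 <= 1) (a2b : 2^-1 <= a2 <= 1) (e0 : 0 <= e).
Hypothesis hu : forall x, `|x.1| <= d -> `|x.2| <= d -> `|u x| <= M /\
 exists b1 b2 a11 a22, h2 u x b1 b2 a11 a22 /\ `|a1 * a11 + a2 * a22 - e * u x| <= N.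

Let M0 : 0 <= M.
Proof. by have [||h _] := @hu 0; rewrite /= ?normr0; [exact: ltW|exact: ltW|exact: le_trans h]. Qed.
Let N0 : 0 <= N.
Proof. by have [||_ [b1 [b2 [a11 [a22 [_ h]]]]]] := @hu 0; rewrite /= ?normr0; [exact: ltW|exact: ltW|exact: le_trans h]. Qed.
Let psi x : R := 2^-1 * (u x - u (x.1, - x.2)).
(** Comparison function for the odd part [psi] on the half square: nonnegative on x.2 = 0, at least
    M on the three other sides, and mapped by the operator below - N', since a1 <= 1 <= 2 a2. Its
    slope at the origin is the final bound. *)
Let v (N' : R) x : R := M / d ^+ 2 * (x.1 * x.1 + x.2 * (3 * d - 2 * x.2)) + N' * (x.2 * (d - x.2)).

Let h2_v N' x : exists b1 b2, h2 (v N') x b1 b2 (M / d ^+ 2 * 2) (M / d ^+ 2 * (- 4) - N' * 2).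
Proof.
have hx := h2_fst x; have hy := h2_snd x.
have h := h2D (h2Z (M / d ^+ 2) (h2D (h2M hx hx) (h2M hy (h2B (h2_cst (3 * d) x) (h2Z 2 hy)))))
  (h2Z N' (h2M hy (h2B (h2_cst d x) hy))).
by do 2 eexists; apply: (h2_eq h) => //; ring.
Qed.

Let psi_le (s : R) N' : s = 1 \/ s = -1 -> N < N' -> forall x, - d <= x.1 <= d -> 0 <= x.2 <= d -> s * psi x <= v N' x.
Proof.
move=> hs NN'; have N'0 : 0 < N' := le_lt_trans N0 NN'.
pose g x := s * psi x - v N' x.
have /andP[A1 A1'] := a1b; have /andP[A2 A2'] := a2b.
have bx x : - d <= x.1 <= d -> 0 <= x.2 <= d -> [/\ `|x.1| <= d, `|x.2| <= d & `|- x.2| <= d].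
 by move=> h1 /andP[h3 h4]; rewrite normrN !ler_norml h1 h4 andbT (le_trans _ h3)// oppr_le0 ltW.
have Md : 0 <= M / d ^+ 2 by apply: divr_ge0; [exact: M0|exact: sqr_ge0].
have dd : M / d ^+ 2 * (d * d) = M by rewrite -expr2 divfK// expf_neq0// gt_eqF.
have v0 x : 0 <= x.2 <= d -> 0 <= v N' x.
 move=> /andP[h1 h2']; apply: addr_ge0; apply: mulr_ge0 => //; try exact: ltW.
  by rewrite addr_ge0 -?expr2 ?sqr_ge0// mulr_ge0//; lran.
 by rewrite mulr_ge0//; lran.
have psi_M x : - d <= x.1 <= d -> 0 <= x.2 <= d -> s * psi x <= M.
 move=> h1 h2'; have [k1 k2 k3] := bx x h1 h2'.
 have [+ _] := hu k1 k2; have [+ _] := @hu (x.1, - x.2) k1 k3.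
 by rewrite !ler_norml /psi; case: hs => ->; lran.
have h2g x : - d <= x.1 <= d -> 0 <= x.2 <= d -> exists b1 b2 a11 a22, h2 g x b1 b2 a11 a22 /\
  N' - N + e * g x <= a1 * a11 + a2 * a22.
 move=> h1 h2'; have [k1 k2 k3] := bx x h1 h2'.
 have [_ [b1 [b2 [a11 [a22 [ha la]]]]]] := hu k1 k2; have [_ [c1 [c2 [d11 [d22 [hd ld]]]]]] := @hu (x.1, - x.2) k1 k3.
 have [f1 [f2 hv]] := h2_v N' x.
 do 4 eexists; split; first exact: h2B (h2Z s (h2Z 2^-1 (h2B ha (h2_refl hd)))) hv.
 have := v0 x h2' => vx; have ev : 0 <= e * v N' x by exact: mulr_ge0.
 have t1 : M / d ^+ 2 * (a1 - 2 * a2) <= 0 by apply: mulr_ge0_le0 => //; lran.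
 have t2 : N' <= 2 * a2 * N' by apply: ler_peMl; [exact: ltW|lran].
 move: la ld; rewrite !ler_norml /g /psi.
 have -> : a1 * (s * (2^-1 * (a11 - d11)) - M / d ^+ 2 * 2) + a2 * (s * (2^-1 * (a22 - d22)) - (M / d ^+ 2 * -4 - N' * 2)) =
   s * (2^-1 * ((a1 * a11 + a2 * a22) - (a1 * d11 + a2 * d22))) - 2 * (M / d ^+ 2 * (a1 - 2 * a2)) + 2 * a2 * N' by ring.
 have -> : e * (s * (2^-1 * (u x - u (x.1, - x.2))) - v N' x) = s * (2^-1 * (e * u x - e * u (x.1, - x.2))) - e * v N' x by ring.
 by case: hs => ->; lran.
have dN : - d <= d by rewrite -subr_ge0 opprK addr_ge0 ?ltW.
have [x x1 x2|x [x1 x2 mx]] := @box_max g (- d) d 0 d dN (ltW d0).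
 by have [b1 [b2 [a11 [a22 [/h2_hg /hg_cont]]]]] := h2g x x1 x2.
move=> y y1 y2; rewrite -subr_le0; apply: le_trans (mx y y1 y2) _.
rewrite leNgt; apply/negP => gx.
have [b1 [b2 [a11 [a22 [hx lx]]]]] := h2g x x1 x2.
have eg : 0 <= e * g x by rewrite mulr_ge0// ltW.
have pM := psi_M x x1 x2.
have [k1 k2 k3] := bx x x1 x2.
have gM : v N' x < M by move: gx; rewrite /g; lran.
have vE : v N' x = M / d ^+ 2 * (x.1 * x.1) + M / d ^+ 2 * (x.2 * (3 * d - 2 * x.2)) + N' * (x.2 * (d - x.2)) by rewrite /v; ring.
have [x20 x2d] := andP x2.
have p1 : 0 <= M / d ^+ 2 * (x.1 * x.1) by rewrite mulr_ge0// -expr2 sqr_ge0.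
have p2 : 0 <= M / d ^+ 2 * (x.2 * (3 * d - 2 * x.2)) by rewrite mulr_ge0// mulr_ge0//; lran.
have p3 : 0 <= N' * (x.2 * (d - x.2)) by apply: mulr_ge0; [exact: ltW|apply: mulr_ge0 => //; lran].
have i1 : `|x.1| < d.
 rewrite lt_neqAle k1 andbT; apply/eqP => E.
 have : x.1 * x.1 = d * d by rewrite -!expr2 -(real_normK (num_real x.1)) E.
 by move=> E'; move: p1 vE; rewrite E' dd; lran.
have i2 : 0 < x.2.
 rewrite lt_neqAle x20 andbT; apply/eqP => E.
 have P0 : psi x = 0.
  rewrite /psi (_ : (x.1, - x.2) = x) ?subrr ?mulr0//.
  by apply: pt_eq => //=; rewrite -E oppr0.
 by move: gx; rewrite /g P0 mulr0; have := v0 x x2; lran.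
have i3 : x.2 < d.
 rewrite lt_neqAle x2d andbT; apply/eqP => E.
 by move: p2 vE; rewrite E (_ : 3 * d - 2 * d = d) ?dd; [lran|ring].
have [|_ _ l1 l2] := h2_max hx.
 have n1 : \forall z \near x, `|z.1| < d.
  have c : {for x, continuous (fun z : R * R => `|z.1|)}.
   by apply: (@continuous_comp _ _ _ fst (fun t : R => `|t|)); [exact: fst_cont|exact: norm_continuous].
  exact: cvgr_lt c _ i1.
 have c2 := @snd_cont x.
 have n2 : \forall z \near x, 0 < z.2 by exact: cvgr_gt c2 _ i2.
 have n3 : \forall z \near x, z.2 < d by exact: cvgr_lt c2 _ i3.
 near=> z; apply: mx.
  rewrite -ler_norml ltW//; near: z; exact: n1.
 apply/andP; split; apply: ltW; near: z; [exact: n2|exact: n3].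
have : a1 * a11 <= 0 by apply: mulr_ge0_le0 => //; lran.
have : a2 * a22 <= 0 by apply: mulr_ge0_le0 => //; lran.
by lran.
Unshelve. all: by end_near. Qed.

Lemma grad_est2 (g1 g2 : R) : hg u 0 g1 g2 -> `|g2| <= 3 * M / d + N * d.
Proof.
move=> h; apply/ler_addgt0Pr => eps eps0.
(* The comparison needs a strict inequality N < N'; the loss eps is arbitrary. *)
pose N' := N + eps / d.
have NN' : N < N' by rewrite ltrDl divr_gt0.
have dn : d != 0 by rewrite gt_eqF.
have -> : 3 * M / d + N * d + eps = 3 * M / d + N' * d by rewrite /N'; field.
have key (s : R) : s = 1 \/ s = -1 -> s * g2 <= 3 * M / d + N' * d.
 move=> hs; rewrite -subr_le0.
 pose p (t : R) : R := s * psi (0, t) - v N' (0, t).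
 refine (@drv_right p (s * g2 - (3 * M / d + N' * d)) d d0 _ _ _).
 - have L (q : R * R -> R) c1 c2 : hg q 0 c1 c2 -> is_derive (0 : R) (1 : R) (fun t => q (0, t)) c2.
   move=> hq; have -> : (fun t => q (0, t)) = (fun t : R => q (0 + t *: (0, 1))).
    by apply/funext => t; congr q; apply: pt_eq => /=; rewrite !scaleRE; ring.
   have := @hg_line R q 0 (0, 1) c1 c2 0; rewrite scale0r addr0 => /(_ hq).
   by rewrite /= mulr0 add0r mulr1.
  have d1 := L _ _ _ h.
  have hr : hg (fun z => u (z.1, - z.2)) 0 g1 (- g2).
   have E z : (z.1, - z.2) = 0 + z.1 *: (1, 0) + z.2 *: (0, - 1) :> R * R.
    by apply: pt_eq => /=; rewrite !scaleRE; ring.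
   apply: (hg_ext (f := fun z => u (0 + z.1 *: (1, 0) + z.2 *: (0, - 1)))).
    by move=> t; rewrite (E t).
   have hu0 : hg u (0 + (0 : R * R).1 *: (1, 0) + (0 : R * R).2 *: (0, - 1)) g1 g2.
    by rewrite -(E 0) (_ : (_, _) = 0)//; apply: pt_eq => //=; rewrite oppr0.
   by apply: (hg_eq (hg_aff hu0)) => /=; ring.
  have d2 := L _ _ _ hr.
  have dpsi := drvZ (drvB d1 d2) 2^-1.
  have i := drv_id (0 : R).
  have dv := drvD (drvZ (drvD (drv_cst (0 * 0) 0) (drvM i (drvB (drv_cst (3 * d) 0) (drvZ i 2)))) (M / d ^+ 2))
    (drvZ (drvM i (drvB (drv_cst d 0) i)) N').
  have dd := drvB (drvZ dpsi s) dv.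
  by apply: (drv_eq dd); field.
 - rewrite /p /psi /v /= (_ : (0 : R, - 0) = (0, 0)); last by apply: pt_eq => //=; rewrite oppr0.
  ring.
 - move=> t /andP[t0 td]; rewrite /p subr_le0; apply: psi_le => //=.
   by rewrite oppr_le0 ltW.
  by rewrite !ltW.
by rewrite ler_norml; have := key 1 (or_introl erefl); have := key (-1) (or_intror erefl); lra.
Qed.
End Grad.

Lemma grad_est u (a1 a2 e M N d g1 g2 : R) : 0 < d -> 2^-1 <= a1 <= 1 -> 2^-1 <= a2 <= 1 -> 0 <= e ->
 (forall x, `|x.1| <= d -> `|x.2| <= d -> `|u x| <= M /\
  exists b1 b2 a11 a22, h2 u x b1 b2 a11 a22 /\ `|a1 * a11 + a2 * a22 - e * u x| <= N) ->
 hg u 0 g1 g2 -> `|g1| <= 3 * M / d + N * d /\ `|g2| <= 3 * M / d + N * d.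
Proof.
move=> d0 a1b a2b e0 hu h; split; last exact: (grad_est2 d0 a1b a2b e0 hu h).
have E z : (z.2, z.1) = 0 + z.1 *: (0, 1) + z.2 *: (1, 0) :> R * R.
 by apply: pt_eq => /=; rewrite !scaleRE; ring.
have H p z c1 c2 : hg p (z.2, z.1) c1 c2 -> hg (fun z => p (z.2, z.1)) z c2 c1.
 rewrite (E z) => /hg_aff /hg_eq h'; apply: (hg_ext (f := fun z => p (0 + z.1 *: (0, 1) + z.2 *: (1, 0)))).
  by move=> t; rewrite (E t).
 by apply: h' => /=; ring.
apply: (@grad_est2 (fun z => u (z.2, z.1)) a2 a1 e M N d d0 a2b a1b e0 _ g2 g1); last first.
 by apply: H; rewrite (_ : (_, _) = 0).
move=> x h1 h2'; have [k1 [b1 [b2 [a11 [a22 [hx lx]]]]]] := hu (x.2, x.1) h2' h1.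
split => //; exists b2, b1, a22, a11; split; last by rewrite addrC [a2 * _ + _]addrC addrC.
move: hx => [f1 [f2 [a12 [a21 [nf [<- <-] hf1 hf2]]]]].
exists (fun z => f2 (z.2, z.1)), (fun z => f1 (z.2, z.1)), a21, a12; split => //; try exact: H.
have c : {for x, continuous (fun z : R * R => (z.2, z.1) : R * R)}.
 by apply: pair_cont; [exact: snd_cont|exact: fst_cont].
by have : \forall z \near x, hg u (z.2, z.1) (f1 (z.2, z.1)) (f2 (z.2, z.1)) := c _ nf; apply: filterS => z; exact: H.
Qed.

End MaxP.

(** * One-dimensional monotonicity arguments *)

Section OneD.
Variable R : realType.
Implicit Types (f g : R -> R) (a b r s t : R).

Lemma mvt f f' a b : a < b -> (forall x, a <= x <= b -> is_derive x (1 : R) f (f' x)) ->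
 exists c, a < c < b /\ f b - f a = f' c * (b - a).
Proof.
move=> ab df; have [||c] := @MVT R f f' a b ab.
- by move=> x; rewrite in_itv /= => /andP[/ltW h1 /ltW h2]; apply: df; rewrite h1.
- apply: continuous_in_subspaceT => x /set_mem /=; rewrite in_itv /= => h.
 exact: drv_cont (df x h).
by rewrite in_itv /= => h e; exists c.
Qed.

Lemma incr_lt f f' a b : a < b -> (forall x, a <= x <= b -> is_derive x (1 : R) f (f' x)) ->
 (forall x, a < x < b -> 0 < f' x) -> f a < f b.
Proof.
move=> ab df fp; have [c [cab e]] := mvt ab df.
by rewrite -subr_gt0 e mulr_gt0 ?fp// subr_gt0.
Qed.

Lemma incr_le f f' a b : a <= b -> (forall x, a <= x <= b -> is_derive x (1 : R) f (f' x)) ->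
 (forall x, a < x < b -> 0 <= f' x) -> f a <= f b.
Proof.
rewrite le_eqVlt => /orP[/eqP -> //|ab] df fp; have [c [cab e]] := mvt ab df.
by rewrite -subr_ge0 e mulr_ge0 ?fp// subr_ge0 ltW.
Qed.

Lemma decr_lt f f' a b : a < b -> (forall x, a <= x <= b -> is_derive x (1 : R) f (f' x)) ->
 (forall x, a < x < b -> f' x < 0) -> f b < f a.
Proof.
move=> ab df fp; have [c [cab e]] := mvt ab df.
by rewrite -subr_lt0 e nmulr_rlt0 ?fp// subr_gt0.
Qed.

Lemma decr_le f f' a b : a <= b -> (forall x, a <= x <= b -> is_derive x (1 : R) f (f' x)) ->
 (forall x, a < x < b -> f' x <= 0) -> f b <= f a.
Proof.
rewrite le_eqVlt => /orP[/eqP -> //|ab] df fp; have [c [cab e]] := mvt ab df.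
by rewrite -subr_le0 e mulr_le0_ge0 ?fp// subr_ge0 ltW.
Qed.

Lemma first_zero f a b : a <= b -> (forall x, a <= x <= b -> {for x, continuous f}) ->
 0 < f a -> f b <= 0 ->
 exists z, [/\ a < z <= b, f z = 0 & forall t, a <= t < z -> 0 < f t].
Proof.
move=> ab cf fa fb.
pose S : set R := [set t | a <= t <= b /\ f t <= 0].
have S0 : S !=set0 by exists b; rewrite /S /= ab lexx.
have lS : has_lbound S by exists a => t [/andP[]].
have hS : has_inf S by [].
pose z := inf S.
have az : a <= z by apply: lb_le_inf => // t [/andP[]].
have zb : z <= b by apply: inf_lbound => //; rewrite /S /= ab lexx.
have pos t : a <= t < z -> 0 < f t.
 move=> /andP[h1 h2]; rewrite ltNge; apply/negP => h3.
 have : z <= t by apply: inf_lbound => //; split => //; rewrite h1 (le_trans (ltW h2)).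
 by rewrite leNgt h2.
have cz : {for z, continuous f} by apply: cf; rewrite az.
have fz1 : f z <= 0.
 rewrite leNgt; apply/negP => fz.
 have /nbhs_ballP [d /= d0 hd] : \forall t \near z, 0 < f t by exact: cvgr_gt cz _ fz.
 have [t [[t1 t2] tz]] : exists t, S t /\ t < z + d.
  by have [t St tz] := inf_adherent d0 hS; exists t.
 have zt : z <= t by exact: inf_lbound.
 have := hd t; rewrite -ball_normE /ball_ /= => /(_ _); rewrite distrC ger0_norm ?subr_ge0// ltrBlDl tz => /(_ isT).
 by rewrite ltNge t2.
have az' : a < z.
 by rewrite lt_neqAle az andbT; apply/eqP => e; move: fz1; rewrite -e leNgt fa.
exists z; split => //; first by rewrite az' zb.
apply/eqP; rewrite eq_le fz1 /= leNgt; apply/negP => fz.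
have /nbhs_ballP [d /= d0 hd] : \forall t \near z, f t < 0 by exact: cvgr_lt cz _ fz.
pose t := Num.max a (z - d / 2).
have tz : t < z by rewrite gt_max az' /=; lra.
have ta : a <= t by rewrite le_max lexx.
have : z - d / 2 <= t by rewrite le_max lexx orbT.
move=> td; have := hd t; rewrite -ball_normE /ball_ /= => /(_ _); rewrite ger0_norm ?subr_ge0 1?ltW//.
have -> : z - t < d by lra.
by move=> /(_ isT); have := pos t; rewrite ta tz => /(_ isT); lra.
Qed.

Lemma drv_pos_near f z d : is_derive z (1 : R) f d -> 0 < d ->
 exists2 e : R, 0 < e & forall t, (z - e < t < z -> f t < f z) /\ (z < t < z + e -> f z < f t).
Proof.
move=> [df <-] d0.
have c : h^-1 *: (f (h *: (1 : R) + z) - f z) @[h --> (0 : R)^'] --> 'D_1 f z.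
 rewrite /derive; apply: cvg_trans df.
 by apply: near_eq_cvg; near=> h => /=; rewrite addrC.
have : \forall h \near (0 : R)^', 0 < h^-1 *: (f (h *: (1 : R) + z) - f z) by exact: cvgr_gt c _ d0.
move=> /nbhs_ballP [e /= e0 he]; exists e => // t; split=> /andP[h1 h2].
 have := he (t - z); rewrite -ball_normE /ball_ /= sub0r normrN ltr0_norm ?subr_lt0// => /(_ _).
 have -> : - (t - z) < e by lra.
 move=> /(_ isT); rewrite subr_eq0 lt_eqF// => /(_ isT).
 have -> : (t - z)%:A = t - z by rewrite /GRing.scale /= mulr1.
 by rewrite subrK scaleRE nmulr_rgt0 ?invr_lt0 ?subr_lt0// .
have := he (t - z); rewrite -ball_normE /ball_ /= sub0r normrN gtr0_norm ?subr_gt0// => /(_ _).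
have -> : t - z < e by lra.
move=> /(_ isT); rewrite subr_eq0 gt_eqF// => /(_ isT).
have -> : (t - z)%:A = t - z by rewrite /GRing.scale /= mulr1.
by rewrite subrK scaleRE pmulr_rgt0 ?invr_gt0 ?subr_gt0// .
Unshelve. all: by end_near. Qed.

(** At its first zero a positive function cannot have a positive derivative. This is how a sign is
    propagated along an ODE. *)
Lemma stay_pos f f' a b : a <= b -> (forall x, a <= x <= b -> is_derive x (1 : R) f (f' x)) ->
 0 < f a -> (forall t, a < t <= b -> f t = 0 -> 0 < f' t) -> 0 < f b.
Proof.
move=> ab df fa fz; rewrite ltNge; apply/negP => fb.
have [x|z [/andP[az zb] z0 pz]] := first_zero ab _ fa fb; first by move=> h; exact: drv_cont (df x h).
have azb : a <= z <= b by rewrite (ltW az).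
have [|e e0 he] := drv_pos_near (df z azb); first by apply: fz; rewrite ?az.
pose t := Num.max ((a + z) / 2) (z - e / 2).
have tz : t < z by rewrite gt_max; apply/andP; split; lra.
have t1 : (a + z) / 2 <= t by rewrite le_max lexx.
have t2 : z - e / 2 <= t by rewrite le_max lexx orbT.
have [h _] := he t.
have zt : z - e < t < z by rewrite tz andbT; lra.
have := h zt; rewrite z0; have := pz t; have -> : a <= t < z by rewrite tz andbT; lra.
by move=> /(_ isT); lra.
Qed.

(** * The radial profile and its logarithmic derivative *)

Section Radial.
Variables q q1 q2 : R -> R.
Hypotheses (dq : forall r, is_derive r (1 : R) q (q1 r)) (dq1 : forall r, is_derive r (1 : R) q1 (q2 r)).
Hypothesis ode : forall r, r * q2 r + q1 r = r * (q r - q r ^+ 3).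
Hypotheses (qpos : forall r, 0 < q r) (q20 : 2 * q2 0 = q 0 - q 0 ^+ 3).

Lemma q1_0 : q1 0 = 0.
Proof. by have := ode 0; rewrite !mul0r add0r. Qed.
(** The mechanical energy of the radial ODE, with r as time; the term q' / r acts as friction and
    makes it decrease. *)
Definition En r : R := q1 r ^+ 2 / 2 - q r ^+ 2 / 2 + q r ^+ 4 / 4.

Lemma drv_X f r d n : is_derive r (1 : R) f d -> is_derive r (1 : R) (fun s => f s ^+ n) (n%:R * f r ^+ n.-1 * d).
Proof.
move=> df; elim: n => [|n IH].
 by apply: (drv_eq (drv_cst 1 r)); rewrite !mul0r.
have := drvM df IH; rewrite (_ : (fun s => f s * f s ^+ n) = (fun s => f s ^+ n.+1)); last first.
 by apply/funext => s; rewrite exprS.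
move=> h; apply: (drv_eq h); case: n {IH h} => [|n] /=; first by rewrite expr0; ring.
by rewrite -!natr1 exprS; ring.
Qed.

Lemma dEn r : is_derive r (1 : R) En (q1 r * (q2 r - (q r - q r ^+ 3))).
Proof.
have h := drvD (drvB (drvZ (drv_X 2 (dq1 r)) 2^-1) (drvZ (drv_X 2 (dq r)) 2^-1)) (drvZ (drv_X 4 (dq r)) 4^-1).
have E : (fun s => 2^-1 * q1 s ^+ 2 - 2^-1 * q s ^+ 2 + 4^-1 * q s ^+ 4) = En.
 by apply/funext => s; rewrite /En; field.
by rewrite E in h; apply: (drv_eq h) => /=; field.
Qed.

Lemma En_decr r s : 0 <= r <= s -> En s <= En r.
Proof.
move=> /andP[r0 rs]; apply: (decr_le rs (fun x _ => dEn x)) => x /andP[rx _].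
have x0 : 0 < x := le_lt_trans r0 rx.
have xn : x != 0 by rewrite gt_eqF.
have -> : q2 x - (q x - q x ^+ 3) = - (q1 x / x).
 apply: (mulfI xn); rewrite mulrBr -ode; by field.
by rewrite mulrN oppr_le0 mulrA -expr2 divr_ge0 ?sqr_ge0 ?ltW.
Qed.

Lemma q1_bd r : 0 <= r -> q1 r ^+ 2 <= 2 * (En 0 + 1).
Proof.
move=> r0; have := @En_decr 0 r; rewrite lexx r0 => /(_ isT); rewrite {1}/En.
have := sqr_ge0 (q r ^+ 2 - 1).
have -> : (q r ^+ 2 - 1) ^+ 2 = q r ^+ 4 - 2 * q r ^+ 2 + 1 by ring.
by lra.
Qed.

Hypothesis qlim : forall e : R, 0 < e -> exists2 rho : R, 0 < rho & forall r, rho < r -> q r < e.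

Lemma En_ge0 r : 0 <= r -> 0 <= En r.
Proof.
move=> r0; apply/ler_addgt0Pr => e e0.
have e1 : 0 < Num.min 1 e by rewrite lt_min ltr01.
have [rho rho0 hrho] := qlim e1.
pose s := Num.max r rho + 1.
have rs : r <= s /\ rho < s.
 have : r <= Num.max r rho /\ rho <= Num.max r rho by rewrite !le_max !lexx orbT.
 by rewrite /s => -[h1 h2]; split; lra.
have := En_decr (_ : 0 <= r <= s); rewrite r0 rs.1 => /(_ isT); rewrite {1}/En.
have := hrho s rs.2; rewrite lt_min => /andP[k1 k2].
have := qpos s; have := sqr_ge0 (q1 s); have : 0 <= q s ^+ 4 by rewrite exprn_even_ge0.
have : q s ^+ 2 <= q s by rewrite expr2 ger_pMl ?qpos// ltW.
by lra.
Qed.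

Lemma sq_ge2 r : 0 <= r -> q1 r = 0 -> 2 <= q r ^+ 2.
Proof.
move=> r0 h; have := En_ge0 r0; rewrite /En h expr0n mul0r add0r => k.
have p : 0 < q r ^+ 2 by rewrite exprn_gt0.
have : 0 <= q r ^+ 2 * (q r ^+ 2 - 2).
 have -> : q r ^+ 2 * (q r ^+ 2 - 2) = 4 * (- (q r ^+ 2 / 2) + q r ^+ 4 / 4) by field.
 lran.
by rewrite pmulr_rge0// subr_ge0.
Qed.

Lemma cubic_neg t : 0 < t -> 2 <= t ^+ 2 -> t - t ^+ 3 < 0.
Proof.
move=> t0 t2; have -> : t - t ^+ 3 = t * (1 - t ^+ 2) by ring.
by rewrite pmulr_rlt0//; lra.
Qed.

(** Since q tends to 0 the energy is nonnegative, so at a critical point q^2 >= 2 and q'' < 0. Thus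
    q', negative just after 0, cannot return to zero. *)
Lemma q1_neg r : 0 < r -> q1 r < 0.
Proof.
move=> r0.
have h0 : q2 0 < 0.
 by have := cubic_neg (qpos 0) (sq_ge2 (lexx 0) q1_0); rewrite -q20; lra.
have dn s : is_derive s (1 : R) (fun t => - q1 t) (- q2 s) := drvN (dq1 s).
have [|e e0 he] := drv_pos_near (dn 0); first by lra.
pose s := Num.min r e / 2.
have s0 : 0 < s by rewrite divr_gt0// lt_min r0.
have sre : s < r /\ s < e.
 have : Num.min r e <= r /\ Num.min r e <= e by rewrite !ge_min !lexx orbT.
 by move=> [h1 h2]; rewrite /s; split; lra.
have [_ h1] := he s; have q1s : 0 < - q1 s.
 by have := h1; rewrite add0r s0 sre.2 q1_0 oppr0 => /(_ isT).
suff : 0 < - q1 r by lra.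
apply: (stay_pos (ltW sre.1) (fun x _ => dn x) q1s) => t /andP[st tr] /eqP.
have t0 : 0 < t := lt_trans s0 st.
rewrite oppr_eq0 => /eqP z; have := cubic_neg (qpos t) (sq_ge2 (ltW t0) z).
have := ode t; rewrite z addr0 => /(mulfI _) -> //; first by lra.
by rewrite gt_eqF.
Qed.

Hypothesis qdec : forall (n : nat) (c : R), 0 < c -> exists2 rho : R, 0 < rho & forall r, rho < r -> q r * r ^+ n < c.

(** The derivative of log q with respect to log r; [lp] is its derivative in the same variable,
    written by a Riccati equation. Since r q' + a q = q (ly + a), the strict decrease of [ly] leaves
    this function at most one positive zero. *)
Definition ly r : R := r * q1 r / q r.
Definition lp r : R := r ^+ 2 * (1 - q r ^+ 2) - ly r ^+ 2.

Lemma dly r : 0 < r -> is_derive r (1 : R) ly (lp r / r).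
Proof.
move=> r0; have qn : q r != 0 by rewrite gt_eqF.
have rn : r != 0 by rewrite gt_eqF.
have h := drvM (drvM (drv_id r) (dq1 r)) (drvV (dq r) qn).
apply: (drv_eq h); rewrite /lp /ly.
have -> : 1 * q1 r + r * q2 r = r * (q r - q r ^+ 3) by rewrite mul1r addrC ode.
by field; rewrite qn rn.
Qed.

Lemma dlp r : 0 < r -> is_derive r (1 : R) lp (2 * r * (1 - q r ^+ 2) - 2 * r * q r ^+ 2 * ly r - 2 * ly r * lp r / r).
Proof.
move=> r0; have qn : q r != 0 by rewrite gt_eqF.
have rn : r != 0 by rewrite gt_eqF.
have h := drvB (drvM (drv_X 2 (drv_id r)) (drvB (drv_cst 1 r) (drv_X 2 (dq r)))) (drv_X 2 (dly r0)).
apply: (drv_eq h) => /=; rewrite [ly r ^+ 1]expr1 [q r ^+ 1]expr1 /lp /ly.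
by field; rewrite qn rn.
Qed.

Lemma ly_neg r : 0 < r -> ly r < 0.
Proof.
by move=> r0; rewrite /ly pmulr_llt0 ?invr_gt0// pmulr_rlt0// q1_neg.
Qed.

(** At a zero of [lp] one has r^2 (1 - q^2) = ly^2 > 0 and ly < 0, so its derivative is positive:
    once nonnegative, [lp] is positive from then on. Then [ly] is bounded below by some - n, q r^(n
    + 1) is nondecreasing, and this contradicts the decay of q. *)
Lemma lp_neg r0 : 0 < r0 -> lp r0 < 0.
Proof.
move=> r00; rewrite ltNge; apply/negP => p0.
have zero t : 0 < t -> lp t = 0 -> 0 < 2 * t * (1 - q t ^+ 2) - 2 * t * q t ^+ 2 * ly t - 2 * ly t * lp t / t.
 move=> t0 e; have l0 := ly_neg t0.
 have : t * (t * (1 - q t ^+ 2)) = ly t ^+ 2 by apply/eqP; rewrite -subr_eq0 mulrA -expr2 -/(lp t) e.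
 move=> e1; rewrite e mulr0 mul0r subr0.
 have h1 : 0 < t * (1 - q t ^+ 2) by rewrite -(pmulr_rgt0 _ t0) e1 exprn_even_gt0//= (lt_eqF l0).
 have h2 : 0 < t * q t ^+ 2 * (- ly t) by rewrite !mulr_gt0 ?exprn_gt0// oppr_gt0.
 by lra.
have [r1 [r10 rr1 p1]] : exists r1, [/\ 0 < r1, r0 <= r1 & 0 < lp r1].
 case: (ltrgtP 0 (lp r0)) p0 => // [h _|h _]; first by exists r0.
 have [|e e0 he] := drv_pos_near (dlp r00); first by apply: zero.
 have [_ h1] := he (r0 + e / 2).
 exists (r0 + e / 2); split; [lran|lran|rewrite h; apply: h1; apply/andP; split; lra].
have pp r : r1 <= r -> 0 < lp r.
 move=> hr; apply: (stay_pos hr (fun x h => dlp (lt_le_trans r10 (andP h).1)) p1) => t /andP[h1 h2].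
 exact: zero (lt_trans r10 h1).
have yl r : r1 <= r -> ly r1 <= ly r.
 move=> hr; apply: (incr_le hr (fun x h => dly (lt_le_trans r10 (andP h).1))) => t /andP[h1 h2].
 by apply: divr_ge0; [exact: ltW (pp _ (ltW h1))|exact: ltW (lt_trans r10 h1)].
have [n hn] : exists n : nat, - ly r1 <= n%:R.
 by exists (Num.bound `|ly r1|); apply: le_trans (ltW (archi_boundP (normr_ge0 _))); rewrite -normrN ler_norm.
pose F r := q r * r ^+ n.+1.
have dF r : is_derive r (1 : R) F (q1 r * r ^+ n.+1 + q r * (n.+1%:R * r ^+ n)).
 by have h := drvM (dq r) (drv_X n.+1 (drv_id r)); apply: (drv_eq h); rewrite mulr1.
have Fi r : r1 <= r -> F r1 <= F r.
 move=> hr; apply: (incr_le hr (fun x _ => dF x)) => t /andP[h1 h2].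
 have t0 : 0 < t := lt_trans r10 h1.
 have qn : q t != 0 by rewrite gt_eqF.
 have -> : q1 t * t ^+ n.+1 + q t * (n.+1%:R * t ^+ n) = t ^+ n * q t * (ly t + n.+1%:R).
  by rewrite /ly exprS; field.
 rewrite mulr_ge0// ?mulr_ge0 ?exprn_ge0 ?ltW//.
 by have := yl t (ltW h1); rewrite -natr1; lra.
have F1 : 0 < F r1 by rewrite mulr_gt0 ?exprn_gt0.
have [rho rho0 hrho] := qdec n.+1 F1.
pose s := Num.max r1 rho + 1.
have [k1 k2] : r1 <= s /\ rho < s.
 have : r1 <= Num.max r1 rho /\ rho <= Num.max r1 rho by rewrite !le_max !lexx orbT.
 by rewrite /s => -[]; lra.
have := hrho s k2; have := Fi s k1; rewrite /F; lra.
Qed.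

Lemma ly_decr r s : 0 < r < s -> ly s < ly r.
Proof.
move=> /andP[r0 rs]; apply: (decr_lt rs (fun x h => dly (lt_le_trans r0 (andP h).1))) => t /andP[h1 h2].
have t0 := lt_trans r0 h1.
by rewrite pmulr_llt0 ?invr_gt0// lp_neg.
Qed.

Lemma q_decr r s : 0 <= r < s -> q s < q r.
Proof.
move=> /andP[r0 rs]; apply: (decr_lt rs (fun x _ => dq x)) => t /andP[h1 h2].
exact: q1_neg (le_lt_trans r0 h1).
Qed.

(** * Radial solutions of the linearised equation *)

Section Kernel.
Variables v v1 v2 : R -> R.
Hypotheses (dv : forall r, is_derive r (1 : R) v (v1 r)) (dv1 : forall r, is_derive r (1 : R) v1 (v2 r)).
Hypothesis odev : forall r, r * v2 r + v1 r = r * ((1 - 3 * q r ^+ 2) * v r).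

Let dpsi (a r : R) : is_derive r (1 : R) (fun s => s * q1 s + a * q s) (r * (q r - q r ^+ 3) + a * q1 r).
Proof.
have h := drvD (drvM (drv_id r) (dq1 r)) (drvZ (dq r) a).
by apply: (drv_eq h); rewrite -ode; ring.
Qed.

Definition Wr (a r : R) : R := r * (v1 r * (r * q1 r + a * q r) - v r * (r * (q r - q r ^+ 3) + a * q1 r)).

(* Wronskian identity for the scaling family: [- Delta + 1 - 3 q^2] maps [r q' + a q] to [2 q ((1 - a) q^2 - 1)]. *)
Lemma dWr (a r : R) : is_derive r (1 : R) (Wr a) (r * v r * (2 * q r * ((1 - a) * q r ^+ 2 - 1))).
Proof.
have i := drv_id r.
have dc := drvB (dq r) (drv_X 3 (dq r)).
have h := drvM i (drvB (drvM (dv1 r) (dpsi a r)) (drvM (dv r) (drvD (drvM i dc) (drvZ (dq1 r) a)))).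
apply: (drv_eq h) => /=.
set A := v2 r; set B := q2 r; set x := q r; set x1 := q1 r; set y := v r; set y1 := v1 r.
have e1 : r * A = r * ((1 - 3 * x ^+ 2) * y) - y1 by rewrite /A /x /y /y1 -odev; ring.
have e2 : r * B = r * (x - x ^+ 3) - x1 by rewrite /B /x /x1 -ode; ring.
transitivity ((y1 * (r * x1 + a * x) - y * (r * (x - x ^+ 3) + a * x1)) +
  ((r * A) * (r * x1 + a * x) + r * y1 * (r * (x - x ^+ 3) + a * x1) - r * y1 * (r * (x - x ^+ 3) + a * x1)
  - y * (r * (x - x ^+ 3) + r * r * (x1 - 3 * x ^+ 2 * x1) + a * (r * B)))); first ring.
rewrite e1 e2; ring.
Qed.

Definition Wq r : R := r * (v1 r * q r - v r * q1 r).

Lemma dWq r : is_derive r (1 : R) Wq (- (2 * r * v r * q r ^+ 3)).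
Proof.
have h := drvM (drv_id r) (drvB (drvM (dv1 r) (dq r)) (drvM (dv r) (dq1 r))).
apply: (drv_eq h).
set A := v2 r; set B := q2 r; set x := q r; set x1 := q1 r; set y := v r; set y1 := v1 r.
have e1 : r * A = r * ((1 - 3 * x ^+ 2) * y) - y1 by rewrite /A /x /y /y1 -odev; ring.
have e2 : r * B = r * (x - x ^+ 3) - x1 by rewrite /B /x /x1 -ode; ring.
transitivity (y1 * x - y * x1 + ((r * A) * x - y * (r * B))); first ring.
rewrite e1 e2; ring.
Qed.

Hypotheses (Wq_lim : forall e : R, 0 < e -> exists2 rho : R, 0 < rho & forall r, rho < r -> `|Wq r| < e)
 (Wr_lim : forall a e : R, 0 < e -> exists2 rho : R, 0 < rho & forall r, rho < r -> `|Wr a r| < e).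

Lemma far (r1 rho : R) : exists s, [/\ r1 < s & rho < s].
Proof.
exists (Num.max r1 rho + 1).
have : r1 <= Num.max r1 rho /\ rho <= Num.max r1 rho by rewrite !le_max !lexx orbT.
by move=> [h1 h2]; split; lra.
Qed.

(** A Sturm argument with two Wronskians, both zero at 0 and at infinity: the one with q forces v to
    change sign, the one with r q' + a q, for a tuned to the first zero of v, forbids any later
    behaviour. *)
Lemma pos_contra : ~ (0 < v 0).
Proof.
move=> v00.
have cv x : {for x, continuous v} := drv_cont (dv x).
have Wq0 : Wq 0 = 0 by rewrite /Wq mul0r.
(* If v had no zero, [Wq] would decrease strictly from 0 and could not tend to 0. *)
have [z1 [z10 vz vpos]] : exists z, [/\ 0 < z, v z = 0 & forall t, 0 <= t < z -> 0 < v t].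
 apply: contrapT => no.
 have vp t : 0 <= t -> 0 < v t.
  move=> t0; rewrite ltNge; apply/negP => h.
  have [z [/andP[z0 _] e p]] := first_zero t0 (fun x _ => cv x) v00 h.
  by apply: no; exists z.
 have dec r s : 0 <= r < s -> Wq s < Wq r.
  move=> /andP[r0 rs]; apply: (decr_lt rs (fun x _ => dWq x)) => t /andP[h1 h2].
  have t0 := le_lt_trans r0 h1.
  by rewrite oppr_lt0 !mulr_gt0 ?exprn_gt0// vp// ltW.
 have W1 : Wq 1 < 0 by rewrite -Wq0; apply: dec; rewrite lexx ltr01.
 have [|rho rho0 hrho] := Wq_lim (_ : 0 < - Wq 1); first by lra.
 have [s [s1 s2]] := far 1 rho.
 have := hrho s s2; have := dec 1 s; rewrite ler01 s1 => /(_ isT).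
 by rewrite ltr_norml => h /andP[h1 h2]; lra.
have Wz : Wq z1 < 0.
 rewrite -Wq0; apply: (decr_lt z10 (fun x _ => dWq x)) => t /andP[h1 h2].
 by rewrite oppr_lt0 !mulr_gt0 ?exprn_gt0// vpos// (ltW h1).
have v1z : v1 z1 < 0.
 by move: Wz; rewrite /Wq vz mul0r subr0 pmulr_rlt0// pmulr_llt0.
(* With this a the function r q' + a q vanishes at z1 together with v, so [Wr a] vanishes there as
   well as at 0. *)
pose a := - ly z1.
have psiE r : 0 < r -> r * q1 r + a * q r = q r * (ly r - ly z1).
 move=> r0; rewrite /a /ly; have : q r != 0 by rewrite gt_eqF.
 by move=> n; rewrite mulrBr mulrCA divff// mulr1; ring.
have W0 : Wr a 0 = 0 by rewrite /Wr mul0r.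
have Wz1 : Wr a z1 = 0 by rewrite /Wr psiE// subrr vz !mulr0 mul0r subrr mulr0.
(* Otherwise (1 - a) q^2 - 1 is positive on ]0, z1[ because q decreases, and [Wr a] would increase
   strictly between two zeros. *)
have L1 : (1 - a) * q z1 ^+ 2 - 1 < 0.
 rewrite ltNge; apply/negP => h.
 have a1 : 0 < 1 - a.
  rewrite ltNge; apply/negP => h'.
  have : (1 - a) * q z1 ^+ 2 <= 0 by apply: mulr_le0_ge0 => //; exact: sqr_ge0.
  lran.
 have : Wr a 0 < Wr a z1.
  apply: (incr_lt z10 (fun x _ => dWr a x)) => t /andP[h1 h2].
  have : q z1 ^+ 2 < q t ^+ 2.
   by rewrite ltrXn2r// ?nnegrE ?ltW//; apply: q_decr; rewrite (ltW h1).
  rewrite -(ltr_pM2l a1) => h3.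
  have vt : 0 < v t by apply: vpos; rewrite (ltW h1).
  have : 0 < (1 - a) * q t ^+ 2 - 1 by lra.
  by move=> h4; rewrite !mulr_gt0.
 by rewrite W0 Wz1 ltxx.
have L2 r : z1 < r -> (1 - a) * q r ^+ 2 - 1 < 0.
 move=> hr; have h : q r ^+ 2 < q z1 ^+ 2.
  by rewrite ltrXn2r// ?nnegrE ?ltW//; apply: q_decr; rewrite (ltW z10).
 case: (leP 0 (1 - a)) => h'.
  by have := ler_wpM2l h' (ltW h); lra.
 have : (1 - a) * q r ^+ 2 <= 0 by apply: mulr_le0_ge0; [exact: ltW|exact: sqr_ge0].
 by lra.
have dnv s : is_derive s (1 : R) (fun t => - v t) (- v1 s) := drvN (dv s).
have [|e e0 he] := drv_pos_near (dnv z1); first by lra.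
have Winc r s : z1 <= r < s -> (forall t, r < t < s -> v t < 0) -> Wr a r < Wr a s.
 move=> /andP[hr rs] vn; apply: (incr_lt rs (fun x _ => dWr a x)) => t /andP[h1 h2].
 have t1 : z1 < t := le_lt_trans hr h1.
 have t0 : 0 < t := lt_trans z10 t1.
 have := vn t; rewrite h1 h2 => /(_ isT) vt.
 have -> : t * v t * (2 * q t * ((1 - a) * q t ^+ 2 - 1)) = t * (- v t) * (2 * q t * - ((1 - a) * q t ^+ 2 - 1)) by ring.
 by rewrite !mulr_gt0 ?oppr_gt0// L2.
have near t : z1 < t < z1 + e -> v t < 0.
 by move=> h; have [_ /(_ h)] := he t; rewrite vz oppr0; lra.
pose z' := z1 + e / 2.
have vz' : v z' < 0 by apply: near; rewrite /z'; apply/andP; split; lra.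
(* While v < 0, [Wr a] increases from its value 0 at z1. At a further zero z of v it would have the
   sign of v'(z) (ly z - ly z1), which is nonpositive. *)
have nonneg : forall r, z' <= r -> v r < 0.
 move=> r hr; rewrite ltNge; apply/negP => h.
 have [x _|||z [/andP[z1' _] ze zp]] := @first_zero (fun t => - v t) z' r hr.
 - exact: cvgN (cv x).
 - by rewrite oppr_gt0.
 - by rewrite oppr_le0.
 have vn t : z1 < t < z -> v t < 0.
  move=> /andP[h1 h2]; case: (ltP t z') => h3.
   by apply: near; rewrite h1 /=; move: h3; rewrite /z'; lra.
  by have := zp t; rewrite h3 h2 => /(_ isT); lra.
 have zz : z1 < z by move: z1'; rewrite /z'; lra.
 have z0 : 0 < z := lt_trans z10 zz.
 have vz0 : v z = 0 by lra.
 have W : Wr a z1 < Wr a z by apply: Winc => //; rewrite lexx.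
 have v1zp : 0 <= v1 z.
  rewrite leNgt; apply/negP => h'.
  have [|d d0 hd] := drv_pos_near (dnv z); first by lra.
  pose t := Num.max ((z1 + z) / 2) (z - d / 2).
  have tz : t < z by rewrite gt_max; apply/andP; split; lra.
  have t1 : (z1 + z) / 2 <= t by rewrite le_max lexx.
  have t2 : z - d / 2 <= t by rewrite le_max lexx orbT.
  have [h1 _] := hd t.
  have : z - d < t < z by rewrite tz andbT; lra.
  move=> /h1; rewrite ze; have : z1 < t < z by rewrite tz andbT; lra.
  by move=> /vn; lra.
 move: W; rewrite Wz1 /Wr vz0 mul0r subr0 psiE//.
 have : ly z - ly z1 < 0 by rewrite subr_lt0; apply: ly_decr; rewrite z10.
 move=> ln; rewrite ltNge; apply/negP/negPn.
 rewrite pmulr_rle0// mulr_ge0_le0// mulr_ge0_le0// ltW//.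
have vneg t : z1 < t -> v t < 0.
 move=> h1; case: (ltP t z') => h3; last exact: nonneg.
 by apply: near; rewrite h1 /=; move: h3; rewrite /z'; lra.
have Wp : 0 < Wr a z'.
 rewrite -Wz1; apply: Winc; first by rewrite lexx /z'; lra.
 by move=> t /andP[h _]; exact: vneg.
have [rho rho0 hrho] := Wr_lim a Wp.
have [s [s1 s2]] := far z' rho.
have : Wr a z' < Wr a s.
 apply: Winc; first by rewrite s1 andbT /z'; lra.
 by move=> t /andP[h _]; apply: vneg; apply: lt_trans h; rewrite /z'; lra.
by have := hrho s s2; rewrite ltr_norml => /andP[h1 h2]; lra.
Qed.

(* Gronwall: the singular term [- 2 v'^2 / r] has the favourable sign. *)
Lemma zero_data : v 0 = 0 -> forall r, 0 <= r -> v r = 0.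
Proof.
move=> v0 r r0.
have v10 : v1 0 = 0 by have := odev 0; rewrite !mul0r add0r.
pose M := 1 + (1 + 3 * q 0 ^+ 2).
pose f s := (v s ^+ 2 + v1 s ^+ 2) * expR (- (M * s)).
have df s : is_derive s (1 : R) f ((2 * v s ^+ 1 * v1 s + 2 * v1 s ^+ 1 * v2 s) * expR (- (M * s)) +
  (v s ^+ 2 + v1 s ^+ 2) * (expR (- (M * s)) * (- M))).
 have h := drvM (drvD (drv_X 2 (dv s)) (drv_X 2 (dv1 s))) (@drv_comp R expR (fun t => - (M * t)) s _ _ (is_derive_expR _) (drvN (drv_lin M s))).
 exact: (drv_eq h).
have f0 : f 0 = 0 by rewrite /f v0 v10 !expr0n /= addr0 mul0r.
have : f r <= f 0.
 apply: (decr_le r0 (fun x _ => df x)) => t /andP[t0 _].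
 rewrite !expr1.
 have -> : (2 * v t * v1 t + 2 * v1 t * v2 t) * expR (- (M * t)) + (v t ^+ 2 + v1 t ^+ 2) * (expR (- (M * t)) * - M)
  = expR (- (M * t)) * (2 * v t * v1 t + 2 * v1 t * v2 t - M * (v t ^+ 2 + v1 t ^+ 2)) by ring.
 apply: mulr_ge0_le0; first exact: expR_ge0.
 have tn : t != 0 by rewrite gt_eqF.
 have -> : v2 t = (1 - 3 * q t ^+ 2) * v t - v1 t / t.
  by apply: (mulfI tn); rewrite mulrBr -odev; field.
 have qq : q t ^+ 2 <= q 0 ^+ 2.
  by rewrite lerXn2r// ?nnegrE ?ltW//; apply: q_decr; rewrite lexx t0.
 have p1 : 0 <= v1 t ^+ 2 / t by rewrite divr_ge0 ?sqr_ge0 ?ltW.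
 have -> : 2 * v t * v1 t + 2 * v1 t * ((1 - 3 * q t ^+ 2) * v t - v1 t / t) - M * (v t ^+ 2 + v1 t ^+ 2)
  = (2 - 3 * q t ^+ 2) * (2 * (v t * v1 t)) - 2 * (v1 t ^+ 2 / t) - M * (v t ^+ 2 + v1 t ^+ 2) by field.
 have h1 : `|2 * (v t * v1 t)| <= v t ^+ 2 + v1 t ^+ 2.
  have := sqr_ge0 (v t - v1 t); have := sqr_ge0 (v t + v1 t).
  have -> : (v t + v1 t) ^+ 2 = v t ^+ 2 + v1 t ^+ 2 + 2 * (v t * v1 t) by ring.
  have -> : (v t - v1 t) ^+ 2 = v t ^+ 2 + v1 t ^+ 2 - 2 * (v t * v1 t) by ring.
  by rewrite ler_norml => h2 h3; apply/andP; split; lra.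
 have h2 : `|2 - 3 * q t ^+ 2| <= M.
  have := sqr_ge0 (q t); rewrite ler_norml /M => h3; apply/andP; split; lra.
 have h3 : (2 - 3 * q t ^+ 2) * (2 * (v t * v1 t)) <= M * (v t ^+ 2 + v1 t ^+ 2).
  by apply: le_trans (ler_norm _) _; rewrite normrM; apply: ler_pM.
 lran.
rewrite f0 /f pmulr_lle0 ?expR_gt0// => h.
have := sqr_ge0 (v r); have := sqr_ge0 (v1 r) => h1 h2.
have : v r ^+ 2 = 0 by lra.
by move/eqP; rewrite sqrf_eq0 => /eqP.
Qed.
End Kernel.

End Radial.
End OneD.

(** * The radius, exponential against polynomial weights, and integration by parts *)

Section Gen.
Variable R : realType.
Local Notation mu2 := (leb2 R).
Local Notation J := (@jap R).
Local Notation w2 := (@japw R).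
Local Notation phi := (@barrier R).
Implicit Types (f g h F G : R * R -> R) (x y z v xi : R * R).

Lemma dot2_ge0 x : 0 <= dot2 x x.
Proof. by rewrite addr_ge0// -expr2 sqr_ge0. Qed.
Lemma enorm2_ge0 x : 0 <= enorm2 x.
Proof. exact: sqrtr_ge0. Qed.
Lemma enorm2_sq x : enorm2 x ^+ 2 = x.1 ^+ 2 + x.2 ^+ 2.
Proof. by rewrite sqr_sqrtr ?dot2_ge0// /dot2 -!expr2. Qed.

Lemma enorm2_eq0 x : enorm2 x = 0 -> x = 0.
Proof.
move=> h; have := enorm2_sq x; rewrite h expr0n /= => /esym/eqP.
rewrite paddr_eq0 ?sqr_ge0// !sqrf_eq0 => /andP[/eqP h1 /eqP h2]; exact: pt_eq.
Qed.

Lemma enorm2_gt0 x : x != 0 -> 0 < enorm2 x.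
Proof.
move=> x0; rewrite lt_neqAle enorm2_ge0 andbT eq_sym.
by apply: contra x0 => /eqP/enorm2_eq0 ->.
Qed.

Lemma enorm2_axis (r : R) : enorm2 (r, 0) = `|r|.
Proof. by rewrite /enorm2 /dot2 /= mulr0 addr0 -expr2 sqrtr_sqr. Qed.
Lemma enorm2_axis2 (r : R) : enorm2 (0, r) = `|r|.
Proof. by rewrite /enorm2 /dot2 /= mulr0 add0r -expr2 sqrtr_sqr. Qed.
Lemma abs1_le x : `|x.1| <= enorm2 x.
Proof. by rewrite -sqrtr_sqr ler_wsqrtr// /dot2 -expr2 lerDl -expr2 sqr_ge0. Qed.
Lemma abs2_le x : `|x.2| <= enorm2 x.
Proof. by rewrite -sqrtr_sqr ler_wsqrtr// /dot2 -!expr2 lerDr sqr_ge0. Qed.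

Lemma enorm2_le_sum x : enorm2 x <= `|x.1| + `|x.2|.
Proof.
rewrite -(ler_pXn2r (_ : (0 < 2)%N)) ?nnegrE ?enorm2_ge0 ?addr_ge0//.
rewrite enorm2_sq sqrrD !real_normK ?num_real//.
by have := mulr_ge0 (normr_ge0 x.1) (normr_ge0 x.2); lra.
Qed.

Lemma J_enorm x : J x = 1 + enorm2 x ^+ 2.
Proof. by rewrite sqr_sqrtr ?dot2_ge0. Qed.

Lemma h2_enorm x : x != 0 -> h2 (@enorm2 R) x (x.1 / enorm2 x) (x.2 / enorm2 x)
 (x.2 ^+ 2 / enorm2 x ^+ 3) (x.1 ^+ 2 / enorm2 x ^+ 3).
Proof.
move=> x0; have r0 := enorm2_gt0 x0; have rn : enorm2 x != 0 by rewrite gt_eqF.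
have d0 : 0 < dot2 x x by rewrite -(sqr_sqrtr (dot2_ge0 x)) exprn_gt0.
have hd : h2 (fun x => dot2 x x) x (2 * x.1) (2 * x.2) 2 2.
 have h := h2D (h2M (h2_fst x) (h2_fst x)) (h2M (h2_snd x) (h2_snd x)).
 by apply: (h2_eq h) => /=; ring.
have n2 : 2 * Num.sqrt (dot2 x x) != 0 by rewrite mulf_neq0// pnatr_eq0.
have n0 : \forall t \near dot2 x x, 0 < t by apply: open_nbhs_nbhs; split; [exact: open_gt|exact: d0].
have h := @h2_comp R Num.sqrt (fun t => (2 * Num.sqrt t)^-1) _ (fun y => dot2 y y) x _ _ _ _ _
 (drvV (drvZ (is_derive1_sqrt d0) 2) n2) hd.
have E : x.2 ^+ 2 = enorm2 x ^+ 2 - x.1 ^+ 2 by rewrite enorm2_sq; ring.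
apply: (h2_eq (h _)); first by apply: filterS n0 => t t0; exact: is_derive1_sqrt.
- by rewrite -/(enorm2 x); field.
- by rewrite -/(enorm2 x); field.
- by rewrite -/(enorm2 x) E; field.
- have E' : x.1 ^+ 2 = enorm2 x ^+ 2 - x.2 ^+ 2 by rewrite enorm2_sq; ring.
 by rewrite -/(enorm2 x) E'; field.
Qed.

Lemma phi_J (k : nat) : exists2 C : R, 0 <= C & forall x, phi x <= C * J x ^- k.
Proof.
case: k => [|k].
 exists 1 => // x; rewrite expr0 invr1 mulr1 -expR0 ler_expR oppr_le0 divr_ge0 ?sqrtr_ge0//.
pose m := (2 * k.+1)%N; pose c : R := 2 * m%:R.
have c0 : 0 < c by rewrite mulr_gt0// ltr0n.
exists (c ^+ m); first by rewrite exprn_ge0 ?ltW.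
move=> x; have J0 := J_gt0 x; have s0 : 0 < Num.sqrt (J x) by rewrite sqrtr_gt0.
rewrite ler_pdivlMr ?exprn_gt0// -[J x](sqr_sqrtr (J_ge0 x)) -exprM -/m.
rewrite /barrier.
set s := Num.sqrt _ in s0 *.
have h : (s / c) ^+ m <= expR (s / 2).
 have -> : s / 2 = m%:R * (s / c) by rewrite /c; field; rewrite pnatr_eq0.
 rewrite expRM_natl lerXn2r ?nnegrE ?expR_ge0 ?(divr_ge0 (ltW s0) (ltW c0))//.
 by apply: le_trans (expR_ge1Dx _); lra.
have e1 : expR (- (s / 2)) * expR (s / 2) = 1 by rewrite -expRD addNr expR0.
have -> : s ^+ m = c ^+ m * (s / c) ^+ m by rewrite -exprMn mulrCA divff ?mulr1// gt_eqF.
rewrite mulrCA ler_piMr ?exprn_ge0 ?(ltW c0)//.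
apply: (@le_trans _ _ (expR (- (s / 2)) * expR (s / 2))); last by rewrite e1.
by apply: ler_wpM2l => //; exact: expR_ge0.
Qed.

(** Difference quotients of F have integral zero by translation invariance and converge to G. The
    domination by 64 M w2 comes from J(x) <= 8 J(x + c v) for 0 <= c <= 1. *)
Lemma II_dir F G v (M : R) : `|v.1| <= 1 -> `|v.2| <= 1 ->
 (forall x t, is_derive t (1 : R) (fun s : R => F (x + s *: v)) (G (x + t *: v))) ->
 meas G -> Int F -> bd 2 M G -> II G = 0.
Proof.
move=> v1 v2 dF mG iF bG.
have M0 := bd_ge0 bG.
have [e0 el] := seq_e R.
pose h (n : nat) : R := n.+1%:R^-1.
have h1 n : h n <= 1 by rewrite invf_le1// ler1n.
pose D n x := (h n)^-1 * (F (x + h n *: v) - F x).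
have iD n : Int (D n) by apply: IntZ; apply: IntB => //; exact: Int_add.
have zD n : II (D n) = 0.
 by rewrite IIZ ?IIB ?II_add ?subrr ?mulr0//; [exact: Int_add|apply: IntB => //; exact: Int_add].
have c : II (D n) @[n --> \oo] --> II G.
 apply: (@Rdct _ _ _ mu2 _ _ (fun x => 64 * M * w2 x)).
 - by move=> n; exact: Int_meas.
 - exact: mG.
 - exact: IntZ (@Int_w2 R).
 - move=> x; have [dx ex] := dF x 0; rewrite scale0r addr0 in ex.
  have cx : s^-1 *: (F (x + (s *: (1 : R) + 0) *: v) - F (x + 0 *: v)) @[s --> (0 : R)^'] --> G x.
   by rewrite -ex /derive; apply: cvg_trans dx; apply: near_eq_cvg; near=> s.
  have ch : h n @[n --> \oo] --> (0 : R)^'.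
   move=> A hA; have : \forall n \near \oo, h n != 0 -> A (h n) := el _ hA.
   by apply: filterS => n; apply; rewrite gt_eqF// e0.
  have := cvg_comp _ _ ch cx; apply: cvg_trans; apply: near_eq_cvg; near=> n.
  by rewrite /D /= scale0r !addr0 /GRing.scale /= mulr1.
 - move=> n x.
  have hn : 0 < h n := e0 n.
  have [c [cn E]] := mvt hn (fun t _ => dF x t).
  rewrite /D; have -> : F (x + h n *: v) - F x = G (x + c *: v) * h n.
   by rewrite -[X in _ - F X]addr0 -(scale0r v) E subr0.
  rewrite mulrC mulfK ?gt_eqF//.
  apply: le_trans (bG _) _; rewrite [64 * M]mulrC -mulrA; apply: ler_wpM2l => //.
  rewrite /japw -ler_pdivrMr ?Jk_gt0// invrK mulrC ler_pdivrMr ?exprn_gt0 ?J_gt0//.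
  have -> : 64 = 8 ^+ 2 :> R by ring.
  rewrite -exprMn lerXn2r ?nnegrE ?J_ge0 ?mulr_ge0 ?J_ge0//.
  have := J_sum (x + c *: v) (- (c *: v)); rewrite addrK J_opp => /le_trans; apply.
  have [c0 c1] := andP cn.
  have cc : c ^+ 2 <= 1 by rewrite expr_le1 ?ltW//; exact: lt_le_trans (h1 n).
  have hv (t : R) : `|t| <= 1 -> (c * t) * (c * t) <= 1.
   move=> t1; have -> : c * t * (c * t) = c ^+ 2 * t ^+ 2 by ring.
   rewrite mulr_ile1 ?sqr_ge0//.
   by rewrite -(real_normK (num_real t)) expr_le1.
  have := hv _ v1; have := hv _ v2; have := J_ge1 (x + c *: v).
  rewrite {3}/jap /dot2 !pE; lra.
have c0 : II (D n) @[n --> \oo] --> (0 : R) by under eq_fun do rewrite zD; exact: cvg_cst.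
exact: (cvg_unique _ c c0).
Unshelve. all: by end_near. Qed.

Lemma hg_cosdot xi x : hg (fun z => cos (dot2 xi z)) x (- sin (dot2 xi x) * xi.1) (- sin (dot2 xi x) * xi.2).
Proof. exact: (@hg_comp R cos (fun z => dot2 xi z) x _ _ _ (is_derive_cos _) (hg_lin xi.1 xi.2 x)). Qed.
Lemma hg_sindot xi x : hg (fun z => sin (dot2 xi z)) x (cos (dot2 xi x) * xi.1) (cos (dot2 xi x) * xi.2).
Proof. exact: (@hg_comp R sin (fun z => dot2 xi z) x _ _ _ (is_derive_sin _) (hg_lin xi.1 xi.2 x)). Qed.

Lemma bdD k (M N : R) f g : bd k M f -> bd k N g -> bd k (M + N) (fun x => f x + g x).
Proof.
by move=> bf bg x; apply: normD_le; rewrite mulrDl lerD ?bf ?bg.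
Qed.

Lemma bdB k (M N : R) f g : bd k M f -> bd k N g -> bd k (M + N) (fun x => f x - g x).
Proof.
by move=> bf bg x; apply: normB_le; rewrite mulrDl lerD ?bf ?bg.
Qed.

Lemma bdM k (M K : R) f p : bd k M f -> (forall x, `|p x| <= K) -> bd k (K * M) (fun x => p x * f x).
Proof. by move=> bf pK x; rewrite normrM -mulrA; apply: ler_pM. Qed.
Lemma abssin (t : R) : `|sin t| <= 1.
Proof. by rewrite ler_norml sin_geN1 sin_le1. Qed.

Lemma FT_dd f f1 f11 xi v (M : R) : v = dir1 R \/ v = dir2 R ->
 (forall x t, is_derive t (1 : R) (fun s : R => f (x + s *: v)) (f1 (x + t *: v))) ->
 (forall x t, is_derive t (1 : R) (fun s : R => f1 (x + s *: v)) (f11 (x + t *: v))) ->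
 meas f -> meas f1 -> meas f11 -> bd 2 M f -> bd 2 M f1 -> bd 2 M f11 ->
 Tr 0 f11 xi = - (dot2 xi v ^+ 2 * Tr 0 f xi).
Proof.
move=> hv df df1 mf mf1 mf11 bf bf1 bf11.
set k := dot2 xi v.
have cm : meas (fun x => cos (dot2 xi x)) by exact: meas_cosdot.
have sm : meas (fun x => sin (dot2 xi x)).
 by apply: measC => x; exact: hg_cont (hg_sindot xi x).
(* Two integrations by parts in one: the derivative of F along v is cos (xi . x) (f11 + k^2 f), the
   terms with f1 cancelling. *)
pose F x := cos (dot2 xi x) * f1 x + k * sin (dot2 xi x) * f x.
pose G x := cos (dot2 xi x) * (f11 x + k ^+ 2 * f x).
have L p x (t a b : R) : hg p (x + t *: v) a b -> is_derive t (1 : R) (fun s : R => p (x + s *: v)) (a * v.1 + b * v.2).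
 exact: hg_line.
have dF x t : is_derive t (1 : R) (fun s : R => F (x + s *: v)) (G (x + t *: v)).
 have hc := L _ _ _ _ _ (hg_cosdot xi (x + t *: v)).
 have hs := L _ _ _ _ _ (hg_sindot xi (x + t *: v)).
 have h := drvD (drvM hc (df1 x t)) (drvM (drvZ hs k) (df x t)).
 by apply: (drv_eq h); rewrite /G /k /dot2; ring.
have bG : bd 2 (1 * (M + k ^+ 2 * M)) G.
 by apply: bdM; [apply: bdD => //; apply: bdM => // x; rewrite ger0_norm ?sqr_ge0|move=> x; exact: abscos].
have bF : bd 2 (1 * M + `|k| * M) F.
 apply: bdD; first by apply: bdM => // x; exact: abscos.
 by apply: bdM => // x; rewrite normrM ler_piMr// abssin.
have mF : meas F.
 by apply: measD; apply: measM => //; apply: measM => //; exact: meas_cst.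
have mG : meas G by apply: measM => //; apply: measD => //; apply: measM => //; exact: meas_cst.
have v1 : `|v.1| <= 1 /\ `|v.2| <= 1 by case: hv => -> /=; rewrite normr1 normr0.
have z := II_dir v1.1 v1.2 dF mG (bd_Int mF bF) bG.
have if11 := bd_Int mf11 bf11; have iff := bd_Int mf bf.
apply/eqP; rewrite -subr_eq0 opprK -(TrZ 0 (k ^+ 2) xi iff) -TrD//; last exact: IntZ.
by apply/eqP; transitivity (II G) => //; apply: II_ext => x; rewrite addr0 /G; ring.
Qed.

Lemma FT_J f f1 f2 f11 f22 xi (M : R) : (forall x, hg f x (f1 x) (f2 x)) ->
 (forall x, exists a, hg f1 x (f11 x) a) -> (forall x, exists a, hg f2 x a (f22 x)) ->
 meas f11 -> meas f22 -> bd 2 M f -> bd 2 M f1 -> bd 2 M f2 -> bd 2 M f11 -> bd 2 M f22 ->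
 J xi * Tr 0 f xi = Tr 0 (fun x => f x - (f11 x + f22 x)) xi.
Proof.
move=> h h1 h2' m11 m22 b b1 b2 b11 b22.
have mf : meas f by apply: measC => x; exact: hg_cont (h x).
have mf1 : meas f1 by apply: measC => x; have [a ha] := h1 x; exact: hg_cont ha.
have mf2 : meas f2 by apply: measC => x; have [a ha] := h2' x; exact: hg_cont ha.
have L1 p x (t a b' : R) : hg p (x + t *: dir1 R) a b' -> is_derive t (1 : R) (fun s : R => p (x + s *: dir1 R)) a.
 by move=> /hg_line/= hh; apply: (drv_eq hh); rewrite mulr1 mulr0 addr0.
have L2 p x (t a b' : R) : hg p (x + t *: dir2 R) a b' -> is_derive t (1 : R) (fun s : R => p (x + s *: dir2 R)) b'.
 by move=> /hg_line/= hh; apply: (drv_eq hh); rewrite mulr1 mulr0 add0r.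
have e1 := @FT_dd f f1 f11 xi (dir1 R) M (or_introl erefl) (fun x t => L1 _ _ _ _ _ (h _)) _ mf mf1 m11 b b1 b11.
have e2 := @FT_dd f f2 f22 xi (dir2 R) M (or_intror erefl) (fun x t => L2 _ _ _ _ _ (h _)) _ mf mf2 m22 b b2 b22.
have i := bd_Int mf b; have i1 := bd_Int m11 b11; have i2 := bd_Int m22 b22.
rewrite (TrB 0 xi i (IntD i1 i2)) (TrD 0 xi i1 i2).
have -> : Tr 0 f11 xi = - (dot2 xi (dir1 R) ^+ 2 * Tr 0 f xi).
 by apply: e1 => x t; have [a ha] := h1 (x + t *: dir1 R); exact: L1 ha.
have -> : Tr 0 f22 xi = - (dot2 xi (dir2 R) ^+ 2 * Tr 0 f xi).
 by apply: e2 => x t; have [a ha] := h2' (x + t *: dir2 R); exact: L2 ha.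
by rewrite /jap /dot2 /=; ring.
Qed.

End Gen.

(** * The ground state: radial equation, limit and decay *)

Section Ground.
Variable R : realType.
Local Notation mu2 := (leb2 R).
Local Notation T2 := (measurableTypeR R * measurableTypeR R)%type.
Local Notation J := (@jap R).
Local Notation phi := (@barrier R).
Implicit Types (x y z v xi : R * R).
Variables (Q : R * R -> R) (hQ : positive_radial_solution Q).

(** The profile is read on the whole first axis, so r = 0 is an ordinary point; the ODE is kept
    multiplied by r for the same reason. *)
Definition qr (r : R) : R := Q (r, 0).
Definition qr1 (r : R) : R := pd1 Q (r, 0).
Definition qr2 (r : R) : R := pdm (2%N, 0%N) Q (r, 0).
Lemma Qpos x : 0 < Q x. Proof. by case: hQ. Qed.
Lemma Qrad x : Q x = qr (enorm2 x).
Proof. by case: hQ => _ h _ _ _; apply: h; rewrite enorm2_axis ger0_norm ?enorm2_ge0. Qed.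
Lemma Qeq x : pdm (2%N, 0%N) Q x + pdm (0%N, 2%N) Q x = Q x - Q x ^+ 3.
Proof. by case: hQ => _ _ _ _ h; exact: h. Qed.
Lemma Qhg x : hg Q x (pd1 Q x) (pd2 Q x).
Proof. by case: hQ => _ _ _ [h _] _; apply: diff_hg; exact: (h (0, 0)%N). Qed.
Lemma Qhg1 x : hg (pd1 Q) x (pdm (2%N, 0%N) Q x) (pd2 (pd1 Q) x).
Proof. by case: hQ => _ _ _ [h _] _; apply: diff_hg; exact: (h (1, 0)%N). Qed.
Lemma Qhg2 x : hg (pd2 Q) x (pd1 (pd2 Q) x) (pdm (0%N, 2%N) Q x).
Proof. by case: hQ => _ _ _ [h _] _; apply: diff_hg; exact: (h (0, 1)%N). Qed.
Lemma Qc11 : continuous (pdm (2%N, 0%N) Q).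
Proof. by case: hQ => _ _ _ [_ h] _; apply: h. Qed.
Lemma Qc22 : continuous (pdm (0%N, 2%N) Q).
Proof. by case: hQ => _ _ _ [_ h] _; apply: h. Qed.

Lemma Qh2 x : h2 Q x (pd1 Q x) (pd2 Q x) (pdm (2%N, 0%N) Q x) (pdm (0%N, 2%N) Q x).
Proof.
exists (pd1 Q), (pd2 Q), (pd2 (pd1 Q) x), (pd1 (pd2 Q) x); split => //.
- by apply: near2W => z; exact: Qhg.
- exact: Qhg1.
- exact: Qhg2.
Qed.

Lemma axis1 (t : R) : 0 + t *: dir1 R = (t, 0).
Proof. by apply: pt_eq => /=; rewrite !scaleRE; ring. Qed.
Lemma axis2 (t : R) : 0 + t *: dir2 R = (0, t).
Proof. by apply: pt_eq => /=; rewrite !scaleRE; ring. Qed.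

Lemma line1 (p : R * R -> R) (t a b : R) : hg p (t, 0) a b -> is_derive t (1 : R) (fun s => p (s, 0)) a.
Proof.
rewrite -axis1 => /hg_line /= h.
rewrite (_ : (fun s => p (s, 0)) = (fun s : R => p (0 + s *: dir1 R))); last by apply/funext => s; rewrite axis1.
by apply: (drv_eq h); rewrite mulr1 mulr0 addr0.
Qed.

Lemma line2 (p : R * R -> R) (t a b : R) : hg p (0, t) a b -> is_derive t (1 : R) (fun s => p (0, s)) b.
Proof.
rewrite -axis2 => /hg_line /= h.
rewrite (_ : (fun s => p (0, s)) = (fun s : R => p (0 + s *: dir2 R))); last by apply/funext => s; rewrite axis2.
by apply: (drv_eq h); rewrite mulr1 mulr0 add0r.
Qed.

Lemma dqr r : is_derive r (1 : R) qr (qr1 r).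
Proof. exact: line1 (Qhg (r, 0)). Qed.
Lemma dqr1 r : is_derive r (1 : R) qr1 (qr2 r).
Proof. exact: line1 (Qhg1 (r, 0)). Qed.

Lemma Qh2r x : x != 0 -> h2 Q x (qr1 (enorm2 x) * (x.1 / enorm2 x)) (qr1 (enorm2 x) * (x.2 / enorm2 x))
 (qr2 (enorm2 x) * (x.1 / enorm2 x) ^+ 2 + qr1 (enorm2 x) * (x.2 ^+ 2 / enorm2 x ^+ 3))
 (qr2 (enorm2 x) * (x.2 / enorm2 x) ^+ 2 + qr1 (enorm2 x) * (x.1 ^+ 2 / enorm2 x ^+ 3)).
Proof.
move=> x0; apply: (h2_ext (f := fun z => qr (enorm2 z))) => [z|]; first by rewrite -Qrad.
apply: h2_comp (h2_enorm x0); [by apply: near1W => s; exact: dqr|exact: dqr1].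
Qed.

Lemma Qpd1 x : x != 0 -> pd1 Q x = qr1 (enorm2 x) * (x.1 / enorm2 x).
Proof. by move=> /Qh2r /h2_hg /hg_pd1. Qed.
Lemma Qpd2 x : x != 0 -> pd2 Q x = qr1 (enorm2 x) * (x.2 / enorm2 x).
Proof. by move=> /Qh2r /h2_hg /hg_pd2. Qed.

Lemma Qtan x : x.1 * pd2 Q x = x.2 * pd1 Q x.
Proof.
have [->|x0] := eqVneq x 0; first by rewrite /= !mul0r.
by rewrite Qpd1// Qpd2//; ring.
Qed.

Lemma Qtan1 x : pd2 Q x + x.1 * pd1 (pd2 Q) x = x.2 * pdm (2%N, 0%N) Q x /\
 x.1 * pdm (0%N, 2%N) Q x = pd1 Q x + x.2 * pd2 (pd1 Q) x.
Proof.
have al (a b c d t s : R) : 0 = 1 * a + t * b - (0 * c + s * d) -> a + t * b = s * d by move=> e; lra.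
have bl (a b c d t s : R) : 0 = 0 * a + t * b - (1 * c + s * d) -> t * b = c + s * d by move=> e; lra.
have h := hgB (hgM (hg_fst x) (Qhg2 x)) (hgM (hg_snd x) (Qhg1 x)).
have h0 : hg (fun z => z.1 * pd2 Q z - z.2 * pd1 Q z) x 0 0.
 by apply: hg_ext (hg_cst 0 x) => z; rewrite Qtan subrr.
have := hg_pd1 h; rewrite (hg_pd1 h0) => e1; have := hg_pd2 h; rewrite (hg_pd2 h0) => e2.
by split; [exact: al e1|exact: bl e2].
Qed.

Lemma drv_uniq (f : R -> R) (t a b : R) : is_derive t (1 : R) f a -> is_derive t (1 : R) f b -> a = b.
Proof. by move=> [_ <-] [_ <-]. Qed.

(** Differentiating the rotation identity x.1 d2 Q = x.2 d1 Q at (r, 0) gives r d22 Q = d1 Q, which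
    turns the Laplacian into the radial operator. *)
Lemma qr_ode r : r * qr2 r + qr1 r = r * (qr r - qr r ^+ 3).
Proof.
have [_] := Qtan1 (r, 0); rewrite /= mul0r addr0 => e.
have al (t a b c s : R) : t * b = c -> a + b = s -> t * a + c = t * s by move=> <- <-; ring.
exact: al e (Qeq (r, 0)).
Qed.

Lemma qr20 : 2 * qr2 0 = qr 0 - qr 0 ^+ 3.
Proof.
have E : (fun s : R => pd2 Q (0, s)) = qr1.
 apply/funext => s.
 have h1 := line2 (Qhg (0, s)).
 have e : (fun s => Q (0, s)) = qr.
  apply/funext => t; case: hQ => _ h _ _ _; apply: h; by rewrite enorm2_axis enorm2_axis2.
 rewrite e in h1; exact: drv_uniq h1 (dqr s).
have h := line2 (Qhg2 (0, 0)); rewrite E in h.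
have e := drv_uniq h (dqr1 0).
have al (a b c : R) : b = a -> a + b = c -> 2 * a = c by move=> -> <-; ring.
exact: al e (Qeq (0, 0)).
Qed.

Lemma qr_pos r : 0 < qr r. Proof. exact: Qpos. Qed.
Definition Lq : R := 2 * (En qr qr1 0 + 1) + 1.

Lemma qr1_bd r : 0 <= r -> `|qr1 r| <= Lq.
Proof.
move=> r0; have h := q1_bd dqr dqr1 qr_ode r0.
have : `|qr1 r| <= qr1 r ^+ 2 + 1.
 rewrite -real_normK ?num_real//; have := sqr_ge0 (`|qr1 r| - 2^-1).
 have -> : (`|qr1 r| - 2^-1) ^+ 2 = `|qr1 r| ^+ 2 - `|qr1 r| + 4^-1 by field.
 lran.
rewrite /Lq; lra.
Qed.

Lemma Lq_ge0 : 0 <= Lq. Proof. exact: le_trans (qr1_bd (lexx 0)). Qed.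

Lemma qr_lip a b : 0 <= a <= b -> qr a - qr b <= Lq * (b - a).
Proof.
move=> /andP[a0 ab].
have := @incr_le R (fun r => qr r + Lq * r) (fun r => qr1 r + Lq) a b ab.
move=> /(_ (fun (t : R) _ => drvD (dqr t) (drv_lin Lq t))) h.
have : qr a + Lq * a <= qr b + Lq * b.
 apply: h => x /andP[ax _]; have := qr1_bd (le_trans a0 (ltW ax)); rewrite ler_norml => /andP[h _]; lra.
by rewrite mulrBr; lra.
Qed.

Lemma qr_lip2 a b : 0 <= a <= b -> qr b - qr a <= Lq * (b - a).
Proof.
move=> /andP[a0 ab].
have := @decr_le R (fun r => qr r - Lq * r) (fun r => qr1 r - Lq) a b ab.
move=> /(_ (fun (t : R) _ => drvB (dqr t) (drv_lin Lq t))) h.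
have : qr b - Lq * b <= qr a - Lq * a.
 apply: h => x /andP[ax _]; have := qr1_bd (le_trans a0 (ltW ax)); rewrite ler_norml => /andP[_ h]; lra.
by rewrite mulrBr; lra.
Qed.

Lemma Qcont : continuous Q.
Proof. by move=> x; exact: hg_cont (Qhg x). Qed.

Lemma Qsq_Int : Int (fun x => Q x ^+ 2).
Proof.
case: hQ => _ _ hs _ _.
have [y [g hg'] _] := ereal_inf_lt hs.
have [[_ lt] _ _] := hg'.
move=> _; apply: Int_lty; [by apply: measM; exact: measC Qcont|by move=> x; exact: sqr_ge0|].
apply: le_lt_trans lt; apply: ge0_le_integral => //.
- by move=> x _; rewrite lee_fin sqr_ge0.
- by apply/measurable_EFinP; apply: measM; exact: measC Qcont.
- apply/measurable_EFinP; rewrite (_ : (fun x => _) = (fun x : T2 => Q x ^+ 2)).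
  by apply: measM; exact: measC Qcont.
 by apply/funext => x; rewrite /toC normc_toC real_normK ?num_real.
- by move=> x _; rewrite lee_fin /toC normc_toC real_normK ?num_real.
Qed.

(** The energy bounds q', so q is Lipschitz. A value q r >= e far out would keep Q above e / 2 on a
    square of fixed size around (r, 0), against the smallness of the L^2 tail. *)
Lemma qr_lim (e : R) : 0 < e -> exists2 rho : R, 0 < rho & forall r, rho < r -> qr r < e.
Proof.
move=> e0.
(* Half the side of that square: points of it differ from r in radius by at most 2 d, over which q
   varies by at most e / 2. *)
pose d := e / (4 * (Lq + 1)).
have L1 : 0 < 4 * (Lq + 1) by have := Lq_ge0; lra.
have d0 : 0 < d by rewrite divr_gt0.
have de : Lq * (2 * d) <= e / 2.
 have : 4 * (Lq + 1) * d = e by rewrite /d mulrC divfK// gt_eqF.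
 by lra.
have c0 : 0 < (e / 2) ^+ 2 * (2 * d * (2 * d)) by apply: mulr_gt0; [rewrite exprn_gt0// divr_gt0|do 2 apply: mulr_gt0 => //; exact: mulr_gt0].
have := II_chi Qsq_Int => /cvgrPdist_lt /(_ _ c0) [N _ hN].
exists (N%:R + 2 * d); first by have := ler0n R N; lra.
move=> r hr; rewrite ltNge; apply/negP => he.
have r0 : 0 <= r - d by have := ler0n R N; lra.
pose K : set T2 := [set` `[r - d, r + d]] `*` [set` `[- d, d]].
have mK : measurable K by apply: measurableX; exact: measurable_itv.
have muK : mu2 K = (2 * d * (2 * d))%:E.
 rewrite leb2E; try exact: measurable_itv.
 rewrite !lebesgue_measure_itv /= !lte_fin.
 have -> : r - d < r + d by lra.
 have -> : - d < d by lra.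
 by rewrite -!EFinB -EFinM; congr (_%:E); ring.
have iK : Int (\1_K).
 apply: (@Int_lty _ (\1_K)); [exact: measurable_indic|by move=> x; rewrite /= indicE ler0n|].
 by rewrite integral_indic// setIT muK ltry.
have IK : II (\1_K) = 2 * d * (2 * d).
 have := IIE iK; rewrite integral_indic// setIT muK => -[<-]//.
have : (e / 2) ^+ 2 * (2 * d * (2 * d)) <= II (fun x => Q x ^+ 2 * (1 - chi N%:R x)).
 rewrite -IK -IIZ//; apply: II_le.
 - exact: IntZ.
 - apply: Int_le Qsq_Int; first apply: measM.
   exact: Int_meas Qsq_Int.
   by apply: measB; [exact: meas_cst|exact: chi_meas].
  move=> x; rewrite normrM (ger0_norm (sqr_ge0 _)) ler_piMr ?sqr_ge0//.
  by have /andP[h1 h2] := chi01 N%:R x; rewrite ger0_norm; lra.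
 - move=> x; have /andP[h1 h2] := chi01 N%:R x.
  rewrite indicE; case: (boolP (x \in K)) => [/set_mem|_]; last first.
   by rewrite mulr0 mulr_ge0 ?sqr_ge0//; lra.
  rewrite /K /= !in_itv /= => -[/andP[k1 k2] /andP[k3 k4]]; rewrite mulr1.
  have x1 : r - d <= enorm2 x.
   by apply: le_trans k1 _; apply: le_trans (ler_norm _) (abs1_le x).
  have x2 : enorm2 x <= r + 2 * d.
   apply: le_trans (enorm2_le_sum x) _; rewrite ger0_norm; last lra.
   have : `|x.2| <= d by rewrite ler_norml k3.
   by lra.
  have xN : N%:R < enorm2 x by lra.
  rewrite /chi (leNgt (enorm2 x)) xN /= subr0 mulr1; rewrite lerXn2r ?nnegrE ?(ltW (Qpos _)) ?(divr_ge0 (ltW e0))//.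
  rewrite Qrad.
  have qd : qr r - qr (enorm2 x) <= Lq * (2 * d).
   have Ld : 0 <= Lq * d by rewrite mulr_ge0 ?Lq_ge0// ltW.
   case: (leP r (enorm2 x)) => h.
    have := @qr_lip r (enorm2 x); rewrite h andbT => /(_ _)/le_trans; apply; first by lra.
    by apply: ler_wpM2l; [exact: Lq_ge0|lran].
   have := @qr_lip2 (enorm2 x) r; rewrite enorm2_ge0 ltW// => /(_ isT)/le_trans; apply.
   by apply: ler_wpM2l; [exact: Lq_ge0|lran].
  lran.
have := hN N (leqnn N); rewrite /= sub0r normrN => /(le_lt_trans (ler_norm _)).
by move=> h1 h2; have := lt_le_trans h1 h2; rewrite ltxx.
Qed.

Lemma qr1_neg r : 0 < r -> qr1 r < 0.
Proof. exact: q1_neg dqr dqr1 qr_ode qr_pos qr20 qr_lim r. Qed.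
Lemma qr_decr r s : 0 <= r < s -> qr s < qr r.
Proof. exact: q_decr dqr dqr1 qr_ode qr_pos qr20 qr_lim r s. Qed.
Lemma qr_le0 r : 0 <= r -> qr r <= qr 0.
Proof. by rewrite le_eqVlt => /orP[/eqP <- //|h]; apply/ltW/qr_decr; rewrite lexx. Qed.

Lemma Q_decay : exists2 C : R, 0 <= C & forall x, Q x <= C * phi x.
Proof.
have i2 : 0 < 2^-1 :> R by rewrite invr_gt0.
have [rho rho0 hr] := qr_lim i2.
pose C := 4 * 0 + qr 0 / expR (- (Num.sqrt (1 + rho ^+ 2) / 2)).
exists C; first by rewrite /C mulr0 add0r divr_ge0 ?expR_ge0 ?ltW ?qr_pos.
apply: decay_le => //; [exact: ltW|exact: Qcont| |].
 by move=> x; rewrite gtr0_norm ?Qpos// Qrad; apply: qr_le0; exact: enorm2_ge0.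
move=> x hx _; do 4 eexists; split; first exact: Qh2.
rewrite mul0r subr0 Qeq; have := hr _ hx; rewrite -Qrad => h.
have := Qpos x => p.
have : Q x ^+ 2 <= 2^-1.
 by rewrite expr2; apply: le_trans (_ : 2^-1 * 1 <= _); [apply: ler_pM; lra|rewrite mulr1].
rewrite -(ler_pM2l p) => h3; have -> : Q x ^+ 3 = Q x * Q x ^+ 2 by ring.
lran.
Qed.

Lemma phi_axis (r s : R) : 0 <= s -> s <= r -> phi (r, 0) <= phi (s, 0).
Proof.
move=> s0 sr; rewrite ler_expR lerN2 ler_pM2r ?invr_gt0// ler_wsqrtr// /jap /dot2 /= !mulr0 !addr0 lerD2l.
by rewrite -!expr2 lerXn2r ?nnegrE// (le_trans s0).
Qed.

Lemma phi_rad x : phi x = phi (enorm2 x, 0).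
Proof. by rewrite /barrier !J_enorm enorm2_axis ger0_norm ?enorm2_ge0. Qed.

Lemma phi_shift (r : R) : 1 <= r -> phi (r - 1, 0) <= expR 2^-1 * phi (r, 0).
Proof.
move=> r1; rewrite -expRD ler_expR.
have J1 (t : R) : J (t, 0) = 1 + t ^+ 2 by rewrite /jap /dot2 /= mulr0 addr0 expr2.
rewrite !J1; set s := Num.sqrt (1 + (r - 1) ^+ 2); set s' := Num.sqrt _.
suff : s' <= s + 1 by lra.
have ss : s ^+ 2 = 1 + (r - 1) ^+ 2 by rewrite sqr_sqrtr// addr_ge0 ?sqr_ge0.
have s0 : 0 <= s by exact: sqrtr_ge0.
have sr : r - 1 <= s.
 rewrite -(ler_pXn2r (_ : (0 < 2)%N)) ?nnegrE ?subr_ge0// ss; lra.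
rewrite -(ler_pXn2r (_ : (0 < 2)%N)) ?nnegrE ?sqrtr_ge0 ?addr_ge0// sqr_sqrtr; last by rewrite addr_ge0 ?sqr_ge0.
have -> : (s + 1) ^+ 2 = s ^+ 2 + 2 * s + 1 by ring.
have -> : r ^+ 2 = (r - 1) ^+ 2 + 2 * (r - 1) + 1 by ring.
by rewrite ss; lra.
Qed.

Lemma qr_dec n (c : R) : 0 < c -> exists2 rho : R, 0 < rho & forall r, rho < r -> qr r * r ^+ n < c.
Proof.
move=> c0; have [C C0 hC] := Q_decay; have [D D0 hD] := phi_J R n.+1.
exists ((C * D + 1) / c + 1); first by rewrite addr_gt0// divr_gt0// ltr_wpDl// mulr_ge0.
move=> r hr.
have CD : 0 <= C * D by exact: mulr_ge0.
have r1 : 1 < r by apply: lt_trans hr; rewrite ltrDr divr_gt0//; lra.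
have r0 : 0 < r by lra.
have : qr r <= C * D * (r ^+ n.+1)^-1.
 apply: le_trans (hC _) _; rewrite -mulrA; apply: ler_wpM2l => //.
 apply: le_trans (hD _) _; apply: ler_wpM2l => //.
 rewrite lef_pV2 ?posrE ?exprn_gt0 ?J_gt0// lerXn2r ?nnegrE ?J_ge0 ?(ltW r0)//.
 rewrite /jap /dot2 /= mulr0 addr0; apply: le_trans (_ : r * r <= _); last by rewrite lerDr.
 by rewrite ler_peMr// ltW.
move=> h; apply: (@le_lt_trans _ _ (C * D / r)).
 apply: le_trans (_ : C * D * (r ^+ n.+1)^-1 * r ^+ n <= _); first by rewrite ler_pM2r ?exprn_gt0.
 by rewrite exprS invfM -!mulrA mulVf ?mulr1// expf_neq0// gt_eqF.
have : (C * D + 1) / c < r by lra.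
by rewrite !ltr_pdivrMr// [r * c]mulrC; lra.
Qed.

(** Where q < 1 the profile is convex, because q' < 0, so |q'(r)| <= q(r - 1) - q(r) <= q(r - 1). A
    unit shift costs a factor exp (1/2) on the barrier. *)
Lemma qr1_decay : exists2 C : R, 0 <= C & forall r, 0 <= r -> `|qr1 r| <= C * phi (r, 0).
Proof.
have [rho rho0 hr] := qr_lim (@ltr01 R).
have [C C0 hC] := Q_decay.
have e0 : 0 < phi (rho + 1, 0) by exact: phi_gt0.
exists (C * expR 2^-1 + Lq / phi (rho + 1, 0)).
 by apply: addr_ge0; [apply: mulr_ge0 => //; exact: expR_ge0|apply: divr_ge0; [exact: Lq_ge0|exact: ltW]].
move=> r r0.
have p0 := phi_gt0 (r, 0 : R).
case: (leP r (rho + 1)) => h.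
 apply: (@le_trans _ _ (Lq / phi (rho + 1, 0) * phi (r, 0))); last first.
  by rewrite ler_pM2r// lerDr mulr_ge0 ?expR_ge0.
 apply: le_trans (qr1_bd r0) _.
 rewrite -mulrA ler_peMr ?Lq_ge0// mulrC ler_pdivlMr// mul1r.
 exact: phi_axis.
have rr : r - 1 < r by rewrite gtrBl.
have [c [/andP[c1 c2] e]] := mvt rr (fun (t : R) _ => dqr t).
have q1c : qr1 c <= qr1 r.
 apply: (incr_le (ltW c2) (fun (t : R) _ => dqr1 t)) => x /andP[x1 x2].
 have x0 : 0 < x by lra.
 have := qr_ode x; have := qr1_neg x0 => h1 h3.
 have : 0 < x * (qr x - qr x ^+ 3).
  rewrite mulr_gt0//; have q1 := hr x; have : rho < x by lra.
  move=> /q1 q1x; have qp := qr_pos x.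
  have -> : qr x - qr x ^+ 3 = qr x * (1 - qr x * qr x) by ring.
  rewrite mulr_gt0// subr_gt0 mulr_ilt1// ltW//.
 by move=> h4; rewrite -(pmulr_rge0 _ x0); lra.
have r1 := qr1_neg (_ : 0 < r).
rewrite ltr0_norm; last by apply: r1; lra.
have -> : - qr1 r = - qr1 r by [].
apply: (@le_trans _ _ (qr (r - 1))).
 move: e; rewrite (_ : r - (r - 1) = 1); last by ring.
 by rewrite mulr1; have := qr_pos r; lra.
apply: le_trans (hC _) _.
rewrite mulrDl -[leLHS]addr0; apply: lerD; last by apply: mulr_ge0; [apply: divr_ge0; [exact: Lq_ge0|exact: ltW]|exact: ltW].
by rewrite -mulrA; apply: ler_wpM2l => //; apply: phi_shift; lra.
Qed.

End Ground.

(** * Rapidly decreasing even functions on the frequency side *)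

Section Spectral.
Variable R : realType.
Local Notation J := (@jap R).
Local Notation kap := (@kap R).
Implicit Types (a b f g h : R * R -> R) (x y z v xi : R * R).

Lemma Tr_evn f : evn (Tr 0 f).
Proof.
by move=> x; apply: II_ext => xi; rewrite !addr0 /dot2 !pE !mulNr -opprD cosN.
Qed.

Lemma FI_evn f : evn (FI f).
Proof. by move=> x; rewrite /FI Tr_evn. Qed.

Lemma FI_bd f x : Int f -> `|FI f x| <= kap * II (fun xi => `|f xi|).
Proof.
by move=> i; rewrite normrM ger0_norm ?kap_ge0// ler_wpM2l ?kap_ge0// Tr_bd.
Qed.

Lemma FI_conv a b (A B : R) x : meas a -> meas b -> evn b -> bd 2 A a -> bd 2 B b ->
 FI (cnv a b) x = FI a x * FI b x.
Proof.
by move=> ma mb eb ba bb; rewrite /FI (conv_Tr x ma mb eb ba bb); ring.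
Qed.

Lemma Tr_FI a (A : R) xi : Int a -> evn a -> (forall x, `|a x| <= A) -> {for xi, continuous a} ->
 Int (FI a) -> Tr 0 (FI a) xi = a xi.
Proof.
move=> ia ea aA ca iT.
have iT' : Int (Tr 0 a).
 by apply: Int_ext (IntZ kap^-1 iT) => x; rewrite /FI mulKf// kap_neq0.
by rewrite (inversion ia ea aA ca iT') /FI (TrZ 0 kap xi iT').
Qed.

Lemma FID a b x : Int a -> Int b -> FI (fun xi => a xi + b xi) x = FI a x + FI b x.
Proof. by move=> ia ib; rewrite /FI TrD// mulrDr. Qed.
Lemma FIB a b x : Int a -> Int b -> FI (fun xi => a xi - b xi) x = FI a x - FI b x.
Proof. by move=> ia ib; rewrite /FI TrB// mulrBr. Qed.
Lemma FIZ (k : R) a x : Int a -> FI (fun xi => k * a xi) x = k * FI a x.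
Proof. by move=> ia; rewrite /FI TrZ// mulrCA. Qed.

Lemma rap_of_bd g : meas g -> (forall k, exists M : R, bd k M g) -> rap g.
Proof.
move=> mg bg; split => // k; have [M hM] := bg (k + 2)%N.
apply: Int_le (IntZ M (@Int_w2 R)).
 by apply: measM; [exact: meas_abs|exact: measX _ (@J_meas R)].
move=> x; rewrite normrM normr_id (ger0_norm (exprn_ge0 _ (J_ge0 _))).
rewrite /japw ler_pdivlMr ?exprn_gt0 ?J_gt0// -mulrA -exprD.
have := hM x; rewrite ler_pdivlMr ?exprn_gt0 ?J_gt0//.
Qed.

(** The frequency-side class closed under convolution, in which the inversion formula holds
    everywhere; no smoothness in xi is imposed. *)
Definition Sz g : Prop := [/\ evn g, uc g & forall k, exists M : R, bd k M g].
Lemma Sz_meas g : Sz g -> meas g. Proof. by case=> _ /uc_meas. Qed.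
Lemma Sz_rap g : Sz g -> rap g.
Proof. by move=> sg; apply: rap_of_bd; [exact: Sz_meas|case: sg]. Qed.
Lemma Sz_bounded g : Sz g -> exists B : R, forall x, `|g x| <= B.
Proof. by case=> _ _ /(_ 0%N) [M hM]; exists M => x; exact: bd_abs hM. Qed.

Lemma Sz_spec g : Sz g -> spec g.
Proof.
move=> sg; have [eg ug bg] := sg; split; [exact: Sz_rap|exact: eg|exact: Sz_bounded|].
by move=> x _; exact: uc_cont.
Qed.

Lemma Sz_Int g : Sz g -> Int g.
Proof. by move=> /Sz_rap/rap_Int. Qed.
Lemma bd_ex_le (k l : nat) g : (k <= l)%N -> (exists M : R, bd l M g) -> exists M : R, bd k M g.
Proof. by move=> kl [M hM]; exists M; exact: bd_le kl _ hM. Qed.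

Lemma Sz_conv a b : Sz a -> Sz b -> Sz (cnv a b).
Proof.
move=> sa sb; have [ea ua ba] := sa; have [eb ub bb] := sb.
have [B hB] := Sz_bounded sb.
split.
- apply: conv_even => //; [exact: Sz_Int|exact: Sz_meas|by exists B].
- exact: conv_uc (Sz_Int sa) hB ub.
- move=> k; apply: (@bd_ex_le _ (k + 2)%N); first exact: leq_addr.
 have [M hM] := ba (k + 2)%N; have [N hN] := bb (k + 2)%N.
 exists (Ck R (k + 2) * M * N); apply: conv_bd => //; [exact: leq_addl|exact: Sz_meas|exact: Sz_meas].
Qed.

Lemma FI_convS a b x : Sz a -> Sz b -> FI (cnv a b) x = FI a x * FI b x.
Proof.
move=> sa sb; have [_ _ /(_ 2%N) [A hA]] := sa; have [eb _ /(_ 2%N) [B hB]] := sb.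
exact: FI_conv (Sz_meas sa) (Sz_meas sb) eb hA hB.
Qed.

(* Multiplication by [J] gains one power on the physical side, so [J g = T] with [T] preserving decay rates bootstraps. *)
Lemma bootstrap g : (exists M : R, bd 2 M g) ->
 (forall k, (2 <= k)%N -> (exists M : R, bd k M g) -> exists M : R, bd k M (fun xi => J xi * g xi)) ->
 forall k, exists M : R, bd k M g.
Proof.
move=> b2 step.
have main k : exists M : R, bd (k + 2) M g.
 elim: k => [//|k IH]; have [M hM] := step _ (leq_addl _ _) IH.
 exists M => x; have := hM x; rewrite normrM (ger0_norm (J_ge0 _)) => h.
 rewrite addSn exprS invfM mulrCA -(ler_pM2l (J_gt0 x)) mulVKf//.
 exact: J_neq0.
by move=> k; apply: bd_ex_le (main k); exact: leq_addr.
Qed.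

Lemma Tr_uc g th : meas g -> Int (fun xi => `|g xi| * J xi) -> uc (Tr th g).
Proof. by move=> mg ig; apply: uc_lip => x y; exact: Tr_lip. Qed.

End Spectral.

(** * The transform of the ground state *)

Section GroundFT.
Variable R : realType.
Local Notation J := (@jap R).
Local Notation kap := (@kap R).
Local Notation phi := (@barrier R).
Implicit Types (a b f g h : R * R -> R) (x y z v xi : R * R).
Variables (Q : R * R -> R) (hQ : positive_radial_solution Q).
Local Notation q := (qr Q).
Local Notation q1 := (qr1 Q).
Local Notation q2 := (qr2 Q).
Local Notation Q11 := (pdm (2%N, 0%N) Q).
Local Notation Q22 := (pdm (0%N, 2%N) Q).

Lemma dir_le1 x : x != 0 -> `|x.1 / enorm2 x| <= 1 /\ `|x.2 / enorm2 x| <= 1.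
Proof.
move=> x0; have r0 := enorm2_gt0 x0.
by rewrite !normrM !normfV (ger0_norm (ltW r0)) !ler_pdivrMr// !mul1r abs1_le abs2_le.
Qed.

Lemma Qd1_decay : exists2 C : R, 0 <= C & forall x, `|pd1 Q x| <= C * phi x /\ `|pd2 Q x| <= C * phi x.
Proof.
have [C C0 hC] := qr1_decay hQ; exists C => // x.
have p0 := phi_gt0 x; have Cp : 0 <= C * phi x by rewrite mulr_ge0// ltW.
have [->|x0] := eqVneq x 0.
 have e1 : pd1 Q 0 = 0 by exact: (q1_0 (qr_ode hQ)).
 have al (a b c : R) : a + 0 * b = 0 * c -> a = 0 by rewrite !mul0r addr0.
 have e2 : pd2 Q 0 = 0 := al _ _ _ (Qtan1 hQ 0).1.
 by rewrite e1 e2 normr0 mulr_ge0// ltW// phi_gt0.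
have [d1 d2] := dir_le1 x0.
have h := hC _ (enorm2_ge0 x); rewrite -phi_rad in h.
by rewrite (Qpd1 hQ)// (Qpd2 hQ)// !(normrM (q1 _)); split; (apply: le_trans (_ : `|q1 (enorm2 x)| * 1 <= _); [exact: ler_wpM2l|by rewrite mulr1]).
Qed.

Lemma near0_bd (f : R * R -> R) : continuous f -> exists2 K : R, 0 <= K & forall x, enorm2 x <= 1 -> `|f x| <= K * phi x.
Proof.
move=> cf.
have l1 : -1 <= 1 :> R by lra.
have [|x [_ _ mx]] := @box_max R (fun x => `|f x|) (-1) 1 (-1) 1 l1 l1.
 by move=> x _ _; apply: (@continuous_comp _ _ _ f (fun t : R => `|t|)); [exact: cf|exact: norm_continuous].
have p0 : 0 < phi (1, 0) by exact: phi_gt0.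
exists (`|f x| / phi (1, 0)); first by rewrite divr_ge0// ltW.
move=> y y1.
have h : `|f y| <= `|f x|.
 by apply: mx; rewrite -ler_norml (le_trans _ y1)// ?abs1_le ?abs2_le.
apply: le_trans h _; rewrite -mulrA ler_peMr// mulrC ler_pdivlMr// mul1r (phi_rad y).
by apply: phi_axis => //; exact: enorm2_ge0.
Qed.

Lemma Qd2_decay : exists2 C : R, 0 <= C & forall x, `|Q11 x| <= C * phi x /\ `|Q22 x| <= C * phi x.
Proof.
have [C C0 hC] := qr1_decay hQ; have [D D0 hD] := Q_decay hQ.
have [K1 K10 hK1] := near0_bd (Qc11 hQ); have [K2 K20 hK2] := near0_bd (Qc22 hQ).
pose E := (1 + q 0 ^+ 2) * D + 2 * C.
have E0 : 0 <= E.
 by apply: addr_ge0; apply: mulr_ge0 => //; rewrite addr_ge0// sqr_ge0.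
exists (E + K1 + K2); first by apply: addr_ge0 => //; exact: addr_ge0.
move=> x; have p0 := phi_gt0 x.
have P (t : R) : 0 <= t -> 0 <= t * phi x by move=> t0; rewrite mulr_ge0// ltW.
rewrite (mulrDl (E + K1) K2) (mulrDl E K1).
case: (leP (enorm2 x) 1) => hx.
 have := hK1 x hx; have := hK2 x hx; have := P _ E0; have := P _ K10; have := P _ K20.
 by move=> a b c d e; split; [apply: le_trans e _|apply: le_trans d _]; lra.
set r := enorm2 x in hx *.
have r0 : 0 < r by lra.
have rn : r != 0 by rewrite gt_eqF.
have x0 : x != 0 by apply/eqP => e; move: r0; rewrite /r e /enorm2 /dot2 /= !mulr0 addr0 sqrtr0 ltxx.
have [d1 d2] := dir_le1 x0.
have h1 := hC r (ltW r0); have h0 := hD (r, 0); rewrite -phi_rad in h1; rewrite -phi_rad -/(qr Q r) in h0.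
have s1 (t : R) : `|t| <= 1 -> 0 <= t ^+ 2 <= 1.
 by move=> ht; rewrite sqr_ge0/= -(real_normK (num_real t)) expr_le1.
have c3 (t : R) : `|t / r| <= 1 -> 0 <= t ^+ 2 / r ^+ 3 <= 1.
 move=> ht; have /andP[a b] := s1 _ ht.
 have -> : t ^+ 2 / r ^+ 3 = (t / r) ^+ 2 / r by field.
 rewrite divr_ge0 ?sqr_ge0 ?(ltW r0)//= ler_pdivrMr// mul1r; lra.
have q2b : `|q2 r| <= (1 + q 0 ^+ 2) * D * phi x + C * phi x.
 have -> : q2 r = (q r - q r ^+ 3) - q1 r / r.
  by apply: (mulfI rn); rewrite mulrBr -(qr_ode hQ); field.
 apply: normB_le; apply: lerD.
  have qp := qr_pos hQ r; have qq := qr_le0 hQ (ltW r0).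
  have -> : q r - q r ^+ 3 = (1 - q r ^+ 2) * q r by ring.
  rewrite normrM (gtr0_norm qp) -mulrA; apply: ler_pM => //; first exact: ltW.
  apply: normB_le; rewrite normr1 ger0_norm ?sqr_ge0// lerD2l.
  by rewrite lerXn2r// nnegrE ltW// qr_pos.
 apply: le_trans _ h1; rewrite normrM normfV (gtr0_norm r0) ler_pdivrMr// ler_peMr//; exact: ltW.
have fin (s t : R) : 0 <= s <= 1 -> 0 <= t <= 1 -> `|q2 r * s + q1 r * t| <= E * phi x.
 move=> /andP[a b] /andP[c d]; apply: normD_le; rewrite !normrM (ger0_norm a) (ger0_norm c).
 have -> : E * phi x = (1 + q 0 ^+ 2) * D * phi x + C * phi x + C * phi x by rewrite /E; ring.
 by apply: lerD; [apply: le_trans _ q2b|apply: le_trans _ h1]; rewrite ler_piMr.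
have k1 := P _ K10; have k2 := P _ K20.
have fin' (s t : R) : 0 <= s <= 1 -> 0 <= t <= 1 -> `|q2 r * s + q1 r * t| <= E * phi x + K1 * phi x + K2 * phi x.
 by move=> hs ht; apply: le_trans (fin _ _ hs ht) _; rewrite -addrA lerDl addr_ge0.
have [e1 e2] := h2_lap (Qh2r hQ x0).
by rewrite e1 e2; split; apply: fin'; [exact: s1|exact: c3|exact: s1|exact: c3].
Qed.

Lemma phi_to_bd k f (C : R) : 0 <= C -> (forall x, `|f x| <= C * phi x) -> exists M : R, bd k M f.
Proof.
move=> C0 hf; have [D D0 hD] := phi_J R k; exists (C * D) => x.
by apply: le_trans (hf x) _; rewrite -mulrA ler_wpM2l.
Qed.

Lemma Qall_bd : exists M : R, [/\ bd 2 M Q, bd 2 M (pd1 Q), bd 2 M (pd2 Q), bd 2 M Q11 & bd 2 M Q22].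
Proof.
have [C C0 hC] := Q_decay hQ; have [C1 C10 hC1] := Qd1_decay; have [C2 C20 hC2] := Qd2_decay.
have [M0 hM0] : exists M : R, bd 2 M Q.
 by apply: (phi_to_bd _ C0) => x; rewrite gtr0_norm ?hC// Qpos.
have [M1 hM1] : exists M : R, bd 2 M (pd1 Q) by apply: (phi_to_bd _ C10) => x; exact: (hC1 x).1.
have [M2 hM2] : exists M : R, bd 2 M (pd2 Q) by apply: (phi_to_bd _ C10) => x; exact: (hC1 x).2.
have [M3 hM3] : exists M : R, bd 2 M Q11 by apply: (phi_to_bd _ C20) => x; exact: (hC2 x).1.
have [M4 hM4] : exists M : R, bd 2 M Q22 by apply: (phi_to_bd _ C20) => x; exact: (hC2 x).2.
have p0 := bd_ge0 hM0; have p1 := bd_ge0 hM1; have p2 := bd_ge0 hM2; have p3 := bd_ge0 hM3; have p4 := bd_ge0 hM4.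
exists (M0 + M1 + M2 + M3 + M4); split; [apply: bd_le hM0|apply: bd_le hM1|apply: bd_le hM2|apply: bd_le hM3|apply: bd_le hM4]; rewrite ?leqnn//; lra.
Qed.

Definition g0 : R * R -> R := Tr 0 Q.
Lemma Q_evn : evn Q.
Proof. by move=> x; rewrite !(Qrad hQ) enorm2N. Qed.
Lemma Q_le x : `|Q x| <= q 0.
Proof. by rewrite gtr0_norm ?Qpos// (Qrad hQ); apply: qr_le0 => //; exact: enorm2_ge0. Qed.
Lemma Q_meas : meas Q. Proof. by apply: measC; exact: Qcont hQ. Qed.
Lemma Q_Int : Int Q.
Proof. by have [M [h _ _ _ _]] := Qall_bd; exact: bd_Int Q_meas h. Qed.

Lemma g0_J xi : J xi * g0 xi = Tr 0 (fun x => Q x ^+ 3) xi.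
Proof.
have [M [b b1 b2 b11 b22]] := Qall_bd.
have E x : Q x - (Q11 x + Q22 x) = Q x ^+ 3 by rewrite (Qeq hQ) opprB addrC subrK.
rewrite -(Tr_ext 0 xi E) /g0; apply: (FT_J xi _ _ _ _ _ b b1 b2 b11 b22).
- exact: Qhg hQ.
- by move=> x; eexists; exact: (Qhg1 hQ x).
- by move=> x; eexists; exact: (Qhg2 hQ x).
- by apply: measC; exact: Qc11 hQ.
- by apply: measC; exact: Qc22 hQ.
Qed.

(** Q is only known to be C^2, so the integrable rate J^-2 for its transform comes in two halves:
    two derivatives of Q^3 give J^-1 here, and the equation in the form [g0_J] gives the other. *)
Lemma FT_Q3_bd : exists K : R, forall xi, `|Tr 0 (fun x => Q x ^+ 3) xi| <= K * (J xi)^-1.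
Proof.
have [M [b b1 b2 b11 b22]] := Qall_bd.
have M0 := bd_ge0 b.
pose f1 x := 3 * Q x * Q x * pd1 Q x; pose f2 x := 3 * Q x * Q x * pd2 Q x.
pose f11 x := 6 * Q x * pd1 Q x * pd1 Q x + 3 * Q x * Q x * Q11 x.
pose f22 x := 6 * Q x * pd2 Q x * pd2 Q x + 3 * Q x * Q x * Q22 x.
have A f x : bd 2 M f -> `|f x| <= M by exact: bd_abs.
have bb (k : R) f g : 0 <= k -> bd 2 M f -> bd 2 M g -> bd 2 (k * M * M * M) (fun x => k * Q x * f x * g x).
 move=> k0 bf bg; apply: bdM => // x; rewrite !normrM (ger0_norm k0) -!mulrA; apply: ler_wpM2l => //.
 by apply: ler_pM => //; exact: A.
have bb3 g := bb 3 Q g (ler0n _ _) b.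
pose N := 9 * M * M * M.
have NN (t : R) : 0 <= t <= 9 -> t * M * M * M <= N.
 by move=> /andP[t0 t9]; rewrite /N; do 3 apply: ler_wpM2r => //.
have bF11 : bd 2 N f11.
 have := bdD (bb 6 _ _ (ler0n _ _) b1 b1) (bb3 _ b11); apply: bd_le => //; rewrite /N; lra.
have bF22 : bd 2 N f22.
 have := bdD (bb 6 _ _ (ler0n _ _) b2 b2) (bb3 _ b22); apply: bd_le => //; rewrite /N; lra.
have bF1 : bd 2 N f1 by apply: bd_le (bb3 _ b1) => //; apply: NN; rewrite ler0n ler_nat.
have bF2 : bd 2 N f2 by apply: bd_le (bb3 _ b2) => //; apply: NN; rewrite ler0n ler_nat.
have bF : bd 2 N (fun x => Q x ^+ 3).
 have := bb 1 _ _ ler01 b b.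
 move=> h x; have := h x; rewrite (_ : 1 * Q x * Q x * Q x = Q x ^+ 3); last by ring.
 move/le_trans; apply; apply: ler_wpM2r; first exact: Jk_ge0.
 by apply: NN; rewrite ler01/= ler1n.
have mQ1 : meas (pd1 Q) by apply: measC => x; exact: hg_cont (Qhg1 hQ x).
have mQ2 : meas (pd2 Q) by apply: measC => x; exact: hg_cont (Qhg2 hQ x).
have mQ11 : meas Q11 by apply: measC; exact: Qc11 hQ.
have mQ22 : meas Q22 by apply: measC; exact: Qc22 hQ.
have mQ := Q_meas.
have m11 : meas f11 by apply: measD; do !(apply: measM => //); exact: meas_cst.
have m22 : meas f22 by apply: measD; do !(apply: measM => //); exact: meas_cst.
have e3 z : Q z * Q z * Q z = Q z ^+ 3 by ring.
have al (a d t : R) : ((0 * a + 3 * d) * a + 3 * a * d) * d + 3 * a * a * t = 6 * a * d * d + 3 * a * a * t by ring.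
have al1 (a d : R) : (d * a + a * d) * a + a * a * d = 3 * a * a * d by ring.
have H xi := @FT_J R (fun x => Q x ^+ 3) f1 f2 f11 f22 xi N.
have {}H xi : J xi * Tr 0 (fun x => Q x ^+ 3) xi = Tr 0 (fun x => Q x ^+ 3 - (f11 x + f22 x)) xi.
 apply: H => //.
 - move=> x; apply: (hg_ext e3).
  by apply: (hg_eq (hgM (hgM (Qhg hQ x) (Qhg hQ x)) (Qhg hQ x))); exact: al1.
 - move=> x; have h := hgM (hgM (hgM (hg_cst 3 x) (Qhg hQ x)) (Qhg hQ x)) (Qhg1 hQ x).
  by eexists; apply: (hg_eq h _ erefl); exact: al.
 - move=> x; have h := hgM (hgM (hgM (hg_cst 3 x) (Qhg hQ x)) (Qhg hQ x)) (Qhg2 hQ x).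
  by eexists; apply: (hg_eq h erefl _); exact: al.
have mF : meas (fun x => Q x ^+ 3 - (f11 x + f22 x)).
 by apply: measB; [rewrite -(funext e3); do !apply: measM|apply: measD].
have iF := bd_Int mF (bdB bF (bdD bF11 bF22)).
exists (II (fun x => `|Q x ^+ 3 - (f11 x + f22 x)|)) => xi.
rewrite ler_pdivlMr ?J_gt0// mulrC -{1}(ger0_norm (J_ge0 xi)) -normrM H.
exact: Tr_bd.
Qed.

Lemma g0_bd2 : exists M : R, bd 2 M g0.
Proof.
have [K hK] := FT_Q3_bd; exists K => xi.
have := hK xi; rewrite -g0_J normrM (ger0_norm (J_ge0 _)) !ler_pdivlMr ?exprn_gt0 ?J_gt0//.
by rewrite (_ : J xi * _ * J xi = `|g0 xi| * J xi ^+ 2)//; ring.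
Qed.

Lemma g0_uc : uc g0.
Proof.
apply: Tr_uc; first exact: Q_meas.
have [C C0 hC] := Q_decay hQ.
have [M hM] : exists M : R, bd 3 M Q.
 by apply: (phi_to_bd _ C0) => x; rewrite gtr0_norm ?hC// Qpos.
apply: Int_le (IntZ M (@Int_w2 R)).
 by apply: measM; [apply: meas_abs; exact: Q_meas|exact: J_meas].
move=> x; rewrite normrM normr_id (ger0_norm (J_ge0 x)).
have := hM x; rewrite exprS invfM mulrCA mulrC ler_pdivlMr ?J_gt0//.
Qed.

Lemma g0_meas : meas g0. Proof. exact: uc_meas g0_uc. Qed.
Lemma g0_Int : Int g0. Proof. by have [M h] := g0_bd2; exact: bd_Int g0_meas h. Qed.

Lemma FI_g0 x : FI g0 x = Q x.
Proof.
rewrite /FI -(inversion Q_Int Q_evn Q_le)//; [exact: Qcont hQ _|exact: g0_Int].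
Qed.

Lemma Q3_conv xi : Tr 0 (fun x => Q x ^+ 3) xi = cnv (cnv g0 g0) g0 xi.
Proof.
have [M hM] := g0_bd2; have ev : evn g0 by exact: Tr_evn.
have hc := conv_bd (leqnn 2) g0_meas g0_meas hM hM.
have uc1 : uc (cnv g0 g0) := conv_uc g0_Int (fun y => bd_abs y hM) g0_uc.
have mc := uc_meas uc1; have ic := bd_Int mc hc.
have hcc := conv_bd (leqnn 2) mc g0_meas hc hM.
have ec := conv_even ev ev g0_Int g0_meas (ex_intro _ M (fun y => bd_abs y hM)).
have uc2 : uc (cnv (cnv g0 g0) g0) := conv_uc ic (fun y => bd_abs y hM) g0_uc.
have E x : FI (cnv (cnv g0 g0) g0) x = Q x ^+ 3.
 rewrite (FI_conv x mc g0_meas ev hc hM) (FI_conv x g0_meas g0_meas ev hM hM) FI_g0; ring.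
rewrite -[RHS](@Tr_FI R (cnv (cnv g0 g0) g0) (Ck R 2 * (Ck R 2 * M * M) * M) xi).
- by apply: Tr_ext => x; rewrite E.
- exact: bd_Int (uc_meas uc2) hcc.
- exact: conv_even ec ev ic g0_meas (ex_intro _ M (fun y => bd_abs y hM)).
- by move=> x; exact: bd_abs hcc.
- exact: (@uc_cont _ _ uc2 xi).
- have [N [b _ _ _ _]] := Qall_bd.
 apply: (Int_le _ _ (IntZ (q 0 * q 0) (Int_abs Q_Int))).
  by rewrite (funext E); do !apply: measM; exact: Q_meas.
 move=> x; rewrite E !exprS expr0 mulr1 mulrA normrM ler_wpM2r// normrM.
 by apply: ler_pM => //; exact: Q_le.
Qed.

Lemma g0_eq xi : J xi * g0 xi = cnv (cnv g0 g0) g0 xi.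
Proof. by rewrite g0_J Q3_conv. Qed.

(** Regularity of Q: [J g0] is a triple convolution of g0, which keeps the decay rate, so each round
    gains a power of J. *)
Lemma g0_Sz : Sz g0.
Proof.
split; [exact: Tr_evn|exact: g0_uc|].
apply: bootstrap; first exact: g0_bd2.
move=> k k2 [M hM].
have hc := conv_bd k2 g0_meas g0_meas hM hM.
have [M2 hM2] := g0_bd2.
have mc : meas (cnv g0 g0) := uc_meas (conv_uc g0_Int (fun y => bd_abs y hM2) g0_uc).
exists (Ck R k * (Ck R k * M * M) * M) => xi; rewrite g0_eq.
exact: conv_bd k2 mc g0_meas hc hM xi.
Qed.

End GroundFT.

(** * Derivatives of inverse transforms *)

Section WdS.
Variable R : realType.
Local Notation J := (@jap R).
Local Notation kap := (@kap R).
Implicit Types (f g h : R * R -> R) (x y z v xi : R * R).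

(** The derivative d1^a d2^b of [FI g] in closed form: one coordinate factor and a quarter turn of
    phase per differentiation. *)
Definition Wd g (a b : nat) x : R :=
 kap * Tr ((a + b)%:R * (pi / 2)) (fun xi => mono (a, b) xi * g xi) x.

Lemma Wd00 g x : Wd g 0 0 x = FI g x.
Proof.
by rewrite /Wd mul0r; congr (_ * _); apply: Tr_ext => xi; rewrite /mono !expr0 !mul1r.
Qed.

Lemma Wd_hg g a b x : rap g -> hg (Wd g a b) x (Wd g a.+1 b x) (Wd g a b.+1 x).
Proof.
move=> rg; have rm := rap_mono (a, b) rg.
have h := hgZ kap (Tr_hg ((a + b)%:R * (pi / 2)) x (rap_meas rm) (rap_J rm)).
have al (n : nat) (p : R) : n%:R * p + p = n.+1%:R * p by rewrite -natr1 mulrDl mul1r.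
have e1 : (a + b)%:R * (pi / 2) + pi / 2 = (a.+1 + b)%:R * (pi / 2) :> R by rewrite addSn al.
have e2 : (a + b)%:R * (pi / 2) + pi / 2 = (a + b.+1)%:R * (pi / 2) :> R by rewrite addnS al.
apply: (hg_eq h); rewrite /Wd -?e1 -?e2; congr (_ * _); apply: Tr_ext => xi; rewrite /mono /= exprS; ring.
Qed.

Lemma Wd_h2 g a b x : rap g -> h2 (Wd g a b) x (Wd g a.+1 b x) (Wd g a b.+1 x) (Wd g a.+2 b x) (Wd g a b.+2 x).
Proof.
move=> rg; exists (Wd g a.+1 b), (Wd g a b.+1), (Wd g a.+1 b.+1 x), (Wd g a.+1 b.+1 x); split => //.
- by apply: near2W => z; exact: Wd_hg.
- exact: Wd_hg.
- exact: Wd_hg.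
Qed.

Lemma Wd_cont g a b : rap g -> continuous (Wd g a b).
Proof. by move=> rg x; exact: hg_cont (Wd_hg a b x rg). Qed.

Lemma Wd_bdd g a b : rap g -> exists2 C : R, 0 <= C & forall x, `|Wd g a b x| <= C.
Proof.
move=> rg; have rm := rap_mono (a, b) rg.
exists (kap * II (fun xi => `|mono (a, b) xi * g xi|)).
 by apply: mulr_ge0; [exact: kap_ge0|apply: II_ge0 => x; exact: normr_ge0].
move=> x; rewrite normrM (ger0_norm (kap_ge0 R)); apply: ler_wpM2l; first exact: kap_ge0.
exact: Tr_bd (rap_Int rm).
Qed.

Lemma Wd_lap g x : rap g -> Wd g 0 0 x - (Wd g 2 0 x + Wd g 0 2 x) = FI (fun xi => J xi * g xi) x.
Proof.
move=> rg.
have r2 := rap_mono (2, 0)%N rg; have r2' := rap_mono (0, 2)%N rg.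
have E (m : nat * nat) : rap (fun xi => mono m xi * g xi) -> Tr (2 * (pi / 2)) (fun xi => mono m xi * g xi) x = - Tr 0 (fun xi => mono m xi * g xi) x.
 move=> rm; rewrite /Tr -(IIN (Int_Tr 0 x (rap_Int rm))); apply: II_ext => xi.
 by rewrite (_ : 2 * (pi / 2) = pi :> R); [rewrite cosDpi addr0 mulrN|field].
rewrite Wd00 /Wd /= addn0 add0n (E (2, 0)%N)// (E (0, 2)%N)// /FI.
rewrite -mulrDr -mulrBr; congr (_ * _).
rewrite -opprD opprK.
rewrite -(TrD 0 x (rap_Int r2) (rap_Int r2')).
rewrite -(TrD 0 x (rap_Int rg)); last by apply: IntD; exact: rap_Int.
by apply: Tr_ext => xi; rewrite /mono /= !expr0 /jap /dot2; ring.
Qed.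

Lemma hg_uniq f x a b a' b' : hg f x a b -> hg f x a' b' -> a = a' /\ b = b'.
Proof. by move=> h h'; rewrite -(hg_pd1 h) -(hg_pd2 h) (hg_pd1 h') (hg_pd2 h'). Qed.

Lemma hg_opp f x a b : hg f (- x) a b -> hg (fun z => f (- z)) x (- a) (- b).
Proof.
have E z : - z = (-1) *: (z - 0) by rewrite subr0 scaleN1r.
move=> h; rewrite (E x) in h.
apply: (hg_ext (f := fun z => f ((-1) *: (z - 0)))); first by move=> z; rewrite -E.
by apply: hg_eq (hg_shift h) _ _; rewrite mulN1r.
Qed.

Definition refl x : R * R := (x.1, - x.2).

Lemma hg_refl f x a b : hg f (refl x) a b -> hg (fun z => f (refl z)) x a (- b).
Proof.
have E z : refl z = 0 + z.1 *: (1, 0) + z.2 *: (0, - 1) :> R * R.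
 by apply: pt_eq => /=; rewrite !scaleRE; ring.
rewrite (E x) => /hg_aff /hg_eq h; apply: (hg_ext (f := fun z => f (0 + z.1 *: (1, 0) + z.2 *: (0, - 1)))).
 by move=> t; rewrite (E t).
by apply: h => /=; ring.
Qed.

Lemma refl_cont : continuous refl.
Proof. by move=> x; apply: pair_cont; [exact: fst_cont|apply: cvgN; exact: snd_cont]. Qed.

End WdS.

(** * A supersolution on the quarter plane *)

Section Quarter.
Variable R : realType.
Local Notation kos := (@kos R).
Implicit Types (f g h : R * R -> R) (x y z v xi : R * R).
Variables (Q : R * R -> R) (hQ : positive_radial_solution Q).
Local Notation q := (qr Q).
Local Notation q1 := (qr1 Q).
Local Notation g0 := (g0 Q).
Local Notation Qd := (Wd g0).

Let rg := Sz_rap (g0_Sz hQ).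
Lemma Qd00 x : Qd 0 0 x = Q x.
Proof. by rewrite Wd00 (FI_g0 hQ). Qed.
Lemma Qd_hg x : hg Q x (Qd 1 0 x) (Qd 0 1 x).
Proof. exact: hg_ext Qd00 (Wd_hg 0 0 x rg). Qed.

Lemma Qd_tan x : x.1 * Qd 0 1 x = x.2 * Qd 1 0 x.
Proof.
by have [-> ->] := hg_uniq (Qd_hg x) (Qhg hQ x); exact: Qtan hQ x.
Qed.

Lemma Qd_tan1 x : Qd 0 1 x + x.1 * Qd 1 1 x = x.2 * Qd 2 0 x.
Proof.
have h := hgB (hgM (hg_fst x) (Wd_hg 0 1 x rg)) (hgM (hg_snd x) (Wd_hg 1 0 x rg)).
have h0 : hg (fun z => z.1 * Qd 0 1 z - z.2 * Qd 1 0 z) x 0 0.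
 by apply: hg_ext (hg_cst 0 x) => z; rewrite Qd_tan subrr.
have [e _] := hg_uniq h h0; move: e; rewrite mul1r mul0r add0r => /eqP.
by rewrite subr_eq0 => /eqP.
Qed.

Lemma Qd_lap x : Qd 2 0 x + Qd 0 2 x = Q x - Q x ^+ 3.
Proof.
have [e1 e2] := h2_lap (Wd_h2 0 0 x rg); rewrite -(Qeq hQ x) -e1 -e2.
by rewrite (_ : Qd 0 0 = Q)//; apply/funext; exact: Qd00.
Qed.

Definition Vp x : R := 1 - 3 * Q x ^+ 2.

Lemma Qd_lap1 x : Qd 3 0 x + Qd 1 2 x = Vp x * Qd 1 0 x /\ Qd 2 1 x + Qd 0 3 x = Vp x * Qd 0 1 x.
Proof.
have h := hgD (Wd_hg 2 0 x rg) (Wd_hg 0 2 x rg).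
have h' : hg (fun z => Qd 2 0 z + Qd 0 2 z) x (Qd 1 0 x - (Qd 1 0 x * Q x + Q x * Qd 1 0 x) * Q x - Q x * Q x * Qd 1 0 x)
  (Qd 0 1 x - (Qd 0 1 x * Q x + Q x * Qd 0 1 x) * Q x - Q x * Q x * Qd 0 1 x).
 have k := hgB (Qd_hg x) (hgM (hgM (Qd_hg x) (Qd_hg x)) (Qd_hg x)).
 apply: (hg_ext (f := fun z => Q z - Q z * Q z * Q z)).
  by move=> z; rewrite Qd_lap; ring.
 by apply: (hg_eq k); ring.
have [-> ->] := hg_uniq h h'; rewrite /Vp.
have al (a d : R) : d - (d * a + a * d) * a - a * a * d = (1 - 3 * a ^+ 2) * d by ring.
by split; exact: al.
Qed.

(* [- d1 Q - d2 Q] solves the linearised equation and vanishes only at the origin of the closed quarter plane; the extra term makes it a strict supersolution. *)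
Definition Phi x : R := - (Qd 1 0 x + Qd 0 1 x + Qd 1 0 x * (x.2 * (enorm2 x)^-1)).
Definition pr x : R := - q1 (enorm2 x) / enorm2 x.

Lemma pr_gt0 x : x != 0 -> 0 < pr x.
Proof.
move=> /enorm2_gt0 r0; rewrite /pr divr_gt0// oppr_gt0.
exact: qr1_neg hQ _ r0.
Qed.

Lemma Qd_pr x : x != 0 -> Qd 1 0 x = - pr x * x.1 /\ Qd 0 1 x = - pr x * x.2.
Proof.
move=> x0; have [-> ->] := hg_uniq (Qd_hg x) (Qhg hQ x).
by rewrite (Qpd1 hQ x0) (Qpd2 hQ x0) /pr; split; ring.
Qed.

Lemma PhiE x : x != 0 -> Phi x = pr x * (x.1 + x.2 + x.1 * x.2 / enorm2 x).
Proof. by move=> x0; rewrite /Phi; have [-> ->] := Qd_pr x0; ring. Qed.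

Lemma Phi_gt0 x : x != 0 -> 0 <= x.1 -> 0 <= x.2 -> 0 < Phi x.
Proof.
move=> x0 x1 x2; rewrite PhiE// mulr_gt0 ?pr_gt0//.
have r0 := enorm2_gt0 x0.
have h : 0 <= x.1 * x.2 / enorm2 x by rewrite !mulr_ge0// invr_ge0 ltW.
have := le_lt_trans _ (lt_le_trans r0 (enorm2_le_sum x)) => /(_ _ (lexx 0)).
by rewrite !ger0_norm//; lra.
Qed.

Lemma h2_theta x : x != 0 -> h2 (fun z => z.2 * (enorm2 z)^-1) x (- (x.1 * x.2) / enorm2 x ^+ 3) (x.1 ^+ 2 / enorm2 x ^+ 3)
  (x.2 * (2 * x.1 ^+ 2 - x.2 ^+ 2) / enorm2 x ^+ 5) (- 2 * x.2 / enorm2 x ^+ 3 + x.2 * (2 * x.2 ^+ 2 - x.1 ^+ 2) / enorm2 x ^+ 5).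
Proof.
move=> x0; have r0 := enorm2_gt0 x0; have rn : enorm2 x != 0 by rewrite gt_eqF.
have r2n : enorm2 x ^+ 2 != 0 by rewrite expf_neq0.
have d1 t : t != 0 :> R -> is_derive t (1 : R) (fun s => s^-1) (- (t ^+ 2)^-1).
 by move=> tn; have h := drvV (drv_id t) tn; apply: (drv_eq h); rewrite mulN1r.
have d2 : is_derive (enorm2 x) (1 : R) (fun t => - (t ^+ 2)^-1) (2 / enorm2 x ^+ 3).
 have h := drvN (drvV (drv_X 2 (drv_id (enorm2 x))) r2n).
 by apply: (drv_eq h) => /=; field.
have n0 : \forall t \near enorm2 x, is_derive t (1 : R) (fun s => s^-1) (- (t ^+ 2)^-1).
 have n1 : \forall t \near enorm2 x, 0 < t by apply: open_nbhs_nbhs; split; [exact: open_gt|exact: r0].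
 by apply: filterS n1 => t t0; apply: d1; rewrite gt_eqF.
have h := h2M (h2_snd x) (h2_comp n0 d2 (h2_enorm x0)).
have E : x.2 ^+ 2 = enorm2 x ^+ 2 - x.1 ^+ 2 by rewrite enorm2_sq; ring.
have E' : x.1 ^+ 2 = enorm2 x ^+ 2 - x.2 ^+ 2 by rewrite enorm2_sq; ring.
apply: (h2_eq h).
- by field.
- by rewrite E'; field.
- by field.
- by field.
Qed.

(** The extra term is - q' sin (2 theta) / 2. As q' solves the linearised equation in angular mode
    1, placing it in mode 2 leaves the difference 3 / r^2 of the centrifugal terms, and hence the
    strict defect. *)
Lemma h2_Phi x : x != 0 -> exists b1 b2 a11 a22, h2 Phi x b1 b2 a11 a22 /\
 a11 + a22 = Vp x * Phi x - 3 * pr x * (x.1 * x.2) / enorm2 x ^+ 3.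
Proof.
move=> x0; have r0 := enorm2_gt0 x0; have rn : enorm2 x != 0 by rewrite gt_eqF.
have hth := h2_theta x0.
have h10 := Wd_h2 1 0 x rg; have h01 := Wd_h2 0 1 x rg.
have h := h2Z (-1) (h2D (h2D h10 h01) (h2M h10 hth)).
do 4 eexists; split.
 by apply: h2_ext h => z; rewrite mulN1r.
have [l1 l2] := Qd_lap1 x; have t1 := Qd_tan1 x; have [p1 p2] := Qd_pr x0.
have E : x.2 ^+ 2 = enorm2 x ^+ 2 - x.1 ^+ 2 by rewrite enorm2_sq; ring.
rewrite /Phi; move: l1 l2 t1 p1 p2 E.
move: (Qd 1 0 x) (Qd 0 1 x) (Qd 2 0 x) (Qd 1 1 x) (Qd 3 0 x) (Qd 1 2 x) (Qd 2 1 x) (Qd 0 3 x) (Vp x) (pr x) (enorm2 x) rn.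
move: x.1 x.2 => x1 x2 A B C D E F G H V p r rn l1 l2 t1 p1 p2 Er.
have -> : F = V * A - E by rewrite -l1; ring.
have -> : H = V * B - G by rewrite -l2; ring.
have e3 : x1 * D = x2 * C - B by rewrite -t1; ring.
have r3 : r ^+ 3 != 0 by rewrite expf_neq0.
transitivity (V * - (A + B + A * (x2 * r^-1)) - 2 * (x1 / r ^+ 3) * (x1 * D - x2 * C)
  - A * (x2 * ((x1 ^+ 2 + x2 ^+ 2) - 2 * r ^+ 2) / r ^+ 5)); first by field.
by rewrite e3 Er p1 p2; field.
Qed.

Lemma Phi_cont x : x != 0 -> {for x, continuous Phi}.
Proof. by move=> /h2_Phi [b1 [b2 [a11 [a22 [/h2_hg /hg_cont]]]]]. Qed.

(** q''(0) < 0 gives a positive lower bound on - q'(r) / r near 0: [Phi] grows linearly at the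
    corner, while a function vanishing on both axes is only O(x.1 x.2). *)
Lemma pr_near0 : exists e p0 : R, [/\ 0 < e, 0 < p0 & forall x, x != 0 -> enorm2 x < e -> p0 <= pr x].
Proof.
have n0 : qr2 Q 0 < 0.
 have := cubic_neg (qr_pos hQ 0) (sq_ge2 (dqr hQ) (dqr1 hQ) (qr_ode hQ) (qr_pos hQ) (qr_lim hQ) (lexx 0) (q1_0 (qr_ode hQ))).
 by rewrite -(qr20 hQ); lra.
pose p0 : R := - qr2 Q 0 / 2.
have d : is_derive (0 : R) (1 : R) (fun r => - q1 r - p0 * r) (- qr2 Q 0 - p0) := drvB (drvN (dqr1 hQ 0)) (drv_lin p0 0).
have [|e e0 he] := drv_pos_near d; first by rewrite /p0; lra.
exists e, p0; split => //; first by rewrite /p0; lra.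
move=> x x0 xe; have r0 := enorm2_gt0 x0.
have [_ h] := he (enorm2 x); have := h; rewrite add0r r0 xe (q1_0 (qr_ode hQ)) mulr0 !oppr0 addr0 => /(_ isT) h1.
by rewrite /pr ler_pdivlMr//; lra.
Qed.

Lemma Vp_far : exists2 rho : R, 0 < rho & forall x, rho < enorm2 x -> 2^-1 <= Vp x.
Proof.
have i6 : 0 < 6^-1 :> R by rewrite invr_gt0.
have [rho rho0 hr] := qr_lim hQ i6; exists rho => // x /hr; rewrite -(Qrad hQ) => h.
have := Qpos hQ x => p.
have : Q x ^+ 2 <= 6^-1.
 by rewrite expr2; apply: (@le_trans _ _ (6^-1 * 1)); [apply: ler_pM; lra|rewrite mulr1].
rewrite /Vp; lra.
Qed.

(** The corner is cut off because the ratio z / Phi is not controlled at the origin, where [Phi]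
    vanishes. *)
Definition cut (d B : R) x : Prop := [/\ 0 <= x.1 <= B, 0 <= x.2 <= B & d <= x.1 + x.2].

Lemma cut_max f (d B : R) : (exists x, cut d B x) -> (forall x, cut d B x -> {for x, continuous f}) ->
 exists x, cut d B x /\ forall y, cut d B y -> f y <= f x.
Proof.
move=> K0 cf.
pose K : set (R * R) := ([set` `[0, B]] `*` [set` `[0, B]]) `&` [set x | d <= x.1 + x.2].
have inK y : K y <-> cut d B y.
 rewrite /K /cut /= !in_itv /=; split; first by move=> [[h1 h2] h3].
 by move=> [h1 h2 h3].
have cK : compact K.
 apply: compact_closedI; first by apply: compact_setX; exact: segment_compact.
 apply: (@closed_comp _ _ (fun x : R * R => x.1 + x.2) [set t : R | d <= t]); last exact: closed_ge.
 by move=> x _; apply: cvgD; [exact: fst_cont|exact: snd_cont].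
have K1 : K !=set0 by case: K0 => x hx; exists x; exact/inK.
have [|x /set_mem /inK hx mx] := @compact_EVT_max _ R f K K1 cK.
 by apply: continuous_in_subspaceT => y /set_mem /inK hy; exact: cf.
by exists x; split => // y hy; apply: mx; apply/mem_set/inK.
Qed.

Section Z.
Variables z z1 z2 z12 z11 z22 : R * R -> R.
Hypotheses (hz : forall x, hg z x (z1 x) (z2 x)) (hz2 : forall x, hg z2 x (z12 x) (z22 x)).
Hypotheses (h2z : forall x, h2 z x (z1 x) (z2 x) (z11 x) (z22 x)) (cz12 : continuous z12)
 (lapz : forall x, z11 x + z22 x = Vp x * z x).
Hypotheses (odd1 : forall t : R, z (0, t) = 0) (odd2 : forall t : R, z (t, 0) = 0).
Hypothesis bz : exists2 W : R, 0 <= W & forall x, `|z x| <= W.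

(** Two mean value theorems starting from the zeros on the axes; K is the maximum of the mixed
    derivative over the square. *)
Let z_loc (B : R) : 0 <= B -> exists2 K : R, 0 <= K & forall x, 0 <= x.1 <= B -> 0 <= x.2 <= B -> z x <= K * (x.1 * x.2).
Proof.
move=> B0.
have [|y [_ _ my]] := @box_max R (fun x => `|z12 x|) 0 B 0 B B0 B0.
 by move=> x _ _; apply: (@continuous_comp _ _ _ z12 (fun t : R => `|t|)); [exact: cz12|exact: norm_continuous].
exists `|z12 y| => // x /andP[x1 x1B] /andP[x2 x2B].
have z20 t : z2 (0, t) = 0.
 apply: (drv_uniq (line2 (hz (0, t)))); rewrite (_ : (fun s => z (0, s)) = fun=> 0); first exact: drv_cst.
 by apply/funext => s; exact: odd1.
have L2 (s t a b : R) (p : R * R -> R) : hg p (s, t) a b -> is_derive t (1 : R) (fun u => p (s, u)) b.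
 move=> h; have E u : (s, u) = (s, 0) + u *: dir2 R :> R * R by apply: pt_eq => /=; rewrite scaleRE; ring.
 rewrite (funext (fun u => congr1 p (E u))); rewrite E in h.
 by have k := hg_line h; apply: (drv_eq k) => /=; ring.
have L1 (s t a b : R) (p : R * R -> R) : hg p (s, t) a b -> is_derive s (1 : R) (fun u => p (u, t)) a.
 move=> h; have E u : (u, t) = (0, t) + u *: dir1 R :> R * R by apply: pt_eq => /=; rewrite scaleRE; ring.
 rewrite (funext (fun u => congr1 p (E u))); rewrite E in h.
 by have k := hg_line h; apply: (drv_eq k) => /=; ring.
case: x x1 x1B x2 x2B => s t /= s0 sB t0 tB.
move: t0; rewrite le_eqVlt => /orP[/eqP <-|t0]; first by rewrite odd2 !mulr0.
move: s0; rewrite le_eqVlt => /orP[/eqP <-|s0]; first by rewrite odd1 mul0r mulr0.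
have [b [/andP[b0 bt] eb]] := mvt t0 (fun (u : R) _ => L2 s u _ _ z (hz (s, u))).
have [a [/andP[a0 as_] ea]] := mvt s0 (fun (u : R) _ => L1 u b _ _ z2 (hz2 (u, b))).
rewrite odd2 !subr0 in eb; rewrite z20 !subr0 in ea.
rewrite eb ea -mulrA; apply: ler_wpM2r; first by rewrite mulr_ge0 ?ltW.
apply: le_trans (ler_norm _) _; apply: my; rewrite /= ?(ltW a0) ?(ltW b0)/=.
 by rewrite (le_trans (ltW as_)).
by rewrite (le_trans (ltW bt)).
Qed.

(** Take the largest ratio m of z to [Phi] over a truncated square. The corner and the region at
    infinity are then dominated as well, so z <= m Phi on the whole quarter plane with equality at
    an interior point, where the Laplacian of z - m Phi is strictly positive. *)
Lemma quarter_le x : 0 < x.1 -> 0 < x.2 -> z x <= 0.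
Proof.
move: x => y0 y01 y02; rewrite leNgt; apply/negP => zy0.
have zp x : 0 <= x.1 -> 0 <= x.2 -> 0 < z x -> 0 < x.1 /\ 0 < x.2.
 move=> x1 x2 zx; rewrite !lt_neqAle x1 x2 !andbT; split; apply/eqP => E; move: zx.
  by rewrite (_ : x = (0, x.2)) ?odd1 ?ltxx//; apply: pt_eq.
 by rewrite (_ : x = (x.1, 0)) ?odd2 ?ltxx//; apply: pt_eq.
have [rho rho0 hrho] := Vp_far.
have [W W0 hW] := bz.
have [e [p0 [e0 p00 hp]]] := pr_near0.
pose B := rho + y0.1 + y0.2.
have Brho : rho < B by rewrite /B; lran.
have B0 : 0 < B by rewrite /B; lran.
have [K K0 hK] := z_loc (ltW B0).
have nz (y : R * R) : 0 < y.1 + y.2 -> y != 0.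
 by move=> h; apply/eqP => e'; move: h; rewrite e' addr0 ltxx.
have y0n : y0 != 0 by apply: nz; exact: addr_gt0.
have P0 := Phi_gt0 y0n (ltW y01) (ltW y02).
pose m0 := z y0 / Phi y0.
have m00 : 0 < m0 by exact: divr_gt0.
have Kp : 0 < K + 1 by lran.
(* The three bounds put the corner where [pr >= p0], keep y0 outside it, and give K d <= m0 p0. *)
pose d := Num.min (Num.min e (y0.1 + y0.2)) (m0 * p0 / (K + 1)) / 2.
have mn : 0 < Num.min (Num.min e (y0.1 + y0.2)) (m0 * p0 / (K + 1)).
 by rewrite !lt_min e0 addr_gt0//= divr_gt0// mulr_gt0.
have d0 : 0 < d by rewrite divr_gt0.
have [de dy dK] : [/\ d < e, d < y0.1 + y0.2 & K * d <= m0 * p0].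
 have h1 : d < Num.min (Num.min e (y0.1 + y0.2)) (m0 * p0 / (K + 1)) by rewrite /d; lran.
 move: h1; rewrite !lt_min => /andP[/andP[h1 h2] h3]; split => //.
 move: h3; rewrite ltr_pdivlMr// => h3; have : d * (K + 1) = K * d + d by ring.
 by lran.
have dB : d < B by rewrite /B; lran.
have cy0 : cut d B y0 by split; [rewrite /B; lran|rewrite /B; lran|exact: ltW].
have cz : continuous z by move=> y; exact: hg_cont (hz y).
have cutn d' B' y : 0 < d' -> cut d' B' y -> y != 0.
 by move=> d'0 [_ _ h]; apply: nz; lran.
have cratio y : cut d B y -> {for y, continuous (fun y => z y / Phi y)}.
 move=> hy; have yn := cutn _ _ _ d0 hy; have [/andP[h1 _] /andP[h2 _] _] := hy.
 apply: cvgM; first exact: cz.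
 apply: cvgV; last exact: Phi_cont.
 by rewrite gt_eqF// Phi_gt0.
have [xs [hxs mx]] := cut_max (ex_intro _ y0 cy0) cratio.
set m := z xs / Phi xs in mx.
have mm0 : m0 <= m by exact: mx.
have m_gt0 : 0 < m by lran.
(* In the corner, z <= K y.1 y.2 <= K d (y.1 + y.2) <= m0 p0 (y.1 + y.2) <= m0 Phi. *)
have inB y : y != 0 -> 0 <= y.1 <= B -> 0 <= y.2 <= B -> z y <= m * Phi y.
 move=> yn hy1 hy2; have [y1 _] := andP hy1; have [y2 _] := andP hy2.
 have Py := Phi_gt0 yn y1 y2.
 case: (leP d (y.1 + y.2)) => hd.
  by rewrite -ler_pdivrMr//; apply: mx; split.
 apply: le_trans (hK y hy1 hy2) _.
 have ye : enorm2 y < e.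
  by apply: le_lt_trans (enorm2_le_sum y) _; rewrite !ger0_norm//; lran.
 have hpr := hp y yn ye.
 have ry := enorm2_gt0 yn.
 have s1 : K * (y.1 * y.2) <= K * d * (y.1 + y.2).
  rewrite -mulrA; apply: ler_wpM2l => //.
  apply: (@le_trans _ _ (y.1 * d)); first by apply: ler_wpM2l => //; lran.
  by rewrite mulrC; apply: ler_wpM2l; [exact: ltW|lran].
 apply: le_trans s1 _; apply: (@le_trans _ _ (m0 * p0 * (y.1 + y.2))).
  by apply: ler_wpM2r => //; exact: addr_ge0.
 apply: (@le_trans _ _ (m0 * Phi y)); last by apply: ler_wpM2r => //; exact: ltW.
 rewrite -mulrA; apply: ler_wpM2l; first exact: ltW.
 rewrite PhiE//; apply: ler_pM => //; [exact: ltW|exact: addr_ge0|].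
 by rewrite lerDl; apply: divr_ge0; [exact: mulr_ge0|exact: ltW].
(* Outside the square of side B the potential is at least 1/2. Subtracting [ep * kos] confines a
   positive maximum to the interior of a larger square, and there 1/2 beats the 1/16 of [kos]. *)
have all y : 0 <= y.1 -> 0 <= y.2 -> y != 0 -> z y <= m * Phi y.
 move=> y1 y2 yn; rewrite -subr_le0; apply/ler_addgt0Pr => eps eps0; rewrite add0r.
 pose ep := eps / kos y.
 have ep0 : 0 < ep by rewrite divr_gt0 ?kos_gt0.
 suff : z y - m * Phi y - ep * kos y <= 0 by rewrite /ep divfK ?gt_eqF ?kos_gt0//; lran.
 pose f x := z x - m * Phi x - ep * kos x.
 rewrite -/(f y) leNgt; apply/negP => fy.
 pose B' := B + y.1 + y.2 + 4 * W / ep.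
 have We : 0 <= 4 * W / ep by apply: divr_ge0; [exact: mulr_ge0|exact: ltW].
 have yB : ~ (y.1 <= B /\ y.2 <= B).
  move=> [h1 h2]; have := inB y yn; rewrite y1 y2 h1 h2 => /(_ isT isT).
  by move: fy; rewrite /f; have := mulr_gt0 ep0 (kos_gt0 y); lran.
 have cy : cut d B' y.
  split; [rewrite y1/= /B'; lran|rewrite y2/= /B'; lran|].
  rewrite leNgt; apply/negP => h; apply: yB; split; lran.
 have cf x : cut d B' x -> {for x, continuous f}.
  move=> hx; have xn := cutn _ _ _ d0 hx.
  apply: cvgB; first apply: cvgB; first exact: cz.
   by apply: cvgMl_tmp; exact: Phi_cont.
  by apply: cvgMl_tmp; exact: kos_cont.
 have [x [hx mf]] := cut_max (ex_intro _ y cy) cf.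
 have fx : 0 < f x := lt_le_trans fy (mf y cy).
 have xn := cutn _ _ _ d0 hx.
 have [/andP[x1 x1B] /andP[x2 x2B] xd] := hx.
 have Px := Phi_gt0 xn x1 x2.
 have mP : 0 < m * Phi x by exact: mulr_gt0.
 have ek : 0 < ep * kos x by rewrite mulr_gt0 ?kos_gt0.
 have zx : 0 < z x by move: fx mP ek; rewrite /f; lran.
 have [x1p x2p] := zp _ x1 x2 zx.
 have xout : ~ (x.1 <= B /\ x.2 <= B).
  move=> [h1 h2]; have := inB x xn; rewrite x1 x2 h1 h2 => /(_ isT isT).
  by move: fx ek; rewrite /f; lran.
 have [k1 k2] := kos_ge x.
 have side (t : R) : 0 <= t -> 1 + `|t| / 4 <= kos x -> t < B'.
  move=> t0 ht; rewrite ltNge; apply/negP => h.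
  have : W <= ep * kos x.
   apply: (@le_trans _ _ (ep * (1 + `|t| / 4))); last by rewrite ler_pM2l.
   have : 4 * W / ep <= t by move: h y1 y2 B0; rewrite /B'; lran.
   by rewrite ler_pdivrMr// ger0_norm// mulrDr mulr1; move: ep0; lran.
  by have := le_trans (ler_norm _) (hW x); move: fx mP; rewrite /f; lran.
 have x1l := side _ x1 k1; have x2l := side _ x2 k2.
 have xs_d : d < x.1 + x.2.
  rewrite ltNge; apply/negP => h; apply: xout; split; apply: le_trans (ltW dB); apply: le_trans h.
   by rewrite lerDl.
  by rewrite lerDr.
 have xrho : rho < enorm2 x.
  rewrite ltNge; apply/negP => h; apply: xout.
  by split; apply: le_trans (ltW Brho); apply: le_trans h; apply: le_trans (ler_norm _) _; [exact: abs1_le|exact: abs2_le].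
 have VV := hrho x xrho.
 have [b1 [b2 [a11 [a22 [hP lP]]]]] := h2_Phi xn.
 have [c1 [c2 [d11 [d22 [hk lk]]]]] := h2_kos x.
 have hf := h2B (h2B (h2z x) (h2Z m hP)) (h2Z ep hk).
 have [|_ _ l1 l2] := h2_max hf.
  have c1' := @fst_cont R x; have c2' := @snd_cont R x.
  have cs : {for x, continuous (fun u : R * R => u.1 + u.2)} by exact: cvgD c1' c2'.
  have n1 : \forall u \near x, 0 < u.1 by exact: cvgr_gt c1' _ x1p.
  have n2 : \forall u \near x, 0 < u.2 by exact: cvgr_gt c2' _ x2p.
  have n3 : \forall u \near x, u.1 < B' by exact: cvgr_lt c1' _ x1l.
  have n4 : \forall u \near x, u.2 < B' by exact: cvgr_lt c2' _ x2l.
  have n5 : \forall u \near x, d < u.1 + u.2 by exact: cvgr_gt cs _ xs_d.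
  near=> u; apply: mf; split; [apply/andP; split|apply/andP; split|]; apply: ltW; near: u => //.
 have S0 : 0 <= 3 * pr x * (x.1 * x.2) / enorm2 x ^+ 3.
  apply: divr_ge0; last by rewrite exprn_ge0// enorm2_ge0.
  by apply: mulr_ge0; [apply: mulr_ge0 => //; exact: ltW (pr_gt0 xn)|exact: mulr_ge0].
 have mS : 0 <= m * (3 * pr x * (x.1 * x.2) / enorm2 x ^+ 3) by rewrite mulr_ge0// ltW.
 have Vf : 2^-1 * (z x - m * Phi x) <= Vp x * (z x - m * Phi x).
  by move: fx; rewrite /f => fx; apply: ler_wpM2r VV; move: fx ek; lran.
 have T : (z11 x - m * a11 - ep * d11) + (z22 x - m * a22 - ep * d22) =
   Vp x * (z x - m * Phi x) + m * (3 * pr x * (x.1 * x.2) / enorm2 x ^+ 3) - ep * kos x / 16.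
  transitivity ((z11 x + z22 x) - m * (a11 + a22) - ep * (d11 + d22)); first by ring.
  by rewrite lapz lP lk; field; rewrite gt_eqF// enorm2_gt0.
 move: T Vf mS fx l1 l2; rewrite /f; clear -ek; move: (ep * kos x) (m * (3 * pr x * _ / _)) (Vp x * _) ek => A S V ek T Vf mS fx l1 l2.
 by lran.
have xsn := cutn _ _ _ d0 hxs.
have [/andP[x1 x1B] /andP[x2 x2B] xd] := hxs.
have Px := Phi_gt0 xsn x1 x2.
have zxs : z xs = m * Phi xs by rewrite /m divfK// gt_eqF.
have zx : 0 < z xs by rewrite zxs mulr_gt0.
have [x1p x2p] := zp _ x1 x2 zx.
have [b1 [b2 [a11 [a22 [hP lP]]]]] := h2_Phi xsn.
have hf := h2B (h2z xs) (h2Z m hP).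
have [|_ _ l1 l2] := h2_max hf.
 have c1' := @fst_cont R xs; have c2' := @snd_cont R xs.
 have n1 : \forall u \near xs, 0 < u.1 by exact: cvgr_gt c1' _ x1p.
 have n2 : \forall u \near xs, 0 < u.2 by exact: cvgr_gt c2' _ x2p.
 near=> u; rewrite zxs subrr subr_le0.
 have u1 : 0 < u.1 by near: u.
 have u2 : 0 < u.2 by near: u.
 by apply: all; [exact: ltW|exact: ltW|apply: nz; exact: addr_gt0].
have S0 : 0 < m * (3 * pr xs * (xs.1 * xs.2) / enorm2 xs ^+ 3).
 apply: mulr_gt0 => //; apply: divr_gt0; last by rewrite exprn_gt0// enorm2_gt0.
 by apply: mulr_gt0; [apply: mulr_gt0 => //; exact: pr_gt0|exact: mulr_gt0].
(* At the touching point the potential terms cancel and only the strict defect of [Phi] survives. *)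
have T : (z11 xs - m * a11) + (z22 xs - m * a22) = m * (3 * pr xs * (xs.1 * xs.2) / enorm2 xs ^+ 3).
 transitivity ((z11 xs + z22 xs) - m * (a11 + a22)); first by ring.
 by rewrite lapz lP zxs; ring.
by have := lerD l1 l2; rewrite T addr0 leNgt S0.
Unshelve. all: by end_near. Qed.

End Z.

End Quarter.

(** * Nondegeneracy of the linearised operator on even functions *)

Section Nondeg.
Variable R : realType.
Local Notation J := (@jap R).
Local Notation phi := (@barrier R).
Implicit Types (f g h : R * R -> R) (x y z v xi : R * R).
Variables (Q : R * R -> R) (hQ : positive_radial_solution Q).
Local Notation q := (qr Q).
Local Notation q1 := (qr1 Q).
Local Notation g0 := (g0 Q).
Local Notation Qd := (Wd g0).
Local Notation Vp := (Vp Q).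

Section Kernel.
Variable h : R * R -> R.
Hypotheses (Sh : Sz h) (ker : forall xi, J xi * h xi = 3 * cnv (cnv g0 g0) h xi).
Local Notation W := (Wd h).
Let rh := Sz_rap Sh.

Lemma W_lap x : W 2 0 x + W 0 2 x = Vp x * W 0 0 x.
Proof.
have sg := g0_Sz hQ; have sgg := Sz_conv sg sg; have sc := Sz_conv sgg Sh.
have := Wd_lap x rh; have -> : FI (fun xi => J xi * h xi) x = 3 * (Q x * Q x) * FI h x.
 rewrite (_ : (fun xi => _) = (fun xi => 3 * cnv (cnv g0 g0) h xi)); last exact/funext.
 by rewrite (FIZ 3 x (Sz_Int sc)) (FI_convS x sgg Sh) (FI_convS x sg sg) (FI_g0 hQ) mulrA.
rewrite -Wd00 /Vp => e.
have al (a b c : R) : a - b = c -> b = a - c by move=> <-; ring.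
by rewrite (al _ _ _ e); ring.
Qed.

Lemma W_lap1 x : W 3 0 x + W 1 2 x = Vp x * W 1 0 x - 6 * Q x * Qd 1 0 x * W 0 0 x /\
 W 2 1 x + W 0 3 x = Vp x * W 0 1 x - 6 * Q x * Qd 0 1 x * W 0 0 x.
Proof.
have k := hgD (Wd_hg 2 0 x rh) (Wd_hg 0 2 x rh).
have hV : hg (fun z => 1 - 3 * (Q z * Q z)) x _ _ := hgB (hg_cst 1 x) (hgZ 3 (hgM (Qd_hg hQ x) (Qd_hg hQ x))).
have k' := hgM hV (Wd_hg 0 0 x rh).
have E z : (1 - 3 * (Q z * Q z)) * W 0 0 z = W 2 0 z + W 0 2 z by rewrite W_lap /Vp; ring.
have [-> ->] := hg_uniq k (hg_ext E k'); rewrite /Vp.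
have al (a d u v : R) : (0 - 3 * (d * a + a * d)) * u + (1 - 3 * (a * a)) * v = (1 - 3 * a ^+ 2) * v - 6 * a * d * u by ring.
by split; exact: al.
Qed.

Lemma decay_abs w (Wb F rho : R) : 0 <= rho -> 0 <= F -> continuous w -> (forall x, `|w x| <= Wb) ->
 (forall x, rho < enorm2 x -> exists b1 b2 a11 a22 (s : R), [/\ h2 w x b1 b2 a11 a22,
   a11 + a22 = Vp x * w x + s & `|s| <= F * phi x]) ->
 (forall x, rho < enorm2 x -> 2^-1 <= Vp x) ->
 exists2 C : R, 0 <= C & forall x, `|w x| <= C * phi x.
Proof.
move=> rho0 F0 cw wW hw hV.
pose C := 4 * F + Wb / expR (- (Num.sqrt (1 + rho ^+ 2) / 2)).
have W0 : 0 <= Wb := le_trans (normr_ge0 _) (wW 0).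
exists C; first by apply: addr_ge0; [exact: mulr_ge0|apply: divr_ge0 => //; exact: expR_ge0].
move=> x.
have h1 : w x <= C * phi x.
 apply: decay_le => // y hy wy; have [b1 [b2 [a11 [a22 [f [k1 k2 k3]]]]]] := hw y hy.
 exists b1, b2, a11, a22; split => //; rewrite k2.
 have : 2^-1 * w y <= Vp y * w y by apply: ler_wpM2r; [exact: ltW|exact: hV].
 by move: k3; rewrite ler_norml => /andP[k3 _] k4; lra.
have h2 : - w x <= C * phi x.
 apply: (@decay_le _ (fun x => - w x)) => //.
 - by move=> y; apply: cvgN; exact: cw.
 - by move=> y; rewrite normrN.
 move=> y hy wy; have [b1 [b2 [a11 [a22 [f [k1 k2 k3]]]]]] := hw y hy.
 have k1' := h2Z (-1) k1.
 do 4 eexists; split; first by apply: h2_ext k1' => z; rewrite mulN1r.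
 rewrite !mulN1r -opprD k2.
 have : 2^-1 * (- w y) <= Vp y * (- w y) by apply: ler_wpM2r; [exact: ltW|exact: hV].
 by move: k3; rewrite ler_norml => /andP[_ k3] k4; lra.
by rewrite ler_norml h1 andbT lerNl.
Qed.

Lemma W_decay : exists2 C : R, 0 <= C & forall x, [/\ `|W 0 0 x| <= C * phi x, `|W 1 0 x| <= C * phi x & `|W 0 1 x| <= C * phi x].
Proof.
have [rho rho0 hrho] := Vp_far hQ.
have [B0 B00 hB0] := Wd_bdd 0 0 rh; have [B1 B10 hB1] := Wd_bdd 1 0 rh; have [B2 B20 hB2] := Wd_bdd 0 1 rh.
have [D D0 hD] := Qd1_decay hQ.
have hQ1 x : `|Qd 1 0 x| <= D * phi x /\ `|Qd 0 1 x| <= D * phi x.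
 by have [-> ->] := hg_uniq (Qd_hg hQ x) (Qhg hQ x); exact: hD.
have q00 : 0 <= q 0 by rewrite ltW// qr_pos.
pose F := 6 * q 0 * B0 * D.
have F0 : 0 <= F by do 3 (apply: mulr_ge0 => //).
have fF x d : `|d| <= D * phi x -> `|- (6 * Q x * d * W 0 0 x)| <= F * phi x.
 have al (a c w A E K : R) : `|a| <= A -> `|c| <= E -> `|w| <= K -> `|- (6 * a * c * w)| <= 6 * A * E * K.
  move=> ha hc hw; rewrite normrN !normrM (ger0_norm (_ : 0 <= 6))//.
  apply: ler_pM; [by do 2 (apply: mulr_ge0 => //)|exact: normr_ge0| |exact: hw].
  by apply: ler_pM; [apply: mulr_ge0|exact: normr_ge0|apply: ler_wpM2l|exact: hc].
 move=> hd; have -> : F * phi x = 6 * q 0 * (D * phi x) * B0 by rewrite /F; ring.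
 exact: al (Q_le hQ x) hd (hB0 x).
have [C0 C00 hC0] : exists2 C : R, 0 <= C & forall x, `|W 0 0 x| <= C * phi x.
 apply: (@decay_abs (W 0 0) B0 0 rho (ltW rho0) (lexx _) (Wd_cont (a := 0) (b := 0) rh) hB0) => // x hx.
 do 4 eexists; exists 0; split; [exact: Wd_h2|by rewrite addr0 W_lap|by rewrite normr0 mul0r].
have [C1 C10 hC1] : exists2 C : R, 0 <= C & forall x, `|W 1 0 x| <= C * phi x.
 apply: (@decay_abs (W 1 0) B1 F rho (ltW rho0) F0 (Wd_cont (a := 1) (b := 0) rh) hB1) => // x hx.
 have [e1 e2] := W_lap1 x; have [k1 k2] := hQ1 x.
 do 4 eexists; exists (- (6 * Q x * Qd 1 0 x * W 0 0 x)); split; [exact: Wd_h2|exact: e1|exact: fF].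
have [C2 C20 hC2] : exists2 C : R, 0 <= C & forall x, `|W 0 1 x| <= C * phi x.
 apply: (@decay_abs (W 0 1) B2 F rho (ltW rho0) F0 (Wd_cont (a := 0) (b := 1) rh) hB2) => // x hx.
 have [e1 e2] := W_lap1 x; have [k1 k2] := hQ1 x.
 do 4 eexists; exists (- (6 * Q x * Qd 0 1 x * W 0 0 x)); split; [exact: Wd_h2|exact: e2|exact: fF].
exists (C0 + C1 + C2); first by rewrite !addr_ge0.
move=> x; have p := ltW (phi_gt0 x).
have P (t : R) : 0 <= t -> 0 <= t * phi x by move=> t0; exact: mulr_ge0.
rewrite (mulrDl (C0 + C1)) (mulrDl C0).
have p0 := P _ C00; have p1 := P _ C10; have p2 := P _ C20.
have al (a b c : R) : 0 <= a -> 0 <= b -> 0 <= c -> [/\ a <= a + b + c, b <= a + b + c & c <= a + b + c].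
 by clear; move=> *; split; lra.
have [a0 a1 a2] := al _ _ _ p0 p1 p2.
by split; [exact: le_trans (hC0 x) a0|exact: le_trans (hC1 x) a1|exact: le_trans (hC2 x) a2].
Qed.

Lemma W_evn x : W 0 0 (- x) = W 0 0 x. Proof. by rewrite !Wd00 FI_evn. Qed.

Lemma W_odd x : W 1 0 (- x) = - W 1 0 x /\ W 0 1 (- x) = - W 0 1 x.
Proof.
have k := hg_opp (Wd_hg 0 0 (- x) rh).
have [e1 e2] := hg_uniq (hg_ext (fun z => W_evn z) k) (Wd_hg 0 0 x rh).
by rewrite -e1 -e2 !opprK.
Qed.

Lemma refl_enorm x : enorm2 (refl x) = enorm2 x.
Proof. by rewrite /enorm2 /dot2 /= mulrNN. Qed.
Lemma Vp_refl x : Vp (refl x) = Vp x.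
Proof. by rewrite /Vp !(Qrad hQ) refl_enorm. Qed.

(** Odd under reflection and even under the half turn, z vanishes on both axes; the one-sided bound
    on the open quarter applies to z and to - z, and symmetry covers the other quarters. *)
Lemma quarter0 (z z1 z2 z12 z11 z22 : R * R -> R) : (forall x, hg z x (z1 x) (z2 x)) -> (forall x, hg z2 x (z12 x) (z22 x)) ->
 (forall x, h2 z x (z1 x) (z2 x) (z11 x) (z22 x)) -> continuous z12 ->
 (forall x, z11 x + z22 x = Vp x * z x) -> (forall x, z (refl x) = - z x) -> (forall x, z (- x) = z x) ->
 (exists2 Wb : R, 0 <= Wb & forall x, `|z x| <= Wb) -> forall x, z x = 0.
Proof.
move=> hz hz2 h2z cz lz zr ze bz.
have self (t : R) : t = - t -> t = 0 by move=> e; lra.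
have o1 (t : R) : z (0, t) = 0.
 apply: self; rewrite -zr -[RHS]ze; congr z; apply: pt_eq => /=; rewrite ?oppr0 ?opprK//.
have o2 (t : R) : z (t, 0) = 0.
 by apply: self; rewrite -zr; congr z; apply: pt_eq => //=; rewrite oppr0.
have pos x : 0 < x.1 -> 0 < x.2 -> z x = 0.
 move=> x1 x2; apply/eqP; rewrite eq_le; apply/andP; split.
  exact: (quarter_le hQ hz hz2 h2z cz lz o1 o2 bz x1 x2).
 rewrite -oppr_le0.
 have [Wb W0 hW] := bz.
 apply: (@quarter_le R Q hQ (fun x => - z x) (fun x => - z1 x) (fun x => - z2 x) (fun x => - z12 x) (fun x => - z11 x) (fun x => - z22 x)) => //.
 - by move=> y; exact: hgN.
 - by move=> y; exact: hgN.
 - by move=> y; have k := h2Z (-1) (h2z y); rewrite !mulN1r in k; apply: h2_ext k => u; rewrite mulN1r.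
 - by move=> y; apply: cvgN; exact: cz.
 - by move=> y; rewrite -opprD lz mulrN.
 - by move=> t; rewrite o1 oppr0.
 - by move=> t; rewrite o2 oppr0.
 - by exists Wb => // y; rewrite normrN.
have pos2 x : 0 < x.1 -> z x = 0.
 move=> x1; case: (ltrgtP x.2 0) => x2.
 - have := pos (refl x); rewrite /= oppr_gt0 => /(_ x1 x2); rewrite zr => /eqP; by rewrite oppr_eq0 => /eqP.
 - exact: pos.
 - by rewrite (_ : x = (x.1, 0)) ?o2//; apply: pt_eq.
move=> x; case: (ltrgtP x.1 0) => x1.
- by rewrite -ze; apply: pos2; rewrite oppr_gt0.
- exact: pos2.
- by rewrite (_ : x = (0, x.2)) ?o1//; apply: pt_eq.
Qed.

Lemma W_refl x : W 0 0 (refl x) = W 0 0 x.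
Proof.
have [B B0 hB] := Wd_bdd 0 0 rh.
apply/esym/eqP; rewrite -subr_eq0; apply/eqP.
pose z x := W 0 0 x - W 0 0 (refl x).
pose z1 x := W 1 0 x - W 1 0 (refl x); pose z2 x := W 0 1 x - - W 0 1 (refl x).
pose z11 x := W 2 0 x - W 2 0 (refl x); pose z12 x := W 1 1 x - - W 1 1 (refl x).
pose z22 x := W 0 2 x - W 0 2 (refl x).
have H a b y := hg_refl (Wd_hg a b (refl y) rh).
have hz y : hg z y (z1 y) (z2 y) by exact: hgB (Wd_hg 0 0 y rh) (H 0 0 y)%N.
have hz1 y : hg z1 y (z11 y) (z12 y) by exact: hgB (Wd_hg 1 0 y rh) (H 1 0 y)%N.
have hz2 y : hg z2 y (z12 y) (z22 y).
 by apply: (hg_eq (hgB (Wd_hg 0 1 y rh) (hgN (H 0 1 y)%N))); rewrite // opprK.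
have h2z y : h2 z y (z1 y) (z2 y) (z11 y) (z22 y).
 by exists z1, z2, (z12 y), (z12 y); split => //; apply: near2W.
apply: (@quarter0 z z1 z2 z12 z11 z22) => //.
- move=> y; apply: cvgB; first exact: Wd_cont.
 by apply: cvgN; apply: (@continuous_comp _ _ _ (@refl R) (W 1 1)); [exact: refl_cont|exact: Wd_cont].
- move=> y; rewrite /z11 /z22 /z.
 have := W_lap y; have := W_lap (refl y); rewrite Vp_refl => e1 e2.
 have al (a b c d u v t : R) : c + d = t * v -> a + b = t * u -> (a - c) + (b - d) = t * (u - v).
  by move=> k1 k2; rewrite mulrBr -k1 -k2; ring.
 exact: al e1 e2.
- by move=> y; rewrite /z (_ : refl (refl y) = y) ?opprB//; apply: pt_eq => //=; rewrite opprK.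
- move=> y; rewrite /z W_evn (_ : refl (- y) = - refl y); last by apply: pt_eq => /=.
 by rewrite W_evn.
- exists (B + B); first exact: addr_ge0.
 by move=> y; apply: normB_le; exact: lerD.
Qed.

Lemma W_refl1 x : W 1 0 (refl x) = W 1 0 x /\ W 0 1 (refl x) = - W 0 1 x.
Proof.
have k := hg_refl (Wd_hg 0 0 (refl x) rh).
have [e1 e2] := hg_uniq (hg_ext W_refl k) (Wd_hg 0 0 x rh).
by rewrite -e1 -e2 opprK.
Qed.

(** The angular derivative commutes with the linearised operator, since Q is radial. By [W_refl] it
    is odd under reflection, so it vanishes and the kernel element is radial. *)
Lemma W_tan x : x.1 * W 0 1 x = x.2 * W 1 0 x.
Proof.
apply: subr0_eq; rewrite -[LHS]/((fun x => x.1 * W 0 1 x - x.2 * W 1 0 x) x).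
have [C C0 hC] := W_decay; have [D D0 hD] := phi_J R 1.
pose z x := x.1 * W 0 1 x - x.2 * W 1 0 x.
pose z1 x := 1 * W 0 1 x + x.1 * W 1 1 x - (0 * W 1 0 x + x.2 * W 2 0 x).
pose z2 x := 0 * W 0 1 x + x.1 * W 0 2 x - (1 * W 1 0 x + x.2 * W 1 1 x).
have hz y : hg z y (z1 y) (z2 y) := hgB (hgM (hg_fst y) (Wd_hg 0 1 y rh)) (hgM (hg_snd y) (Wd_hg 1 0 y rh)).
have hz1 y := hgB (hgD (hgM (hg_cst 1 y) (Wd_hg 0 1 y rh)) (hgM (hg_fst y) (Wd_hg 1 1 y rh)))
  (hgD (hgM (hg_cst 0 y) (Wd_hg 1 0 y rh)) (hgM (hg_snd y) (Wd_hg 2 0 y rh))).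
have hz2 y := hgB (hgD (hgM (hg_cst 0 y) (Wd_hg 0 1 y rh)) (hgM (hg_fst y) (Wd_hg 0 2 y rh)))
  (hgD (hgM (hg_cst 1 y) (Wd_hg 1 0 y rh)) (hgM (hg_snd y) (Wd_hg 1 1 y rh))).
pose z11 x := 2 * W 1 1 x + x.1 * W 2 1 x - x.2 * W 3 0 x.
pose z12 x := W 0 2 x + x.1 * W 1 2 x - W 2 0 x - x.2 * W 2 1 x.
pose z22 x := x.1 * W 0 3 x - 2 * W 1 1 x - x.2 * W 1 2 x.
have al11 (a b c d e f s t : R) : 0 * a + 1 * b + (1 * b + s * c) - (0 * d + 0 * e + (0 * e + t * f)) = 2 * b + s * c - t * f by ring.
have al22 (a b c d e f s t : R) : 0 * a + 0 * b + (0 * b + s * c) - (0 * d + 1 * e + (1 * e + t * f)) = s * c - 2 * e - t * f by ring.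
have al12 (a b c d e f g s t : R) : 0 * a + 0 * b + (1 * c + s * d) - (0 * e + 1 * f + (0 * b + t * g)) = c + s * d - f - t * g by ring.
have hz1' y : exists a, hg z1 y (z11 y) a by eexists; apply: (hg_eq (hz1 y) _ erefl); exact: al11.
have hz2' y : hg z2 y (z12 y) (z22 y) by apply: (hg_eq (hz2 y)); [exact: al12|exact: al22].
have cf := @fst_cont R; have cs := @snd_cont R.
move: x; apply: (@quarter0 z z1 z2 z12 z11 z22) => //.
- move=> y; have [a ha] := hz1' y; exists z1, z2, a, (z12 y); split => //; by apply: near2W.
- move=> y; apply: cvgB; last by apply: cvgM; [exact: cs|exact: Wd_cont].
 apply: cvgB; last exact: Wd_cont.
 by apply: cvgD; [exact: Wd_cont|apply: cvgM; [exact: cf|exact: Wd_cont]].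
- move=> y; rewrite /z11 /z22 /z; have [e1 e2] := W_lap1 y; have e3 := Qd_tan hQ y.
 have al (a1 a2 a3 b c d V k u1 u2 s t w0 wx wy : R) :
   b + c = V * wx - k * u1 * w0 -> a2 + a3 = V * wy - k * u2 * w0 -> s * u2 = t * u1 ->
   2 * a1 + s * a2 - t * b + (s * a3 - 2 * a1 - t * c) = V * (s * wy - t * wx).
  move=> k1 k2 k3; transitivity (s * (a2 + a3) - t * (b + c)); first by ring.
  rewrite k1 k2; transitivity (V * (s * wy - t * wx) - k * w0 * (s * u2 - t * u1)); first by ring.
  by rewrite k3 subrr mulr0 subr0.
 exact: al e1 e2 e3.
- move=> y; rewrite /z; have [-> ->] := W_refl1 y.
 by rewrite /=; ring.
- by move=> y; rewrite /z; have [-> ->] := W_odd y; rewrite !pE !mulrNN.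
- exists (C * D + C * D); first by apply: addr_ge0; exact: mulr_ge0.
 have P y : J y * phi y <= D.
  by have := hD y; rewrite expr1 ler_pdivlMr ?J_gt0// mulrC.
 move=> y; have [_ h1 h2] := hC y; apply: normB_le.
 have B (t d : R) : `|t| <= J y -> `|d| <= C * phi y -> `|t * d| <= C * D.
  move=> k1 k2; rewrite normrM; apply: le_trans (ler_pM _ _ k1 k2) _ => //.
  by rewrite mulrCA; apply: ler_wpM2l.
 by apply: lerD; apply: B => //; [exact: abs1_le_J|exact: abs2_le_J].
Qed.

Lemma ray_lim (f : R -> R) (C : R) : 0 <= C -> (forall r, 0 <= r -> `|f r| <= C * (J (r, 0) ^+ 2 * phi (r, 0))) ->
 forall e : R, 0 < e -> exists2 rho : R, 0 < rho & forall r, rho < r -> `|f r| < e.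
Proof.
move=> C0 hf e e0; have [D D0 hD] := phi_J R 3.
have CD : 0 <= C * D by exact: mulr_ge0.
exists ((C * D + 1) / e + 1); first by apply: addr_gt0 => //; apply: divr_gt0 => //; lra.
move=> r hr.
have r1 : 1 < r by apply: lt_trans hr; rewrite ltrDr divr_gt0//; lra.
have r0 : 0 <= r by lra.
apply: le_lt_trans (hf r r0) _.
have Jr : r < J (r, 0).
 rewrite /jap /dot2 /= mulr0 addr0.
 have : r * 1 < r * r by rewrite ltr_pM2l//; lra.
 by lra.
have J0 := J_gt0 (r, 0 : R).
apply: (@le_lt_trans _ _ (C * D / J (r, 0))).
 rewrite -mulrA; apply: ler_wpM2l => //.
 have := hD (r, 0); rewrite !ler_pdivlMr ?exprn_gt0// => hh.
 by rewrite mulrAC -exprSr mulrC.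
rewrite ltr_pdivrMr//; apply: (@lt_trans _ _ (e * r)); last by rewrite ltr_pM2l.
have : (C * D + 1) / e < r by lra.
by rewrite ltr_pdivrMr// mulrC; lra.
Qed.

(** Along a unit direction the radial kernel element solves the ODE of [pos_contra], with Wronskians
    tending to 0 by [W_decay]. Applied to v and to - v this gives v 0 = 0, and [zero_data]
    finishes. *)
Lemma ray_zero (e : R * R) : dot2 e e = 1 -> forall r, 0 <= r -> W 0 0 (r *: e) = 0.
Proof.
move=> ee.
have Er (r : R) : enorm2 (r *: e) = `|r|.
 rewrite /enorm2 (_ : dot2 (r *: e) (r *: e) = r ^+ 2) ?sqrtr_sqr//.
 by transitivity (r ^+ 2 * dot2 e e); [rewrite /dot2 /= !scaleRE; ring|rewrite ee mulr1].
pose v (r : R) := W 0 0 (r *: e).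
pose v1 (r : R) := W 1 0 (r *: e) * e.1 + W 0 1 (r *: e) * e.2.
pose v2 (r : R) := (W 2 0 (r *: e) * e.1 + W 1 1 (r *: e) * e.2) * e.1 + (W 1 1 (r *: e) * e.1 + W 0 2 (r *: e) * e.2) * e.2.
have L p (t a b : R) : hg p (t *: e) a b -> is_derive t (1 : R) (fun s : R => p (s *: e)) (a * e.1 + b * e.2).
 move=> hp; have := @hg_line R p 0 e a b t; rewrite add0r => /(_ hp).
 by rewrite (_ : (fun s : R => p (0 + s *: e)) = (fun s : R => p (s *: e)))//; apply/funext => s; rewrite add0r.
have dv t : is_derive t (1 : R) v (v1 t) := L _ _ _ _ (Wd_hg 0 0 _ rh).
have Z (p : R -> R) (t k d : R) : is_derive t (1 : R) p d -> is_derive t (1 : R) (fun s => p s * k) (d * k).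
 by move=> dp; have hk := drvM dp (drv_cst k t); apply: (drv_eq hk); rewrite mulr0 addr0.
have dv1 t : is_derive t (1 : R) v1 (v2 t) := drvD (Z _ _ e.1 _ (L _ _ _ _ (Wd_hg 1 0 _ rh))) (Z _ _ e.2 _ (L _ _ _ _ (Wd_hg 0 1 _ rh))).
have qe (r : R) : Q (r *: e) = q r.
 rewrite (Qrad hQ) Er; case: (leP 0 r) => r0; first by rewrite ger0_norm.
 by rewrite ltr0_norm// /qr -(Q_evn hQ); congr Q; apply: pt_eq => //=; rewrite ?opprK ?oppr0.
(* Both partial derivatives of the identity [W_tan] convert the second derivative along the ray into
   the full Laplacian. *)
have odev r : r * v2 r + v1 r = r * ((1 - 3 * q r ^+ 2) * v r).
 have hT := hgB (hgM (hg_fst (r *: e)) (Wd_hg 0 1 (r *: e) rh)) (hgM (hg_snd (r *: e)) (Wd_hg 1 0 (r *: e) rh)).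
 have h0 : hg (fun z => z.1 * W 0 1 z - z.2 * W 1 0 z) (r *: e) 0 0.
  by apply: hg_ext (hg_cst 0 (r *: e)) => z; rewrite W_tan subrr.
 have [t1 t2] := hg_uniq hT h0.
 have lp := W_lap (r *: e).
 rewrite -(qe r) -[1 - _]/(Vp (r *: e)) /v -lp /v1 /v2.
 move: t1 t2; rewrite !pE.
 have al (a b c d f s e1 e2 : R) : e1 * e1 + e2 * e2 = 1 -> 1 * a + s * e1 * b - (0 * c + s * e2 * d) = 0 ->
   0 * a + s * e1 * f - (1 * c + s * e2 * b) = 0 ->
   s * ((d * e1 + b * e2) * e1 + (b * e1 + f * e2) * e2) + (c * e1 + a * e2) = s * (d + f).
  move=> k0 k1 k2.
  have a_ : a = s * e2 * d - s * e1 * b by apply: subr0_eq; rewrite -[RHS]k1; ring.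
  have c_ : c = s * e1 * f - s * e2 * b by apply/eqP; rewrite eq_sym -subr_eq0; apply/eqP; rewrite -[RHS]k2; ring.
  by rewrite a_ c_; transitivity (s * (d + f) * (e1 * e1 + e2 * e2)); [ring|rewrite k0 mulr1].
 exact: al ee.
have [C C0 hC] := W_decay.
have e1 : `|e.1| <= 1 /\ `|e.2| <= 1.
 have : enorm2 e = 1 by rewrite /enorm2 ee sqrtr1.
 by move=> <-; split; [exact: abs1_le|exact: abs2_le].
have pe (r : R) : 0 <= r -> phi (r *: e) = phi (r, 0) by move=> r0; rewrite phi_rad Er ger0_norm.
have hv r : 0 <= r -> `|v r| <= C * phi (r, 0) by move=> r0; have [k _ _] := hC (r *: e); rewrite -pe.
have hv1 r : 0 <= r -> `|v1 r| <= 2 * C * phi (r, 0).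
 move=> r0; have [_ k1 k2] := hC (r *: e); rewrite -pe//; apply: normD_le.
 have B (s t : R) : `|s| <= C * phi (r *: e) -> `|t| <= 1 -> `|s * t| <= C * phi (r *: e).
  by move=> hs ht; rewrite normrM -[leRHS]mulr1; apply: ler_pM.
 rewrite (_ : 2 * C * phi (r *: e) = C * phi (r *: e) + C * phi (r *: e)); last by ring.
 by apply: lerD; apply: B => //; [exact: e1.1|exact: e1.2].
have Lq0 := Lq_ge0 hQ.
have q00 : 0 <= q 0 by rewrite ltW// qr_pos.
have hq r : 0 <= r -> `|q r| <= q 0 by move=> r0; rewrite gtr0_norm ?qr_pos//; exact: qr_le0.
have hq1 r : 0 <= r -> `|q1 r| <= Lq Q by move=> r0; exact: qr1_bd.
have main (s : R) : `|s| = 1 -> ~ (0 < s * v 0).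
 move=> hs.
 have dsv t : is_derive t (1 : R) (fun r => s * v r) (s * v1 t) := drvZ (dv t) s.
 have dsv1 t : is_derive t (1 : R) (fun r => s * v1 r) (s * v2 t) := drvZ (dv1 t) s.
 have ods r : r * (s * v2 r) + s * v1 r = r * ((1 - 3 * q r ^+ 2) * (s * v r)).
  by transitivity (s * (r * v2 r + v1 r)); [ring|rewrite odev; ring].
 have bnd (K : R) (r a b c d : R) : 0 <= r -> 0 <= K -> `|a| <= 2 * C * phi (r, 0) -> `|c| <= C * phi (r, 0) ->
   `|b| <= K * J (r, 0) -> `|d| <= K * J (r, 0) -> `|r * (s * a * b - s * c * d)| <= 3 * C * K * (J (r, 0) ^+ 2 * phi (r, 0)).
  move=> r0 K0 ha hc hb hd.
  have rJ : `|r| <= J (r, 0) by exact: (abs1_le_J (r, 0)).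
  have -> : r * (s * a * b - s * c * d) = s * (r * (a * b - c * d)) by ring.
  rewrite normrM hs mul1r normrM.
  have -> : 3 * C * K * (J (r, 0) ^+ 2 * phi (r, 0)) = J (r, 0) * (2 * C * phi (r, 0) * (K * J (r, 0)) + C * phi (r, 0) * (K * J (r, 0))) by ring.
  apply: ler_pM => //; apply: normB_le; rewrite !normrM.
  by apply: lerD; apply: ler_pM.
 have J1 r : 1 <= J (r, 0) := J_ge1 (r, 0).
 have rJ r : 0 <= r -> r <= J (r, 0) by move=> r0; apply: le_trans (ler_norm _) (abs1_le_J (r, 0)).
 have e3 : 0 <= q 0 + Lq Q by exact: addr_ge0.
 apply: (pos_contra (dqr hQ) (dqr1 hQ) (qr_ode hQ) (qr_pos hQ) (qr20 hQ) (qr_lim hQ) (qr_dec hQ) dsv dsv1 ods).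
 - apply: (@ray_lim _ (3 * C * (q 0 + Lq Q))); first by apply: mulr_ge0 => //; exact: mulr_ge0.
  move=> r r0; rewrite /Wq; apply: bnd => //; [exact: hv1|exact: hv|apply: le_trans (hq r r0) _|apply: le_trans (hq1 r r0) _].
   by rewrite -[leLHS]mulr1; apply: ler_pM => //; rewrite lerDl.
  by rewrite -[leLHS]mulr1; apply: ler_pM => //; rewrite lerDr.
 - move=> a; set K := Lq Q + `|a| * q 0 + (q 0 + q 0 ^+ 3) + `|a| * Lq Q.
  have p1 : 0 <= `|a| * q 0 by exact: mulr_ge0.
  have p2 : 0 <= `|a| * Lq Q by exact: mulr_ge0.
  have p3 : 0 <= q 0 + q 0 ^+ 3 by rewrite addr_ge0// exprn_ge0.
  have K0 : 0 <= K by rewrite /K; do 3 (apply: addr_ge0 => //).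
  apply: (@ray_lim _ (3 * C * K)); first by apply: mulr_ge0 => //; exact: mulr_ge0.
  move=> r r0; rewrite /Wr; have rr := rJ r r0; have j1 := J1 r; have J0 := J_ge0 (r, 0 : R).
  have c1 : `|q r - q r ^+ 3| <= q 0 + q 0 ^+ 3.
   apply: normB_le; apply: lerD; first exact: hq.
   by rewrite normrX lerXn2r ?nnegrE// hq.
  have B1 (t k : R) : `|t| <= k -> `|r * t| <= k * J (r, 0).
   by move=> ht; rewrite normrM (ger0_norm r0) mulrC; apply: ler_pM.
  have B2 (t k : R) : `|t| <= k -> `|a * t| <= `|a| * k * J (r, 0).
   move=> ht; rewrite normrM -mulrA; apply: ler_wpM2l => //.
   have k0 : 0 <= k by exact: le_trans ht.
   by apply: le_trans ht _; rewrite ler_peMr.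
  apply: bnd => //; [exact: hv1|exact: hv| |]; apply: normD_le.
   apply: (@le_trans _ _ (Lq Q * J (r, 0) + `|a| * q 0 * J (r, 0))).
    by apply: lerD; [apply: B1; exact: hq1|apply: B2; exact: hq].
   by rewrite -mulrDl; apply: ler_wpM2r => //; rewrite /K -[leRHS]addrA lerDl; exact: addr_ge0.
  apply: (@le_trans _ _ ((q 0 + q 0 ^+ 3) * J (r, 0) + `|a| * Lq Q * J (r, 0))).
   by apply: lerD; [exact: B1|apply: B2; exact: hq1].
  by rewrite -mulrDl; apply: ler_wpM2r => //; rewrite /K -[leRHS]addrA lerDr; exact: addr_ge0.
have v0 : v 0 = 0.
 apply/eqP; rewrite eq_le; apply/andP; split; rewrite leNgt; apply/negP => k.
  by apply: (main 1); rewrite ?normr1// mul1r.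
 by apply: (main (-1)); rewrite ?normrN ?normr1// mulN1r oppr_gt0.
exact: (zero_data (dqr hQ) (dqr1 hQ) (qr_ode hQ) (qr_pos hQ) (qr20 hQ) (qr_lim hQ) dv dv1 odev v0).
Qed.

Lemma nondeg xi : h xi = 0.
Proof.
have w0 x : FI h x = 0.
 rewrite -Wd00; have [->|x0] := eqVneq x 0.
  by have := @ray_zero (1, 0) _ 0 (lexx 0); rewrite scale0r; apply; rewrite /dot2 /= mulr0 mulr1 addr0.
 have r0 := enorm2_gt0 x0; have rn : enorm2 x != 0 by rewrite gt_eqF.
 have := @ray_zero ((enorm2 x)^-1 *: x) _ (enorm2 x) (ltW r0).
 rewrite scalerA divff// scale1r; apply.
 have := enorm2_sq x => e; rewrite /dot2 /= !scaleRE.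
 transitivity ((x.1 ^+ 2 + x.2 ^+ 2) / enorm2 x ^+ 2); first by field.
 by rewrite -e divff// expf_neq0.
have [B hB] := Sz_bounded Sh; have [eh uh _] := Sh.
rewrite -(Tr_FI (Sz_Int Sh) eh hB (@uc_cont _ _ uh xi)).
 rewrite -(II0 R); apply: II_ext => x; by rewrite w0 mul0r.
by apply: Int_ext (@Int0 R) => x; rewrite w0.
Qed.

End Kernel.

End Nondeg.

(** * Inversion of the linearised operator by finite rank approximation *)

Section Fred.
Variable R : realType.
Local Notation J := (@jap R).
Local Notation w2 := (@japw R).
Local Notation kap := (@kap R).
Local Notation T2 := (measurableTypeR R * measurableTypeR R)%type.
Implicit Types (a b f g h P : R * R -> R) (x y z v xi : R * R) (M B : R).

Lemma geo_cvg (u : nat -> R) B : (forall n, `|u n.+1 - u n| <= B * 2^-1 ^+ n) ->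
 exists2 l : R, u n @[n --> \oo] --> l & forall n, `|u n - l| <= 2 * B * 2^-1 ^+ n.
Proof.
move=> hu.
pose v n := u n + 2 * B * 2^-1 ^+ n.
have B0 : 0 <= B by have := hu 0; rewrite expr0 mulr1; exact: le_trans.
have p0 n : 0 <= B * 2^-1 ^+ n by rewrite mulr_ge0// exprn_ge0.
have st n : 2 * B * 2^-1 ^+ n.+1 = B * 2^-1 ^+ n by rewrite exprS; field.
have main n m : `|u (n + m)%N - u n| <= 2 * B * 2^-1 ^+ n - 2 * B * 2^-1 ^+ (n + m).
 elim: m => [|m IH]; first by rewrite addn0 !subrr normr0.
 rewrite addnS; have := hu (n + m)%N; have := st (n + m)%N.
 move: IH; rewrite !ler_norml => /andP[a b] e /andP[c d]; apply/andP; split; lra.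
have bnd n m : `|u (n + m)%N - u n| <= 2 * B * 2^-1 ^+ n.
 by apply: le_trans (main n m) _; have := p0 (n + m)%N; lra.
have ni : nonincreasing_seq v.
 apply/nonincreasing_seqP => n; rewrite /v; have := hu n; have := st n.
 by rewrite ler_norml => e /andP[a b]; have := p0 n; lra.
have lb : has_lbound (range v).
 exists (u 0%N - 2 * B) => _ [n _ <-]; rewrite /v; have := bnd 0%N n; rewrite add0n expr0 mulr1 ler_norml => /andP[a b].
 by have := p0 n; lra.
have cv := nonincreasing_is_cvgn ni lb.
have cg : 2 * B * 2^-1 ^+ n @[n --> \oo] --> (0 : R).
 rewrite -[X in _ --> X](mulr0 (2 * B)); apply: cvgMl_tmp.
 by apply: cvg_expr; rewrite ger0_norm ?invr_ge0// invf_lt1// ltr1n.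
exists (limn v).
 rewrite (_ : u = (fun n => v n - 2 * B * 2^-1 ^+ n)); last by apply/funext => n; rewrite /v addrK.
 by rewrite -[X in _ --> X]subr0; apply: cvgB.
have cu : u n @[n --> \oo] --> limn v.
 rewrite (_ : u = (fun n => v n - 2 * B * 2^-1 ^+ n)); last by apply/funext => n; rewrite /v addrK.
 by rewrite -[X in _ --> X]subr0; apply: cvgB.
move=> n; rewrite distrC.
have c2 : `|u (n + m)%N - u n| @[m --> \oo] --> `|limn v - u n|.
 apply: cvg_norm; apply: cvgB; last exact: cvg_cst.
 rewrite (_ : (fun m => u (n + m)%N) = (fun m => u (m + n)%N)); last by apply/funext => m; rewrite addnC.
 by rewrite (cvg_shiftn n u).
rewrite -(cvg_lim (@Rhausdorff R) c2); apply: limr_le; first exact: cvgP c2.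
by apply: nearW => m; exact: bnd.
Qed.

Definition Yc M h : Prop := [/\ evn h, meas h & bd 2 M h].
Lemma Yc_le M M' h : M <= M' -> Yc M h -> Yc M' h.
Proof. by move=> MM [e m b]; split => //; exact: bd_le b. Qed.
Lemma Yc_Int M h : Yc M h -> Int h.
Proof. by move=> [_ m b]; exact: bd_Int m b. Qed.

Lemma YcD M N f g : Yc M f -> Yc N g -> Yc (M + N) (fun x => f x + g x).
Proof.
move=> [e m b] [e' m' b']; split; [by move=> x; rewrite e e'|exact: measD|exact: bdD].
Qed.

Lemma YcZ k M f : Yc M f -> Yc (`|k| * M) (fun x => k * f x).
Proof.
move=> [e m b]; split; [by move=> x; rewrite e|by apply: measM => //; exact: meas_cst|].
by move=> x; rewrite normrM -mulrA; apply: ler_wpM2l.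
Qed.

Lemma Yc0 : Yc 0 (fun=> 0).
Proof. by split => //; [exact: meas_cst|move=> x; rewrite normr0 mul0r]. Qed.
Lemma bd_sub M f g : bd 2 M (fun x => f x - g x) -> bd 2 M (fun x => g x - f x).
Proof. by move=> h x; rewrite distrC. Qed.

(** Picard iteration with ratio 1/2 in a ball of the weighted space. The boolean adds uniform
    continuity to the invariant: it is off for the linear remainder and on for the nonlinear fixed
    point. *)
Lemma Ycontr (b : bool) (T : (R * R -> R) -> (R * R -> R)) B : 0 <= B ->
 (forall h, Yc B h -> (b -> uc h) -> Yc B (T h) /\ (b -> uc (T h))) ->
 (forall h1 h2 M, Yc B h1 -> Yc B h2 -> (b -> uc h1) -> (b -> uc h2) -> bd 2 M (fun x => h1 x - h2 x) ->
   bd 2 (M / 2) (fun x => T h1 x - T h2 x)) ->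
 exists2 h, Yc B h /\ (b -> uc h) & forall x, T h x = h x.
Proof.
move=> B0 TY TC.
pose s n := iter n T (fun=> 0).
have sYu n : Yc B (s n) /\ (b -> uc (s n)).
 elim: n => [|n [IH IH']]; last exact: TY.
 split=> [|_]; [exact: Yc_le Yc0|by apply: (@uc_lip _ _ 0) => x y; rewrite subrr normr0 mul0r].
have sY n : Yc B (s n) by have [] := sYu n.
have sU n : b -> uc (s n) by have [] := sYu n.
have sd n : bd 2 (2 * B * 2^-1 ^+ n) (fun x => s n.+1 x - s n x).
 elim: n => [|n IH].
  rewrite expr0 mulr1 mulr_natl mulr2n; have [_ _ b1] := sY 1%N; have [_ _ b0] := sY 0%N.
  exact: bdB.
 have := TC _ _ _ (sY n.+1) (sY n) (sU n.+1) (sU n) IH; rewrite exprS.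
 by rewrite (_ : 2 * B * 2^-1 ^+ n / 2 = 2 * B * (2^-1 * 2^-1 ^+ n)); last by ring.
have hl x : exists l : R, s n x @[n --> \oo] --> l /\ forall n, `|s n x - l| <= 2 * (2 * B * J x ^- 2) * 2^-1 ^+ n.
 have [n|l l1 l2] := @geo_cvg (fun n => s n x) (2 * B * J x ^- 2).
  by have := sd n x; rewrite mulrAC.
 by exists l.
have [h hh] := choice hl.
have eh : evn h.
 move=> x; have [c1 _] := hh x; have [c2 _] := hh (- x).
 have E : (fun n => s n (- x)) = (fun n => s n x) by apply/funext => n; have [e _ _] := sY n; rewrite e.
 by rewrite E in c2; exact: (cvg_unique _ c2 c1).
have mh : meas h.
 apply: (@measurable_fun_cvg _ _ _ _ (fun n => (s n : T2 -> R))) => [n|x _].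
  by have [_ m _] := sY n.
 by have [] := hh x.
have bh n : bd 2 (4 * B * 2^-1 ^+ n) (fun x => s n x - h x).
 by move=> x; have [_ k] := hh x; apply: le_trans (k n) _; apply: eqW; ring.
have bB : bd 2 B h.
 move=> x; have [c _] := hh x.
 have cn : `|s n x| @[n --> \oo] --> `|h x| by apply: cvg_norm.
 rewrite -(cvg_lim (@Rhausdorff R) cn); apply: limr_le; first exact: cvgP cn.
 by apply: nearW => n; have [_ _ bn] := sY n; exact: bn.
have Yh : Yc B h by split.
have cg : 8 * B * 2^-1 ^+ n @[n --> \oo] --> (0 : R).
 rewrite -[X in _ --> X](mulr0 (8 * B)); apply: cvgMl_tmp.
 by apply: cvg_expr; rewrite ger0_norm ?invr_ge0// invf_lt1// ltr1n.
have J1 x : J x ^- 2 <= 1.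
 by rewrite invf_le1 ?exprn_gt0 ?J_gt0// exprn_ege1// J_ge1.
have g0 n : 0 <= B * 2^-1 ^+ n by rewrite mulr_ge0// exprn_ge0.
have Uh : b -> uc h.
 move=> bb; apply: uc_lim => e e0.
 move/cvgrPdist_le: cg => /(_ _ e0) [n _ /(_ n (leqnn n))]; rewrite sub0r normrN => hn.
 exists (s n); first exact: sU.
 move=> x; rewrite distrC; apply: le_trans (bh n x) _.
 apply: le_trans (_ : 4 * B * 2^-1 ^+ n * 1 <= _).
  by apply: ler_wpM2l => //; rewrite -mulrA mulr_ge0.
 by apply: le_trans (le_trans (ler_norm _) hn); have := g0 n; lra.
exists h => // x; apply/eqP; rewrite -subr_eq0 -normr_le0; apply/ler_addgt0Pr => e e0; rewrite add0r.
move/cvgrPdist_le: cg => /(_ _ e0) [n _ /(_ n (leqnn n))]; rewrite sub0r normrN => hn.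
have t1 := TC _ _ _ Yh (sY n) Uh (sU n) (bd_sub (bh n)) x; have t2 := bh n.+1 x.
have {}g0 := g0 n; have {}J1 := J1 x.
have -> : T h x - h x = (T h x - T (s n) x) + (s n.+1 x - h x) by rewrite /s /=; ring.
apply: normD_le; apply: le_trans (lerD t1 t2) _.
apply: le_trans _ (le_trans (ler_norm _) hn).
rewrite -mulrDl (exprS 2^-1); apply: le_trans (_ : 4 * (B * 2^-1 ^+ n) * 1 <= _); last lra.
have -> : 4 * B * 2^-1 ^+ n / 2 + 4 * B * (2^-1 * 2^-1 ^+ n) = 4 * (B * 2^-1 ^+ n) by field.
by apply: ler_wpM2l => //; rewrite mulr_ge0.
Qed.

Lemma sum_delta (I : finType) (j0 : I) (c : I -> R) (G : I -> R) : (forall j, c j = ((j == j0) : nat)%:R) ->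
 \sum_j c j * G j = G j0.
Proof.
move=> hc; rewrite (bigD1 j0)//= big1; first by rewrite hc eqxx mul1r addr0.
by move=> j /negbTE jn; rewrite hc jn mul0r.
Qed.

(** Equal half-open cells of length 2 rho / N < d, with their left endpoints as nodes: a measurable
    partition of unity that discretises a function up to its oscillation over distance d. *)
Lemma grid1 (rho d : R) : 0 < rho -> 0 < d -> exists (N : nat) (c : 'I_N -> R -> R) (p : 'I_N -> R),
 (forall i, measurable_fun setT (c i)) /\
 forall t, (`|t| <= rho /\ exists i0, `|t - p i0| < d /\ forall i, c i t = ((i == i0) : nat)%:R) \/
   (rho <= `|t| /\ forall i, c i t = 0).
Proof.
move=> rho0 d0.
pose N := (Num.truncn (2 * rho / d)).+1.
pose del := 2 * rho / N%:R.
have N0 : 0 < N%:R :> R by rewrite ltr0n.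
have del0 : 0 < del by rewrite divr_gt0// mulr_gt0.
have deld : del < d.
 have t0 : 0 <= 2 * rho / d by apply: divr_ge0; [apply: mulr_ge0 => //|]; exact: ltW.
 have /andP[_ t1] := truncn_itv t0.
 by rewrite /del ltr_pdivrMr// [d * _]mulrC -(ltr_pdivrMr _ _ d0).
exists N, (fun i => \1_([set` `[- rho + i%:R * del, - rho + i.+1%:R * del[])), (fun i => - rho + i%:R * del); split.
 by move=> i; apply: measurable_indic; exact: measurable_itv.
have cE (i : 'I_N) (t : R) : \1_([set` `[- rho + i%:R * del, - rho + i.+1%:R * del[]) t = ((((i%:R : R) <= (t + rho) / del) && ((t + rho) / del < (i.+1%:R : R))) : nat)%:R :> R.
 rewrite indicE; congr (_ %:R); congr nat_of_bool; rewrite ler_pdivlMr// ltr_pdivrMr//.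
 apply/idP/idP => [/set_mem|h].
  by rewrite /= in_itv /= => /andP[a b]; apply/andP; split; lra.
 by apply/mem_set; rewrite /= in_itv /=; move/andP: h => [a b]; apply/andP; split; lra.
move=> t; case: (boolP (- rho <= t < rho)) => [/andP[t1 t2]|ht]; last first.
 right; split.
  move: ht; rewrite negb_and -ltNge -leNgt => /orP[h|h]; last exact: le_trans h (ler_norm _).
  by rewrite -normrN; apply: le_trans (ler_norm _); lra.
 move=> i; rewrite cE; case: (boolP (_ <= _ < _)) => //= /andP[a b]; exfalso; move/negP: ht; apply.
 move: a b; rewrite ler_pdivlMr// ltr_pdivrMr// => a b.
 have i0 : 0 <= i%:R * del by rewrite mulr_ge0 ?ler0n// ltW.
 have iN : i.+1%:R * del <= N%:R * del by rewrite ler_pM2r// ler_nat ltn_ord.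
 have NN : N%:R * del = 2 * rho by rewrite /del mulrC divfK// gt_eqF.
 by apply/andP; split; lra.
left; split; first by rewrite ler_norml t1 ltW.
pose u := (t + rho) / del.
have u0 : 0 <= u by rewrite divr_ge0 ?(ltW del0)//; lra.
have /andP[k1 k2] := truncn_itv u0.
have kN : (Num.truncn u < N)%N.
 rewrite -(ltr_nat R); apply: le_lt_trans k1 _; rewrite /u ltr_pdivrMr//.
 by rewrite /del mulrC divfK ?gt_eqF//; lra.
exists (Ordinal kN); split => /=.
 have k3 : (Num.truncn u)%:R * del <= t + rho by rewrite -ler_pdivlMr.
 have k4 : t + rho < ((Num.truncn u)%:R + 1) * del by rewrite natr1 -ltr_pdivrMr.
 move: k4; rewrite mulrDl mul1r => k4.
 by rewrite ger0_norm; lra.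
move=> i; rewrite cE; congr (_ %:R); congr nat_of_bool; rewrite -/u; apply/idP/eqP => [/andP[a b]|->]; last by rewrite /= k1 k2.
apply/val_inj => /=; apply/eqP; rewrite eqn_leq -ltnS -(ltr_nat R) (le_lt_trans a k2)/=.
by rewrite -ltnS -(ltr_nat R) (le_lt_trans k1 b).
Qed.

Lemma grid (rho d : R) : 0 < rho -> 0 < d -> exists (n : nat) (a : 'I_n -> R * R -> R) (p : 'I_n -> R * R),
 (forall j, meas (a j)) /\
 forall x, ([/\ `|x.1| <= rho, `|x.2| <= rho & exists j0, [/\ `|x.1 - (p j0).1| < d, `|x.2 - (p j0).2| < d & forall j, a j x = ((j == j0) : nat)%:R]]) \/
   ((rho <= `|x.1| \/ rho <= `|x.2|) /\ forall j, a j x = 0).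
Proof.
move=> rho0 d0; have [N [c [p [mc hc]]]] := grid1 rho0 d0.
pose I := ('I_N * 'I_N)%type.
exists #|{: I}|, (fun j x => c (enum_val j).1 x.1 * c (enum_val j).2 x.2), (fun j => (p (enum_val j).1, p (enum_val j).2)).
split.
 move=> j; apply: measM.
  by apply: (@measurableT_comp _ _ _ _ _ _ (c (enum_val j).1)) => //; exact: measurable_fst.
 by apply: (@measurableT_comp _ _ _ _ _ _ (c (enum_val j).2)) => //; exact: measurable_snd.
move=> x; case: (hc x.1) => [[h1 [i0 [hi ci]]]|[h1 ci]]; last first.
 by right; split; [left|move=> j; rewrite ci mul0r].
case: (hc x.2) => [[h2 [k0 [hk ck]]]|[h2 ck]]; last first.
 by right; split; [right|move=> j; rewrite ck mulr0].
left; split => //; exists (enum_rank (i0, k0)); rewrite !enum_rankK /=; split => // j.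
rewrite ci ck -natrM mulnb; congr (_ %:R); congr nat_of_bool.
apply/andP/eqP => [[/eqP e1 /eqP e2]|->]; last by rewrite enum_rankK /=.
by apply: enum_val_inj; rewrite enum_rankK; case: (enum_val j) e1 e2 => /= u v -> ->.
Qed.

(** The modulus of continuity of [cnv h P] is that of P, scaled by the weighted norm of h alone;
    this equicontinuity is the source of compactness. *)
Lemma conv_mod h P M (e : R) x y : meas h -> bd 2 M h -> meas P -> (exists B, forall x, `|P x| <= B) ->
 (forall eta, `|P (x - eta) - P (y - eta)| <= e) -> `|cnv h P x - cnv h P y| <= kap * (M * II w2 * e).
Proof.
move=> mh bh mP [B PB] he; have ih := bd_Int mh bh.
have i1 := conv_Int x ih mP PB; have i2 := conv_Int y ih mP PB.
rewrite /cnv -mulrBr normrM (ger0_norm (kap_ge0 R)); apply: ler_wpM2l; first exact: kap_ge0.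
rewrite -IIB//.
have -> : M * II w2 * e = II (fun z => M * e * w2 z) by rewrite IIZ; [ring|exact: Int_w2].
apply: II_absle; [exact: Int_meas (IntB i1 i2)|exact: IntZ (@Int_w2 R)|].
move=> z; rewrite -mulrBr normrM; have := ler_pM (normr_ge0 _) (normr_ge0 _) (bh z) (he z).
by rewrite mulrAC.
Qed.

Lemma Jinv_uc : uc (fun x => (J x)^-1).
Proof.
apply: (@uc_lip _ _ 2) => x y.
have jx := J_gt0 x; have jy := J_gt0 y; have jxn := J_neq0 x; have jyn := J_neq0 y.
have -> : (J x)^-1 - (J y)^-1 = (J y - J x) / (J x * J y) by field; rewrite jxn jyn.
rewrite normrM normfV (gtr0_norm (mulr_gt0 jx jy)) ler_pdivrMr ?mulr_gt0//.
have -> : J y - J x = (y.1 - x.1) * (y.1 + x.1) + (y.2 - x.2) * (y.2 + x.2) by rewrite /jap /dot2; ring.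
apply: normD_le; rewrite !normrM.
have B (s t : R) : `|s| <= J x -> `|t| <= J y -> `|t + s| <= 2 * (J x * J y).
 move=> hs ht; apply: normD_le.
 have : J x <= J x * J y by rewrite ler_peMr ?J_ge1// ltW.
 have : J y <= J x * J y by rewrite ler_peMl ?J_ge1// ltW.
 lran.
have b1 := B _ _ (abs1_le_J x) (abs1_le_J y); have b2 := B _ _ (abs2_le_J x) (abs2_le_J y).
rewrite (distrC x.1) (distrC x.2).
have := ler_wpM2l (normr_ge0 (y.1 - x.1)) b1; have := ler_wpM2l (normr_ge0 (y.2 - x.2)) b2.
by move=> k1 k2; rewrite (_ : 2 * _ * _ = `|y.1 - x.1| * (2 * (J x * J y)) + `|y.2 - x.2| * (2 * (J x * J y))); [exact: lerD|ring].
Qed.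

Section Inverse.
Variable P : R * R -> R.
Hypotheses (SP : Sz P) (injK : forall h M, Yc M h -> (forall x, h x = 3 * (J x)^-1 * cnv h P x) -> forall x, h x = 0).

Let eP : evn P. Proof. by case: SP. Qed.
Let uP : uc P. Proof. by case: SP. Qed.
Let mP : meas P := Sz_meas SP.
Let PB : exists B, forall x, `|P x| <= B := Sz_bounded SP.
Let Gev M h : Yc M h -> evn (cnv h P).
Proof. by move=> Y; have [e m b] := Y; apply: conv_even => //; exact: Yc_Int Y. Qed.
Let Guc M h : Yc M h -> uc (cnv h P).
Proof. by move=> Y; have [B hB] := PB; exact: conv_uc (Yc_Int Y) hB uP. Qed.

Let Gbd : exists2 C, 0 <= C & forall M h, Yc M h -> bd 2 (C * M) (cnv h P).
Proof.
have [_ _ /(_ 2%N) [B hB]] := SP; have B0 := bd_ge0 hB.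
exists (Ck R 2 * B); first by rewrite mulr_ge0 ?Ck_ge0.
move=> M h [e m b]; have := conv_bd (leqnn 2) m mP b hB; by rewrite mulrAC.
Qed.

Let GD M N f g x : Yc M f -> Yc N g -> cnv (fun x => f x + g x) P x = cnv f P x + cnv g P x.
Proof.
move=> Yf Yg; have [B hB] := PB.
rewrite /cnv -mulrDr -IID; [|exact: conv_Int (Yc_Int Yf) mP hB|exact: conv_Int (Yc_Int Yg) mP hB].
by congr (_ * _); apply: II_ext => y; ring.
Qed.

Let GZ k M f x : Yc M f -> cnv (fun x => k * f x) P x = k * cnv f P x.
Proof.
move=> Yf; have [B hB] := PB.
rewrite /cnv mulrCA -(IIZ k (conv_Int x (Yc_Int Yf) mP hB)).
by congr (_ * _); apply: II_ext => y; ring.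
Qed.

Let Gsum (n : nat) (al : 'I_n -> R) (f : 'I_n -> R * R -> R) (M : 'I_n -> R) x : (forall j, Yc (M j) (f j)) ->
 Yc (\sum_j `|al j| * M j) (fun x => \sum_j al j * f j x) /\
 cnv (fun x => \sum_j al j * f j x) P x = \sum_j al j * cnv (f j) P x.
Proof.
elim: n al f M => [|n IH] al f M Yf.
 split; first by rewrite big_ord0; under eq_fun do rewrite big_ord0; exact: Yc0.
 rewrite big_ord0 /cnv; set F := (X in II X).
 have -> : II F = 0; last by rewrite mulr0.
 by rewrite -(II0 R); apply: II_ext => y; rewrite /F big_ord0 mul0r.
have [Y1 E1] := IH (fun j => al (lift ord0 j)) (fun j => f (lift ord0 j)) (fun j => M (lift ord0 j)) (fun j => Yf _).
have Y0 := YcZ (al ord0) (Yf ord0).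
have E : (fun x => \sum_(j < n.+1) al j * f j x) = (fun x => al ord0 * f ord0 x + \sum_(j < n) al (lift ord0 j) * f (lift ord0 j) x).
 by apply/funext => y; rewrite big_ord_recl.
rewrite E !big_ord_recl; split; first exact: YcD.
by rewrite (GD x Y0 Y1) E1 (GZ _ x (Yf ord0)).
Qed.

(** On a large square the convolution is replaced by its values at grid nodes; outside, its own
    decay makes it small relative to J^-1. In both regions the error is at most (M / 6) J^-1, and
    the factor 3 J^-1 leaves a remainder of norm 1/2. *)
Lemma split_rank : exists (n : nat) (e : 'I_n -> R * R -> R) (p : 'I_n -> R * R) (Me : R),
 (forall j, Yc Me (e j)) /\
 forall h M, Yc M h -> Yc (M / 2) (fun x => 3 * (J x)^-1 * cnv h P x - \sum_j cnv h P (p j) * e j x).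
Proof.
have [C C0 hC] := Gbd.
(* Outside the square J >= rho^2 >= 6 C, which turns C M J^-2 into (M / 6) J^-1. *)
pose rho : R := 6 * C + 1.
have rho0 : 0 < rho by rewrite /rho; lra.
pose L := kap * II w2 + 1.
have L0 : 0 < L by rewrite ltr_wpDl// mulr_ge0 ?kap_ge0// II_ge0// => x; exact: w2_ge0.
(* Makes M L eps at most (M / 6) J^-1 on the square, where J <= 1 + 2 rho^2. *)
pose eps := (6 * (1 + 2 * rho ^+ 2) * L)^-1.
have r2 : 0 < 6 * (1 + 2 * rho ^+ 2) by rewrite mulr_gt0// ltr_wpDr// mulr_ge0// sqr_ge0.
have eps0 : 0 < eps by rewrite invr_gt0 mulr_gt0.
have [d d0 hd] := uP eps0.
have [n [a [p [ma hg]]]] := grid rho0 d0.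
(* Symmetrised, so that the finite rank part takes values in even functions. *)
pose e (j : 'I_n) x := 3 * (J x)^-1 * (2^-1 * (a j x + a j (- x))).
have Jb x : `|x.1| <= rho -> `|x.2| <= rho -> J x <= 1 + 2 * rho ^+ 2.
 move=> x1 x2; rewrite /jap lerD2l /dot2 -!expr2.
 have s (t : R) : `|t| <= rho -> t ^+ 2 <= rho ^+ 2.
  by move=> ht; rewrite -(real_normK (num_real t)) lerXn2r// nnegrE// ltW.
 by have := s _ x1; have := s _ x2; lra.
have a01 j x : 0 <= a j x <= 1 /\ (a j x = 0 \/ J x <= 1 + 2 * rho ^+ 2).
 case: (hg x) => [[x1 x2 [j0 [_ _ hj]]]|[_ ->]]; last by split; [rewrite lexx ler01|left].
 split; first by rewrite hj; case: (_ == _); rewrite ?lexx ?ler01.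
 by right; exact: Jb.
have maN j : meas (fun x => a j (- x)).
 have := meas_comp_aff (-1) 0 (ma j); by under eq_fun do rewrite aff_opp.
have mJi : meas (fun x => (J x)^-1) := uc_meas Jinv_uc.
pose Me := 3 * (1 + 2 * rho ^+ 2).
exists n, e, p, Me; split.
 move=> j; split.
 - by move=> x; rewrite /e J_opp opprK; congr (_ * (_ * _)); rewrite addrC.
 - by apply: measM; [apply: measM => //; exact: meas_cst|apply: measM; [exact: meas_cst|exact: measD]].
 - move=> x; have jp := J_gt0 x.
  have [/andP[u0 u1] hu] := a01 j x; have [/andP[v0 v1] hv] := a01 j (- x); rewrite J_opp in hv.
  have s0 : 0 <= 2^-1 * (a j x + a j (- x)) by rewrite mulr_ge0// addr_ge0.
  rewrite ger0_norm; last by rewrite /e mulr_ge0// mulr_ge0// invr_ge0 ltW.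
  rewrite /e /Me -!mulrA; apply: ler_wpM2l => //.
  have -> : J x ^- 2 = (J x)^-1 * (J x)^-1 by rewrite exprS expr1 invfM.
  rewrite (_ : (1 + 2 * rho ^+ 2) * ((J x)^-1 * (J x)^-1) = (J x)^-1 * ((1 + 2 * rho ^+ 2) * (J x)^-1)); last by ring.
  apply: ler_wpM2l; first by rewrite invr_ge0 ltW.
  case: (leP (J x) (1 + 2 * rho ^+ 2)) => hJ.
   by rewrite ler_pdivlMr//; apply: le_trans (_ : 1 * J x <= _); [rewrite ler_pM2r//; lra|rewrite mul1r].
  have z1 : a j x = 0 by case: hu => //; rewrite leNgt hJ.
  have z2 : a j (- x) = 0 by case: hv => //; rewrite leNgt hJ.
  rewrite z1 z2 addr0 mulr0; apply: divr_ge0; [lran|exact: ltW].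
move=> h M Yh; have [eh mh bh] := Yh; have M0 := bd_ge0 bh.
set G := cnv h P.
have Ge : evn G := Gev Yh.
pose RG x := \sum_j a j x * G (p j).
have key x : `|G x - RG x| <= M / 6 * (J x)^-1.
 have jp := J_gt0 x; have M6 : 0 <= M / 6 by rewrite divr_ge0.
 case: (hg x) => [[x1 x2 [j0 [h1 h2 hj]]]|[hx hj]].
  rewrite /RG (sum_delta (fun j => G (p j)) hj).
  have hJ := Jb _ x1 x2.
  apply: le_trans (conv_mod (e := eps) mh bh mP PB _) _.
   by move=> eta; apply: hd; rewrite !pE opprB addrA subrK.
  apply: (@le_trans _ _ (M * (L * eps))).
   have -> : kap * (M * II w2 * eps) = M * (kap * II w2 * eps) by ring.
   apply: ler_wpM2l => //; apply: ler_wpM2r; first exact: ltW.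
   by rewrite /L lerDl.
  have -> : L * eps = (6 * (1 + 2 * rho ^+ 2))^-1.
   by rewrite /eps invfM mulrCA divff ?mulr1// gt_eqF.
  rewrite -mulrA; apply: ler_wpM2l => //; rewrite invfM; apply: ler_wpM2l; first by rewrite invr_ge0.
  by rewrite lef_pV2// posrE; lra.
 rewrite /RG big1 ?subr0; last by move=> j _; rewrite hj mul0r.
 apply: le_trans (hC _ _ Yh x) _.
 have -> : J x ^- 2 = (J x)^-1 * (J x)^-1 by rewrite exprS expr1 invfM.
 rewrite mulrA; apply: ler_wpM2r; first by rewrite invr_ge0 ltW.
 rewrite ler_pdivrMr// mulrAC ler_pdivlMr//.
 have hJ : 6 * C <= J x.
  have s (t : R) : rho <= `|t| -> 6 * C <= t ^+ 2.
   move=> ht; rewrite -(real_normK (num_real t)).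
   have r1 : 1 <= `|t| by apply: le_trans ht; rewrite /rho; lra.
   have : `|t| * 1 <= `|t| * `|t| by apply: ler_wpM2l.
   rewrite expr2 /rho in ht *; lra.
  case: hx => /s hh; apply: le_trans hh _; [exact: sq1_le_J|exact: sq2_le_J].
 have -> : C * M * 6 = M * (6 * C) by ring.
 by apply: ler_wpM2l.
have E x : 3 * (J x)^-1 * G x - \sum_j G (p j) * e j x = 3 * (J x)^-1 * (2^-1 * ((G x - RG x) + (G (- x) - RG (- x)))).
 have -> : \sum_j G (p j) * e j x = 3 * (J x)^-1 * (2^-1 * (RG x + RG (- x))).
  rewrite /RG -big_split mulr_sumr mulr_sumr; apply: eq_bigr => j _ /=; rewrite /e; ring.
 by rewrite Ge; field; exact: J_neq0.
have J0 x : 0 <= 3 * (J x)^-1 by rewrite mulr_ge0// invr_ge0 ltW// J_gt0.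
rewrite (funext E); split.
- by move=> x; rewrite J_opp opprK; congr (_ * (_ * _)); rewrite addrC.
- have mG : meas G := uc_meas (Guc Yh).
 have mR : meas RG.
  rewrite /RG; elim: (index_enum _) => [|j s IH]; first by under eq_fun do rewrite big_nil; exact: meas_cst.
  by under eq_fun do rewrite big_cons; apply: measD => //; apply: measM => //; exact: meas_cst.
 have mD : meas (fun x => G x - RG x) by exact: measB.
 have mN : meas (fun x => G (- x) - RG (- x)).
  by have := meas_comp_aff (-1) 0 mD; under eq_fun do rewrite aff_opp.
 by apply: measM; [apply: measM => //; exact: meas_cst|apply: measM; [exact: meas_cst|exact: measD]].
- move=> x; rewrite normrM (ger0_norm (J0 x)).
 have k1 := key x; have k2 := key (- x); rewrite J_opp in k2.
 have kk : `|2^-1 * ((G x - RG x) + (G (- x) - RG (- x)))| <= M / 6 * (J x)^-1.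
  rewrite normrM ger0_norm ?invr_ge0//; have := ler_normD (G x - RG x) (G (- x) - RG (- x)); lra.
 apply: le_trans (ler_wpM2l (J0 x) kk) _.
 by rewrite exprS expr1 invfM; apply: eqW; field; exact: J_neq0.
Qed.

(** The remainder [K2] is inverted by contraction, which reduces the equation to a linear system of
    size n. Its matrix is invertible because the full operator is injective; C collects the inverse
    of [1 - K2] and the entries of the inverse matrix. *)
Lemma fred : exists2 C, 0 <= C & forall M f, Yc M f ->
 exists2 h, Yc (C * M) h & forall x, h x = 3 * (J x)^-1 * cnv h P x + f x.
Proof.
have [C C0 hC] := Gbd.
have [n [e [p [Me [Ye HK]]]]] := split_rank.
pose K2 h x := 3 * (J x)^-1 * cnv h P x - \sum_j cnv h P (p j) * e j x.
have Sinv M f : Yc M f -> exists2 h, Yc (2 * M) h & forall x, K2 h x + f x = h x.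
 move=> Yf; have M0 : 0 <= M by have [_ _ b] := Yf; exact: bd_ge0 b.
 have M20 : 0 <= 2 * M by rewrite mulr_ge0.
 have [||h [Yh _] hh] := @Ycontr false (fun h x => K2 h x + f x) (2 * M) M20; last by exists h.
  move=> h Yh _; split => //; apply: Yc_le (YcD (HK _ _ Yh) Yf); lra.
 move=> h1 h2 M' Y1 Y2 _ _ b12.
 have Y12 : Yc M' (fun x => h1 x + (-1) * h2 x).
  have [e1 m1 _] := YcD Y1 (YcZ (-1) Y2); split => // x.
  by rewrite mulN1r; exact: b12.
 have [_ _ b] := HK _ _ Y12.
 move=> x; have := b x.
 have lin z : cnv (fun x => h1 x + (-1) * h2 x) P z = cnv h1 P z - cnv h2 P z.
  by rewrite (GD z Y1 (YcZ (-1) Y2)) (GZ (-1) z Y2) mulN1r.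
 have -> : \sum_j cnv (fun x => h1 x + (-1) * h2 x) P (p j) * e j x =
  \sum_j cnv h1 P (p j) * e j x - \sum_j cnv h2 P (p j) * e j x.
  by rewrite -sumrB; apply: eq_bigr => j _; rewrite lin mulrBl.
 rewrite lin /K2 => bb; apply: le_trans _ bb; apply: eqW; congr (`|_|).
 by ring.
(* psi j is the image of e j under the inverse of 1 - K2; the matrix A records the convolutions of
   the psi j at the nodes. *)
have [psi hpsi] := choice (fun j => let: ex_intro2 h a b := Sinv _ _ (Ye j) in ex_intro _ h (conj a b)).
pose A : 'M[R]_n := \matrix_(j, i) cnv (psi j) P (p i).
have combo (al : 'I_n -> R) : Yc (\sum_j `|al j| * (2 * Me)) (fun x => \sum_j al j * psi j x) /\
  forall x, cnv (fun x => \sum_j al j * psi j x) P x = \sum_j al j * cnv (psi j) P x.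
 have Ypsi j : Yc (2 * Me) (psi j) by have [] := hpsi j.
 by split=> [|x]; have [] := Gsum al 0 Ypsi => //; have [] := Gsum al x Ypsi.
have psiE (al : 'I_n -> R) x : \sum_j al j * psi j x =
 3 * (J x)^-1 * (\sum_j al j * cnv (psi j) P x) - \sum_i (\sum_j al j * A j i) * e i x + \sum_j al j * e j x.
 have -> : \sum_i (\sum_j al j * A j i) * e i x = \sum_j al j * \sum_i cnv (psi j) P (p i) * e i x.
  under eq_bigr do rewrite mulr_suml; rewrite exchange_big /=; apply: eq_bigr => j _.
  by rewrite mulr_sumr; apply: eq_bigr => i _; rewrite mxE mulrA.
 rewrite mulr_sumr -sumrB -big_split /=; apply: eq_bigr => j _.
 by have [_ hj] := hpsi j; rewrite -{1}hj /K2; ring.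
(* A row v with v A = v makes the combination of the psi j a solution of the homogeneous equation,
   hence zero by [injK]; its convolution at the nodes is v A, so v = 0. *)
have un : (1%:M - A) \in unitmx.
 rewrite -row_free_unit; apply: inj_row_free => v hv.
 have vE i : \sum_j v 0 j * A j i = v 0 i.
  move: hv; rewrite mulmxBr mulmx1 => /eqP; rewrite subr_eq0 => /eqP hv.
  have E := congr1 (fun w : 'rV_n => w 0 i) hv; rewrite /= [X in _ = X]mxE in E.
  exact: esym E.
 have [Yv Cv] := combo (v 0).
 have z := injK Yv; apply/rowP => i; rewrite mxE -vE.
 have z0 : forall x, \sum_j v 0 j * psi j x = 0.
  apply: z => x; rewrite Cv psiE; rewrite [X in _ - X + _ = _](_ : _ = \sum_j v 0 j * e j x) ?subrK//.
  by apply: eq_bigr => j _; rewrite vE.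
 have := Cv (p i); rewrite (_ : (fun x => _) = (fun=> 0)); last exact/funext.
 have -> : \sum_j v 0 j * A j i = \sum_j v 0 j * cnv (psi j) P (p i).
  by apply: eq_bigr => j _; rewrite mxE.
 move=> <-; rewrite /cnv; set F := (X in II X).
 have -> : II F = 0; last by rewrite mulr0.
 by rewrite -(II0 R); apply: II_ext => y; rewrite /F mul0r.
pose B := invmx (1%:M - A).
pose S := \sum_(j < n) \sum_(i < n) `|B i j|.
have S0 : 0 <= S by apply: sumr_ge0 => j _; apply: sumr_ge0.
have Me0 : 0 <= `|Me| by [].
exists (2 + 2 * C * S * (2 * `|Me|)).
 by apply: addr_ge0 => //; do 2 (apply: mulr_ge0; last by rewrite mulr_ge0 || exact: S0); exact: mulr_ge0.
move=> M f Yf; have M0 : 0 <= M by have [_ _ b] := Yf; exact: bd_ge0 b.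
have [phi Yphi hphi] := Sinv _ _ Yf.
pose be : 'rV[R]_n := \row_i cnv phi P (p i).
pose al := be *m B.
have beE i : `|be 0 i| <= 2 * C * M.
 rewrite mxE; apply: le_trans (hC _ _ Yphi (p i)) _.
 rewrite ler_pdivrMr ?exprn_gt0 ?J_gt0//.
 apply: le_trans (_ : 2 * C * M * 1 <= _); first by rewrite mulr1; apply: eqW; ring.
 by apply: ler_wpM2l; [rewrite !mulr_ge0|rewrite exprn_ege1// J_ge1].
have alA i : \sum_j al 0 j * A j i = al 0 i - be 0 i.
 have : al *m (1%:M - A) = be by rewrite /al mulmxKV.
 move/rowP => /(_ i); rewrite mulmxBr mulmx1 [in X in X -> _]mxE [X in _ + X]mxE => <-.
 by rewrite [(al *m A) 0 i]mxE opprB addrC subrK.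
have [Yal Cal] := combo (al 0).
exists (fun x => phi x + \sum_j al 0 j * psi j x).
 apply: Yc_le (YcD Yphi Yal).
 rewrite -mulr_suml (mulrDl 2 (2 * C * S * (2 * `|Me|)) M) lerD2l.
 have h1 : \sum_j `|al 0 j| <= 2 * C * M * S.
  rewrite /S mulr_sumr; apply: ler_sum => j _; rewrite mxE mulr_sumr.
  apply: le_trans (ler_norm_sum _ _ _) _; apply: ler_sum => i _; rewrite normrM.
  by apply: ler_wpM2r => //; rewrite -[be]/be; exact: beE.
 apply: le_trans (_ : (2 * C * M * S) * (2 * `|Me|) <= _); last first.
  by apply: eqW; ring.
 apply: le_trans (_ : (\sum_j `|al 0 j|) * (2 * `|Me|) <= _).
  by apply: ler_wpM2l; [exact: sumr_ge0|rewrite ler_pM2l// ler_norm].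
 by apply: ler_wpM2r => //; rewrite mulr_ge0.
move=> x; rewrite (GD x Yphi Yal) Cal psiE -[in LHS]hphi /K2.
have -> : \sum_i (\sum_j al 0 j * A j i) * e i x = \sum_j al 0 j * e j x - \sum_j cnv phi P (p j) * e j x.
 have beI i : be 0 i = cnv phi P (p i) by rewrite mxE.
 by rewrite -sumrB; apply: eq_bigr => i _; rewrite alA beI mulrBl.
by ring.
Qed.

End Inverse.

Section NonDegenerate.
Variables (Q : R * R -> R) (hQ : positive_radial_solution Q).
Local Notation g0 := (g0 Q).

Lemma P_Sz : Sz (cnv g0 g0).
Proof. exact: Sz_conv (g0_Sz hQ) (g0_Sz hQ). Qed.

(** A solution that is merely measurable with decay J^-2 is rapidly decreasing by the equation
    itself, so nondegeneracy applies to it. *)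
Lemma injK0 h M : Yc M h -> (forall x, h x = 3 * (J x)^-1 * cnv h (cnv g0 g0) x) -> forall x, h x = 0.
Proof.
move=> Yh hh; have SP := P_Sz; have [e m b] := Yh; have [B hB] := Sz_bounded SP; have [_ uP bP] := SP.
have J1 x : `|(J x)^-1| <= 1 by rewrite ger0_norm ?invr_ge0 ?(ltW (J_gt0 x))// invf_le1 ?J_gt0// J_ge1.
have [B2 hB2] := bP 2%N.
have ub : uc (cnv h (cnv g0 g0)) := conv_uc (Yc_Int Yh) hB uP.
have hb := conv_bd (leqnn 2) m (Sz_meas SP) b hB2.
have JE x : J x * h x = 3 * cnv h (cnv g0 g0) x.
 by rewrite {1}hh; field; exact: J_neq0.
have Sh : Sz h.
 split => //.
  have E : h = (fun x => 3 * ((J x)^-1 * cnv h (cnv g0 g0) x)) by apply/funext => x; rewrite {1}hh mulrA.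
  by rewrite E; apply: ucZ; apply: ucM J1 (fun x => bd_abs x hb) Jinv_uc ub.
 apply: bootstrap; first by exists M.
 move=> k k2 [N hN]; have [N' hN'] := bP k.
 exists (3 * (Ck R k * N * N')) => x; rewrite JE normrM (ger0_norm (ler0n R 3)) -mulrA.
 by apply: ler_wpM2l => //; exact: conv_bd k2 m (Sz_meas SP) hN hN' x.
move=> x; apply: (nondeg hQ Sh) => xi; rewrite JE; congr (_ * _).
by apply: conv_comm => [||y|y]; [exact: Yc_Int Yh|exact: Sz_Int SP|exact: bd_abs b|exact: hB].
Qed.

Lemma fred0 : exists2 C : R, 0 <= C & forall M f, Yc M f ->
 exists2 h, Yc (C * M) h & forall x, h x = 3 * (J x)^-1 * cnv h (cnv g0 g0) x + f x.
Proof. exact: fred P_Sz injK0. Qed.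

End NonDegenerate.
End Fred.

(** * The nonlinear fixed point *)

Section Contr.
Variable R : realType.
Local Notation J := (@jap R).
Local Notation kap := (@kap R).
Implicit Types (a b d f g h th : R * R -> R) (x y xi c : R * R) (M A B D tau : R).

Definition Ac c xi : R := dot2 xi xi - dot2 c xi ^+ 2.
(** The excess over 1 in the response of - N to U^2, on the frequency side. Division by zero gives
    [mu c 0 = 0], so the bounds and the parity hold at the origin too. *)
Definition mu c xi : R := dot2 c xi ^+ 2 / Ac c xi.

Lemma Ac_ge c xi : dot2 c c <= 2^-1 -> dot2 xi xi / 2 <= Ac c xi.
Proof.
move=> c2; have := dot2_sq c xi; have := ler_wpM2r (dot2_ge0 xi) c2; rewrite /Ac; lra.
Qed.

Lemma dot2_gt0 xi : xi != 0 -> 0 < dot2 xi xi.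
Proof. by move=> /enorm2_gt0; rewrite /enorm2 sqrtr_gt0. Qed.
Lemma Ac_gt0 c xi : dot2 c c <= 2^-1 -> xi != 0 -> 0 < Ac c xi.
Proof. by move=> c2 /dot2_gt0 x0; apply: lt_le_trans (Ac_ge _ c2); rewrite divr_gt0. Qed.
Lemma Ac0 c : Ac c 0 = 0.
Proof. by rewrite /Ac /dot2 /= !mulr0 !addr0 expr0n subrr. Qed.

Lemma Ac_cont c : continuous (Ac c).
Proof.
have D : Dk 0 (Ac c).
 apply: DkB; first by apply: DkD; apply: DkM; [exact: Dk_fst|exact: Dk_fst|exact: Dk_snd|exact: Dk_snd].
 have l : Dk 0 (fun z => dot2 c z) by apply: Dk_ext (Dk_lin 0 c.1 c.2 0) => z; rewrite /dot2 addr0.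
 by apply: Dk_ext (DkM l l) => z; rewrite expr2.
exact: D.
Qed.

Lemma Ac_opp c xi : Ac c (- xi) = Ac c xi.
Proof. by rewrite /Ac /dot2 !pE; ring. Qed.

Lemma quot_cont c (p : R * R -> R) xi : dot2 c c <= 2^-1 -> continuous p -> xi != 0 -> {for xi, continuous (fun x => p x / Ac c x)}.
Proof.
move=> c2 cp x0; apply: cvgM; first exact: cp.
by apply: cvgV; [rewrite gt_eqF// Ac_gt0|exact: Ac_cont].
Qed.

Lemma quot_meas c (p : R * R -> R) : dot2 c c <= 2^-1 -> continuous p -> meas (fun x => p x / Ac c x).
Proof. by move=> c2 cp; apply: (@punctured_meas _ _ 0) => x x0; exact: quot_cont. Qed.

Lemma dotsq_cont c : continuous (fun x => dot2 c x ^+ 2).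
Proof.
have l : Dk 0 (fun z => dot2 c z) by apply: Dk_ext (Dk_lin 0 c.1 c.2 0) => z; rewrite /dot2 addr0.
have D : Dk 0 (fun x => dot2 c x ^+ 2) by apply: Dk_ext (DkM l l) => z; rewrite expr2.
exact: D.
Qed.

Lemma mu_meas c : dot2 c c <= 2^-1 -> meas (mu c).
Proof. by move=> c2; apply: quot_meas => //; exact: dotsq_cont. Qed.
Lemma mu_opp c : evn (mu c).
Proof. by move=> x; rewrite /mu Ac_opp /dot2 !pE !mulrN -opprD sqrrN. Qed.

Lemma mu_bd c xi : dot2 c c <= 2^-1 -> 0 <= mu c xi <= 2 * dot2 c c.
Proof.
move=> c2; have [->|x0] := eqVneq xi 0.
 by rewrite /mu Ac0 invr0 mulr0 lexx mulr_ge0// dot2_ge0.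
have a0 := Ac_gt0 c2 x0; rewrite divr_ge0 ?sqr_ge0 ?(ltW a0)//=.
rewrite /mu ler_pdivrMr//; apply: le_trans (dot2_sq c xi) _.
rewrite -mulrA mulrCA; apply: ler_wpM2l; first exact: dot2_ge0.
by have := Ac_ge xi c2; lra.
Qed.

Local Notation k2 := (Ck R 2).
Let k20 : 0 <= k2 := Ck_ge0 R 2.
Definition Xc M h : Prop := Yc M h /\ uc h.
Definition good tau th : Prop := [/\ evn th, meas th & forall x, `|th x| <= tau].

Lemma goodY tau th M h : good tau th -> Yc M h -> Yc (tau * M) (fun x => th x * h x).
Proof.
move=> [et mt bt] [e m b]; split; [by move=> x; rewrite e et|exact: measM|exact: bdM b bt].
Qed.

Lemma YX_cnv A B a b : Yc A a -> Xc B b -> Xc (k2 * A * B) (cnv a b).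
Proof.
move=> Ya [Yb ub]; have [ea ma ba] := Ya; have [eb mb bb] := Yb.
have bB y := bd_abs y bb; have uab := conv_uc (Yc_Int Ya) bB ub.
split => //; split; [|exact: uc_meas|exact: conv_bd].
by apply: conv_even => //; [exact: Yc_Int Ya|exists B].
Qed.

Lemma Xc_sub M N k f g : Xc M f -> Xc N g -> bd 2 k (fun x => f x - g x) -> Xc k (fun x => f x - g x).
Proof.
move=> [[e m b] u] [[e' m' b'] u'] bk; split; last first.
 by have := ucD u (ucZ (-1) u'); under eq_fun do rewrite mulN1r.
by split => //; [move=> x; rewrite e e'|exact: measB].
Qed.

Lemma cnvBl M N B f g b x : Yc M f -> Yc N g -> Xc B b ->
 cnv (fun x => f x - g x) b x = cnv f b x - cnv g b x.
Proof.
move=> Yf Yg [[_ mb bb] _]; have bB y := bd_abs y bb.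
rewrite /cnv -mulrBr -IIB; [|exact: conv_Int (Yc_Int Yf) mb bB|exact: conv_Int (Yc_Int Yg) mb bB].
by congr (_ * _); apply: II_ext => y; ring.
Qed.

Lemma cnvBr A M N a f g x : Yc A a -> Xc M f -> Xc N g ->
 cnv a (fun x => f x - g x) x = cnv a f x - cnv a g x.
Proof.
move=> Ya [[_ mf bf] _] [[_ mg bg] _].
rewrite /cnv -mulrBr -IIB; [|exact: conv_Int (Yc_Int Ya) mf (fun y => bd_abs y bf)|exact: conv_Int (Yc_Int Ya) mg (fun y => bd_abs y bg)].
by congr (_ * _); apply: II_ext => y; ring.
Qed.

(** With multiplier 1 + mu and a = b = d = g this is the transform of - N U. *)
Definition T3 th a b d : R * R -> R := cnv (fun x => th x * cnv a b x) d.

Lemma T3_X tau th A B D a b d : good tau th -> Xc A a -> Xc B b -> Xc D d ->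
 Xc (k2 * (tau * (k2 * A * B)) * D) (T3 th a b d).
Proof.
move=> gt [Ya _] Xb Xd; have [Yab _] := YX_cnv Ya Xb.
by apply: YX_cnv => //; exact: goodY.
Qed.

Lemma bd_eq k M M' f : bd k M f -> M = M' -> bd k M' f.
Proof. by move=> h <-. Qed.

Lemma T3_diff tau th A B D a b d a' b' d' da db dd : good tau th ->
 Xc A a -> Xc B b -> Xc D d -> Xc A a' -> Xc B b' -> Xc D d' ->
 bd 2 da (fun x => a x - a' x) -> bd 2 db (fun x => b x - b' x) -> bd 2 dd (fun x => d x - d' x) ->
 bd 2 (k2 * (tau * k2) * (da * B * D + A * db * D + A * B * dd)) (fun x => T3 th a b d x - T3 th a' b' d' x).
Proof.
move=> gt Xa Xb Xd Xa' Xb' Xd' ha hb hd.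
have Xda := Xc_sub Xa Xa' ha; have Xdb := Xc_sub Xb Xb' hb; have Xdd := Xc_sub Xd Xd' hd.
have [Ya _] := Xa; have [Ya' _] := Xa'.
have Xab := YX_cnv Ya Xb; have Xab' := YX_cnv Ya' Xb'; have Xmb := YX_cnv Ya' Xb.
have Y1 := goodY gt (proj1 Xab); have Y2 := goodY gt (proj1 Xab'); have Y3 := goodY gt (proj1 Xmb).
have [[_ _ b1] _] := T3_X gt Xda Xb Xd.
have [[_ _ b2] _] := T3_X gt Xa' Xdb Xd.
have [[_ _ b3] _] := T3_X gt Xa' Xb' Xdd.
have E x : T3 th a b d x - T3 th a' b' d' x = (T3 th (fun x => a x - a' x) b d x + T3 th a' (fun x => b x - b' x) d x) + T3 th a' b' (fun x => d x - d' x) x.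
 have e1 : T3 th (fun x => a x - a' x) b d x = T3 th a b d x - T3 th a' b d x.
  rewrite /T3 -(cnvBl x Y1 Y3 Xd); congr (cnv _ d x); apply/funext => z.
  by rewrite (cnvBl z Ya Ya' Xb) mulrBr.
 have e2 : T3 th a' (fun x => b x - b' x) d x = T3 th a' b d x - T3 th a' b' d x.
  rewrite /T3 -(cnvBl x Y3 Y2 Xd); congr (cnv _ d x); apply/funext => z.
  by rewrite (cnvBr z Ya' Xb Xb') mulrBr.
 have e3 : T3 th a' b' (fun x => d x - d' x) x = T3 th a' b' d x - T3 th a' b' d' x.
  by rewrite /T3 -(cnvBr x Y2 Xd Xd').
 have al (p q r s : R) : p - s = ((p - q) + (q - r)) + (r - s) by ring.
 by rewrite e1 e2 e3; exact: al.
by rewrite (funext E); apply: bd_eq (bdD (bdD b1 b2) b3) _; ring.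
Qed.

Lemma good1 : good 1 (fun=> 1).
Proof. by split => [//||x]; [exact: meas_cst|rewrite normr1]. Qed.

Lemma good_mu c : dot2 c c <= 2^-1 -> good (2 * dot2 c c) (mu c).
Proof.
move=> c2; split; [exact: mu_opp|exact: mu_meas|].
by move=> x; have /andP[p q] := mu_bd x c2; rewrite ger0_norm.
Qed.

Lemma good_1mu c : dot2 c c <= 2^-1 -> good 2 (fun x => 1 + mu c x).
Proof.
move=> c2; split; [by move=> x; rewrite mu_opp|by apply: measD; [exact: meas_cst|exact: mu_meas]|].
by move=> x; have /andP[p q] := mu_bd x c2; rewrite ger0_norm ?addr_ge0//; lra.
Qed.

Lemma XcD M N f g : Xc M f -> Xc N g -> Xc (M + N) (fun x => f x + g x).
Proof. by move=> [y u] [y' u']; split; [exact: YcD|exact: ucD]. Qed.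
Lemma XcZ k M f : Xc M f -> Xc (`|k| * M) (fun x => k * f x).
Proof. by move=> [y u]; split; [exact: YcZ|exact: ucZ]. Qed.
Lemma Xc_le M M' h : M <= M' -> Xc M h -> Xc M' h.
Proof. by move=> MM [y u]; split; [exact: Yc_le y|]. Qed.
Lemma Jinv_bd1 x : `|(J x)^-1| <= 1.
Proof. by rewrite ger0_norm ?invr_ge0 ?(ltW (J_gt0 x))// invf_le1 ?J_gt0// J_ge1. Qed.

Lemma Xc_Jinv M f : Xc M f -> Xc M (fun x => (J x)^-1 * f x).
Proof.
move=> [[e m b] u]; split.
 split; [by move=> x; rewrite J_opp e|by apply: measM => //; exact: uc_meas (@Jinv_uc R)|].
 by rewrite -[M]mul1r; apply: bdM b Jinv_bd1.
exact: ucM Jinv_bd1 (fun x => bd_abs x b) (@Jinv_uc R) u.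
Qed.

(* Elements of [X] are determined by their inverse transforms, so identities between iterated convolutions can be checked on the physical side. *)
Lemma Xc_FI_inj M N f g : Xc M f -> Xc N g -> (forall x, FI f x = FI g x) -> forall x, f x = g x.
Proof.
move=> Xf Xg E x; apply: subr0_eq.
have [_ _ bf] := proj1 Xf; have [_ _ bg] := proj1 Xg.
have Xd := Xc_sub Xf Xg (bdB bf bg); have [Yd ud] := Xd; have [ed _ bd_] := Yd.
have z y : FI (fun x => f x - g x) y = 0.
 by rewrite FIB ?E ?subrr//; [exact: Yc_Int (proj1 Xf)|exact: Yc_Int (proj1 Xg)].
have ct : {for x, continuous (fun x => f x - g x)} by exact: uc_cont.
rewrite -(Tr_FI (Yc_Int Yd) ed (fun y => bd_abs y bd_) ct); last by apply: Int_ext (Int0 R) => y; rewrite z.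
rewrite (funext z) /Tr -[RHS](II0 R); apply: II_ext => y; by rewrite mul0r.
Qed.

Lemma FI_YX A B a b x : Yc A a -> Xc B b -> FI (cnv a b) x = FI a x * FI b x.
Proof. by move=> [ea ma ba] [[eb mb bb] _]; exact: FI_conv ma mb eb ba bb. Qed.
Lemma FI_1 a x : FI (fun x => 1 * a x) x = FI a x.
Proof. by congr (FI _ x); apply/funext => y; rewrite mul1r. Qed.

Section Fixed.
Variables (Q : R * R -> R) (hQ : positive_radial_solution Q).
Local Notation g0 := (g0 Q).

(** Turns the existence statement [fred0] into a solution operator. Uniqueness, from [injK0], makes
    it independent of the radius M and additive on differences, hence Lipschitz. *)
Lemma fredS : exists C (S : (R * R -> R) -> (R * R -> R)), [/\ 0 <= C,
 forall M f, Yc M f -> Yc (C * M) (S f),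
 forall M f, Yc M f -> uc f -> uc (S f),
 (forall M f, Yc M f -> forall x, J x * S f x = 3 * cnv (S f) (cnv g0 g0) x + J x * f x) &
 forall M N k f g, Yc M f -> Yc N g -> bd 2 k (fun x => f x - g x) -> bd 2 (C * k) (fun x => S f x - S g x)].
Proof.
have [C C0 hC] := fred0 hQ.
have SP := P_Sz hQ; have [eP uP bP] := SP; have [B2 hB2] := bP 2%N.
have XP : Xc B2 (cnv g0 g0) by split=> //; split => //; exact: Sz_meas.
pose eqn f s := forall x, s x = 3 * (J x)^-1 * cnv s (cnv g0 g0) x + f x.
have lin f s f' s' M M' : Yc M s -> Yc M' s' -> eqn f s -> eqn f' s' -> eqn (fun x => f x - f' x) (fun x => s x - s' x).
 by move=> Y Y' e e' x; rewrite (cnvBl x Y Y' XP) {1}e {1}e'; ring.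
have YB M N f g : Yc M f -> Yc N g -> Yc (M + N) (fun x => f x - g x).
 by move=> [e m b] [e' m' b']; split; [by move=> x; rewrite e e'|exact: measB|exact: bdB].
have uniq f s s' M M' : Yc M s -> Yc M' s' -> eqn f s -> eqn f s' -> s = s'.
 move=> Y Y' e e'; have l := lin _ _ _ _ _ _ Y Y' e e'.
 have z := injK0 hQ (YB _ _ _ _ Y Y'); apply/funext => x; apply: subr0_eq; apply: z => y.
 by rewrite {1}l subrr addr0.
have ex f : exists s, forall M, Yc M f -> Yc (C * M) s /\ eqn f s.
 have [[M0 Y0]|n] := pselect (exists M, Yc M f); last by exists f => M Y; exfalso; apply: n; exists M.
 have [s Ys es] := hC _ _ Y0; exists s => M Y; split => //.
 by have [s' Ys' es'] := hC _ _ Y; rewrite (uniq _ _ _ _ _ Ys Ys' es es').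
have [S hS] := choice ex.
exists C, S; split => //.
- by move=> M f Y; have [] := hS f M Y.
- move=> M f Y uf; have [[e m b] eq] := hS f M Y.
 have Xs := YX_cnv (And3 e m b) XP; have [_ ur] := XcZ 3 (Xc_Jinv Xs).
 have := ucD ur uf; congr uc; apply/funext => x; by rewrite [RHS]eq mulrA.
- move=> M f Y x; have [_ eq] := hS f M Y; rewrite {1}eq.
 rewrite mulrDr; congr (_ + _); rewrite -mulrA mulrCA; congr (_ * _).
 by rewrite mulrA divff ?mul1r// J_neq0.
- move=> M N k f g Yf Yg b.
 have [Ys es] := hS f M Yf; have [Ys' es'] := hS g N Yg.
 have Yk : Yc k (fun x => f x - g x) by have [e m _] := YB _ _ _ _ Yf Yg; split.
 have [s Y e] := hC _ _ Yk; have [_ _] := Y.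
 by rewrite (uniq _ _ _ _ _ (YB _ _ _ _ Ys Ys') Y (lin _ _ _ _ _ _ Ys Ys' es es') e).
Qed.

Lemma g0_X : exists2 M0, 0 <= M0 & Xc M0 g0.
Proof.
have [e u b] := g0_Sz hQ; have [M0 h0] := b 2%N; exists M0; first exact: bd_ge0 h0.
by split=> //; split=> //; exact: g0_meas.
Qed.

(** What remains of the nonlinearity once g0 and the term linear in h at c = 0 are removed: h^2 (3
    g0 + h) as iterated convolutions, and the whole [mu] term. At h = 0 only the latter is left, of
    size |c|^2. *)
Definition Ec c h x : R := (J x)^-1 *
 (T3 (fun=> 1) h h (fun x => 3 * g0 x + h x) x +
  T3 (mu c) (fun x => g0 x + h x) (fun x => g0 x + h x) (fun x => g0 x + h x) x).

Lemma X30 M0 B h : Xc M0 g0 -> Xc B h -> B <= 1 -> Xc (3 * M0 + 1) (fun x => 3 * g0 x + h x).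
Proof.
move=> X0 Xh B1; have := XcZ 3 X0; rewrite ger0_norm// => X3.
by apply: Xc_le (XcD X3 Xh); rewrite lerD2l.
Qed.

Lemma X31 M0 B h : Xc M0 g0 -> Xc B h -> B <= 1 -> Xc (M0 + 1) (fun x => g0 x + h x).
Proof. by move=> X0 Xh B1; apply: Xc_le (XcD X0 Xh); rewrite lerD2l. Qed.

Lemma Ec_X c M0 B h : dot2 c c <= 2^-1 -> Xc M0 g0 -> Xc B h -> B <= 1 -> exists M, Xc M (Ec c h).
Proof.
move=> c2 X0 Xh B1; have Xg := X31 X0 Xh B1; have X3 := X30 X0 Xh B1.
have t1 := T3_X good1 Xh Xh X3; have t2 := T3_X (good_mu c2) Xg Xg Xg.
by eexists; apply: Xc_Jinv; exact: XcD t1 t2.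
Qed.

Lemma Ec_diff c M0 B h1 h2 M : dot2 c c <= 2^-1 -> Xc M0 g0 -> Xc B h1 -> Xc B h2 -> B <= 1 ->
 bd 2 M (fun x => h1 x - h2 x) ->
 bd 2 (k2 ^+ 2 * M * (2 * B * (3 * M0 + 1) + B ^+ 2 + 6 * dot2 c c * (M0 + 1) ^+ 2)) (fun x => Ec c h1 x - Ec c h2 x).
Proof.
move=> c2 X0 X1 X2 B1 hM.
have G1 := X31 X0 X1 B1; have G2 := X31 X0 X2 B1.
have D1 := X30 X0 X1 B1; have D2 := X30 X0 X2 B1.
have sh (a : R * R -> R) : bd 2 M (fun x => (a x + h1 x) - (a x + h2 x)).
 by move=> x; have := hM x; rewrite opprD addrACA subrr add0r.
have b1 := T3_diff good1 X1 X1 D1 X2 X2 D2 hM hM (sh _).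
have b2 := T3_diff (good_mu c2) G1 G1 G1 G2 G2 G2 (sh _) (sh _) (sh _).
have al (j p q r s : R) : j * (p + q) - j * (r + s) = j * ((p - r) + (q - s)) by ring.
move=> x; rewrite /Ec al normrM; have := bdD b1 b2 x => hb.
apply: le_trans (ler_wpM2r (normr_ge0 _) (Jinv_bd1 x)) _; rewrite mul1r; apply: le_trans hb _.
by apply: eqW; congr (_ / _); ring.
Qed.

Lemma X0 : Xc 0 (fun=> 0 : R).
Proof.
split; first exact: Yc0.
by apply: (@uc_lip _ _ 0) => x y; rewrite subrr normr0 mul0r.
Qed.

Lemma Ec0 c M0 : dot2 c c <= 2^-1 -> Xc M0 g0 -> Xc (2 * k2 ^+ 2 * M0 ^+ 3 * dot2 c c) (Ec c (fun=> 0)).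
Proof.
move=> c2 XM.
have X3 := XcD (XcZ 3 XM) X0; have Xg := XcD XM X0.
have := Xc_Jinv (XcD (T3_X good1 X0 X0 X3) (T3_X (good_mu c2) Xg Xg Xg)).
by apply: Xc_le; apply: eqW; rewrite !addr0; ring.
Qed.

(** Contraction in a ball of radius proportional to |c|^2. Half of the radius is used by the image
    of 0, the other half by the Lipschitz constant 1/2. *)
Lemma fixed_pt : exists k0 be : R, [/\ 0 < k0, k0 <= 2^-1, 0 <= be &
 forall c, dot2 c c <= k0 -> exists2 h, Xc (be * dot2 c c) h & be * dot2 c c <= 1 /\
  forall xi, J xi * h xi = 3 * cnv h (cnv g0 g0) xi + J xi * Ec c h xi].
Proof.
have [C [S [C0 SY Su Seq Sd]]] := fredS.
have [M0 M00 XM] := g0_X.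
(* B0 |c|^2 bounds the image of 0, by [Ec0]; doubling it gives the radius of the ball. *)
pose B0 := C * (2 * k2 ^+ 2 * M0 ^+ 3); pose be := 2 * B0.
(* On that ball the Lipschitz constant of [Ec c] is at most L |c|^2; the square of the radius is
   replaced by the radius, which is at most 1. *)
pose L := k2 ^+ 2 * (2 * be * (3 * M0 + 1) + be + 6 * (M0 + 1) ^+ 2).
have B00 : 0 <= B0.
 by apply: mulr_ge0 => //; apply: mulr_ge0; [apply: mulr_ge0 => //; exact: sqr_ge0|exact: exprn_ge0].
have be0 : 0 <= be by rewrite mulr_ge0.
have L0 : 0 <= L.
 apply: mulr_ge0; first exact: sqr_ge0.
 apply: addr_ge0; last by rewrite mulr_ge0 ?sqr_ge0.
 by apply: addr_ge0 => //; apply: mulr_ge0; [rewrite mulr_ge0|lran].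
have i1 : 0 < (be + 1)^-1 by rewrite invr_gt0 ltr_wpDl.
have CL : 0 <= C * L by exact: mulr_ge0.
have i2 : 0 < (2 * (C * L) + 1)^-1 by rewrite invr_gt0; lra.
exists (Num.min 2^-1 (Num.min (be + 1)^-1 (2 * (C * L) + 1)^-1)), be; split => //.
- by rewrite !lt_min i1 i2 invr_gt0 ltr0n.
- by rewrite ge_min lexx.
move=> c; rewrite !le_min => /andP[c2 /andP[k1 k3]].
set k := dot2 c c in c2 k1 k3 *.
have kk0 : 0 <= k := dot2_ge0 c.
have bk1 : be * k <= 1.
 move: k1; rewrite -[(be + 1)^-1]mul1r ler_pdivlMr; last by rewrite ltr_wpDl.
 by rewrite mulrDr mulr1 mulrC; lra.
have CLk : C * L * k <= 2^-1.
 move: k3; rewrite -[(2 * (C * L) + 1)^-1]mul1r ler_pdivlMr; last lra.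
 by rewrite mulrDr mulr1 => k3; rewrite mulrC; lra.
have bk0 : 0 <= be * k by exact: mulr_ge0.
have dE h1 h2 M : Xc (be * k) h1 -> Xc (be * k) h2 -> bd 2 M (fun x => h1 x - h2 x) ->
  bd 2 (M / 2) (fun x => S (Ec c h1) x - S (Ec c h2) x).
 move=> X1 X2 hM; have M_0 := bd_ge0 hM.
 have [m1 E1] := Ec_X c2 XM X1 bk1; have [m2 E2] := Ec_X c2 XM X2 bk1.
 have := Sd _ _ _ _ _ (proj1 E1) (proj1 E2) (Ec_diff c2 XM X1 X2 bk1 hM).
 apply: bd_le => //.
 apply: le_trans (_ : M * (C * L * k) <= _); last by apply: ler_wpM2l.
 have -> : M * (C * L * k) = C * (k2 ^+ 2 * M * ((2 * be * (3 * M0 + 1) + be + 6 * (M0 + 1) ^+ 2) * k)).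
  by rewrite /L; ring.
 apply: ler_wpM2l => //; apply: ler_wpM2l; first by rewrite mulr_ge0// sqr_ge0.
 have : (be * k) ^+ 2 <= be * k by rewrite expr2 ler_piMl.
 by rewrite -/k; lra.
have S0 : bd 2 (be * k / 2) (S (Ec c (fun=> 0))).
 have [_ _] := SY _ _ (proj1 (Ec0 c2 XM)); apply: bd_le => //.
 by rewrite /be /B0 -/k; apply: eqW; field.
have X00 : Xc (be * k) (fun=> 0) by apply: Xc_le X0.
have [||h [Yh uh] hh] := @Ycontr R true (fun h => S (Ec c h)) (be * k) bk0.
- move=> h Yh uh; have Xh : Xc (be * k) h by split => //; exact: uh.
 have [M E1] := Ec_X c2 XM Xh bk1; have [YE uE] := E1.
 split=> [|_]; last exact: Su YE uE.
 have [e m _] := SY _ _ YE; split => // x.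
 have d := dE _ _ (be * k) Xh X00 _ x.
 have al (p q : R) : p = (p - q) + q by ring.
 rewrite (al (S (Ec c h) x) (S (Ec c (fun=> 0)) x)); apply: normD_le.
 have dd : bd 2 (be * k) (fun x => h x - 0) by move=> y; rewrite subr0; have [_ _] := Yh.
 by have := lerD (d dd) (S0 x); rewrite -mulrDl -splitr.
- by move=> h1 h2 M Y1 Y2 u1 u2 hM; apply: dE hM; split=> //; [exact: u1|exact: u2].
have Xh : Xc (be * k) h by split => //; exact: uh.
exists h => //; split => // xi.
have [M [YE _]] := Ec_X c2 XM Xh bk1.
by have := Seq _ _ YE xi; rewrite (funext hh).
Qed.

(** On the physical side this is (Q + w)^3 = Q^3 + 3 Q^2 w + w^2 (3 Q + w), carried back to the
    convolutions by injectivity of the transform; the [mu] term is untouched. *)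
Lemma expand g h M0 B c : dot2 c c <= 2^-1 -> Xc M0 g0 -> Xc B h -> B <= 1 ->
 (forall xi, J xi * h xi = 3 * cnv h (cnv g0 g0) xi + J xi * Ec c h xi) ->
 (forall xi, g xi = g0 xi + h xi) ->
 forall xi, J xi * g xi = T3 (fun x => 1 + mu c x) g g g xi.
Proof.
move=> c2 XM Xh B1 eh /funext eg xi.
have XP := YX_cnv (proj1 XM) XM.
have Xg := X31 XM Xh B1; rewrite -eg in Xg; have X3 := X30 XM Xh B1.
have t1 := T3_X good1 Xg Xg Xg; have t2 := T3_X good1 Xh Xh X3.
have c1 := YX_cnv (proj1 XP) XM; have ch := YX_cnv (proj1 Xh) XP.
have I f M (X : Xc M f) : Int f := Yc_Int (proj1 X).
have key x : T3 (fun=> 1) g g g x = (cnv (cnv g0 g0) g0 x + 3 * cnv h (cnv g0 g0) x) + T3 (fun=> 1) h h (fun x => 3 * g0 x + h x) x.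
 move: x; apply: (Xc_FI_inj t1 (XcD (XcD c1 (XcZ 3 ch)) t2)) => x.
 rewrite (FID _ (I _ _ (XcD c1 (XcZ 3 ch))) (I _ _ t2)) (FID _ (I _ _ c1) (I _ _ (XcZ 3 ch))) (FIZ _ _ (I _ _ ch)).
 have F3 f1 f2 f3 A1 A2 A3 : Xc A1 f1 -> Xc A2 f2 -> Xc A3 f3 -> FI (T3 (fun=> 1) f1 f2 f3) x = FI f1 x * FI f2 x * FI f3 x.
  move=> x1 x2 x3; have x12 := YX_cnv (proj1 x1) x2.
  by rewrite /T3 (FI_YX _ (goodY good1 (proj1 x12)) x3) FI_1 (FI_YX _ (proj1 x1) x2).
 rewrite (F3 _ _ _ _ _ _ Xg Xg Xg) (F3 _ _ _ _ _ _ Xh Xh X3) (FI_YX _ (proj1 XP) XM) (FI_YX _ (proj1 Xh) XP) (FI_YX _ (proj1 XM) XM).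
 rewrite (FID _ (I _ _ (XcZ 3 XM)) (I _ _ Xh)) (FIZ _ _ (I _ _ XM)) eg (FID _ (I _ _ XM) (I _ _ Xh)).
 ring.
have Xgg := YX_cnv (proj1 Xg) Xg.
have spl : T3 (fun x => 1 + mu c x) g g g xi = T3 (fun=> 1) g g g xi + T3 (mu c) g g g xi.
 have := cnvBl xi (goodY (good_1mu c2) (proj1 Xgg)) (goodY (good_mu c2) (proj1 Xgg)) Xg.
 rewrite (_ : (fun x => (1 + mu c x) * cnv g g x - mu c x * cnv g g x) = (fun x => 1 * cnv g g x)); last first.
  by apply/funext => x; ring.
 by rewrite -/(T3 (fun=> 1) g g g xi) => ->; rewrite /T3; ring.
rewrite spl key {1}eg mulrDr (g0_eq hQ) eh /Ec mulVKf ?J_neq0// -eg.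
ring.
Qed.

(* Constants uniform in [c]: the decay of [g] in Fourier space bootstraps with bounds depending only on the previous ones. *)
Lemma uniform_bd (G : (R * R -> R) -> Prop) M : (forall g, G g -> Xc M g /\ exists c, dot2 c c <= 2^-1 /\
  forall xi, J xi * g xi = T3 (fun x => 1 + mu c x) g g g xi) ->
 forall k, exists2 N, 0 <= N & forall g, G g -> bd k N g.
Proof.
move=> HG.
have main k : exists2 N, 0 <= N & forall g, G g -> bd (k + 2) N g.
 elim: k => [|k [N N0 hN]].
  exists `|M| => // g /HG[[[_ _ b] _] _]; apply: bd_le b => //; exact: ler_norm.
 pose Ck' := Ck R (k + 2).
 have C0 : 0 <= Ck' by exact: Ck_ge0.
 exists (Ck' * (2 * (Ck' * N * N)) * N).
  by apply: mulr_ge0 => //; apply: mulr_ge0 => //; apply: mulr_ge0 => //; apply: mulr_ge0 => //; exact: mulr_ge0.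
 move=> g Gg x; have [[[_ m b] u] [c [c2 eq]]] := HG _ Gg; have bN := hN _ Gg.
 have k2' : (2 <= k + 2)%N by exact: leq_addl.
 have [_ mg bg] := good_1mu c2.
 have [Ygg _] := YX_cnv (proj1 (proj1 (HG _ Gg))) (proj1 (HG _ Gg)).
 have b1 := bdM (conv_bd k2' m m bN bN) bg.
 have [_ m1 _] := goodY (good_1mu c2) Ygg.
 have := conv_bd k2' m1 m b1 bN x; rewrite -/(T3 _ g g g x) -eq normrM (ger0_norm (J_ge0 _)) => h.
 rewrite addSn exprS invfM mulrCA -(ler_pM2l (J_gt0 x)) mulVKf//.
 exact: J_neq0.
move=> k; have [N N0 hN] := main k; exists N => // g /hN; apply: bd_le => //; exact: leq_addr.
Qed.

(** All candidate solutions, for all admissible c, form one class [G]; the decay constants [Mk] are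
    chosen for the class and thus before c. *)
Lemma main_g : exists (k0 be : R) (Mk : nat -> R), [/\ 0 < k0, k0 <= 2^-1, 0 <= be, forall k, 0 <= Mk k &
 forall c, dot2 c c <= k0 -> exists g, [/\ Sz g, forall k, bd k (Mk k) g,
  bd 2 (be * dot2 c c) (fun x => g x - g0 x) &
  forall xi, J xi * g xi = T3 (fun x => 1 + mu c x) g g g xi]].
Proof.
have [M0 M00 XM] := g0_X.
have [k0 [be [k00 k02 be0 H]]] := fixed_pt.
pose G g := Xc (M0 + 1) g /\ exists c, dot2 c c <= 2^-1 /\
  forall xi, J xi * g xi = T3 (fun x => 1 + mu c x) g g g xi.
have U k : exists N, 0 <= N /\ forall g, G g -> bd k N g.
 by have [N N0 hN] := @uniform_bd G (M0 + 1) (fun g (Gg : G g) => Gg) k; exists N.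
have [Mk hMk] := choice U.
exists k0, be, Mk; split => // [k|c ck]; first by have [] := hMk k.
have c2 := le_trans ck k02.
have [h Xh [b1 eh]] := H c ck.
pose g x := g0 x + h x.
have eg := expand c2 XM Xh b1 eh (fun x => erefl (g x)).
have Gg : G g by split; [exact: X31 XM Xh b1|exists c].
have bg k : bd k (Mk k) g by have [_] := hMk k; exact.
exists g; split => //.
 by have [[e m _] u] := proj1 Gg; split => // k; exists (Mk k).
by move=> x; rewrite /g addrC addKr; have [[_ _]] := Xh; exact.
Qed.

End Fixed.
End Contr.

(** * Jets and the Leibniz rule *)

Section Jets.
Variable R : realType.
Implicit Types (p q r s : nat -> nat -> R * R -> R) (x : R * R) (P S : nat -> nat -> R).

(* [p a b] plays the role of the derivative [d_1^a d_2^b] of [p 0 0]. *)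
Definition jet p : Prop := forall a b x, hg (p a b) x (p a.+1 b x) (p a b.+1 x).

Lemma jet_uniq p q : jet p -> jet q -> (forall x, p 0 0 x = q 0 0 x) -> forall a b x, p a b x = q a b x.
Proof.
move=> jp jq e0.
have E0 b x : p 0 b x = q 0 b x.
 elim: b x => [//|b IH] x; have h := hg_ext IH (jp 0%N b x).
 by have [_ ->] := hg_uniq h (jq 0%N b x).
move=> a b; elim: a b => [//|a IH] b x; have h := hg_ext (IH b) (jp a b x).
by have [-> _] := hg_uniq h (jq a b x).
Qed.

Lemma jet_pdm p m x : jet p -> pdm m (p 0 0) x = p m.1 m.2 x.
Proof.
move=> jp; case: m => a b; rewrite /pdm /=.
have -> : iter b (@pd2 R) (p 0 0) = p 0 b.
 by elim: b => [//|b IH]; rewrite iterS IH; apply/funext => z; exact: hg_pd2 (jp 0%N b z).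
elim: a x => [//|a IH] x; rewrite iterS (_ : iter a _ _ = p a b); last exact/funext.
exact: hg_pd1 (jp a b x).
Qed.

Lemma jet_Dk p k a b : jet p -> Dk k (p a b).
Proof.
move=> jp; elim: k a b => [|k IH] a b; first by move=> x; exact: hg_cont (jp a b x).
by exists (p a.+1 b), (p a b.+1); split => // x; exact: jp.
Qed.

Lemma jet_smooth p : jet p -> smooth (p 0 0).
Proof. by move=> jp; apply: Dk_smooth => k; exact: jet_Dk. Qed.
Lemma jetD p q : jet p -> jet q -> jet (fun a b x => p a b x + q a b x).
Proof. by move=> jp jq a b x; apply: hgD. Qed.
Lemma jetZ k p : jet p -> jet (fun a b x => k * p a b x).
Proof. by move=> jp a b x; apply: hgZ. Qed.

Lemma jet_cst k : jet (fun a b _ => if (a + b == 0)%N then k else 0).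
Proof.
move=> a b x; rewrite addSn addnS /=; exact: hg_cst.
Qed.

(** The Leibniz sum for the derivative of order (a, b) of a product, by recursion instead of
    binomial coefficients. It acts on arrays of numbers, so the same expression serves for
    derivatives and for their bounds. *)
Fixpoint lz (a b : nat) P S : R :=
 match a with
 | a'.+1 => lz a' b (fun i j => P i.+1 j) S + lz a' b P (fun i j => S i.+1 j)
 | 0 => (fix lz0 (b : nat) P S := match b with
     | b'.+1 => lz0 b' (fun i j => P i j.+1) S + lz0 b' P (fun i j => S i j.+1)
     | 0 => P 0 0 * S 0 0 end) b P S
 end.

Lemma lzS a b P S : lz a.+1 b P S = lz a b (fun i j => P i.+1 j) S + lz a b P (fun i j => S i.+1 j).
Proof. by []. Qed.
Lemma lz0S b P S : lz 0 b.+1 P S = lz 0 b (fun i j => P i j.+1) S + lz 0 b P (fun i j => S i j.+1).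
Proof. by []. Qed.

Lemma jet_lz p q : jet p -> jet q -> jet (fun a b x => lz a b (fun i j => p i j x) (fun i j => q i j x)).
Proof.
have al (s t u v : R) : s + t + (u + v) = s + u + (t + v) by ring.
move=> jp jq a b; elim: a b p q jp jq => [|a IH] b p q jp jq.
 elim: b p q jp jq => [|b IH] p q jp jq x.
  by apply: (hg_eq (hgM (jp 0%N 0%N x) (jq 0%N 0%N x))).
 have h1 := IH (fun i j => p i j.+1) q (fun i j => jp i j.+1) jq x.
 have h2 := IH p (fun i j => q i j.+1) jp (fun i j => jq i j.+1) x.
 by apply: (hg_eq (hgD h1 h2)); [rewrite !lzS !lz0S; exact: al|].
move=> x.
have h1 := IH b (fun i j => p i.+1 j) q (fun i j => jp i.+1 j) jq x.
have h2 := IH b p (fun i j => q i.+1 j) jp (fun i j => jq i.+1 j) x.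
exact: hgD h1 h2.
Qed.

Lemma lz_le a b (p q P S : nat -> nat -> R) :
 (forall i j, `|p i j| <= P i j) -> (forall i j, (i + j <= a + b)%N -> `|q i j| <= S i j) ->
 `|lz a b p q| <= lz a b P S.
Proof.
elim: a b p q P S => [|a IH] b p q P S.
 elim: b p q P S => [|b IH] p q P S hp hq.
  by rewrite /= normrM ler_pM// hq.
 rewrite !lz0S; apply: le_trans (ler_normD _ _) (lerD _ _); apply: IH => // i j ij; apply: hq.
  by rewrite addnS leqW.
 by rewrite !addnS ltnS.
move=> hp hq; rewrite !lzS; apply: le_trans (ler_normD _ _) (lerD _ _); apply: IH => // i j ij; apply: hq.
 by rewrite addSn leqW.
by rewrite !addSn ltnS.
Qed.

(** After removal of the single term with the top derivative of q, only orders below a + b remain: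
    the form suited to an induction on the order. *)
Lemma lz_low a b (p q P S : nat -> nat -> R) : (forall i j, 0 <= S i j) ->
 (forall i j, `|p i j| <= P i j) -> (forall i j, (i + j < a + b)%N -> `|q i j| <= S i j) ->
 `|lz a b p q - p 0 0 * q a b| <= lz a b P S.
Proof.
have al (s t u : R) : s + t - u = s + (t - u) by ring.
elim: a b p q P S => [|a IH] b p q P S.
 elim: b p q P S => [|b IH] p q P S S0 hp hq.
  by rewrite /= subrr normr0 mulr_ge0// (le_trans _ (hp 0%N 0%N)).
 rewrite !lz0S al; apply: le_trans (ler_normD _ _) (lerD _ _).
  by apply: lz_le => // i j ij; apply: hq; rewrite addnS ltnS.
 by apply: IH => // i j ij; apply: hq; rewrite !addnS ltnS.
move=> S0 hp hq; rewrite !lzS al; apply: le_trans (ler_normD _ _) (lerD _ _).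
 by apply: lz_le => // i j ij; apply: hq; rewrite addSn ltnS.
by apply: IH => // i j ij; apply: hq; rewrite !addSn ltnS.
Qed.

Lemma lz_hom a b k l P S : lz a b (fun i j => k * P i j) (fun i j => l * S i j) = k * l * lz a b P S.
Proof.
elim: a b P S => [|a IH] b P S.
 elim: b P S => [|b IH] P S; first by rewrite /=; ring.
 by rewrite !lz0S (IH (fun i j => P i j.+1)) (IH P (fun i j => S i j.+1)) mulrDr.
by rewrite !lzS (IH b (fun i j => P i.+1 j)) (IH b P (fun i j => S i.+1 j)) mulrDr.
Qed.

Lemma lz_ge0 a b P S : (forall i j, 0 <= P i j) -> (forall i j, 0 <= S i j) -> 0 <= lz a b P S.
Proof.
move=> P0 S0; apply: le_trans (normr_ge0 (lz a b P S)) _.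
by apply: lz_le => [i j|i j _]; rewrite ger0_norm.
Qed.

End Jets.

(** * Exponential decay of all derivatives of U, uniformly in c *)

Section Uniform.
Variable R : realType.
Local Notation J := (@jap R).
Local Notation kap := (@kap R).
Local Notation w2 := (@japw R).
Local Notation phi := (@barrier R).
Local Notation k2 := (Ck R 2).
Implicit Types (f g h th : R * R -> R) (x y xi c : R * R) (M : R).

Lemma Wd_jet g : rap g -> jet (Wd g).
Proof. by move=> rg a b x; exact: Wd_hg. Qed.

Lemma mono_le m xi : `|mono m xi| <= J xi ^+ (m.1 + m.2).
Proof.
rewrite /mono normrM !normrX exprD; apply: ler_pM; rewrite ?exprn_ge0//; apply: lerXn2r; rewrite ?nnegrE ?J_ge0//.
 exact: abs1_le_J.
exact: abs2_le_J.
Qed.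

Lemma w2_Int_ge0 : 0 <= kap * II w2.
Proof. by rewrite mulr_ge0 ?kap_ge0// II_ge0// => x; exact: w2_ge0. Qed.

Lemma FI_bd2 f M x : meas f -> bd 2 M f -> `|FI f x| <= kap * II w2 * M.
Proof.
move=> mf bf; apply: le_trans (FI_bd x (bd_Int mf bf)) _; rewrite -mulrA; apply: ler_wpM2l; first exact: kap_ge0.
rewrite mulrC -(IIZ M (@Int_w2 R)); apply: II_le => //; [exact: Int_abs (bd_Int mf bf)|exact: IntZ (@Int_w2 R)].
Qed.

Lemma Wd_bd a b g M x : meas g -> bd (a + b + 2) M g -> `|Wd g a b x| <= kap * II w2 * M.
Proof.
move=> mg bg; rewrite /Wd normrM (ger0_norm (kap_ge0 R)) -mulrA; apply: ler_wpM2l; first exact: kap_ge0.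
have M0 := bd_ge0 bg.
have mm : meas (@mono R (a, b)).
 have m1 : meas (fun x : R * R => x.1 ^+ a) := measX a (@meas_fst R).
 have m2 : meas (fun x : R * R => x.2 ^+ b) := measX b (@meas_snd R).
 exact: measM m1 m2.
have bb : bd 2 M (fun xi => mono (a, b) xi * g xi).
 move=> xi; rewrite normrM; have := bg xi; rewrite exprD invfM => hb.
 apply: le_trans (ler_pM (normr_ge0 _) (normr_ge0 _) (mono_le (a, b) xi) hb) _ => /=.
 by rewrite mulrCA mulVKf// expf_neq0// J_neq0.
have ii := bd_Int (measM mm mg) bb.
apply: le_trans (Tr_bd _ _ ii) _.
rewrite mulrC -(IIZ M (@Int_w2 R)); apply: II_le => //; [exact: Int_abs|exact: IntZ (@Int_w2 R)].
Qed.

Variables (Q : R * R -> R) (hQ : positive_radial_solution Q).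
Variables (be : R) (Mk : nat -> R).
Hypotheses (be0 : 0 <= be) (Mk0 : forall k, 0 <= Mk k).

(** [be] and [Mk] depend on neither c nor g: a bound stated for all such pairs is uniform in the
    velocity. *)
Definition sol c g : Prop := [/\ dot2 c c <= 2^-1, Sz g, forall k, bd k (Mk k) g,
  bd 2 (be * dot2 c c) (fun x => g x - g0 Q x) &
  forall xi, J xi * g xi = T3 (fun x => 1 + mu c x) g g g xi].

(** The transform of - N, so that [sol_lap] is the profile equation: Laplacian U = (1 + N) U. *)
Definition nF c g xi : R := (1 + mu c xi) * cnv g g xi.

Lemma F_bd k : exists2 M, 0 <= M & forall c g, sol c g -> bd k M (cnv g g).
Proof.
exists (Ck R (k + 2) * Mk (k + 2) * Mk (k + 2)); first by rewrite mulr_ge0// mulr_ge0// Ck_ge0.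
move=> c g [_ Sg bg _ _]; apply: bd_le (leq_addr 2 k) (lexx _) _.
by apply: conv_bd; rewrite ?leq_addl//; exact: Sz_meas.
Qed.

Lemma nF_bd k : exists2 M, 0 <= M & forall c g, sol c g -> bd k M (nF c g).
Proof.
have [M M0 h] := F_bd k; exists (2 * M); first by rewrite mulr_ge0.
move=> c g s; have [c2 _ _ _ _] := s; have [_ _ b] := good_1mu c2; exact: bdM (h _ _ s) b.
Qed.

Lemma nF_spec c g : sol c g -> spec (nF c g).
Proof.
move=> s; have [c2 Sg _ _ _] := s; have SF := Sz_conv Sg Sg; have [eF _ _] := SF.
have [e m b] := good_1mu c2.
have mn : meas (nF c g) by apply: measM => //; exact: Sz_meas.
have bk k : exists M, bd k M (nF c g) by have [M _ h] := nF_bd k; exists M; exact: h.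
split; first exact: rap_of_bd.
- by move=> x; rewrite /nF e eF.
- by have [M hM] := bk 0%N; exists M => x; exact: bd_abs hM.
- move=> x x0; apply: cvgM; last by have [_ uF _] := SF; exact: uc_cont.
 by apply: cvgD; [exact: cvg_cst|apply: (quot_cont c2 (@dotsq_cont R c) x0)].
Qed.

Lemma sol_lap c g x : sol c g -> Wd g 2 0 x + Wd g 0 2 x = (1 - FI (nF c g) x) * FI g x.
Proof.
move=> s; have [c2 Sg bg _ eq] := s; have := Wd_lap x (Sz_rap Sg); rewrite (funext eq) Wd00.
have [_ [M2 _ hM]] := (nF_spec s, nF_bd 2).
have [eg ug _] := Sg; have [_ mn _] := And3 I (rap_meas (let: And4 r _ _ _ := nF_spec s in r)) I.
rewrite (FI_conv x mn (Sz_meas Sg) eg (hM _ _ s) (bg 2%N)) -/(nF c g) => h.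
by rewrite mulrBl mul1r -h; ring.
Qed.

Lemma NQ_bd : exists2 B, 0 <= B & forall c g, sol c g -> bd 2 (B * dot2 c c) (fun xi => nF c g xi - cnv (g0 Q) (g0 Q) xi).
Proof.
have [M0 M00 XM] := g0_X hQ.
have [MF MF0 hF] := F_bd 2.
exists (k2 * be * Mk 2 + k2 * M0 * be + 2 * MF).
 have C0 := Ck_ge0 R 2; have t1 := mulr_ge0 (mulr_ge0 C0 be0) (Mk0 2); have t2 := mulr_ge0 (mulr_ge0 C0 M00) be0; lra.
move=> c g s; have [c2 Sg bg bh eq] := s; have [eg ug _] := Sg.
have Xg : Xc (Mk 2) g by split=> //; split => //; exact: Sz_meas.
have Xh := Xc_sub Xg XM bh.
have [[_ _ b1] _] := YX_cnv (proj1 Xh) Xg; have [[_ _ b2] _] := YX_cnv (proj1 XM) Xh.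
have [_ _ bm] := good_mu c2; have b3 := bdM (hF _ _ s) bm.
have E xi : nF c g xi - cnv (g0 Q) (g0 Q) xi = (cnv (fun x => g x - g0 Q x) g xi + cnv (g0 Q) (fun x => g x - g0 Q x) xi) + mu c xi * cnv g g xi.
 by rewrite (cnvBl xi (proj1 Xg) (proj1 XM) Xg) (cnvBr xi (proj1 XM) Xg XM) /nF; ring.
by rewrite (funext E); apply: bd_eq (bdD (bdD b1 b2) b3) _; ring.
Qed.

(** - N differs from Q^2 by at most L |c|^2 in sup norm. Outside the ball of [Vp_far] Q^2 <= 1/6, so
    for L |c|^2 <= 1/4 the potential 1 + N stays above 1/2. *)
Lemma far_field : exists k1 rho : R, [/\ 0 < k1, 0 < rho & forall c g, sol c g -> dot2 c c <= k1 ->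
 forall x, rho < enorm2 x -> 2^-1 <= 1 - FI (nF c g) x].
Proof.
have [B B0 hB] := NQ_bd; have [rho rho0 hr] := Vp_far hQ.
pose L := kap * II w2 * B; have L0 : 0 <= L by rewrite mulr_ge0// w2_Int_ge0.
exists (4 * L + 1)^-1, rho; split => //; first by rewrite invr_gt0; lra.
move=> c g s k1 x /hr; rewrite /Vp => hV.
have c0 := dot2_ge0 c.
have Lk : L * dot2 c c <= 4^-1.
 move: k1; rewrite -[(4 * L + 1)^-1]mul1r ler_pdivlMr; last lra.
 by rewrite mulrDr mulr1 => k1; rewrite mulrC; lra.
have [M0 M00 XM] := g0_X hQ; have XP := YX_cnv (proj1 XM) XM.
have [rn _ _ _] := nF_spec s; have [M2 _ hM] := nF_bd 2.
have i1 := bd_Int (rap_meas rn) (hM _ _ s); have i2 := Yc_Int (proj1 XP).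
have := FI_bd2 x (measB (rap_meas rn) (Int_meas i2)) (hB _ _ s).
rewrite (FIB _ i1 i2) (FI_YX _ (proj1 XM) XM) (FI_g0 hQ) -expr2 mulrA -/L ler_norml => /andP[_ h].
by have := sqr_ge0 (Q x); lra.
Qed.

Definition pN c g (i j : nat) x : R := (if (i + j == 0)%N then 1 else 0) + (-1) * Wd (nF c g) i j x.

Lemma pN_jet c g : sol c g -> jet (pN c g).
Proof.
move=> s; have [rn _ _ _] := nF_spec s.
exact: jetD (jet_cst 1) (jetZ (-1) (Wd_jet rn)).
Qed.

Lemma Wd_lapE c g a b x : sol c g ->
 Wd g a.+2 b x + Wd g a b.+2 x = lz a b (fun i j => pN c g i j x) (fun i j => Wd g i j x).
Proof.
move=> s; have [_ Sg _ _ _] := s; have jg := Wd_jet (Sz_rap Sg).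
have j1 : jet (fun a b x => Wd g a.+2 b x + Wd g a b.+2 x).
 by move=> i j z; apply: hgD; exact: jg.
move: a b x; apply: (jet_uniq j1 (jet_lz (pN_jet s) jg)) => x.
by rewrite (sol_lap x s) /= /pN /= !Wd00 mulN1r.
Qed.

Lemma pN_bd : exists P : nat -> nat -> R, forall c g, sol c g -> forall i j x, `|pN c g i j x| <= P i j.
Proof.
have ex k : exists M, 0 <= M /\ forall c g, sol c g -> bd k M (nF c g) by have [M M0 h] := nF_bd k; exists M.
have [MN hMN] := choice ex.
exists (fun i j => 1 + kap * II w2 * MN (i + j + 2)%N) => c g s i j x.
have [rn _ _ _] := nF_spec s; have [_ h] := hMN (i + j + 2)%N.
rewrite /pN mulN1r; apply: normB_le; apply: lerD; last exact: Wd_bd (rap_meas rn) (h _ _ s).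
by case: ifP; rewrite ?normr1 ?normr0.
Qed.

(** Strong induction on the order of differentiation. The differentiated equation is the same
    potential acting on the top derivative plus Leibniz terms of lower order, already bounded by the
    barrier; [decay_le] treats these as a source, once for each sign. *)
Lemma U_decay (k1 rho : R) : 0 < rho -> (forall c g, sol c g -> dot2 c c <= k1 ->
  forall x, rho < enorm2 x -> 2^-1 <= 1 - FI (nF c g) x) ->
 forall a b, exists2 C, 0 <= C & forall c g, sol c g -> dot2 c c <= k1 -> forall x, `|Wd g a b x| <= C * phi x.
Proof.
move=> rho0 hfar; have [P hP] := pN_bd.
suff main n : forall a b, (a + b)%N = n ->
  exists2 C, 0 <= C & forall c g, sol c g -> dot2 c c <= k1 -> forall x, `|Wd g a b x| <= C * phi x.
 by move=> a b; exact: (main (a + b)%N).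
have al (s u v e F : R) : s * s = 1 -> 2^-1 <= u -> 0 < s * v -> `|e - u * v| <= F -> s * v / 2 - F <= s * e.
 move=> ss u2 sv; rewrite ler_norml => /andP[h1 h2].
 have : 0 <= (u - 2^-1) * (s * v) by rewrite mulr_ge0 ?(ltW sv)// subr_ge0.
 have /orP[/eqP e1|/eqP e1] : (s == 1) || (s == -1) by rewrite -sqrf_eq1 expr2 ss.
  by rewrite e1 !mul1r; nra.
 by rewrite e1 !mulN1r; nra.
elim/ltn_ind: n => n IH a b ab.
have [i j|S Sp hS] := @choice2 _ (fun i j C => (i + j < n)%N -> forall c g, sol c g -> dot2 c c <= k1 -> forall x, `|Wd g i j x| <= C * phi x).
 case: (ltnP (i + j) n) => hp; last by exists 0.
 by have [C C0 h] := IH _ hp _ _ erefl; exists C.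
pose F := lz a b P S.
pose W := kap * II w2 * Mk (a + b + 2)%N.
have W0 : 0 <= W by rewrite mulr_ge0// w2_Int_ge0.
pose C := 4 * `|F| + W / expR (- (Num.sqrt (1 + rho ^+ 2) / 2)).
exists C; first by apply: addr_ge0; [exact: mulr_ge0|apply: divr_ge0 => //; exact: expR_ge0].
move=> c g sl ck; have [_ Sg bg _ _] := sl; have rg := Sz_rap Sg.
have key (s : R) : s * s = 1 -> forall x, s * Wd g a b x <= C * phi x.
 move=> ss; have s1 : `|s| = 1.
  by apply/eqP; rewrite -sqrp_eq1// -normrX expr2 ss normr1.
 apply: decay_le => //; first exact: ltW.
 - by move=> x; apply: cvgMl_tmp; exact: Wd_cont.
 - by move=> x; rewrite normrM s1 mul1r; exact: Wd_bd (Sz_meas Sg) (bg _).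
 move=> x hx sw; do 4 eexists; split; first exact: h2Z (Wd_h2 a b x rg).
 rewrite -mulrDr (Wd_lapE a b x sl).
 have u2 : 2^-1 <= pN c g 0 0 x by rewrite /pN /= Wd00 mulN1r; exact: hfar sl ck _ hx.
 have lo : `|lz a b (fun i j => pN c g i j x) (fun i j => Wd g i j x) - pN c g 0 0 x * Wd g a b x| <= F * phi x.
  rewrite /F (_ : lz a b P S * phi x = lz a b (fun i j => 1 * P i j) (fun i j => phi x * S i j)); last first.
   by rewrite lz_hom mul1r mulrC.
  apply: lz_low => [i j|i j|i j ij].
  - by rewrite mulr_ge0// ltW// phi_gt0.
  - by rewrite mul1r; exact: hP.
  - by rewrite mulrC; apply: (hS i j _ c g sl ck x); rewrite -ab.
 have lo2 : F * phi x <= `|F| * phi x by rewrite ler_pM2r ?phi_gt0// ler_norm.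
 exact: al ss u2 sw (le_trans lo lo2).
move=> x; rewrite ler_norml; apply/andP; split; last by have := key 1 (mulr1 1) x; rewrite mul1r.
have e1 : (-1) * (-1) = 1 :> R by rewrite mulrNN mulr1.
by rewrite lerNl; have := key _ e1 x; rewrite mulN1r.
Qed.

Lemma Wd_FF g a b x : Sz g -> Wd (cnv g g) a b x = lz a b (fun i j => Wd g i j x) (fun i j => Wd g i j x).
Proof.
move=> Sg; have jg := Wd_jet (Sz_rap Sg).
move: a b x; apply: (jet_uniq (Wd_jet (Sz_rap (Sz_conv Sg Sg))) (jet_lz jg jg)) => x.
by rewrite /= !Wd00; exact: FI_convS.
Qed.

Lemma phi_sq_le x : phi x * phi x <= expR (- enorm2 x).
Proof.
rewrite /barrier -expRD ler_expR -opprD -splitr lerN2 /enorm2 ler_sqrt ?(ltW (J_gt0 x))//.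
by rewrite /jap lerDr.
Qed.

Lemma phi_le x : phi x <= expR (- (2^-1 * enorm2 x)).
Proof.
rewrite /barrier ler_expR lerN2 mulrC ler_pM2r ?invr_gt0// /enorm2 ler_sqrt ?(ltW (J_gt0 x))//.
by rewrite /jap lerDr.
Qed.

(** Squaring doubles the rate: U^2 and its derivatives decay like exp (- |x|), which is the
    exponential term in the bound for N. *)
Lemma UU_decay (k1 rho : R) : 0 < rho -> (forall c g, sol c g -> dot2 c c <= k1 ->
  forall x, rho < enorm2 x -> 2^-1 <= 1 - FI (nF c g) x) ->
 forall a b, exists2 C, 0 <= C & forall c g, sol c g -> dot2 c c <= k1 ->
  forall x, `|Wd (cnv g g) a b x| <= C * expR (- enorm2 x).
Proof.
move=> rho0 hfar.
have [S Sp hS] := choice2 (U_decay rho0 hfar); move=> a b; exists (lz a b S S); first exact: lz_ge0.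
move=> c g sl ck x; have [_ Sg _ _ _] := sl; rewrite Wd_FF//.
apply: (@le_trans _ _ (phi x * phi x * lz a b S S)).
 rewrite -lz_hom; apply: lz_le => [i j|i j _]; rewrite mulrC; exact: hS _ _ _ _ sl ck x.
by rewrite mulrC; apply: ler_wpM2l; [exact: lz_ge0|exact: phi_sq_le].
Qed.

End Uniform.

Lemma am_sq (R : realType) (s t u : R) : 0 < s -> 0 < t -> s + t <= 2 * u -> s * t <= u ^+ 2.
Proof. by move=> s0 t0 h; have := sqr_ge0 (s - t); nra. Qed.

Lemma am_gm (R : realType) (s t u : R) : s ^+ 2 <= u -> t ^+ 2 <= u -> `|s * t| <= u.
Proof.
by move=> hs ht; rewrite ler_norml; apply/andP; split; have := sqr_ge0 (s + t); have := sqr_ge0 (s - t); nra.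
Qed.

(** * First derivatives of the regularised potential *)

Section Base.
Variable R : realType.
Local Notation J := (@jap R).
Local Notation kap := (@kap R).
Local Notation w2 := (@japw R).
Implicit Types (x y xi : R * R).
Variables (c : R * R) (e : R) (F F1 F2 : R * R -> R) (MF C : R).
Hypotheses (c2 : dot2 c c <= 2^-1) (e0 : 0 < e) (hF : forall xi, hg F xi (F1 xi) (F2 xi)) (mF1 : meas F1)
 (mF2 : meas F2) (bF : forall k, exists M : R, bd k M F) (MFb : forall xi, `|F xi| <= MF) (C0 : 0 <= C)
 (bF1 : forall xi, `|F1 xi| * enorm2 xi <= C * J xi ^- 2 * dot2 xi xi)
 (bF2 : forall xi, `|F2 xi| * enorm2 xi <= C * J xi ^- 2 * dot2 xi xi).

Definition Ae xi : R := Ac c xi + e ^+ 2.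
(** The transform of psi, the solution of [(- Laplacian + (c . grad)^2 + e^2) psi = FI F]; the term
    e^2 makes it smooth and integrable. *)
Definition se xi : R := F xi / Ae xi.
Definition Ac1 xi : R := 2 * (xi.1 - c.1 * dot2 c xi).
Definition Ac2 xi : R := 2 * (xi.2 - c.2 * dot2 c xi).
Definition se1 xi : R := F1 xi / Ae xi - F xi * Ac1 xi / Ae xi ^+ 2.
Definition se2 xi : R := F2 xi / Ae xi - F xi * Ac2 xi / Ae xi ^+ 2.
Let e20 : 0 < e ^+ 2. Proof. exact: exprn_gt0. Qed.
Let A_ge xi : dot2 xi xi / 2 <= Ac c xi. Proof. exact: Ac_ge. Qed.
Let A_ge0 xi : 0 <= Ac c xi.
Proof. by apply: le_trans (A_ge xi); rewrite divr_ge0 ?dot2_ge0. Qed.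
Lemma Ae_gt0 xi : 0 < Ae xi.
Proof. exact: ltr_wpDl. Qed.
Lemma Ae_ge xi : dot2 xi xi <= 2 * Ae xi.
Proof. by have := A_ge xi; have := e20; rewrite /Ae; lra. Qed.

Lemma Ac_hg xi : hg (Ac c) xi (Ac1 xi) (Ac2 xi).
Proof.
have hd : hg (fun x => dot2 x x) xi (1 * xi.1 + xi.1 * 1 + (0 * xi.2 + xi.2 * 0)) (0 * xi.1 + xi.1 * 0 + (1 * xi.2 + xi.2 * 1)).
 exact: hgD (hgM (hg_fst xi) (hg_fst xi)) (hgM (hg_snd xi) (hg_snd xi)).
have hl := hg_lin c.1 c.2 xi.
apply: (hg_ext (f := fun z => dot2 z z - (c.1 * z.1 + c.2 * z.2) * (c.1 * z.1 + c.2 * z.2))).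
 by move=> z; rewrite /Ac expr2.
by apply: (hg_eq (hgB hd (hgM hl hl))); rewrite /Ac1 /Ac2 /dot2; ring.
Qed.

Lemma se_hg xi : hg se xi (se1 xi) (se2 xi).
Proof.
have An := lt0r_neq0 (Ae_gt0 xi).
have hA : hg Ae xi (Ac1 xi + 0) (Ac2 xi + 0) := hgD (Ac_hg xi) (hg_cst _ xi).
have hv := hg_comp (drvV (drv_id (Ae xi)) An) hA.
apply: (hg_eq (hgM (hF xi) hv)); rewrite /se1 /se2; field; exact: An.
Qed.

Let cn : enorm2 c <= 1.
Proof.
rewrite -(ler_pXn2r (_ : (0 < 2)%N)) ?nnegrE ?enorm2_ge0 ?ler01// expr1n sqr_sqrtr ?dot2_ge0//.
by apply: le_trans c2 _; rewrite invf_le1// ler1n.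
Qed.

Let absdot xi : `|dot2 c xi| <= enorm2 xi.
Proof.
rewrite -sqrtr_sqr /enorm2 ler_sqrt ?dot2_ge0//; apply: le_trans (dot2_sq c xi) _.
by rewrite ler_piMl ?dot2_ge0//; apply: le_trans c2 _; rewrite invf_le1// ler1n.
Qed.

Lemma Ac1_le xi : `|Ac1 xi| <= 4 * enorm2 xi.
Proof.
rewrite /Ac1 normrM ger0_norm// (_ : 4 * enorm2 xi = 2 * (enorm2 xi + 1 * enorm2 xi)); last by ring.
apply: ler_wpM2l => //; apply: le_trans (ler_normB _ _) (lerD (abs1_le xi) _).
by rewrite normrM; apply: ler_pM => //; exact: le_trans (abs1_le c) cn.
Qed.

Lemma Ac2_le xi : `|Ac2 xi| <= 4 * enorm2 xi.
Proof.
rewrite /Ac2 normrM ger0_norm// (_ : 4 * enorm2 xi = 2 * (enorm2 xi + 1 * enorm2 xi)); last by ring.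
apply: ler_wpM2l => //; apply: le_trans (ler_normB _ _) (lerD (abs2_le xi) _).
by rewrite normrM; apply: ler_pM => //; exact: le_trans (abs2_le c) cn.
Qed.

Let enJ xi : enorm2 xi <= J xi.
Proof. by rewrite J_enorm; have := sqr_ge0 (enorm2 xi - 1); have := enorm2_ge0 xi; nra. Qed.

Let quot_le (G : R * R -> R) (B : R) xi : 0 <= B -> `|G xi| * enorm2 xi <= B * J xi ^- 2 * dot2 xi xi ->
 forall l : R, `|l| <= enorm2 xi -> `|l * G xi / Ae xi| <= 2 * B * J xi ^- 2.
Proof.
move=> B0 h l hl; rewrite normrM normfV (gtr0_norm (Ae_gt0 xi)) ler_pdivrMr ?Ae_gt0//.
rewrite normrM mulrC; apply: le_trans (ler_wpM2l (normr_ge0 _) hl) _; apply: le_trans h _.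
rewrite -!mulrA (mulrCA 2); apply: ler_wpM2l => //; rewrite mulrCA; apply: ler_wpM2l; last exact: Ae_ge.
exact: Jk_ge0.
Qed.

Lemma se_bd k : exists M : R, bd k M se.
Proof.
have [M hM] := bF k; exists ((e ^+ 2)^-1 * M) => xi.
rewrite /se mulrC normrM -mulrA normfV (gtr0_norm (Ae_gt0 xi)); apply: ler_pM => //.
 by rewrite invr_ge0 ltW// Ae_gt0.
by rewrite lef_pV2 ?posrE ?Ae_gt0// lerDr.
Qed.

Lemma se_meas : meas se.
Proof. by apply: measC => xi; exact: hg_cont (se_hg xi). Qed.
Lemma se_rap : rap se.
Proof. by apply: rap_of_bd se_bd; exact: se_meas. Qed.
Let mF : meas F. Proof. by apply: measC => xi; exact: hg_cont (hF xi). Qed.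

Let mAi : meas (fun xi => (Ae xi)^-1).
Proof.
apply: measC => xi; have An := lt0r_neq0 (Ae_gt0 xi).
exact: hg_cont (hg_comp (drvV (drv_id (Ae xi)) An) (hgD (Ac_hg xi) (hg_cst _ xi))).
Qed.

Let m1 : meas Ac1.
Proof.
apply: measC => xi; apply: (hg_cont (hg_ext _ (hg_lin (2 * (1 - c.1 * c.1)) (2 * (- (c.1 * c.2))) xi))) => z.
by rewrite /Ac1 /dot2; ring.
Qed.

Let m2 : meas Ac2.
Proof.
apply: measC => xi; apply: (hg_cont (hg_ext _ (hg_lin (2 * (- (c.1 * c.2))) (2 * (1 - c.2 * c.2)) xi))) => z.
by rewrite /Ac2 /dot2; ring.
Qed.

Let mse1 : meas se1.
Proof.
apply: measB; first exact: measM.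
under eq_fun do rewrite exprS expr1 invfM; by apply: measM; apply: measM.
Qed.

Let mse2 : meas se2.
Proof.
apply: measB; first exact: measM.
under eq_fun do rewrite exprS expr1 invfM; by apply: measM; apply: measM.
Qed.

(** This constant blows up as e tends to 0; it only legitimates the integrations by parts below. The
    bound uniform in e is [base_est]. *)
Let Lse_bd (G H : R * R -> R) (l1 l2 : R) : (forall xi, `|G xi| * enorm2 xi <= C * J xi ^- 2 * dot2 xi xi) ->
 (forall xi, `|H xi| <= 4 * enorm2 xi) ->
 exists M : R, bd 2 M (fun xi => (l1 * xi.1 + l2 * xi.2) * (G xi / Ae xi - F xi * H xi / Ae xi ^+ 2)).
Proof.
move=> hG hH; pose l := `|l1| + `|l2|; have l0 : 0 <= l by rewrite addr_ge0.
have [M hM] := bF 4; have M0 := bd_ge0 hM.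
have hL xi : `|l1 * xi.1 + l2 * xi.2| <= l * enorm2 xi.
 apply: normD_le; rewrite !normrM mulrDl; apply: lerD; apply: ler_wpM2l => //.
  exact: abs1_le.
 exact: abs2_le.
exists (l * (2 * C) + l * (4 * (M * e ^- 4))) => xi.
have J0 := J_gt0 xi; have Jn := J_neq0 xi; have n0 := enorm2_ge0 xi.
rewrite mulrBr (mulrDl (l * (2 * C))); apply: le_trans (ler_normB _ _) (lerD _ _).
 have [l00|ln] := eqVneq l 0.
  have : `|l1 * xi.1 + l2 * xi.2| <= 0 by apply: le_trans (hL xi) _; rewrite l00 mul0r.
  by rewrite normr_le0 => /eqP ->; rewrite mul0r normr0 l00 !mul0r.
 have lp : 0 < l by rewrite lt_def ln.
 have hl : `|(l1 * xi.1 + l2 * xi.2) / l| <= enorm2 xi.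
  by rewrite normrM normfV (gtr0_norm lp) ler_pdivrMr// [enorm2 xi * l]mulrC.
 have := quot_le C0 (hG xi) hl.
 have -> : (l1 * xi.1 + l2 * xi.2) * (G xi / Ae xi) = l * ((l1 * xi.1 + l2 * xi.2) / l * G xi / Ae xi).
  by field; rewrite ln lt0r_neq0// Ae_gt0.
 by move=> h; rewrite normrM (gtr0_norm lp) -[l * (2 * C) / _]mulrA; apply: ler_wpM2l.
have A4 : `|(Ae xi ^+ 2)^-1| <= e ^- 4.
 rewrite normfV ger0_norm ?exprn_ge0 ?(ltW (Ae_gt0 xi))// lef_pV2 ?posrE ?exprn_gt0 ?Ae_gt0//.
 have -> : e ^+ 4 = (e ^+ 2) ^+ 2 by rewrite -exprM.
 by rewrite lerXn2r ?nnegrE ?(ltW (Ae_gt0 xi)) ?(ltW e20)// lerDr.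
rewrite !normrM.
have t1 : `|l1 * xi.1 + l2 * xi.2| <= l * J xi by apply: le_trans (hL xi) _; apply: ler_wpM2l.
have t2 : `|H xi| <= 4 * J xi by apply: le_trans (hH xi) _; apply: ler_wpM2l.
have t3 := hM xi.
have := ler_pM (normr_ge0 _) (mulr_ge0 (mulr_ge0 (normr_ge0 _) (normr_ge0 _)) (normr_ge0 _)) t1
 (ler_pM (mulr_ge0 (normr_ge0 _) (normr_ge0 _)) (normr_ge0 _) (ler_pM (normr_ge0 _) (normr_ge0 _) t3 t2) A4).
move=> /le_trans; apply; apply: eqW.
by field; rewrite Jn lt0r_neq0.
Qed.

Let Lse0_bd (l1 l2 : R) : exists M : R, bd 2 M (fun xi => (l1 * xi.1 + l2 * xi.2) * se xi).
Proof.
have [M hM] := se_bd 3; exists ((`|l1| + `|l2|) * M) => xi.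
have hL : `|l1 * xi.1 + l2 * xi.2| <= (`|l1| + `|l2|) * J xi.
 apply: normD_le; rewrite !normrM mulrDl; apply: lerD; apply: ler_wpM2l => //.
  exact: abs1_le_J.
 exact: abs2_le_J.
rewrite normrM; apply: le_trans (ler_pM (normr_ge0 _) (normr_ge0 _) hL (hM xi)) _.
by apply: eqW; field; exact: J_neq0.
Qed.

Let ml (l1 l2 : R) : meas (fun xi => l1 * xi.1 + l2 * xi.2).
Proof. by apply: measC => xi; exact: hg_cont (hg_lin l1 l2 xi). Qed.
Let mcos y : meas (fun xi => cos (dot2 y xi)). Proof. exact: meas_cosdot. Qed.
Let msin y : meas (fun xi => sin (dot2 y xi)).
Proof. by apply: measC => x; exact: hg_cont (hg_sindot y x). Qed.

Let IntMcos y f (M : R) : meas f -> bd 2 M f -> Int (fun xi => f xi * cos (dot2 y xi)).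
Proof.
move=> mf bf; apply: (@bd_Int _ (1 * M)); first exact: measM.
by under eq_fun do rewrite mulrC; apply: bdM bf _ => x; exact: abscos.
Qed.

Let IntMsin y f (M : R) : meas f -> bd 2 M f -> Int (fun xi => f xi * sin (dot2 y xi)).
Proof.
move=> mf bf; apply: (@bd_Int _ (1 * M)); first exact: measM.
by under eq_fun do rewrite mulrC; apply: bdM bf _ => x; exact: abssin.
Qed.

(** The factor y . v in front of a sine transform is traded for a derivative along v on the
    frequency side. *)
Let ibp (G : R * R -> R) (l1 l2 k : R) v y : `|v.1| <= 1 -> `|v.2| <= 1 ->
 (forall xi, G xi = se1 xi * v.1 + se2 xi * v.2) -> k = l1 * v.1 + l2 * v.2 -> meas G ->
 (exists M : R, bd 2 M (fun xi => (l1 * xi.1 + l2 * xi.2) * G xi)) ->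
 Int (fun xi => (k * se xi + (l1 * xi.1 + l2 * xi.2) * G xi) * cos (dot2 y xi)) /\
 dot2 y v * II (fun xi => (l1 * xi.1 + l2 * xi.2) * se xi * sin (dot2 y xi)) =
 II (fun xi => (k * se xi + (l1 * xi.1 + l2 * xi.2) * G xi) * cos (dot2 y xi)).
Proof.
move=> v1 v2 hG hk mG [M1 b1]; have [M2 b2] := Lse0_bd l1 l2; have [M3 b3] := se_bd 2.
have mL := ml l1 l2; have ms := se_meas.
have bk : bd 2 (`|k| * M3) (fun xi => k * se xi) by exact: bdM.
have mk : meas (fun xi => k * se xi) by apply: measM => //; exact: meas_cst.
have iA := IntMcos y (measD mk (measM mL mG)) (bdD bk b1).
have iB := IntMsin y (measM mL ms) b2.
split => //; apply/esym/eqP; rewrite -subr_eq0 -(IIZ (dot2 y v) iB) -IIB//; last exact: IntZ.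
apply/eqP; apply: (@II_dir _ (fun xi => (l1 * xi.1 + l2 * xi.2) * se xi * cos (dot2 y xi)) _ v
 (1 * (`|k| * M3 + M1) + `|dot2 y v| * (1 * M2)) v1 v2).
- move=> x t; have h := hg_line (hgM (hgM (hg_lin l1 l2 (x + t *: v)) (se_hg (x + t *: v))) (hg_cosdot y (x + t *: v))).
 by apply: (drv_eq h); rewrite hG hk /dot2; ring.
- by apply: measB; [exact: Int_meas iA|exact: Int_meas (IntZ _ iB)].
- exact: IntMcos (measM mL ms) b2.
- apply: bdB.
  have := bdM (bdD bk b1) (fun x => @abscos R (dot2 y x)).
  by congr bd; apply/funext => x; rewrite mulrC.
 apply: bdM; last by move=> x; exact: lexx.
 have := bdM b2 (fun x => abssin (dot2 y x)).
 by congr bd; apply/funext => x; rewrite mulrC.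
Qed.

(** The hypotheses control y . S and the cross product of y with (I - c c^T) S. Since |c|^2 <= 1/2,
    the coefficient |y|^2 - (c . yp)^2 of the angular component is at least |y|^2 / 2, so both
    components of S are recovered. *)
Lemma polar_bd y (S1 S2 a b : R) : `|y.1 * S1 + y.2 * S2| <= a ->
 `|(1 - c.2 ^+ 2) * (y.1 * S2) - c.1 * c.2 * (y.1 * S1) - ((1 - c.1 ^+ 2) * (y.2 * S1) - c.1 * c.2 * (y.2 * S2))| <= b ->
 `|S1| * enorm2 y <= 2 * (a + b) /\ `|S2| * enorm2 y <= 2 * (a + b).
Proof.
set P := (_ - _ - (_ - _)) => al1 be1; have a0 := le_trans (normr_ge0 _) al1; have b0 := le_trans (normr_ge0 _) be1.
have [r0|rn] := eqVneq (enorm2 y) 0.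
 by rewrite r0 !mulr0 mulr_ge0 ?addr_ge0.
have rp : 0 < enorm2 y by rewrite lt_def rn enorm2_ge0.
have r2 : 0 < enorm2 y ^+ 2 by rewrite exprn_gt0.
pose al := y.1 * S1 + y.2 * S2; pose ga := y.1 * S2 - y.2 * S1.
pose yp : R * R := (- y.2, y.1).
have cz x : dot2 x x = enorm2 y ^+ 2 -> dot2 c x ^+ 2 <= enorm2 y ^+ 2 / 2.
 by move=> E; apply: le_trans (dot2_sq c x) _; rewrite E mulrC; apply: ler_wpM2l => //; exact: ltW.
have c1' : dot2 c yp ^+ 2 <= enorm2 y ^+ 2 / 2 by apply: cz; rewrite enorm2_sq /dot2 /=; ring.
have c2' : dot2 c y ^+ 2 <= enorm2 y ^+ 2 / 2 by apply: cz; rewrite enorm2_sq /dot2 /=; ring.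
have id1 : ga * (enorm2 y ^+ 2 - dot2 c yp ^+ 2) = P * enorm2 y ^+ 2 + al * (dot2 c yp * dot2 c y).
 by rewrite enorm2_sq /ga /P /al /yp /dot2 /=; ring.
have cc := am_gm c1' c2'.
have ga1 : `|ga| <= 2 * `|P| + `|al|.
 have h1 : `|ga| * (enorm2 y ^+ 2 / 2) <= `|P| * enorm2 y ^+ 2 + `|al| * (enorm2 y ^+ 2 / 2).
  have p0 : enorm2 y ^+ 2 / 2 <= enorm2 y ^+ 2 - dot2 c yp ^+ 2 by lra.
  apply: (@le_trans _ _ (`|ga| * (enorm2 y ^+ 2 - dot2 c yp ^+ 2))); first exact: ler_wpM2l.
  rewrite -{1}(@ger0_norm _ (_ - _ ^+ 2)); last by apply: le_trans p0; rewrite divr_ge0// ltW.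
  rewrite -normrM id1; apply: normD_le.
  by rewrite (normrM P) (gtr0_norm r2) lerD2l (normrM al); exact: ler_wpM2l.
 have r22 : 0 < enorm2 y ^+ 2 / 2 by rewrite divr_gt0.
 rewrite -(ler_pM2r r22) (mulrDl (2 * `|P|)); apply: le_trans h1 _; rewrite lerD2r.
 by apply: eqW; field.
have fin (S u v : R) : enorm2 y ^+ 2 * S = al * u - ga * v -> `|u| <= enorm2 y -> `|v| <= enorm2 y ->
  `|S| * enorm2 y <= 2 * (a + b).
 move=> e1 hu hv; rewrite -(ler_pM2r rp); apply: (@le_trans _ _ ((`|al| + `|ga|) * enorm2 y)).
  have -> : `|S| * enorm2 y * enorm2 y = `|enorm2 y ^+ 2 * S| by rewrite (normrM (enorm2 y ^+ 2) S) (gtr0_norm r2); ring.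
  rewrite e1 (mulrDl `|al|); apply: le_trans (ler_normB _ _) (lerD _ _).
   by rewrite (normrM al); exact: ler_wpM2l.
  by rewrite (normrM ga); exact: ler_wpM2l.
 by rewrite ler_pM2r//; move: al1 be1 ga1; rewrite -/al; lra.
split.
 apply: (fin _ y.1 y.2) (abs1_le y) (abs2_le y).
 by rewrite enorm2_sq /al /ga; ring.
apply: (fin _ y.2 (- y.1)) (abs2_le y) _; last by rewrite normrN; exact: abs1_le.
by rewrite enorm2_sq /al /ga; ring.
Qed.

(** Only combinations of derivatives that see the singularity of 1 / Ae mildly are estimated: the
    divergence of xi times [se], where homogeneity cancels all but a term with e^2, and the field
    tangent to the level sets of the symbol, which differentiates F alone. *)
Lemma base_est y : `|Wd se 1 0 y| * enorm2 y <= 2 * kap * (12 * C * II w2 + 2 * MF * pi ^+ 2) /\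
 `|Wd se 0 1 y| * enorm2 y <= 2 * kap * (12 * C * II w2 + 2 * MF * pi ^+ 2).
Proof.
pose S1 := II (fun xi => (1 * xi.1 + 0 * xi.2) * se xi * sin (dot2 y xi)).
pose S2 := II (fun xi => (0 * xi.1 + 1 * xi.2) * se xi * sin (dot2 y xi)).
have d1 : `|(dir1 R).1| <= 1 /\ `|(dir1 R).2| <= 1 by rewrite /= normr1 normr0.
have d2 : `|(dir2 R).1| <= 1 /\ `|(dir2 R).2| <= 1 by rewrite /= normr1 normr0.
have g1 xi : se1 xi = se1 xi * (dir1 R).1 + se2 xi * (dir1 R).2 by rewrite /= mulr1 mulr0 addr0.
have g2 xi : se2 xi = se1 xi * (dir2 R).1 + se2 xi * (dir2 R).2 by rewrite /= mulr1 mulr0 add0r.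
have z1 (l1 l2 : R) : l1 = l1 * (dir1 R).1 + l2 * (dir1 R).2 by rewrite /= mulr1 mulr0 addr0.
have z2 (l1 l2 : R) : l2 = l1 * (dir2 R).1 + l2 * (dir2 R).2 by rewrite /= mulr1 mulr0 add0r.
have [i11 e11] := ibp y d1.1 d1.2 g1 (z1 1 0) mse1 (Lse_bd 1 0 bF1 Ac1_le).
have [i12 e12] := ibp y d2.1 d2.2 g2 (z2 1 0) mse2 (Lse_bd 1 0 bF2 Ac2_le).
have [i21 e21] := ibp y d1.1 d1.2 g1 (z1 0 1) mse1 (Lse_bd 0 1 bF1 Ac1_le).
have [i22 e22] := ibp y d2.1 d2.2 g2 (z2 0 1) mse2 (Lse_bd 0 1 bF2 Ac2_le).
have y1 : dot2 y (dir1 R) = y.1 by rewrite /dot2 /= mulr1 mulr0 addr0.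
have y2 : dot2 y (dir2 R) = y.2 by rewrite /dot2 /= mulr1 mulr0 add0r.
rewrite y1 -/S1 in e11; rewrite y2 -/S1 in e12; rewrite y1 -/S2 in e21; rewrite y2 -/S2 in e22.
have rad xi : 0 <= enorm2 xi := enorm2_ge0 xi.
have q1 xi (l : R) : `|l| <= enorm2 xi -> `|l * F1 xi / Ae xi| <= 2 * C * w2 xi by move=> hl; exact: quot_le.
have q2 xi (l : R) : `|l| <= enorm2 xi -> `|l * F2 xi / Ae xi| <= 2 * C * w2 xi by move=> hl; exact: quot_le.
have al1 : `|y.1 * S1 + y.2 * S2| <= 4 * C * II w2 + 2 * MF * pi ^+ 2.
 rewrite e11 e22 -(IID i11 i22).
 have [iP eP] := PK_Int e0.
 have iB : Int (fun xi => 4 * C * w2 xi + 2 * MF * pi ^+ 2 * PK e xi) by apply: IntD; apply: IntZ => //; exact: Int_w2.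
 have -> : 4 * C * II w2 + 2 * MF * pi ^+ 2 = II (fun xi => 4 * C * w2 xi + 2 * MF * pi ^+ 2 * PK e xi).
  by rewrite (IID (IntZ (4 * C) (@Int_w2 R)) (IntZ (2 * MF * pi ^+ 2) iP)) (IIZ _ (@Int_w2 R)) (IIZ _ iP) eP mulr1.
 apply: II_absle iB _; first exact: Int_meas (IntD i11 i22).
 move=> xi; have An := lt0r_neq0 (Ae_gt0 xi).
 (* Euler's identity for the quadratic form Ac: what is left of the symbol is 2 F e^2 / Ae^2. *)
 have -> : (1 * se xi + (1 * xi.1 + 0 * xi.2) * se1 xi) * cos (dot2 y xi) + (1 * se xi + (0 * xi.1 + 1 * xi.2) * se2 xi) * cos (dot2 y xi) =
  ((xi.1 * F1 xi / Ae xi + xi.2 * F2 xi / Ae xi) + 2 * F xi * (e ^+ 2 / Ae xi ^+ 2)) * cos (dot2 y xi).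
  have E : e ^+ 2 = Ae xi - (xi.1 * Ac1 xi + xi.2 * Ac2 xi) / 2 by rewrite /Ae /Ac /Ac1 /Ac2 /dot2; field.
  by rewrite E /se /se1 /se2; field.
 rewrite normrM; apply: le_trans (ler_piMr (normr_ge0 _) (abscos _)) _.
 apply: le_trans (ler_normD _ _) (lerD _ _).
  apply: normD_le.
  by have := q1 xi _ (abs1_le xi); have := q2 xi _ (abs2_le xi); lra.
 have M0 : 0 <= MF := le_trans (normr_ge0 _) (MFb xi).
 have pk0 : 0 <= e ^+ 2 / Ae xi ^+ 2 by rewrite divr_ge0 ?sqr_ge0.
 rewrite normrM (ger0_norm pk0) -[2 * MF * pi ^+ 2 * PK e xi]mulrA; apply: ler_pM => //.
  by rewrite normrM ger0_norm//; apply: ler_wpM2l.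
 have p0 : pi != 0 :> R by rewrite gt_eqF// pi_gt0.
 (* e^2 / Ae^2 is dominated by the product Poisson kernel, because twice Ae exceeds (e^2 + xi.1^2) +
    (e^2 + xi.2^2); its mass does not depend on e. *)
 have -> : pi ^+ 2 * PK e xi = pk e xi.1 * pk e xi.2 by rewrite /PK mulrA divff ?mul1r// expf_neq0.
 have s1 : 0 < e ^+ 2 + xi.1 ^+ 2 by rewrite ltr_wpDr// sqr_ge0.
 have s2 : 0 < e ^+ 2 + xi.2 ^+ 2 by rewrite ltr_wpDr// sqr_ge0.
 have -> : pk e xi.1 * pk e xi.2 = e ^+ 2 / ((e ^+ 2 + xi.1 ^+ 2) * (e ^+ 2 + xi.2 ^+ 2)).
  by rewrite /pk invfM; ring.
 apply: ler_wpM2l; first exact: ltW.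
 rewrite lef_pV2 ?posrE ?exprn_gt0 ?mulr_gt0 ?Ae_gt0//.
 apply: am_sq => //; have := A_ge xi; rewrite /Ae /dot2 -!expr2; lra.
(* Coefficients of the field (d2 Ac, - d1 Ac), along which the regularised symbol is constant. *)
pose P := (1 - c.2 ^+ 2) * (y.1 * S2) - c.1 * c.2 * (y.1 * S1) - ((1 - c.1 ^+ 2) * (y.2 * S1) - c.1 * c.2 * (y.2 * S2)).
have be1 : `|P| <= 8 * C * II w2.
 have j1 := IntB (IntZ (1 - c.2 ^+ 2) i21) (IntZ (c.1 * c.2) i11).
 have j2 := IntB (IntZ (1 - c.1 ^+ 2) i12) (IntZ (c.1 * c.2) i22).
 rewrite /P e11 e12 e21 e22 -(IIZ (1 - c.2 ^+ 2) i21) -(IIZ (c.1 * c.2) i11) -(IIZ (1 - c.1 ^+ 2) i12) -(IIZ (c.1 * c.2) i22).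
 rewrite -(IIB (IntZ (1 - c.2 ^+ 2) i21) (IntZ (c.1 * c.2) i11)) -(IIB (IntZ (1 - c.1 ^+ 2) i12) (IntZ (c.1 * c.2) i22)).
 rewrite -(IIB j1 j2) -(IIZ (8 * C) (@Int_w2 R)).
 apply: II_absle; [exact: Int_meas (IntB j1 j2)|exact: IntZ (@Int_w2 R)|].
 move=> xi; have An := lt0r_neq0 (Ae_gt0 xi).
 set LHS := (X in `|X|).
 have -> : LHS = (2 * (Ac2 xi / 4 * F1 xi / Ae xi) - 2 * (Ac1 xi / 4 * F2 xi / Ae xi)) * cos (dot2 y xi).
  by rewrite /LHS /se /se1 /se2 /Ac1 /Ac2 /dot2; field.
 rewrite normrM; apply: le_trans (ler_piMr (normr_ge0 _) (abscos _)) _.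
 have a1 : `|Ac1 xi / 4| <= enorm2 xi by rewrite normrM normfV (ger0_norm (ler0n R 4)) ler_pdivrMr// mulrC Ac1_le.
 have a2 : `|Ac2 xi / 4| <= enorm2 xi by rewrite normrM normfV (ger0_norm (ler0n R 4)) ler_pdivrMr// mulrC Ac2_le.
 have n2 (t : R) : `|2 * t| = 2 * `|t| by rewrite normrM ger0_norm.
 apply: normB_le; rewrite !n2.
 by have := q1 xi _ a2; have := q2 xi _ a1; lra.
have [k1 k2] := polar_bd al1 be1.
have WE a b (l1 l2 : R) : (a + b = 1)%N -> (forall xi, mono (a, b) xi = l1 * xi.1 + l2 * xi.2) ->
  Wd se a b y = - (kap * II (fun xi => (l1 * xi.1 + l2 * xi.2) * se xi * sin (dot2 y xi))).
 move=> ab hm; have [N bN] := Lse0_bd l1 l2.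
 rewrite /Wd /Tr -mulrN -(IIN (IntMsin y (measM (ml l1 l2) se_meas) bN)).
 by congr (_ * _); apply: II_ext => xi; rewrite ab mulr1n mul1r cosDpihalf hm; ring.
rewrite (WE 1%N 0%N 1 0)// => [|xi]; last by rewrite /mono /= expr1 expr0; ring.
rewrite (WE 0%N 1%N 0 1)// => [|xi]; last by rewrite /mono /= expr1 expr0; ring.
rewrite -/S1 -/S2 !normrN !normrM (ger0_norm (kap_ge0 R)).
have -> : 2 * kap * (12 * C * II w2 + 2 * MF * pi ^+ 2) = kap * (2 * (4 * C * II w2 + 2 * MF * pi ^+ 2 + 8 * C * II w2)) by ring.
by rewrite -!mulrA in k1 k2 *; split; apply: ler_wpM2l; rewrite ?kap_ge0.
Qed.

End Base.

(** * Algebraic decay of the derivatives of psi and passage to the limit *)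

Section GradF.
Variable R : realType.
Local Notation J := (@jap R).
Local Notation kap := (@kap R).
Local Notation w2 := (@japw R).
Local Notation phi := (@barrier R).
Implicit Types (x y z xi : R * R) (f g : R * R -> R).

Lemma J_shift x (a : R * R) : `|a.1| <= 1 -> `|a.2| <= 1 -> J x <= 8 * J (x + a).
Proof.
move=> a1 a2; have := J_sum (x + a) (- a); rewrite addrK J_opp.
have s (t : R) : `|t| <= 1 -> t * t <= 1 by move=> t1; rewrite -expr2 -(real_normK (num_real t)) expr_le1.
by have := s _ a1; have := s _ a2; have := J_ge1 (x + a); rewrite {4}/jap /dot2; lra.
Qed.

(* Interpolation at scale [J^-2]: decay of [f] and a bound on its second derivative give decay of the first one. *)
Lemma interp f f1 f2 (v : R * R) (K M : R) : `|v.1| <= 1 -> `|v.2| <= 1 ->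
 (forall x t, is_derive t (1 : R) (fun s : R => f (x + s *: v)) (f1 (x + t *: v))) ->
 (forall x t, is_derive t (1 : R) (fun s : R => f1 (x + s *: v)) (f2 (x + t *: v))) ->
 (forall x, `|f2 x| <= K) -> bd 4 M f -> bd 2 (K + (8 ^+ 4 + 1) * M) f1.
Proof.
move=> v1 v2 d1 d2 hK hM x; have M0 := bd_ge0 hM; have K0 : 0 <= K := le_trans (normr_ge0 _) (hK 0).
have Jp := J_gt0 x; have Jn := J_neq0 x.
pose t := J x ^- 2; have t0 : 0 < t by rewrite invr_gt0 exprn_gt0.
have t1 : t <= 1 by rewrite /t invf_le1 ?exprn_gt0// exprn_ege1// J_ge1.
have [s [/andP[s0 s1] E1]] := mvt t0 (fun r _ => d1 x r).
have [r [/andP[r0 r1] E2]] := mvt s0 (fun r _ => d2 x r).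
rewrite scale0r addr0 !subr0 in E1; rewrite scale0r addr0 !subr0 in E2.
have fx := hM x; have ft := hM (x + t *: v).
have tv (w : R) : `|w| <= 1 -> `|t * w| <= 1 by move=> hw; rewrite normrM gtr0_norm// mulr_ile1// ltW.
have Js : J (x + t *: v) ^- 4 <= 8 ^+ 4 * J x ^- 4.
 have j0 := J_gt0 (x + t *: v).
 rewrite -[X in X <= _]mul1r ler_pdivrMr ?exprn_gt0// mulrAC ler_pdivlMr ?exprn_gt0// mul1r -exprMn lerXn2r ?nnegrE ?mulr_ge0 ?(ltW Jp) ?(ltW j0)//.
 by apply: J_shift; rewrite !pE /=; exact: tv.
have T4 : J x ^- 4 = t * t by rewrite /t -invfM -exprD.
have e1 : f1 x * t = f (x + t *: v) - f x - f2 (x + r *: v) * s * t.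
 by rewrite E1 -E2; ring.
have : `|f1 x * t| <= (K + (8 ^+ 4 + 1) * M) * t * t.
 rewrite e1; apply: normB_le.
 apply: (@le_trans _ _ (M * (8 ^+ 4 * (t * t)) + M * (t * t) + K * t * t)); last by apply: eqW; ring.
 apply: lerD; last first.
  rewrite !normrM (gtr0_norm t0) (gtr0_norm s0); apply: ler_pM => //; first by rewrite mulr_ge0// ltW.
   by rewrite ltW.
  by apply: ler_pM => //; rewrite ltW.
 apply: le_trans (ler_normB _ _) (lerD _ _); last by rewrite -T4.
 by apply: le_trans ft _; apply: ler_wpM2l => //; rewrite -T4.
by rewrite normrM (gtr0_norm t0) ler_pM2r.
Qed.

Lemma exp_pow (k : nat) : exists2 D : R, 0 <= D & forall t : R, 0 < t -> expR (- t) <= D / t ^+ k.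
Proof.
case: k => [|k].
 by exists 1 => // t t0; rewrite expr0 divr1 -expR0 ler_expR oppr_le0 ltW.
pose c : R := k.+1%:R; have c0 : 0 < c by rewrite ltr0n.
exists (c ^+ k.+1); first by rewrite exprn_ge0// ltW.
move=> t t0; rewrite ler_pdivlMr ?exprn_gt0//.
have h : (t / c) ^+ k.+1 <= expR t.
 have et : k.+1%:R * (t / c) = t by rewrite mulrC divfK// gt_eqF.
 rewrite -[X in _ <= expR X]et expRM_natl lerXn2r ?nnegrE ?expR_ge0 ?divr_ge0 ?(ltW t0) ?(ltW c0)//.
 by apply: le_trans (expR_ge1Dx _); rewrite lerDr.
have e1 : expR (- t) * expR t = 1 by rewrite -expRD addNr expR0.
have -> : t ^+ k.+1 = c ^+ k.+1 * (t / c) ^+ k.+1 by rewrite -exprMn mulrCA divff ?mulr1// gt_eqF.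
rewrite mulrCA ler_piMr ?exprn_ge0 ?(ltW c0)//.
apply: (@le_trans _ _ (expR (- t) * expR t)); last by rewrite e1.
by apply: ler_wpM2l => //; exact: expR_ge0.
Qed.

Lemma Wd2 g a b x : rap g -> (a + b = 2)%N -> Wd g a b x = - FI (fun xi => mono (a, b) xi * g xi) x.
Proof.
move=> rg ab; have rm := rap_mono (a, b) rg.
rewrite /Wd ab /FI -mulrN; congr (_ * _); rewrite /Tr -(IIN (Int_Tr 0 x (rap_Int rm))); apply: II_ext => xi.
by rewrite (_ : 2 * (pi / 2) = pi :> R); [rewrite cosDpi addr0 mulrN|field].
Qed.

Lemma h2_jet_aff p a b y u v z : jet p ->
 exists b1 b2, h2 (fun z : R * R => p a b (y + z.1 *: u + z.2 *: v)) z b1 b2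
  (u.1 ^+ 2 * p a.+2 b (y + z.1 *: u + z.2 *: v) + 2 * u.1 * u.2 * p a.+1 b.+1 (y + z.1 *: u + z.2 *: v) + u.2 ^+ 2 * p a b.+2 (y + z.1 *: u + z.2 *: v))
  (v.1 ^+ 2 * p a.+2 b (y + z.1 *: u + z.2 *: v) + 2 * v.1 * v.2 * p a.+1 b.+1 (y + z.1 *: u + z.2 *: v) + v.2 ^+ 2 * p a b.+2 (y + z.1 *: u + z.2 *: v)).
Proof.
move=> jp; pose A (z : R * R) := y + z.1 *: u + z.2 *: v.
pose f1 z := u.1 * p a.+1 b (A z) + u.2 * p a b.+1 (A z).
pose f2 z := v.1 * p a.+1 b (A z) + v.2 * p a b.+1 (A z).
have h w i j : hg (fun z => p i j (A z)) w (p i.+1 j (A w) * u.1 + p i j.+1 (A w) * u.2) (p i.+1 j (A w) * v.1 + p i j.+1 (A w) * v.2).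
 exact: hg_aff (jp i j (A w)).
exists (f1 z), (f2 z), f1, f2; do 2 eexists; split; [|by []| |].
- by apply: near2W => w; apply: (hg_eq (h w a b)); rewrite /f1 /f2; ring.
- apply: (hg_eq (hgD (hgZ u.1 (h z a.+1 b)) (hgZ u.2 (h z a b.+1)))); last reflexivity.
 by rewrite -/(A z); ring.
- apply: (hg_eq (hgD (hgZ v.1 (h z a.+1 b)) (hgZ v.2 (h z a b.+1)))); first reflexivity.
 by rewrite -/(A z); ring.
Qed.

Lemma absdot_le x y : `|dot2 x y| <= enorm2 x * enorm2 y.
Proof. by rewrite -sqrtr_sqr /enorm2 -sqrtrM ?dot2_ge0// ler_wsqrtr// dot2_sq. Qed.

Lemma enorm2_tri x y : enorm2 (x + y) <= enorm2 x + enorm2 y.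
Proof.
have n0 := enorm2_ge0 (x + y); have s0 : 0 <= enorm2 x + enorm2 y by rewrite addr_ge0 ?enorm2_ge0.
rewrite -(ler_pXn2r (_ : (0 < 2)%N)) ?nnegrE//.
have := absdot_le x y; rewrite ler_norml => /andP[_ h].
rewrite sqrrD !enorm2_sq !pE; move: h; rewrite /dot2 => h; nra.
Qed.

Lemma enorm2Z (k : R) x : enorm2 (k *: x) = `|k| * enorm2 x.
Proof.
by rewrite /enorm2 -sqrtr_sqr -sqrtrM ?sqr_ge0//; congr (Num.sqrt _); rewrite /dot2 /= /GRing.scale /=; ring.
Qed.

(* Orthonormal frame in which the matrix [I - c c^T] is diagonal. *)
Lemma frame (c : R * R) : exists u : R * R, [/\ dot2 u u = 1, c.1 = enorm2 c * u.1 & c.2 = enorm2 c * u.2].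
Proof.
have [->|c0] := eqVneq c 0.
 exists (1, 0); have e : enorm2 (0 : R * R) = 0 by rewrite /enorm2 /dot2 /= !mulr0 addr0 sqrtr0.
 by rewrite e !mul0r /dot2 /= mulr1 mulr0 addr0.
have r0 := enorm2_gt0 c0; have rn : enorm2 c != 0 by rewrite gt_eqF.
exists ((enorm2 c)^-1 *: c); split; [|by rewrite /= /GRing.scale /= mulrA divff// mul1r|by rewrite /= /GRing.scale /= mulrA divff// mul1r].
have e : dot2 c c = enorm2 c ^+ 2 by rewrite sqr_sqrtr ?dot2_ge0.
have -> : dot2 ((enorm2 c)^-1 *: c) ((enorm2 c)^-1 *: c) = (enorm2 c)^-1 ^+ 2 * dot2 c c by rewrite /dot2 /= /GRing.scale /=; ring.
by rewrite e -exprMn mulVf// expr1n.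
Qed.

Section Psi.
Variables (Q : R * R -> R) (hQ : positive_radial_solution Q).
Variables (be : R) (Mk : nat -> R) (k1 : R).
Hypotheses (be0 : 0 <= be) (Mk0 : forall k, 0 <= Mk k).
Local Notation sol := (sol Q be Mk).
Local Notation "'all_sol' c g , P" := (forall c g, sol c g -> dot2 c c <= k1 -> P) (at level 200, c name, g name).
Local Notation "'all_psi' c g e y , P" := (forall c g e, sol c g -> dot2 c c <= k1 -> 0 < e -> forall y, y != 0 -> P)
 (at level 200, c name, g name, e name, y name).
Variable CU : nat -> nat -> R.
Hypotheses (CU0 : forall a b, 0 <= CU a b)
 (hCU : forall a b c g, sol c g -> dot2 c c <= k1 -> forall x, `|Wd g a b x| <= CU a b * phi x).
Variable CF : nat -> nat -> R.
Hypotheses (CF0 : forall a b, 0 <= CF a b)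
 (hCF : forall a b c g, sol c g -> dot2 c c <= k1 -> forall x, `|Wd (cnv g g) a b x| <= CF a b * expR (- enorm2 x)).

(* [F = cnv g g] as a transform of [u = FI F], whose decay controls the derivatives of [F]. *)
Lemma u_bd k : exists2 M, 0 <= M & all_sol c g, bd k M (FI (cnv g g)).
Proof.
have [D D0 hD] := phi_J R k; exists (CU 0 0 * CU 0 0 * D); first by rewrite !mulr_ge0.
move=> c g s ck x; have [_ Sg _ _ _] := s; have h := hCU 0 0 s ck x; rewrite Wd00 in h.
have p1 : phi x <= 1 by rewrite -expR0 ler_expR oppr_le0 divr_ge0 ?sqrtr_ge0.
have p0 := ltW (phi_gt0 x).
rewrite (FI_convS x Sg Sg) normrM; apply: le_trans (ler_pM (normr_ge0 _) (normr_ge0 _) h h) _.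
apply: (@le_trans _ _ (CU 0 0 * CU 0 0 * phi x)).
 rewrite mulrACA; apply: ler_wpM2l; first by rewrite mulr_ge0.
 by rewrite ler_piMr.
by rewrite -[leRHS]mulrA; apply: ler_wpM2l; [rewrite mulr_ge0|exact: hD].
Qed.

Lemma u_rap c g : sol c g -> dot2 c c <= k1 -> rap (FI (cnv g g)).
Proof.
move=> s ck; have [_ Sg _ _ _] := s; apply: rap_of_bd.
 by apply: FI_meas; exact: Sz_rap (Sz_conv Sg Sg).
by move=> k; have [M _ h] := u_bd k; exists M; exact: h s ck.
Qed.

(** The frequency derivatives of [cnv g g], available by inversion because its physical side U^2
    decays rapidly. *)
Definition Fd g a b xi : R := kap^-1 * Wd (FI (cnv g g)) a b xi.
Lemma Fd_jet c g : sol c g -> dot2 c c <= k1 -> jet (Fd g).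
Proof. by move=> s ck; apply: jetZ; apply: Wd_jet; exact: u_rap s ck. Qed.

Lemma Fd00 c g xi : sol c g -> dot2 c c <= k1 -> Fd g 0 0 xi = cnv g g xi.
Proof.
move=> s ck; have [_ Sg _ _ _] := s; have SF := Sz_conv Sg Sg; have [eF uF _] := SF; have [B hB] := Sz_bounded SF.
rewrite /Fd Wd00 /FI mulKf ?kap_neq0// -(Tr_FI (Sz_Int SF) eF hB)//; last exact: rap_Int (u_rap s ck).
exact: uc_cont.
Qed.

Lemma F_hg c g xi : sol c g -> dot2 c c <= k1 -> hg (cnv g g) xi (Fd g 1 0 xi) (Fd g 0 1 xi).
Proof.
move=> s ck; apply: (hg_ext (f := Fd g 0 0)) => [z|]; first exact: Fd00 s ck.
exact: Fd_jet s ck 0%N 0%N xi.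
Qed.

Lemma Fd_bd k : exists2 K, 0 <= K & all_sol c g, forall a b, (a + b = k)%N -> forall xi, `|Fd g a b xi| <= K.
Proof.
have [M M0 hM] := u_bd (k + 2); exists (II w2 * M).
 by rewrite mulr_ge0// II_ge0// => x; exact: w2_ge0.
move=> c g s ck a b ab xi; rewrite /Fd normrM.
have k0 := kap_gt0 R; rewrite normfV (gtr0_norm k0) mulrC ler_pdivrMr//.
apply: le_trans (Wd_bd xi (rap_meas (u_rap s ck)) _) _; first by rewrite ab; exact: hM s ck.
by apply: eqW; ring.
Qed.

(** For |xi| <= 1 the gradient vanishes at the origin by evenness and second derivatives are
    bounded; for |xi| >= 1 [interp] gives the decay J^-2. Together: the gradient is O(J^-2 |xi|), as
    [base_est] requires. *)
Lemma gradF : exists2 C, 0 <= C & all_sol c g, forall xi,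
 `|Fd g 1 0 xi| * enorm2 xi <= C * J xi ^- 2 * dot2 xi xi /\ `|Fd g 0 1 xi| * enorm2 xi <= C * J xi ^- 2 * dot2 xi xi.
Proof.
have [K K0 hK] := Fd_bd 2; have [M M0 hM] := F_bd Q be Mk0 4.
pose C2 := K + (8 ^+ 4 + 1) * M.
have C20 : 0 <= C2 by rewrite addr_ge0// mulr_ge0.
exists (8 * K + C2); first by rewrite addr_ge0// mulr_ge0.
move=> c g s ck; have j := Fd_jet s ck; have hb := hM _ _ s.
have eF : Fd g 0 0 = cnv g g by apply/funext => x; exact: Fd00 s ck.
have D1 a b x t : is_derive t (1 : R) (fun r : R => Fd g a b (x + r *: dir1 R)) (Fd g a.+1 b (x + t *: dir1 R)).
 by apply: (drv_eq (hg_line (j a b (x + t *: dir1 R)))); rewrite /= mulr1 mulr0 addr0.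
have D2 a b x t : is_derive t (1 : R) (fun r : R => Fd g a b (x + r *: dir2 R)) (Fd g a b.+1 (x + t *: dir2 R)).
 by apply: (drv_eq (hg_line (j a b (x + t *: dir2 R)))); rewrite /= mulr1 mulr0 add0r.
have dd (t : R) : t = 0 \/ t = 1 -> `|t| <= 1 by case=> ->; rewrite ?normr0 ?normr1.
have b1 : bd 2 C2 (Fd g 1 0).
 apply: (interp (v := dir1 R) _ _ (D1 0%N 0%N) (D1 1%N 0%N)).
 - by apply: dd; right.
 - by apply: dd; left.
 - by move=> x; exact: hK s ck 2%N 0%N erefl x.
 - by rewrite eF.
have b2 : bd 2 C2 (Fd g 0 1).
 apply: (interp (v := dir2 R) _ _ (D2 0%N 0%N) (D2 0%N 1%N)).
 - by apply: dd; left.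
 - by apply: dd; right.
 - by move=> x; exact: hK s ck 0%N 2%N erefl x.
 - by rewrite eF.
have z a b : (a + b = 1)%N -> Fd g a b 0 = 0.
 move=> ab; rewrite /Fd /Wd ab /Tr (_ : II _ = 0) ?mulr0// -(II0 R); apply: II_ext => x.
 by rewrite (_ : dot2 0 x = 0) ?add0r ?mul1r ?cos_pihalf ?mulr0// /dot2 /= !mul0r addr0.
have lin a b xi : (a + b = 1)%N -> `|Fd g a b xi| <= 2 * K * enorm2 xi.
 move=> ab.
 have [r [_ E]] := mvt (@ltr01 R) (fun t _ => hg_line (j a b (0 + t *: xi))).
 rewrite scale0r addr0 z// !subr0 mulr1 add0r scale1r in E; rewrite E.
 apply: normD_le; rewrite (normrM (Fd g a.+1 b _)) (normrM (Fd g a b.+1 _)).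
 have h1 := hK _ _ s ck a.+1 b (congr1 S ab) (0 + r *: xi).
 have h2 := hK _ _ s ck a b.+1 (etrans (addnS a b) (congr1 S ab)) (0 + r *: xi).
 rewrite -mulrA mulr_natl mulr2n; apply: lerD.
  exact: ler_pM (normr_ge0 _) (normr_ge0 _) h1 (abs1_le xi).
 exact: ler_pM (normr_ge0 _) (normr_ge0 _) h2 (abs2_le xi).
have fin xi (v : R) : `|v| <= 2 * K * enorm2 xi -> `|v| <= C2 * J xi ^- 2 -> `|v| * enorm2 xi <= (8 * K + C2) * J xi ^- 2 * dot2 xi xi.
 move=> h1 h2; have e0 := enorm2_ge0 xi; have J0 := J_gt0 xi; have Ji := Jk_gt0 2 xi.
 have -> : dot2 xi xi = enorm2 xi * enorm2 xi by rewrite -expr2 sqr_sqrtr ?dot2_ge0.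
 rewrite [leRHS]mulrA; apply: ler_wpM2r => //.
 case: (leP (enorm2 xi) 1) => hx.
  apply: le_trans h1 _; apply: ler_wpM2r => //; rewrite ler_pdivlMr ?exprn_gt0//.
  have J2 : J xi ^+ 2 <= 2 ^+ 2.
   rewrite lerXn2r ?nnegrE ?(ltW J0)// J_enorm.
   by have : enorm2 xi ^+ 2 <= 1 by [rewrite expr2 mulr_ile1]; lra.
  apply: (@le_trans _ _ (2 * K * 2 ^+ 2)); first by apply: ler_wpM2l => //; rewrite mulr_ge0.
  by rewrite (_ : 2 * K * 2 ^+ 2 = 8 * K) ?lerDl//; ring.
 apply: le_trans h2 _; apply: (@le_trans _ _ (C2 * J xi ^- 2 * 1)); first by rewrite mulr1.
 apply: ler_pM => //; [by rewrite mulr_ge0 ?(ltW Ji)| |exact: ltW].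
 by apply: ler_wpM2r; [exact: ltW|rewrite lerDr mulr_ge0].
move=> xi; split; apply: fin; [exact: lin|exact: b1|exact: lin|exact: b2].
Qed.

Lemma psi_base : exists2 C, 0 <= C & all_psi c g e y,
 `|Wd (se c e (cnv g g)) 1 0 y| <= C / enorm2 y /\ `|Wd (se c e (cnv g g)) 0 1 y| <= C / enorm2 y.
Proof.
have [C C0 hC] := gradF; have [MF MF0 hMF] := F_bd Q be Mk0 0.
exists (2 * kap * (12 * C * II w2 + 2 * MF * pi ^+ 2)).
 have W0 : 0 <= II w2 by apply: II_ge0 => x; exact: w2_ge0.
 apply: mulr_ge0; first by rewrite mulr_ge0 ?kap_ge0.
 by apply: addr_ge0; apply: mulr_ge0; rewrite ?sqr_ge0//; exact: mulr_ge0.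
move=> c g e s ck e0 y y0; have [c2 Sg _ _ _] := s; have SF := Sz_conv Sg Sg.
have r0 := enorm2_gt0 y0; have j := Fd_jet s ck.
rewrite !ler_pdivlMr//.
apply: (@base_est _ c e (cnv g g) (Fd g 1 0) (Fd g 0 1) MF C c2 e0) => //.
- by move=> xi; exact: F_hg s ck.
- by apply: measC => x; exact: hg_cont (j 1%N 0%N x).
- by apply: measC => x; exact: hg_cont (j 0%N 1%N x).
- by move=> k; have [_ _ b] := SF; exact: b.
- by move=> xi; exact: bd_abs (hMF _ _ s).
- by move=> xi; have [] := hC _ _ s ck xi.
- by move=> xi; have [] := hC _ _ s ck xi.
Qed.

(** The equation for psi is checked once on the transforms, where it says that Ae times [se] is F;
    it holds for all derivatives because two jets that agree at order 0 coincide. *)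
Lemma se_lap c g e a b y : sol c g -> dot2 c c <= k1 -> 0 < e ->
 (1 - c.1 ^+ 2) * Wd (se c e (cnv g g)) a.+2 b y - 2 * c.1 * c.2 * Wd (se c e (cnv g g)) a.+1 b.+1 y +
 (1 - c.2 ^+ 2) * Wd (se c e (cnv g g)) a b.+2 y - e ^+ 2 * Wd (se c e (cnv g g)) a b y = - Wd (cnv g g) a b y.
Proof.
move=> s ck e0; have [c2 Sg _ _ _] := s; have SF := Sz_conv Sg Sg; have [_ _ bF] := SF.
have rs : rap (se c e (cnv g g)).
 by apply: (@se_rap _ c e (cnv g g) (Fd g 1 0) (Fd g 0 1) c2 e0) => // xi; exact: F_hg s ck.
set h := se c e (cnv g g) in rs *; have j := Wd_jet rs.
have j1 : jet (fun a b x => (1 - c.1 ^+ 2) * Wd h a.+2 b x + (- (2 * c.1 * c.2)) * Wd h a.+1 b.+1 x +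
 (1 - c.2 ^+ 2) * Wd h a b.+2 x + (- e ^+ 2) * Wd h a b x).
 apply: jetD; last exact: jetZ j.
 apply: jetD; first apply: jetD.
 - by apply: (@jetZ _ _ (fun a b => Wd h a.+2 b)) => i k x; exact: j.
 - by apply: (@jetZ _ _ (fun a b => Wd h a.+1 b.+1)) => i k x; exact: j.
 - by apply: (@jetZ _ _ (fun a b => Wd h a b.+2)) => i k x; exact: j.
have j2 := jetZ (-1) (Wd_jet (Sz_rap SF)).
have r20 := rap_Int (rap_mono (2, 0)%N rs); have r11 := rap_Int (rap_mono (1, 1)%N rs).
have r02 := rap_Int (rap_mono (0, 2)%N rs); have r0 := rap_Int rs.
have z x : (1 - c.1 ^+ 2) * Wd h 2 0 x + (- (2 * c.1 * c.2)) * Wd h 1 1 x +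
 (1 - c.2 ^+ 2) * Wd h 0 2 x + (- e ^+ 2) * Wd h 0 0 x = -1 * Wd (cnv g g) 0 0 x.
 rewrite (Wd2 x rs (erefl : (2 + 0 = 2)%N)) (Wd2 x rs (erefl : (1 + 1 = 2)%N)) (Wd2 x rs (erefl : (0 + 2 = 2)%N)) !Wd00 mulN1r.
 have -> : FI (cnv g g) x = FI (fun xi => ((1 - c.1 ^+ 2) * (mono (2, 0)%N xi * h xi) + (- (2 * c.1 * c.2)) * (mono (1, 1)%N xi * h xi)) + ((1 - c.2 ^+ 2) * (mono (0, 2)%N xi * h xi) + e ^+ 2 * h xi)) x.
  congr (FI _ x); apply/funext => xi; have An := lt0r_neq0 (Ae_gt0 c2 e0 xi).
  have al (F A : R) : A != 0 -> forall m1 m2 m3 k0 k1 k2 k3 : R, A = k0 * m1 + k1 * m2 + (k2 * m3 + k3) ->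
   F = (k0 * (m1 * (F / A)) + k1 * (m2 * (F / A))) + (k2 * (m3 * (F / A)) + k3 * (F / A)).
   by move=> A0 m1 m2 m3 k0 k1' k2 k3 E; rewrite [LHS](_ : F = A * (F / A)); [rewrite {1}E; ring|field].
  by apply: al => //; rewrite /Ae /Ac /mono /dot2 /=; ring.
 rewrite (FID x (IntD (IntZ (1 - c.1 ^+ 2) r20) (IntZ (- (2 * c.1 * c.2)) r11)) (IntD (IntZ (1 - c.2 ^+ 2) r02) (IntZ (e ^+ 2) r0))).
 rewrite (FID x (IntZ (1 - c.1 ^+ 2) r20) (IntZ (- (2 * c.1 * c.2)) r11)) (FID x (IntZ (1 - c.2 ^+ 2) r02) (IntZ (e ^+ 2) r0)).
 rewrite (FIZ (1 - c.1 ^+ 2) x r20) (FIZ (- (2 * c.1 * c.2)) x r11) (FIZ (1 - c.2 ^+ 2) x r02) (FIZ (e ^+ 2) x r0).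
 move: (FI _ x) (FI (fun xi => mono (1, 1)%N xi * _) x) (FI (fun xi => mono (0, 2)%N xi * _) x) (FI h x) => p q r t.
 ring.
have := jet_uniq j1 j2 z a b y; rewrite mulN1r => <-.
move: (Wd h a.+2 b y) (Wd h a.+1 b.+1 y) (Wd h a b.+2 y) (Wd h a b y) => p q r t.
ring.
Qed.

(** The gradient estimate is applied in the eigenframe of I - c c^T on a square of half side r / 4
    centred at y. It stays at distance at least r / 2 from the origin, so the bound of order a + b
    holds on it, and the exponentially small right-hand side is below r^(- a - b - 2): one factor 1
    / r is gained. *)
Lemma psi_step a b : (exists2 C, 0 <= C & all_psi c g e y,
  `|Wd (se c e (cnv g g)) a b y| <= C / enorm2 y ^+ (a + b)) ->
 exists2 C, 0 <= C & all_psi c g e y,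
  `|Wd (se c e (cnv g g)) a.+1 b y| <= C / enorm2 y ^+ (a + b).+1 /\
  `|Wd (se c e (cnv g g)) a b.+1 y| <= C / enorm2 y ^+ (a + b).+1.
Proof.
have al1 (u1 u2 k A B D : R) : u1 * u1 + u2 * u2 = 1 ->
 (1 - k ^+ 2) * (u1 ^+ 2 * A + 2 * u1 * u2 * B + u2 ^+ 2 * D) + 1 * ((- u2) ^+ 2 * A + 2 * (- u2) * u1 * B + u1 ^+ 2 * D) =
 (1 - (k * u1) ^+ 2) * A - 2 * (k * u1) * (k * u2) * B + (1 - (k * u2) ^+ 2) * D.
 move=> uu; apply/eqP; rewrite -subr_eq0 (_ : _ - _ = (u1 * u1 + u2 * u2 - 1) * (A + D)); last by ring.
 by rewrite uu subrr mul0r.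
have al2 (u1 u2 P S B : R) : u1 * u1 + u2 * u2 = 1 -> `|u1| <= 1 -> `|u2| <= 1 ->
 `|P * u1 + S * u2| <= B -> `|P * (- u2) + S * u1| <= B -> `|P| <= 2 * B /\ `|S| <= 2 * B.
 move=> uu h1 h2; set g1 := P * u1 + _; set g2 := P * _ + _ => b1 b2.
 have e1 : P = g1 * u1 - g2 * u2 by rewrite /g1 /g2 -[LHS]mulr1 -uu; ring.
 have e2 : S = g1 * u2 + g2 * u1 by rewrite /g1 /g2 -[LHS]mulr1 -uu; ring.
 have m (s t : R) : `|s| <= B -> `|t| <= 1 -> `|s * t| <= B.
  by move=> hs ht; rewrite normrM; apply: le_trans (ler_piMr (normr_ge0 _) ht) hs.
 rewrite e1 e2 mulr_natl mulr2n; split.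
  by apply: le_trans (ler_normB _ _) (lerD _ _); exact: m.
 by apply: le_trans (ler_normD _ _) (lerD _ _); exact: m.
have al3 (r C D : R) n : 0 < r -> 2 * (3 * (C / (r / 2) ^+ n) / (r / 4) + D / (r / 2) ^+ n.+2 * (r / 4)) =
  (24 * C * 2 ^+ n + 2 * D * 2 ^+ n) / r ^+ n.+1.
 move=> r0; have rn : r != 0 by rewrite gt_eqF.
 rewrite !expr_div_n !exprS; have := expf_neq0 n rn; move: (r ^+ n) => t tn; field; rewrite rn tn /=.
 by apply: expf_neq0; rewrite pnatr_eq0.
move=> [C C0 hC]; have [D D0 hD] := exp_pow (a + b).+2.
exists (24 * C * 2 ^+ (a + b) + 2 * (CF a b * D) * 2 ^+ (a + b)).
 by apply: addr_ge0; apply: mulr_ge0; rewrite ?exprn_ge0// ?mulr_ge0.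
move=> c g e s ck e0 y y0; have [c2 Sg _ _ _] := s.
have rs : rap (se c e (cnv g g)).
 have [_ _ bF] := Sz_conv Sg Sg.
 by apply: (@se_rap _ c e (cnv g g) (Fd g 1 0) (Fd g 0 1) c2 e0) => // xi; exact: F_hg s ck.
have hC' := hC c g e s ck e0; have lap z := se_lap a b z s ck e0.
set W := Wd (se c e (cnv g g)) in hC' lap *; have j : jet W := Wd_jet rs.
have r0 := enorm2_gt0 y0; set r := enorm2 y in r0 *.
have [u [uu cu1 cu2]] := frame c; pose v : R * R := (- u.2, u.1).
have un : enorm2 u = 1 by rewrite /enorm2 uu sqrtr1.
have vv : dot2 v v = 1 by rewrite -uu /v /dot2 /=; ring.
have vn : enorm2 v = 1 by rewrite /enorm2 vv sqrtr1.
have d0 : 0 < r / 4 by rewrite divr_gt0.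
have k2 : enorm2 c ^+ 2 = dot2 c c by rewrite sqr_sqrtr ?dot2_ge0.
have a1 : 2^-1 <= 1 - enorm2 c ^+ 2 <= 1 by rewrite k2; have := dot2_ge0 c; lra.
have a2 : (2^-1 : R) <= (1 : R) <= (1 : R) by apply/andP; split; lra.
have e2 : 0 <= e ^+ 2 by exact: sqr_ge0.
have far z : `|z.1| <= r / 4 -> `|z.2| <= r / 4 -> r / 2 <= enorm2 (y + z.1 *: u + z.2 *: v).
 move=> z1 z2; set p := y + _ + _.
 have yE : y = (p + (- z.1) *: u) + (- z.2) *: v by apply: pt_eq; rewrite /p !pE /=; ring.
 have t1 := enorm2_tri (p + (- z.1) *: u) ((- z.2) *: v); have t2 := enorm2_tri p ((- z.1) *: u).
 move: t1 t2; rewrite -yE !enorm2Z un vn !normrN !mulr1 -/r; lra.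
have r2 : 0 < r / 2 by rewrite divr_gt0.
have est := @grad_est R (fun z => W a b (y + z.1 *: u + z.2 *: v)) (1 - enorm2 c ^+ 2) 1 (e ^+ 2) (C / (r / 2) ^+ (a + b)) (CF a b * D / (r / 2) ^+ (a + b).+2) (r / 4).
have h0 := hg_aff (p := y) (u := u) (v := v) (z := 0) (j a b (y + (0 : R * R).1 *: u + (0 : R * R).2 *: v)).
have [|g1 g2] := est _ _ d0 a1 a2 e2 _ h0.
 move=> z z1 z2; have fz := far z z1 z2; set p := y + _ + _ in fz *.
 have p0 : 0 < enorm2 p by apply: lt_le_trans fz.
 have pn : p != 0 by apply/eqP => pz; move: p0; rewrite pz /enorm2 /dot2 /= !mulr0 addr0 sqrtr0 ltxx.
 split.
  apply: le_trans (hC' _ pn) _; apply: ler_wpM2l => //; rewrite lef_pV2 ?posrE ?exprn_gt0//.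
  by rewrite lerXn2r ?nnegrE ?(ltW r2) ?(ltW p0).
 have [b1 [b2 hh]] := h2_jet_aff a b y u v z j.
 exists b1, b2; do 2 eexists; split; first exact: hh.
 rewrite -/p; have := al1 u.1 u.2 (enorm2 c) (W a.+2 b p) (W a.+1 b.+1 p) (W a b.+2 p) uu.
 rewrite -cu1 -cu2 /v /= => ->; rewrite lap normrN.
 apply: le_trans (hCF a b s ck p) _; rewrite -mulrA; apply: ler_wpM2l; first exact: CF0.
 apply: le_trans (hD _ p0) _; apply: ler_wpM2l => //; rewrite lef_pV2 ?posrE ?exprn_gt0//.
 by rewrite lerXn2r ?nnegrE ?(ltW r2) ?(ltW p0).
move: g1 g2; rewrite /v /= !scale0r !addr0 => g1 g2.
have ue (i : R) : `|i| <= enorm2 u -> `|i| <= 1 by rewrite un.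
have := al2 _ _ _ _ _ uu (ue _ (abs1_le u)) (ue _ (abs2_le u)) g1 g2.
by rewrite al3.
Qed.

(** The induction starts at order one, since psi itself has no bound uniform in e: in the plane the
    potential diverges logarithmically. *)
Lemma psi_decay a b : (0 < a + b)%N -> exists2 C, 0 <= C & all_psi c g e y,
  `|Wd (se c e (cnv g g)) a b y| <= C / enorm2 y ^+ (a + b).
Proof.
suff main n : forall a b, (a + b = n.+1)%N -> exists2 C, 0 <= C & all_psi c g e y,
  `|Wd (se c e (cnv g g)) a b y| <= C / enorm2 y ^+ (a + b).
 by move=> h; apply: (main (a + b).-1); rewrite prednK.
elim: n => [|n IH] {}a {}b.
 have [C C0 hC] := psi_base.
 case: a => [|[|a]] //; case: b => [|[|b]] //= _; exists C => // c g e s ck e0 y y0; rewrite expr1.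
  by have [] := hC _ _ _ s ck e0 _ y0.
 by have [] := hC _ _ _ s ck e0 _ y0.
case: a => [|a] ab.
 case: b ab => [//|b] ab; rewrite add0n in ab; case: ab => ab.
 have [C C0 hC] := psi_step (IH 0%N b ab); exists C => // c g e s ck e0 y y0.
 by have [_] := hC _ _ _ s ck e0 _ y0; rewrite add0n.
case: ab => ab; have [C C0 hC] := psi_step (IH a b ab); exists C => // c g e s ck e0 y y0.
by have [] := hC _ _ _ s ck e0 _ y0.
Qed.

(** For |m| = 2, the transform of minus the derivative of psi of order m at e = 0. The quotient is
    bounded, jumps at the origin, and is 0 there by the convention on division. *)
Definition tq m c g xi : R := mono m xi / Ac c xi * cnv g g xi.

Lemma mono2_le m xi : (m.1 + m.2 = 2)%N -> `|mono m xi| <= dot2 xi xi.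
Proof.
move=> m2; have -> : dot2 xi xi = enorm2 xi ^+ m.1 * enorm2 xi ^+ m.2.
 by rewrite -exprD m2 sqr_sqrtr ?dot2_ge0.
rewrite /mono normrM !normrX; apply: ler_pM; rewrite ?exprn_ge0//; apply: lerXn2r; rewrite ?nnegrE ?enorm2_ge0//.
 exact: abs1_le.
exact: abs2_le.
Qed.

Lemma mono2_opp m xi : (m.1 + m.2 = 2)%N -> mono m (- xi) = mono m xi.
Proof.
have al (s t : R) (i j : nat) : (i + j = 2)%N -> (- s) ^+ i * (- t) ^+ j = s ^+ i * t ^+ j.
 by case: i => [|[|[|i]]] //; case: j => [|[|[|j]]] //= _; ring.
by move=> m2; exact: al.
Qed.

Lemma mono_Dk k m : Dk k (@mono R m).
Proof.
have p f n : Dk k f -> Dk k (fun x : R * R => f x ^+ n).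
 move=> Df; elim: n => [|n IH]; first by apply: Dk_ext (Dk_cst k 1) => z; rewrite expr0.
 by apply: Dk_ext (DkM Df IH) => z; rewrite exprS.
by apply: DkM; apply: p; [exact: Dk_fst|exact: Dk_snd].
Qed.

Lemma tq_quot m c xi : dot2 c c <= 2^-1 -> (m.1 + m.2 = 2)%N -> `|mono m xi / Ac c xi| <= 2.
Proof.
move=> c2 m2; have [->|x0] := eqVneq xi 0; first by rewrite Ac0 invr0 mulr0 normr0.
have a0 := Ac_gt0 c2 x0; rewrite normrM normfV (gtr0_norm a0) ler_pdivrMr//.
by apply: le_trans (mono2_le xi m2) _; have := Ac_ge xi c2; lra.
Qed.

Lemma tq_bd m k : (m.1 + m.2 = 2)%N -> exists2 M, 0 <= M & forall c g, sol c g -> bd k M (tq m c g).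
Proof.
move=> m2; have [M M0 h] := F_bd Q be Mk0 k; exists (2 * M); first by rewrite mulr_ge0.
by move=> c g s; have [c2 _ _ _ _] := s; apply: bdM (h _ _ s) _ => xi; exact: tq_quot.
Qed.

Lemma tq_spec m c g : (m.1 + m.2 = 2)%N -> sol c g -> spec (tq m c g).
Proof.
move=> m2 s; have [c2 Sg _ _ _] := s; have SF := Sz_conv Sg Sg; have [eF uF _] := SF.
have mq : meas (fun xi => mono m xi / Ac c xi) := quot_meas c2 (@mono_Dk 0 m).
have mt : meas (tq m c g) by apply: measM => //; exact: Sz_meas.
have bk k : exists M, bd k M (tq m c g) by have [M _ h] := tq_bd k m2; exists M; exact: h.
split; first exact: rap_of_bd.
- by move=> x; rewrite /tq Ac_opp eF mono2_opp.
- by have [M hM] := bk 0%N; exists M => x; exact: bd_abs hM.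
- move=> x x0; apply: cvgM; last exact: uc_cont.
 exact: (quot_cont c2 (@mono_Dk 0 m) x0).
Qed.

(** Dominated convergence, since |xi|^2 <= 2 Ae bounds the quotients by 2 uniformly in e. The sign
    is the phase pi of two derivatives. *)
Lemma tq_lim m c g a b y : (m.1 + m.2 = 2)%N -> sol c g ->
 Wd (se c n.+1%:R^-1 (cnv g g)) (a + m.1) (b + m.2) y @[n --> \oo] --> - Wd (tq m c g) a b y.
Proof.
move=> m2 s; have [c2 Sg _ _ _] := s; have SF := Sz_conv Sg Sg; have [_ uF bF] := SF.
have rm := rap_mono (a, b) (Sz_rap SF).
have [rt _ _ _] := tq_spec m2 s; have rtm := rap_mono (a, b) rt.
pose en (n : nat) : R := n.+1%:R^-1.
have e0 n : 0 < en n by rewrite invr_gt0 ltr0n.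
have An n xi := Ae_gt0 c2 (e0 n) xi.
pose f n xi := mono (a, b) xi * (mono m xi / Ae c (en n) xi * cnv g g xi) * cos (dot2 y xi + (a + b)%:R * (pi / 2)).
pose f0 xi := mono (a, b) xi * tq m c g xi * cos (dot2 y xi + (a + b)%:R * (pi / 2)).
have mc : meas (fun xi => cos (dot2 y xi + (a + b)%:R * (pi / 2))).
 by apply: measC => x; exact: cont_cosdot.
have q2 n xi : `|mono m xi / Ae c (en n) xi| <= 2.
 rewrite normrM normfV (gtr0_norm (An n xi)) ler_pdivrMr//.
 exact: le_trans (mono2_le xi m2) (Ae_ge c2 (e0 n) xi).
have mA n : meas (fun xi => mono m xi / Ae c (en n) xi).
 apply: measC => x; apply: cvgM; first exact: (@mono_Dk 0 m x).
 by apply: cvgV; [rewrite gt_eqF|apply: cvgD; [exact: Ac_cont|exact: cvg_cst]].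
have mf n : meas (f n).
 apply: measM => //; apply: measM; first by apply: measC => x; exact: (@mono_Dk 0 (a, b) x).
 by apply: measM => //; exact: Sz_meas.
have bnd n xi : `|f n xi| <= 2 * `|mono (a, b) xi * cnv g g xi|.
 have al (p q r t : R) : `|q| <= 2 -> `|t| <= 1 -> `|p * (q * r) * t| <= 2 * `|p * r|.
  move=> hq ht; rewrite normrM; apply: le_trans (ler_piMr (normr_ge0 _) ht) _.
  by rewrite mulrCA normrM; apply: ler_wpM2r.
 by apply: al => //; exact: abscos.
have lim : II (f n) @[n --> \oo] --> II f0.
 apply: (@Rdct _ _ _ (leb2 R) _ _ (fun xi => 2 * `|mono (a, b) xi * cnv g g xi|)) => //.
 - by apply: measM => //; exact: rap_meas rtm.
 - by apply: IntZ; apply: Int_abs; exact: rap_Int.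
 - move=> xi; apply: cvgM; last exact: cvg_cst.
  apply: cvgMl_tmp.
  apply: cvgM; last exact: cvg_cst.
  have [->|x0] := eqVneq xi 0.
   have mz : mono m (0 : R * R) = 0 by apply/eqP; rewrite -normr_le0; apply: le_trans (mono2_le 0 m2) _; rewrite /dot2 /= mulr0 addr0.
   by rewrite mz mul0r; under eq_fun do rewrite mul0r; exact: cvg_cst.
  apply: cvgMl_tmp.
  apply: cvgV; first by rewrite gt_eqF// Ac_gt0.
  rewrite -[X in _ --> X]addr0; apply: cvgD; first exact: cvg_cst.
  rewrite (_ : 0 = 0 * 0 :> R); last by rewrite mul0r.
  by under eq_fun do rewrite expr2; apply: cvgM; exact: cvg_harmonic.
have ph (x : R) : cos (x + (a + m.1 + (b + m.2))%:R * (pi / 2)) = - cos (x + (a + b)%:R * (pi / 2)).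
 rewrite (_ : x + _ = (x + (a + b)%:R * (pi / 2)) + pi) ?cosDpi//.
 by rewrite addnACA m2 (natrD _ (a + b) 2); field.
have E n : Wd (se c (en n) (cnv g g)) (a + m.1) (b + m.2) y = - (kap * II (f n)).
 rewrite /Wd -mulrN; congr (_ * _).
 have iF : Int (f n) by apply: Int_le (mf n) (bnd n) _; apply: IntZ; apply: Int_abs; exact: rap_Int.
 rewrite -(IIN iF); apply: II_ext => xi; rewrite ph /f /se /mono /= !exprD; ring.
rewrite (_ : - Wd (tq m c g) a b y = - (kap * II f0))//.
rewrite (_ : (fun n => _) = (fun n => - (kap * II (f n)))); last exact/funext.
by apply: cvgN; apply: cvgM lim; exact: cvg_cst.
Qed.

Lemma tq_decay m a b : (m.1 + m.2 = 2)%N -> exists2 C, 0 <= C & all_sol c g,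
 forall y, y != 0 -> `|Wd (tq m c g) a b y| <= C / enorm2 y ^+ (a + b + 2).
Proof.
move=> m2; have abm : (a + m.1 + (b + m.2) = a + b + 2)%N by rewrite addnACA m2.
have [|C C0 hC] := @psi_decay (a + m.1) (b + m.2); first by rewrite abm addn2.
exists C => // c g s ck y y0; rewrite abm in hC.
have cn : `|Wd (se c n.+1%:R^-1 (cnv g g)) (a + m.1) (b + m.2) y| @[n --> \oo] --> `|- Wd (tq m c g) a b y|.
 by apply: cvg_norm; exact: tq_lim.
rewrite -normrN -(cvg_lim (@Rhausdorff R) cn); apply: limr_le; first exact: cvgP cn.
by apply: nearW => n; apply: hC => //; rewrite invr_gt0 ltr0n.
Qed.

End Psi.
End GradF.

(** * The travelling wave solves the system *)

Section Assembly.
Variable R : realType.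
Local Notation J := (@jap R).
Local Notation kap := (@kap R).
Implicit Types (x y z xi : R * R) (f g : R * R -> R).

Lemma rapD f g : rap f -> rap g -> rap (fun x => f x + g x).
Proof.
move=> [mf jf] [mg jg]; split=> [|k]; first exact: measD.
apply: Int_le (IntD (jf k) (jg k)).
 by apply: measM; [apply: meas_abs; exact: measD|exact: measX _ (@J_meas R)].
move=> x; have J0 : 0 <= J x ^+ k by rewrite exprn_ge0// J_ge0.
by rewrite normrM normr_id (ger0_norm J0) -mulrDl; apply: ler_wpM2r => //; exact: ler_normD.
Qed.

Lemma rapZ (k : R) f : rap f -> rap (fun x => k * f x).
Proof.
by apply: (rap_mul (C := `|k|) (n := 0)); [exact: meas_cst|move=> x; rewrite expr0 mulr1].
Qed.

Lemma specD f g : spec f -> spec g -> spec (fun x => f x + g x).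
Proof.
move=> [rf ef [A hA] cf] [rg eg [B hB] cg]; split; [exact: rapD|by move=> x; rewrite ef eg| |].
 by exists (A + B) => x; apply: le_trans (ler_normD _ _) (lerD _ _).
by move=> x x0; apply: cvgD; [exact: cf|exact: cg].
Qed.

Lemma specZ (k : R) f : spec f -> spec (fun x => k * f x).
Proof.
move=> [rf ef [A hA] cf]; split; [exact: rapZ|by move=> x; rewrite ef| |].
 by exists (`|k| * A) => x; rewrite normrM; apply: ler_wpM2l.
by move=> x x0; apply: cvgMl_tmp; exact: cf.
Qed.

Lemma WdD f g a b x : rap f -> rap g -> Wd (fun x => f x + g x) a b x = Wd f a b x + Wd g a b x.
Proof.
move=> rf rg; rewrite /Wd -mulrDr -TrD; [|exact: rap_Int (rap_mono _ rf)|exact: rap_Int (rap_mono _ rg)].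
by congr (_ * _); apply: Tr_ext => xi; rewrite mulrDr.
Qed.

Lemma WdZ (k : R) f a b x : rap f -> Wd (fun x => k * f x) a b x = k * Wd f a b x.
Proof.
move=> rf; rewrite /Wd [RHS]mulrCA -(TrZ _ k x (rap_Int (rap_mono _ rf))).
by congr (_ * _); apply: Tr_ext => xi; rewrite mulrCA.
Qed.

Lemma Wd_ext f g a b x : (forall x, f x = g x) -> Wd f a b x = Wd g a b x.
Proof. by move=> /funext ->. Qed.

Lemma Wd_sym f g a b a' b' x : (a + b = a' + b')%N -> (forall xi, mono (a, b) xi * f xi = mono (a', b') xi * g xi) ->
 Wd f a b x = Wd g a' b' x.
Proof. by move=> e h; rewrite /Wd e; congr (_ * _); exact: Tr_ext. Qed.

Lemma jet_aff p (k : R) (q : R * R) : jet p -> jet (fun a b x => k ^+ (a + b) * p a b (k *: (x - q))).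
Proof.
move=> jp a b x; apply: (hg_eq (hgZ (k ^+ (a + b)) (hg_shift (jp a b (k *: (x - q)))))).
 by rewrite addSn exprS; ring.
by rewrite addnS exprS; ring.
Qed.

Lemma jet_cos (l1 l2 th : R) : jet (fun a b x => l1 ^+ a * l2 ^+ b * cos (l1 * x.1 + l2 * x.2 + th + (a + b)%:R * (pi / 2))).
Proof.
move=> a b x.
have h : hg (fun z => l1 * z.1 + l2 * z.2 + th + (a + b)%:R * (pi / 2)) x (l1 + 0 + 0) (l2 + 0 + 0).
 exact: hgD (hgD (hg_lin l1 l2 x) (hg_cst _ x)) (hg_cst _ x).
have hc := hgZ (l1 ^+ a * l2 ^+ b) (hg_comp (is_derive_cos _) h).
have e : (a + b).+1%:R * (pi / 2) = (a + b)%:R * (pi / 2) + pi / 2 :> R by rewrite -natr1 mulrDl mul1r.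
apply: (hg_eq hc); rewrite ?addSn ?addnS e addrA cosDpihalf !addr0 exprS; ring.
Qed.

Lemma pd1_jet p x : jet p -> pd1 (p 0 0) x = p 1 0 x.
Proof. by move=> jp; exact: (jet_pdm (1, 0)%N x jp). Qed.
Lemma pd2_jet p x : jet p -> pd2 (p 0 0) x = p 0 1 x.
Proof. by move=> jp; exact: (jet_pdm (0, 1)%N x jp). Qed.

Section Wave.
Variable Q : R * R -> R.
Variables (be : R) (Mk : nat -> R).
Hypotheses (be0 : 0 <= be) (Mk0 : forall k, 0 <= Mk k).
Variables (c : R * R) (g : R * R -> R).
Hypothesis sl : sol Q be Mk c g.

Local Notation F := (cnv g g).
Local Notation t20 := (tq (2, 0)%N c g).
Local Notation t11 := (tq (1, 1)%N c g).
Local Notation t02 := (tq (0, 2)%N c g).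

Definition sN xi : R := (-1) * nF c g xi.
(** The transform of V is - (c . xi) xi F / Ac, expanded on the symbols [tq]: V is a combination of
    second derivatives of psi with coefficients linear in c. *)
Definition sV1 xi : R := (- c.1) * t20 xi + (- c.2) * t11 xi.
Definition sV2 xi : R := (- c.1) * t11 xi + (- c.2) * t02 xi.
Lemma sN_spec : spec sN. Proof. by apply: specZ; exact: nF_spec sl. Qed.
Lemma sV1_spec : spec sV1.
Proof. by apply: specD; apply: specZ; apply: (@tq_spec _ Q be Mk Mk0). Qed.
Lemma sV2_spec : spec sV2.
Proof. by apply: specD; apply: specZ; apply: (@tq_spec _ Q be Mk Mk0). Qed.
Let Sg : Sz g. Proof. by case: sl. Qed.
Let rg : rap g := Sz_rap Sg.
Let rF : rap F := Sz_rap (Sz_conv Sg Sg).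
Let rN : rap sN. Proof. by case: sN_spec. Qed.
Let rV1 : rap sV1. Proof. by case: sV1_spec. Qed.
Let rV2 : rap sV2. Proof. by case: sV2_spec. Qed.
Let c2 : dot2 c c <= 2^-1. Proof. by case: sl. Qed.

Lemma sN_eq xi : sN xi = (-1) * F xi + (c.1 * sV1 xi + c.2 * sV2 xi).
Proof.
rewrite /sN /nF /sV1 /sV2 /tq /mu; move: (Ac c xi)^-1 => A; rewrite /mono /dot2 /= !expr0 !expr1; ring.
Qed.

Lemma WdN a b x : Wd sN a b x = - Wd F a b x + (c.1 * Wd sV1 a b x + c.2 * Wd sV2 a b x).
Proof.
rewrite (Wd_ext _ _ _ sN_eq) (WdD _ _ _ (rapZ (-1) rF) (rapD (rapZ c.1 rV1) (rapZ c.2 rV2))).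
by rewrite (WdD _ _ _ (rapZ c.1 rV1) (rapZ c.2 rV2)) (WdZ (-1) a b x rF) (WdZ c.1 a b x rV1) (WdZ c.2 a b x rV2) mulN1r.
Qed.

(** V is a gradient, which turns (c . grad) V into grad (c . V) in the equation for v. *)
Lemma Wd_curl x : Wd sV2 1 0 x = Wd sV1 0 1 x.
Proof.
apply: Wd_sym => // xi; rewrite /sV1 /sV2 /tq; move: (Ac c xi)^-1 => A; rewrite /mono /= !expr0 !expr1; ring.
Qed.

(** The continuity equation c . grad N = div V; on the transforms it amounts to the definition of
    Ac, and both integrands vanish at the origin. *)
Lemma Wd_div x : c.1 * Wd sN 1 0 x + c.2 * Wd sN 0 1 x = Wd sV1 1 0 x + Wd sV2 0 1 x.
Proof.
have r f (m : nat * nat) : rap f -> Int (fun xi => mono m xi * f xi) by move=> h; exact: rap_Int (rap_mono m h).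
rewrite /Wd /= addn0 add0n !(mulrCA _ kap) -!mulrDr; congr (_ * _).
rewrite -(TrZ _ c.1 x (r sN (1, 0)%N rN)) -(TrZ _ c.2 x (r sN (0, 1)%N rN)).
rewrite -(TrD _ x (IntZ _ (r sN (1, 0)%N rN)) (IntZ _ (r sN (0, 1)%N rN))) -(TrD _ x (r sV1 (1, 0)%N rV1) (r sV2 (0, 1)%N rV2)).
apply: Tr_ext => xi; rewrite /sN /nF /sV1 /sV2 /tq /mu /mono /= !expr0 !expr1 !mulr1 !mul1r.
have [->|x0] := eqVneq xi 0; first by rewrite /= !(mul0r, mulr0, addr0).
have An := lt0r_neq0 (Ac_gt0 c2 x0).
have al (A F s t k l : R) : A != 0 -> A = s * s + t * t - (k * s + l * t) ^+ 2 ->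
 k * (s * (-1 * ((1 + (k * s + l * t) ^+ 2 / A) * F))) + l * (t * (-1 * ((1 + (k * s + l * t) ^+ 2 / A) * F))) =
 s * (- k * (s ^+ 2 / A * F) + - l * (s * t / A * F)) + t * (- k * (s * t / A * F) + - l * (t ^+ 2 / A * F)).
 move=> An' E; apply/eqP; rewrite -subr_eq0 (_ : _ - _ = - ((k * s + l * t) * F / A) * (A - (s * s + t * t - (k * s + l * t) ^+ 2))); last by field.
 by rewrite {2}E subrr mulr0.
exact: al.
Qed.

Variable om : R.
Hypothesis om0 : 0 < om.
Let w := Num.sqrt om.
Let w2E : w * w = om. Proof. by rewrite -expr2 sqr_sqrtr// ltW. Qed.
Let jm f t := fun a b x => w ^+ (a + b) * Wd f a b (w *: (x - t *: c)).
Let jm_jet f t : rap f -> jet (jm f t). Proof. by move=> rf; apply: jet_aff; exact: Wd_jet. Qed.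
Let th (t : R) := - (enorm2 c ^+ 2 * t / 4) + om * t.
Let jc (ph t : R) := fun a b x => (c.1 / 2) ^+ a * (c.2 / 2) ^+ b * cos (c.1 / 2 * x.1 + c.2 / 2 * x.2 + (th t + ph) + (a + b)%:R * (pi / 2)).
Let jc_jet ph t : jet (jc ph t). Proof. exact: jet_cos. Qed.
(** The jet of the boosted profile: ph = 0 gives the real part of u and ph = - pi / 2 the imaginary
    part, so both are treated at once. *)
Let ju ph t := fun a b x => w * lz a b (fun i j => jm g t i j x) (fun i j => jc ph t i j x).
Let ju_jet ph t : jet (ju ph t).
Proof. by apply: (jetZ w); apply: jet_lz; [exact: jm_jet|exact: jc_jet]. Qed.
Let Theta t x := c.1 / 2 * x.1 + c.2 / 2 * x.2 + th t.
Let ju00 ph t x : ju ph t 0 0 x = w * (FI g (w *: (x - t *: c)) * cos (Theta t x + ph)).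
Proof. by rewrite /ju /= /jm /jc /= !expr0 !mul1r mul0r !addr0 Wd00 addrA. Qed.
Let th1 (s : R) : cos (s + (1 + 0)%:R * (pi / 2)) = - sin s. Proof. by rewrite (mul1r (pi / 2)) cosDpihalf. Qed.
Let th2 (s : R) : cos (s + (2 + 0)%:R * (pi / 2)) = - cos s.
Proof. by rewrite (_ : (2 + 0)%:R * (pi / 2) = pi :> R) ?cosDpi// addn0; field. Qed.

Let jcE ph t x : [/\ jc ph t 0 0 x = cos (Theta t x + ph),
 jc ph t 1 0 x = - (c.1 / 2 * sin (Theta t x + ph)), jc ph t 0 1 x = - (c.2 / 2 * sin (Theta t x + ph)),
 jc ph t 2 0 x = - ((c.1 / 2) ^+ 2 * cos (Theta t x + ph)) & jc ph t 0 2 x = - ((c.2 / 2) ^+ 2 * cos (Theta t x + ph))].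
Proof.
rewrite /jc /Theta (addrA _ (th t) ph); split.
- by rewrite !expr0 !mul1r mul0r addr0.
- by rewrite th1 expr0 expr1 mulr1 mulrN.
- by rewrite (th1 (_ + ph)) expr0 expr1 mul1r mulrN.
- by rewrite th2 expr0 mulr1 mulrN.
- by rewrite (th2 (_ + ph)) expr0 mul1r mulrN.
Qed.

Let lz20 (P S : nat -> nat -> R) : lz 2 0 P S = P 2 0 * S 0 0 + P 1 0 * S 1 0 + (P 1 0 * S 1 0 + P 0 0 * S 2 0).
Proof. by []. Qed.
Let lz02 (P S : nat -> nat -> R) : lz 0 2 P S = P 0 2 * S 0 0 + P 0 1 * S 0 1 + (P 0 1 * S 0 1 + P 0 0 * S 0 2).
Proof. by []. Qed.

Let ju_lap ph t x : ju ph t 2 0 x + ju ph t 0 2 x =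
 w * (om * (Wd g 2 0 (w *: (x - t *: c)) + Wd g 0 2 (w *: (x - t *: c))) * cos (Theta t x + ph)
  - w * (c.1 * Wd g 1 0 (w *: (x - t *: c)) + c.2 * Wd g 0 1 (w *: (x - t *: c))) * sin (Theta t x + ph)
  - dot2 c c / 4 * Wd g 0 0 (w *: (x - t *: c)) * cos (Theta t x + ph)).
Proof.
have al (v o k1 k2 p20 p02 p10 p01 p00 C0 S0 : R) : v * v = o ->
 v * (v ^+ 2 * p20 * C0 + v ^+ 1 * p10 * - (k1 / 2 * S0) + (v ^+ 1 * p10 * - (k1 / 2 * S0) + v ^+ 0 * p00 * - ((k1 / 2) ^+ 2 * C0))) +
 v * (v ^+ 2 * p02 * C0 + v ^+ 1 * p01 * - (k2 / 2 * S0) + (v ^+ 1 * p01 * - (k2 / 2 * S0) + v ^+ 0 * p00 * - ((k2 / 2) ^+ 2 * C0))) =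
 v * (o * (p20 + p02) * C0 - v * (k1 * p10 + k2 * p01) * S0 - (k1 * k1 + k2 * k2) / 4 * p00 * C0).
 by move=> <-; field.
have [e0 e1 e1' e2 e2'] := jcE ph t x.
rewrite /ju lz20 lz02 e0 e1 e1' e2 e2' /jm.
exact: al.
Qed.

Let mf_dt f t x : rap f -> is_derive t (1 : R) (fun t' : R => FI f (w *: (x - t' *: c)))
 (- (w * (c.1 * Wd f 1 0 (w *: (x - t *: c)) + c.2 * Wd f 0 1 (w *: (x - t *: c))))).
Proof.
move=> rf; pose v : R * R := (- w) *: c.
have E (s : R) : w *: (x - s *: c) = w *: x + s *: v by apply: pt_eq; rewrite /v !pE /=; ring.
have h := hg_ext (Wd00 f) (Wd_hg 0 0 (w *: x + t *: v) rf).
have := hg_line h; rewrite (_ : (fun s : R => FI f (w *: x + s *: v)) = (fun t' : R => FI f (w *: (x - t' *: c)))); last first.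
 by apply/funext => s; rewrite E.
by move=> hh; apply: (drv_eq hh); rewrite E /v !pE; ring.
Qed.

Let Th_dt ph t x : is_derive t (1 : R) (fun t' : R => Theta t' x + ph) (om - enorm2 c ^+ 2 / 4).
Proof.
have h := drvD (drv_lin (om - enorm2 c ^+ 2 / 4) t) (drv_cst (c.1 / 2 * x.1 + c.2 / 2 * x.2 + ph) t).
rewrite (_ : (fun t' : R => Theta t' x + ph) = (fun s => (om - enorm2 c ^+ 2 / 4) * s + (c.1 / 2 * x.1 + c.2 / 2 * x.2 + ph))).
 by apply: (drv_eq h); rewrite addr0.
by apply/funext => s; rewrite /Theta /th; move: (enorm2 c ^+ 2) => k; field.
Qed.

Let ju_dt ph t x : is_derive t (1 : R) (fun t' : R => ju ph t' 0 0 x)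
 (w * (- (w * (c.1 * Wd g 1 0 (w *: (x - t *: c)) + c.2 * Wd g 0 1 (w *: (x - t *: c)))) * cos (Theta t x + ph) +
  FI g (w *: (x - t *: c)) * (- sin (Theta t x + ph) * (om - enorm2 c ^+ 2 / 4)))).
Proof.
rewrite (_ : (fun t' : R => ju ph t' 0 0 x) = (fun t' : R => w * (FI g (w *: (x - t' *: c)) * cos (Theta t' x + ph)))); last first.
 by apply/funext => s; exact: ju00.
exact: drvZ (drvM (mf_dt t x rg) (drv_comp (is_derive_cos _) (Th_dt ph t x))) w.
Qed.

Let p1 : R := - (pi / 2).
Let cosp (s : R) : cos (s + p1) = sin s.
Proof. by rewrite /p1 cosD cosN sinN cos_pihalf sin_pihalf; ring. Qed.
Let sinp (s : R) : sin (s + p1) = - cos s.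
Proof. by rewrite /p1 sinD cosN sinN cos_pihalf sin_pihalf; ring. Qed.
Definition Uw : R * R -> R[i]%C := toC (FI g).
Definition Nw : R * R -> R := FI sN.
Definition Vw (y : R * R) : R * R := (FI sV1 y, FI sV2 y).

Let uE t x : wave_u Uw om c t x = (ju 0 t 0 0 x +i* ju p1 t 0 0 x)%C.
Proof.
rewrite !ju00 addr0 cosp /wave_u /Uw /toC /moving_frame /cis -/w.
have -> : dot2 c x / 2 - enorm2 c ^+ 2 * t / 4 + om * t = Theta t x.
 by rewrite /Theta /th /dot2; move: (enorm2 c ^+ 2) => k; field.
move: (FI g _) (cos _) (sin _) => p q r.
by apply/eqP; rewrite eq_complex /=; apply/andP; split; apply/eqP; ring.
Qed.

Let reE t : reF (wave_u Uw om c t) = ju 0 t 0 0.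
Proof. by apply/funext => x; rewrite /reF uE. Qed.
Let imE t : imF (wave_u Uw om c t) = ju p1 t 0 0.
Proof. by apply/funext => x; rewrite /imF uE. Qed.
Let jn f t := fun a b x => om * jm f t a b x.
Let jn_jet f t : rap f -> jet (jn f t). Proof. by move=> rf; apply: jetZ; exact: jm_jet. Qed.
Let jn00 f t x : jn f t 0 0 x = om * FI f (w *: (x - t *: c)).
Proof. by rewrite /jn /jm expr0 mul1r Wd00. Qed.
Let jn10 f t x : jn f t 1 0 x = om * (w * Wd f 1 0 (w *: (x - t *: c))).
Proof. by rewrite /jn /jm expr1. Qed.
Let jn01 f t x : jn f t 0 1 x = om * (w * Wd f 0 1 (w *: (x - t *: c))).
Proof. by rewrite /jn /jm expr1. Qed.
Let nE t : wave_n Nw om c t = jn sN t 0 0.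
Proof. by apply/funext => x; rewrite jn00. Qed.
Let v1E t : fst_of (wave_v Vw om c t) = jn sV1 t 0 0.
Proof. by apply/funext => x; rewrite jn00. Qed.
Let v2E t : snd_of (wave_v Vw om c t) = jn sV2 t 0 0.
Proof. by apply/funext => x; rewrite jn00. Qed.

Let uuE t : (fun z => Normc.normc (wave_u Uw om c t z) ^+ 2) = jn F t 0 0.
Proof.
apply/funext => z; rewrite uE /= sqr_sqrtr ?addr_ge0 ?sqr_ge0// !ju00 addr0 cosp jn00 (FI_convS _ Sg Sg).
have := cos2Dsin2 (Theta t z); move: (FI g _) (cos _) (sin _) => p q r e.
by rewrite (_ : _ + _ = w * w * (p * p) * (q ^+ 2 + r ^+ 2)); [rewrite e w2E mulr1|ring].
Qed.

Let jn_dt f t x : rap f -> is_derive t (1 : R) (fun t' : R => jn f t' 0 0 x)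
 (- (om * (w * (c.1 * Wd f 1 0 (w *: (x - t *: c)) + c.2 * Wd f 0 1 (w *: (x - t *: c)))))).
Proof.
move=> rf; rewrite (_ : (fun t' : R => jn f t' 0 0 x) = (fun t' : R => om * FI f (w *: (x - t' *: c)))).
 by apply: (drv_eq (drvZ (mf_dt t x rf) om)); rewrite mulrN.
by apply/funext => s; exact: jn00.
Qed.

(** Galilean invariance: the cross term of the Laplacian is the transport part of the time
    derivative, and |c|^2 / 4 in the phase speed matches the square of the phase gradient, leaving
    [sol_lap]. The wave part is [Wd_div], and [WdN] with [Wd_curl]. *)
Lemma wave_solution : zakharov_solution (wave_u Uw om c) (wave_n Nw om c) (wave_v Vw om c).
Proof.
have Re_ x : (fun t' : R => complex.Re (wave_u Uw om c t' x)) = (fun t' => ju 0 t' 0 0 x).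
 by apply/funext => s; rewrite uE.
have Im_ x : (fun t' : R => complex.Im (wave_u Uw om c t' x)) = (fun t' => ju p1 t' 0 0 x).
 by apply/funext => s; rewrite uE.
have N_ x : (fun t' : R => wave_n Nw om c t' x) = (fun t' => jn sN t' 0 0 x).
 by apply/funext => s; rewrite nE.
have V1_ x : (fun t' : R => (wave_v Vw om c t' x).1) = (fun t' => jn sV1 t' 0 0 x).
 by apply/funext => s; rewrite -v1E.
have V2_ x : (fun t' : R => (wave_v Vw om c t' x).2) = (fun t' => jn sV2 t' 0 0 x).
 by apply/funext => s; rewrite -v2E.
have dE (p : R -> R) (t d : R) : is_derive t (1 : R) p d -> derivable p t 1 /\ derive1 p t = d.
 by move=> [dp e]; split => //; rewrite derive1E.
split.
- by move=> t; split; rewrite ?reE ?imE; apply: Dk_classC; apply: jet_Dk; exact: ju_jet.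
- by move=> t; rewrite nE; apply: Dk_classC; apply: jet_Dk; exact: jn_jet.
- by move=> t; rewrite v1E v2E; split; apply: Dk_classC; apply: jet_Dk; exact: jn_jet.
- by move=> t x; rewrite Re_ Im_; split; [have [] := dE _ _ _ (ju_dt 0 t x)|have [] := dE _ _ _ (ju_dt p1 t x)].
- by move=> t x; rewrite N_; have [] := dE _ _ _ (jn_dt t x rN).
- by move=> t x; rewrite V1_ V2_; split; [have [] := dE _ _ _ (jn_dt t x rV1)|have [] := dE _ _ _ (jn_dt t x rV2)].
- move=> t x; rewrite Re_ Im_; have [_ ->] := dE _ _ _ (ju_dt 0 t x); have [_ ->] := dE _ _ _ (ju_dt p1 t x).
 rewrite /laplacian_c /laplacian reE imE (jet_pdm (2, 0)%N x (ju_jet 0 t)) (jet_pdm (0, 2)%N x (ju_jet 0 t)).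
 rewrite (jet_pdm (2, 0)%N x (ju_jet p1 t)) (jet_pdm (0, 2)%N x (ju_jet p1 t)) !ju_lap nE jn00 uE !ju00.
 rewrite (sol_lap Mk0 (w *: (x - t *: c)) sl) !addr0 !cosp !sinp !Wd00.
 have -> : FI sN (w *: (x - t *: c)) = - FI (nF c g) (w *: (x - t *: c)).
  by rewrite /sN FIZ ?mulN1r//; have [/rap_Int] := nF_spec Mk0 sl.
 rewrite sqr_sqrtr ?dot2_ge0//.
 move: (FI g _) (FI (nF c g) _) (cos _) (sin _) (Wd g 1 0 _) (Wd g 0 1 _) (dot2 c c) => p n q r p10 p01 k.
 by apply/eqP; rewrite eq_complex /=; apply/andP; split; apply/eqP; field.
- move=> t x; rewrite N_ v1E v2E; have [_ ->] := dE _ _ _ (jn_dt t x rN).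
 rewrite (pd1_jet x (jn_jet t rV1)) (pd2_jet x (jn_jet t rV2)) jn10 jn01 Wd_div -!mulrDr.
 by [].
- move=> t x; rewrite V1_ nE uuE; have [_ ->] := dE _ _ _ (jn_dt t x rV1).
 rewrite (pd1_jet x (jn_jet t rN)) (pd1_jet x (jn_jet t rF)) !jn10 WdN Wd_curl.
 move: (Wd F _ _ _) (Wd sV1 1 0 _) (Wd sV1 0 1 _) => p q r; ring.
- move=> t x; rewrite V2_ nE uuE; have [_ ->] := dE _ _ _ (jn_dt t x rV2).
 rewrite (pd2_jet x (jn_jet t rN)) (pd2_jet x (jn_jet t rF)) !jn01 WdN Wd_curl.
 move: (Wd F _ _ _) (Wd sV1 0 1 _) (Wd sV2 0 1 _) => p q r; ring.
Qed.

End Wave.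
End Assembly.

(** * Sobolev bounds, decay of V and conclusion *)

Section Estimates.
Variable R : realType.
Implicit Types (x y z xi c : R * R) (f g : R * R -> R).
Variables (Q : R * R -> R) (hQ : positive_radial_solution Q).
Variables (be : R) (Mk : nat -> R) (k1 : R).
Hypotheses (be0 : 0 <= be) (Mk0 : forall k, 0 <= Mk k).
Local Notation sol := (sol Q be Mk).

Lemma sobolev_norm2_le f (M : R) : spec f -> bd 2 M f -> (sobolev_norm 2 (toC (FI f)) <= (M * Num.sqrt (hK R))%:E)%E.
Proof.
move=> sf bf; have M0 := bd_ge0 bf.
have := poweR_sqrt_le (sobolev_sq_ge0 2 _) (spec_sq2 sf bf).
by rewrite sqrtrM ?sqr_ge0// sqrtr_sqr ger0_norm.
Qed.

Lemma sobolev_norm2_v_le f g (M : R) : spec f -> spec g -> bd 2 M f -> bd 2 M g ->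
 (sobolev_norm_v 2 (fun y => (FI f y, FI g y)) <= (2 * M * Num.sqrt (hK R))%:E)%E.
Proof.
move=> sf sg bf bg; have M0 := bd_ge0 bf; have h0 := hK_ge0 R.
have h : (sobolev_sq 2 (toC (FI f)) + sobolev_sq 2 (toC (FI g)) <= ((2 * M) ^+ 2 * hK R)%:E)%E.
 apply: le_trans (leeD (spec_sq2 sf bf) (spec_sq2 sg bg)) _; rewrite -EFinD lee_fin.
 by rewrite -mulrDl; apply: ler_wpM2r => //; have := sqr_ge0 M; rewrite exprMn; lra.
have := poweR_sqrt_le (adde_ge0 (sobolev_sq_ge0 2 _) (sobolev_sq_ge0 2 _)) h.
by rewrite sqrtrM ?sqr_ge0// sqrtr_sqr ger0_norm ?mulr_ge0.
Qed.

Lemma sV_bd : exists2 M, 0 <= M & forall c g, sol c g ->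
 bd 2 (enorm2 c * M) (sV1 c g) /\ bd 2 (enorm2 c * M) (sV2 c g).
Proof.
have [A A0 hA] := tq_bd Q be Mk0 2 (erefl : ((2, 0)%N.1 + (2, 0)%N.2 = 2)%N).
have [B B0 hB] := tq_bd Q be Mk0 2 (erefl : ((1, 1)%N.1 + (1, 1)%N.2 = 2)%N).
have [C C0 hC] := tq_bd Q be Mk0 2 (erefl : ((0, 2)%N.1 + (0, 2)%N.2 = 2)%N).
exists (A + B + C); first by rewrite !addr_ge0.
have key c f1 f2 (M1 M2 : R) : 0 <= M1 -> 0 <= M2 -> M1 + M2 <= A + B + C -> bd 2 M1 f1 -> bd 2 M2 f2 ->
  bd 2 (enorm2 c * (A + B + C)) (fun xi => (- c.1) * f1 xi + (- c.2) * f2 xi).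
 move=> m1 m2 m12 b1 b2.
 have h1 := bdM b1 (p := fun=> - c.1) (K := enorm2 c); have h2 := bdM b2 (p := fun=> - c.2) (K := enorm2 c).
 apply: bd_le (bdD (h1 _) (h2 _)) => // [|x|x]; rewrite ?normrN.
 - by rewrite -mulrDr; apply: ler_wpM2l => //; exact: enorm2_ge0.
 - exact: abs1_le.
 - exact: abs2_le.
move=> c g s; split; [apply: key (hA _ _ s) (hB _ _ s)|apply: key (hB _ _ s) (hC _ _ s)] => //; lra.
Qed.

Variable CU : nat -> nat -> R.
Hypotheses (CU0 : forall a b, 0 <= CU a b)
 (hCU : forall a b c g, sol c g -> dot2 c c <= k1 -> forall x, `|Wd g a b x| <= CU a b * barrier x).
Variable CF : nat -> nat -> R.
Hypotheses (CF0 : forall a b, 0 <= CF a b)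
 (hCF : forall a b c g, sol c g -> dot2 c c <= k1 -> forall x, `|Wd (cnv g g) a b x| <= CF a b * expR (- enorm2 x)).

Lemma WdV_decay a b : exists2 C, 0 <= C & forall c g, sol c g -> dot2 c c <= k1 -> forall y, y != 0 ->
 `|Wd (sV1 c g) a b y| <= C * (enorm2 c / enorm2 y ^+ (a + b + 2)) /\
 `|Wd (sV2 c g) a b y| <= C * (enorm2 c / enorm2 y ^+ (a + b + 2)).
Proof.
have [A A0 hA] := tq_decay Mk0 CU0 hCU CF0 hCF a b (erefl : ((2, 0)%N.1 + (2, 0)%N.2 = 2)%N).
have [B B0 hB] := tq_decay Mk0 CU0 hCU CF0 hCF a b (erefl : ((1, 1)%N.1 + (1, 1)%N.2 = 2)%N).
have [C C0 hC] := tq_decay Mk0 CU0 hCU CF0 hCF a b (erefl : ((0, 2)%N.1 + (0, 2)%N.2 = 2)%N).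
exists (A + B + C); first by rewrite !addr_ge0.
move=> c g s ck y y0; have r0 := enorm2_gt0 y0.
have i0 : 0 < (enorm2 y ^+ (a + b + 2))^-1 by rewrite invr_gt0 exprn_gt0.
have rt m : (m.1 + m.2 = 2)%N -> rap (tq m c g) by move=> e; have [] := tq_spec Mk0 e s.
have r20 := rt (2, 0)%N erefl; have r11 := rt (1, 1)%N erefl; have r02 := rt (0, 2)%N erefl.
have key f1 f2 (M1 M2 : R) : rap f1 -> rap f2 -> 0 <= M1 -> 0 <= M2 -> M1 + M2 <= A + B + C ->
  `|Wd f1 a b y| <= M1 / enorm2 y ^+ (a + b + 2) -> `|Wd f2 a b y| <= M2 / enorm2 y ^+ (a + b + 2) ->
  `|Wd (fun xi => (- c.1) * f1 xi + (- c.2) * f2 xi) a b y| <= (A + B + C) * (enorm2 c / enorm2 y ^+ (a + b + 2)).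
 move=> r1 r2 m1 m2 m12 b1 b2.
 rewrite (WdD _ _ _ (rapZ (- c.1) r1) (rapZ (- c.2) r2)) (WdZ (- c.1) a b y r1) (WdZ (- c.2) a b y r2).
 apply: normD_le; rewrite (normrM (- c.1)) (normrM (- c.2)) !normrN.
 apply: le_trans (lerD (ler_pM (normr_ge0 _) (normr_ge0 _) (abs1_le c) b1) (ler_pM (normr_ge0 _) (normr_ge0 _) (abs2_le c) b2)) _.
 rewrite !mulrA -mulrDl; apply: ler_wpM2r; first exact: ltW.
 by rewrite -mulrDr mulrC; apply: ler_wpM2r => //; exact: enorm2_ge0.
split; [apply: key (hA _ _ s ck _ y0) (hB _ _ s ck _ y0)|apply: key (hB _ _ s ck _ y0) (hC _ _ s ck _ y0)] => //; lra.
Qed.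

End Estimates.

Theorem theorem1 (R : realType) (Q : R * R -> R) (hQ : is_ground_state Q) :
  exists (cstar C : R) (Cm : nat * nat -> R),
    [/\ 0 < cstar < 1, 0 < C & (forall m, 0 < Cm m)] /\
    forall c : R * R, enorm2 c < cstar ->
    exists (U : R * R -> R[i]) (N : R * R -> R) (V : R * R -> R * R),
      [/\ in_Hs 1 U, in_L2 (toC N),
          in_L2 (toC (fst_of V)) & in_L2 (toC (snd_of V))] /\
      (forall omega : R, 0 < omega ->
        zakharov_solution (wave_u U omega c) (wave_n N omega c)
          (wave_v V omega c)) /\
      [/\ smooth_c U, smooth N, smooth (fst_of V) & smooth (snd_of V)] /\
      (forall s : R, 0 <= s ->
        [/\ in_Hs s U, in_Hs s (toC N),
            in_Hs s (toC (fst_of V)) & in_Hs s (toC (snd_of V))]) /\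
      [/\ (sobolev_norm 2 (fun y => (U y - toC Q y)%R) <=
             (C * enorm2 c ^+ 2)%:E)%E,
          (sobolev_norm 2 (toC (fun y => (N y + Q y ^+ 2)%R)) <=
             (C * enorm2 c ^+ 2)%:E)%E &
          (sobolev_norm_v 2 V <= (C * enorm2 c)%:E)%E] /\
      (forall (m : nat * nat) (y : R * R), 1 <= enorm2 y ->
        [/\ Normc.normc (pdm_c m U y) <= Cm m * expR (- (2^-1 * enorm2 y)),
            `|pdm m N y| <=
              Cm m * (expR (- enorm2 y) +
                      enorm2 c ^+ 2 / enorm2 y ^+ (mlen m + 2)) &
            enorm2 (pdm_v m V y) <=
              Cm m * (enorm2 c / enorm2 y ^+ (mlen m + 2))]).
Proof.
(* Merges the exponential part and the two products with V into the single constant [Cm] of the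
   bound for N. *)
have al (a b v X Y : R) : 0 <= a -> 0 <= b -> 0 <= v -> 0 <= X -> 0 <= Y ->
  b * X + (v * Y + v * Y) <= (1 + a + b + 2 * v) * (X + Y).
 move=> a0 b0 v0 X0 Y0; have := mulr_ge0 a0 X0; have := mulr_ge0 a0 Y0.
 by have := mulr_ge0 b0 Y0; have := mulr_ge0 v0 X0; lra.
have [pQ _] := hQ.
(* All constants are obtained here, before c is introduced. *)
have [k0 [be [Mk [k00 k02 be0 Mk0 Hg]]]] := main_g pQ.
have [k1 [rho [k10 rho0 hfar]]] := far_field pQ be0 Mk0.
have [CU CUp hCU] := choice2 (U_decay Mk0 rho0 hfar).
have [CF CFp hCF] := choice2 (UU_decay Mk0 rho0 hfar).
have [CV CVp hV] := choice2 (WdV_decay Mk0 CUp hCU CFp hCF).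
have [B B0 hB] := NQ_bd pQ be0 Mk0.
have [MV MV0 hMV] := sV_bd Q be Mk0.
pose S := Num.sqrt (hK R); have S0 : 0 <= S by exact: sqrtr_ge0.
have t1 := mulr_ge0 be0 S0; have t2 := mulr_ge0 B0 S0; have t3 := mulr_ge0 MV0 S0.
(* k0 and k1 are thresholds for |c|^2; below 1/2 one has |c|^2 <= |c|, so it is enough that |c|
   stays under them, and the cap keeps the threshold below 1. *)
exists (Num.min 2^-1 (Num.min k0 k1)), (1 + be * S + B * S + 2 * (MV * S)), (fun m => 1 + CU m.1 m.2 + CF m.1 m.2 + 2 * CV m.1 m.2).
split.
 split; [|lran|by move=> m; have := CUp m.1 m.2; have := CFp m.1 m.2; have := CVp m.1 m.2; lra].
 by rewrite !lt_min k00 k10 invr_gt0 ltr0n /= gt_min invf_lt1 ?ltr0n// ltr1n.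
move=> c; rewrite !lt_min => /andP[c12 /andP[ck0 ck1]].
have e0 := enorm2_ge0 c.
have ce : dot2 c c = enorm2 c ^+ 2 by rewrite sqr_sqrtr ?dot2_ge0.
have cle : dot2 c c <= enorm2 c by rewrite ce expr2 ler_piMl//; lra.
have ck0' : dot2 c c <= k0 by apply: le_trans cle (ltW ck0).
have ck1' : dot2 c c <= k1 by apply: le_trans cle (ltW ck1).
have [g [Sg bg bh eq]] := Hg c ck0'.
have s : sol Q be Mk c g by split => //; exact: le_trans ck0' k02.
have spg := Sz_spec Sg; have spN := sN_spec Mk0 s; have sp1 := sV1_spec Mk0 s; have sp2 := sV2_spec Mk0 s.
have rg := Sz_rap Sg; have rF := Sz_rap (Sz_conv Sg Sg).
have [rN _ _ _] := spN; have [r1 _ _ _] := sp1; have [r2 _ _ _] := sp2.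
have L2 (f : R * R -> R) : spec f -> in_L2 (toC (FI f)).
 by move=> sf; have [rf _ _ _] := sf; apply: toC_L2; [exact: FI_meas|have [] := FI_Bessel sf].
have W0 (f : R * R -> R) : Wd f 0 0 = FI f by apply/funext => x; exact: Wd00.
have sm (f : R * R -> R) : rap f -> smooth (FI f) by move=> rf; rewrite -W0; apply: jet_smooth; exact: Wd_jet.
have pW (f : R * R -> R) m y : rap f -> pdm m (FI f) y = Wd f m.1 m.2 y by move=> rf; rewrite -W0; exact: jet_pdm (Wd_jet rf).
exists (Uw g), (Nw c g), (Vw c g); split.
 by split; [exact: spec_Hs|exact: L2|exact: L2|exact: L2].
split; first by move=> om om0; exact: (wave_solution Mk0 s om0).
have z0 : imF (Uw g) = fun=> 0 by [].
split.
 split; [|exact: sm|exact: sm|exact: sm].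
 move=> k; split; first exact: sm.
 by rewrite z0; apply: Dk_classC; exact: Dk_cst.
split; first by move=> t _; split; exact: spec_Hs.
have Cge (u v : R) : 0 <= v -> u <= 1 + be * S + B * S + 2 * (MV * S) -> u * v <= (1 + be * S + B * S + 2 * (MV * S)) * v.
 by move=> v0 uv; exact: ler_wpM2r.
have c20 : 0 <= enorm2 c ^+ 2 by exact: sqr_ge0.
split.
 split.
 - have S0' := g0_Sz pQ; have rd : Sz (fun x => g x - g0 Q x).
   have [e u b] := Sg; have [e' u' b'] := S0'; split; [by move=> x; rewrite e e'| |].
    by have := ucD u (ucZ (-1) u'); under eq_fun do rewrite mulN1r.
   by move=> k; have [A hA] := b k; have [A' hA'] := b' k; exists (A + A'); exact: bdB.
  have E : (fun y => (Uw g y - toC Q y)%R) = toC (FI (fun x => g x - g0 Q x)).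
   apply/funext => y; rewrite /Uw /toC (FIB _ (Sz_Int Sg) (Sz_Int S0')) (FI_g0 pQ).
   by apply/eqP; rewrite eq_complex /= subrr !eqxx.
  rewrite E; apply: le_trans (sobolev_norm2_le (Sz_spec rd) bh) _; rewrite lee_fin ce mulrAC.
  by apply: Cge => //; rewrite -/S; lra.
 - have SP := P_Sz pQ; have [rn _ _ _] := nF_spec Mk0 s.
  have E : (fun y => (Nw c g y + Q y ^+ 2)%R) = FI (fun xi => (-1) * (nF c g xi + (-1) * cnv (g0 Q) (g0 Q) xi)).
   have iP := Sz_Int SP; have iN := rap_Int rn.
   apply/funext => y; rewrite (FIZ _ _ (IntD iN (IntZ (-1) iP))) (FID _ iN (IntZ (-1) iP)) (FIZ _ _ iP).
   rewrite (FI_convS _ (g0_Sz pQ) (g0_Sz pQ)) !(FI_g0 pQ) /Nw /sN (FIZ _ _ iN); ring.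
  have sp : spec (fun xi => (-1) * (nF c g xi + (-1) * cnv (g0 Q) (g0 Q) xi)).
   exact: (specZ (-1) (specD (nF_spec Mk0 s) (specZ (-1) (Sz_spec SP)))).
  have bN : bd 2 (B * dot2 c c) (fun xi => (-1) * (nF c g xi + (-1) * cnv (g0 Q) (g0 Q) xi)).
   by move=> x; rewrite mulN1r normrN mulN1r; exact: hB s x.
  rewrite E; apply: le_trans (sobolev_norm2_le sp bN) _; rewrite lee_fin ce mulrAC.
  by apply: Cge => //; rewrite -/S; lra.
 - have [b1 b2] := hMV _ _ s.
  apply: le_trans (sobolev_norm2_v_le sp1 sp2 b1 b2) _; rewrite lee_fin -/S.
  rewrite (_ : 2 * (enorm2 c * MV) * S = 2 * (MV * S) * enorm2 c); last by ring.
  by apply: Cge => //; lra.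
move=> m y y1.
have y0 : y != 0 by apply/eqP => yz; move: y1; rewrite yz /enorm2 /dot2 /= !mulr0 addr0 sqrtr0 ler10.
have [v1 v2] := hV m.1 m.2 _ _ s ck1' _ y0.
have a1 := CUp m.1 m.2; have a2 := CFp m.1 m.2; have a3 := CVp m.1 m.2.
set T := enorm2 c / _ in v1 v2.
have y00 : 0 < enorm2 y by apply: lt_le_trans y1.
have T0 : 0 <= T by rewrite divr_ge0// exprn_ge0// ltW.
have ex0 : 0 <= expR (- enorm2 y) by exact: expR_ge0.
split.
- have -> : Normc.normc (pdm_c m (Uw g) y) = `|Wd g m.1 m.2 y|.
  rewrite /pdm_c (_ : reF (Uw g) = FI g)// z0 (pW _ _ _ rg).
  have := @jet_pdm R _ m y (@jet_cst R 0); rewrite /= if_same => ->.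
  exact: normc_toC.
 apply: le_trans (hCU _ _ _ _ s ck1' _) _; apply: ler_pM => //; [exact: ltW (phi_gt0 y)|lran|exact: phi_le].
- rewrite (pW _ _ _ rN) (WdN Mk0 s) -[mlen m]/(m.1 + m.2)%N.
 have hF' := hCF m.1 m.2 _ _ s ck1' y.
 have c1 := abs1_le c; have c2 := abs2_le c.
 (* The coefficient c in N = - U^2 + c . V supplies the second power of |c|. *)
 have n1 : `|c.1 * Wd (sV1 c g) m.1 m.2 y| <= enorm2 c * (CV m.1 m.2 * T) by rewrite normrM; exact: ler_pM.
 have n2 : `|c.2 * Wd (sV2 c g) m.1 m.2 y| <= enorm2 c * (CV m.1 m.2 * T) by rewrite normrM; exact: ler_pM.
 apply: normD_le; rewrite normrN.
 apply: le_trans (lerD hF' (le_trans (ler_normD _ _) (lerD n1 n2))) _.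
 have -> : enorm2 c ^+ 2 / enorm2 y ^+ (m.1 + m.2 + 2) = enorm2 c * T by rewrite /T expr2 mulrA.
 have T1 : 0 <= enorm2 c * T by exact: mulr_ge0.
 rewrite !(mulrCA (enorm2 c) (CV _ _)); exact: al.
- rewrite /pdm_v -[mlen m]/(m.1 + m.2)%N -/T.
 rewrite (_ : fst_of (Vw c g) = FI (sV1 c g))// (_ : snd_of (Vw c g) = FI (sV2 c g))//.
 rewrite (pW _ _ _ r1) (pW _ _ _ r2).
 apply: le_trans (enorm2_le_sum _) _; apply: le_trans (lerD v1 v2) _; rewrite -mulrDl.
 by apply: ler_wpM2r => //; lra.
Qed.
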